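(* Let $n\ge 1$ and $\mathbb C^\times=\mathbb C\setminus\{0\}$. (i) For each $r\in(0,+\infty]$ there exists a Fréchet algebra bundle $(D,p)$ over $\mathbb C^\times$ such that for each $q\in\mathbb C^\times$ the fiber satisfies $D_q\cong\mathcal O_q^{\mathrm{hol}}(\mathbb D_r^n)$. (ii) There exists a Fréchet algebra bundle $(B,p)$ over $\mathbb C^\times$ such that $B_1\cong\mathcal O^{\mathrm{hol}}(\mathbb B^n)$ and such that for each $q\in(0,1)$ we have $B_q\cong\mathcal O_q^{\mathrm{hol}}(\mathbb B^n)$. Here $\cong$ denotes isomorphism of topological algebras.
   Context: All algebras are associative unital $\mathbb C$-algebras. A Fréchet algebra is a complete metrizable locally convex topological algebra. Fréchet algebra bundles. Let $X$ be a locally compact Hausdorff space, $A$ a topological space, $p:A\to X$ a continuous open surjection, such that each fiber $A_x=p^{-1}(x)$ is endowed with the structure of an algebra in such a way that the maps $A\times_XA\to A$, $(a,b)\mapsto a+b$; $\mathbb C\times A\to A$, $(\lambda,a)\mapsto\lambda a$; $A\times_XA\to A$, $(a,b)\mapsto ab$, are continuous, where $A\times_XA=\{(a,b)\in A\times A:p(a)=p(b)\}$. A seminorm on $A$ is a function $A\to[0,+\infty)$ whose restriction to each $A_x$ is a seminorm. Let $\mathcal N=\{\|\cdot\|_i:i\in I\}$ be a directed family of seminorms on $A$ having an at most countable cofinal subfamily, such that for each $x\in X$ the sets $\{a\in A:p(a)\in U,\ \|a\|_i<\varepsilon\}$ ($i\in I$, $\varepsilon>0$, $U\subseteq X$ a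 neighbourhood of $x$) form a neighbourhood base of $0\in A_x$ (in $A$). Assume that each fiber $A_x$ is complete (so that $A_x$, with the topology inherited from $A$, is a Fréchet algebra). Then $(A,p)$ together with $\mathcal N$ is called a Fréchet algebra bundle over $X$. Quantum polydisk. For $q\in\mathbb C^\times$, $\mathcal O_q^{\mathrm{reg}}(\mathbb C^n)$ is the algebra generated by $x_1,\dots,x_n$ with relations $x_ix_j=q\,x_jx_i$ for $i<j$; the monomials $x^\alpha=x_1^{\alpha_1}\cdots x_n^{\alpha_n}$ ($\alpha\in\mathbb Z_+^n$) form a basis. Put $|\alpha|=\sum_i\alpha_i$, and $w_q(\alpha)=1$ if $|q|\ge1$, $w_q(\alpha)=|q|^{\sum_{i<j}\alpha_i\alpha_j}$ if $|q|<1$. For $r\in(0,+\infty]$, $$\mathcal O_q^{\mathrm{hol}}(\mathbb D_r^n)=\Bigl\{a=\sum_{\alpha\in\mathbb Z_+^n}c_\alpha x^\alpha:\ \|a\|_\rho=\sum_\alpha|c_\alpha|w_q(\alpha)\rho^{|\alpha|}<\infty\ \ \forall\,0<\rho<r\Bigr\},$$ with topology given by the seminorms $\|\cdot\|_\rho$ ($0<\rho<r$) and the continuous product determined by $x_ix_j=q\,x_jx_i$ for $i<j$. Balls. $\mathbb B^n=\{z\in\mathbb C^n:\sum_i|z_i|^2<1\}$, and $\mathcal O^{\mathrm{hol}}(\mathbb B^n)$ is the algebra of holomorphic functions on $\mathbb B^n$ with the topology of compact convergence. For $q\in(0,1)$, $\mathrm{Pol}_q(\mathbb C^n)$ is the $*$-algebra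 generated as a $*$-algebra by $z_1,\dots,z_n$ subject to $z_iz_j=q\,z_jz_i$ $(i<j)$; $z_i^*z_j=q\,z_jz_i^*$ $(i\ne j)$; $z_i^*z_i=q^2z_iz_i^*+(1-q^2)\bigl(1-\sum_{k>i}z_kz_k^*\bigr)$. Its subalgebra generated by $z_1,\dots,z_n$ is $\mathcal O_q^{\mathrm{reg}}(\mathbb C^n)$ (with $x_i=z_i$). Let $H$ be a Hilbert space with orthonormal basis $e_\alpha=|\alpha_1,\dots,\alpha_n\rangle$ ($\alpha\in\mathbb Z_+^n$), $[k]_q=\sum_{i=0}^{k-1}q^{2i}$, and $\pi:\mathrm{Pol}_q(\mathbb C^n)\to\mathcal B(H)$ the faithful irreducible $*$-representation determined by $\pi(z_j)e_\alpha=\sqrt{1-q^2}\sqrt{[\alpha_j+1]_q}\,q^{\sum_{k>j}\alpha_k}|\alpha_1,\dots,\alpha_j+1,\dots,\alpha_n\rangle$. Put $\|a\|_{\mathrm{op}}=\|\pi(a)\|$, and $\|a\|_s=\|\gamma_s(a)\|_{\mathrm{op}}$ for $0<s<1$ and $a\in\mathcal O_q^{\mathrm{reg}}(\mathbb C^n)$, where $\gamma_s$ is the automorphism with $\gamma_s(z_i)=sz_i$. Then $\mathcal O_q^{\mathrm{hol}}(\mathbb B^n)$ is the completion of $\mathcal O_q^{\mathrm{reg}}(\mathbb C^n)$ with respect to $\{\|\cdot\|_s:0<s<1\}$. *)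

(* Defs.v *)
From HB Require Import structures.
From mathcomp Require Import all_boot all_order all_algebra finmap complex ring.
From mathcomp Require Import all_classical all_reals all_analysis.

Set Implicit Arguments.
Unset Strict Implicit.
Unset Printing Implicit Defensive.

Import Order.TTheory GRing.Theory Num.Theory numFieldNormedType.Exports.
Import ComplexField.

Local Open Scope classical_set_scope.
Local Open Scope ring_scope.

(* [R[i]] under a name that MathComp-Analysis equips, as any [numFieldType],
   with its norm topology. *)
Definition Cplx (R : realType) : numClosedFieldType := R[i].

Definition realC (R : realType) (x : R) : Cplx R := (x%:C)%C.

Definition cabs (R : realType) (z : Cplx R) : R := Normc.normc z.

Section Cabs.
Variable R : realType.
Implicit Types z w : Cplx R.

Lemma cabs0 : cabs (0 : Cplx R) = 0. Proof. exact: Normc.normc0. Qed.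
Lemma cabs1 : cabs (1 : Cplx R) = 1. Proof. exact: Normc.normc1. Qed.
Lemma cabsM z w : cabs (z * w) = cabs z * cabs w.
Proof. exact: Normc.normcM. Qed.
Lemma cabsV z : cabs z^-1 = (cabs z)^-1. Proof. exact: Normc.normcV. Qed.
Lemma cabsD z w : cabs (z + w) <= cabs z + cabs w.
Proof. exact: le_normcD. Qed.
Lemma cabsN z : cabs (- z) = cabs z. Proof. exact: normcN. Qed.
Lemma cabs_ge0 z : 0 <= cabs z.
Proof. by case: z => a b; exact: sqrtr_ge0. Qed.
Lemma cabsX z k : cabs (z ^+ k) = cabs z ^+ k.
Proof. by elim: k => [|k IH]; rewrite ?expr0 ?cabs1// !exprS cabsM IH. Qed.
Lemma cabs_gt0 z : z != 0 -> 0 < cabs z.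
Proof.
by move=> z0; rewrite lt0r cabs_ge0 andbT; apply: contra z0 => /eqP/Normc.eq0_normc ->.
Qed.
Lemma cabs_sum (I : Type) (s : seq I) (P : pred I) (F : I -> Cplx R) :
  cabs (\sum_(i <- s | P i) F i) <= \sum_(i <- s | P i) cabs (F i).
Proof.
elim/big_rec2: _ => [|i x y _ IH]; first by rewrite cabs0.
by apply: le_trans (cabsD _ _) _; rewrite lerD2l.
Qed.

End Cabs.

Definition Cstar (R : realType) : topologicalType :=
  set_type [set z : Cplx R | z != 0].

Definition cstar_val (R : realType) (q : Cstar R) : Cplx R := \val q.

Lemma cstar_neq0 (R : realType) (q : Cstar R) : cstar_val q != 0.
Proof. exact/set_mem/(valP q). Qed.

(* An algebra with a topology; as for the [PreTopological...] structures of
   MathComp-Analysis, no compatibility is built in. *)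
#[short(type="preTopologicalAlgType")]
HB.structure Definition PreTopologicalAlgebra (K : numDomainType) :=
  {A of Topological A & GRing.Algebra K A}.

Definition topalg_iso (K : numDomainType) (A B : preTopologicalAlgType K) : Prop :=
  exists (f : {lrmorphism A -> B}) (g : B -> A),
    [/\ cancel f g, cancel g f, continuous f & continuous g].

Definition is_topological_algebra (K : numFieldType)
    (A : preTopologicalAlgType K) : Prop :=
  [/\ continuous (fun ab : A * A => ab.1 + ab.2),
      continuous (fun la : K * A => la.1 *: la.2) &
      continuous (fun ab : A * A => ab.1 * ab.2)].

(* Completeness for the uniformity of the additive topological group. *)
Definition additively_complete (K : numDomainType)
    (A : preTopologicalAlgType K) : Prop :=
  forall F : set_system A, ProperFilter F ->
    (forall U, nbhs 0 U ->
       exists2 S, F S & forall a b, S a -> S b -> U (a - b)) ->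
    exists a : A, F --> a.

Definition is_seminorm (R : realType) (V : lmodType (Cplx R)) (p : V -> R) :=
  [/\ forall v, 0 <= p v,
      forall u v, p (u + v) <= p u + p v &
      forall (c : Cplx R) v, p (c *: v) = cabs c * p v].

(* Neighbourhoods of [x] in the topology of the seminorms [p i], [D i]. *)
Definition seminorm_nbhs (R : realType) (V : zmodType) (I : eqType)
    (D : set I) (p : I -> V -> R) (x : V) : set_system V :=
  [set W | exists (s : seq I) (e : R),
    [/\ forall i, i \in s -> D i, 0 < e &
        [set y | forall i, i \in s -> p i (y - x) < e] `<=` W]].

Section SeminormNbhs.
Variables (R : realType) (V : zmodType) (I : eqType) (D : set I).
Variable p : I -> V -> R.
Hypothesis p0 : forall i, D i -> p i 0 = 0.
Hypothesis pD : forall i, D i -> forall u v, p i (u + v) <= p i u + p i v.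

Lemma seminorm_nbhs_singleton x (W : set V) : seminorm_nbhs D p x W -> W x.
Proof.
by move=> [s [e [sD e0 sW]]]; apply: sW => i /sD Di; rewrite subrr p0.
Qed.

Lemma seminorm_nbhs_filter x : ProperFilter (seminorm_nbhs D p x).
Proof.
split; first by move=> /seminorm_nbhs_singleton.
split.
- by exists [::], 1; split.
- move=> P Q [s [e [sD e0 sP]]] [t [d [tD d0 tQ]]].
  exists (s ++ t), (Num.min e d); split.
  + by move=> i; rewrite mem_cat => /orP[/sD|/tD].
  + by rewrite lt_min e0.
  + move=> y yst; split.
    * apply: sP => i si; have := yst i; rewrite mem_cat si => /(_ isT).
      by rewrite lt_min => /andP[].
    * apply: tQ => i ti; have := yst i; rewrite mem_cat ti orbT => /(_ isT).
      by rewrite lt_min => /andP[].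
- move=> P Q PQ [s [e [sD e0 sP]]]; exists s, e; split => //.
  exact: subset_trans PQ.
Qed.

Lemma seminorm_nbhs_nbhs x (W : set V) : seminorm_nbhs D p x W ->
  seminorm_nbhs D p x ((seminorm_nbhs D p)^~ W).
Proof.
move=> [s [e [sD e0 sW]]]; exists s, (e / 2); split; rewrite ?divr_gt0//.
move=> y ys /=; exists s, (e / 2); split; rewrite ?divr_gt0// => z zs.
apply: sW => i si; rewrite -(subrK y z) -addrA (splitr e).
by apply: le_lt_trans (pD (sD _ si) _ _) _; rewrite ltrD ?zs ?ys.
Qed.

End SeminormNbhs.

(* [fiber_class x] is an algebra structure on the fibre [p^{-1}(x)]. *)
Record fibredAlgebra (R : realType) (X : topologicalType) := FibredAlgebra {
  total_space : topologicalType;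
  bproj : total_space -> X;
  fiber_class : forall x,
    GRing.Algebra.axioms_ (Cplx R) {a : total_space | bproj a = x} }.

Section Fibre.
Variables (R : realType) (X : topologicalType) (A : fibredAlgebra R X).

Definition fiberAlg (x : X) : algType (Cplx R) :=
  GRing.Algebra.Pack (fiber_class A x).

Definition fiber_val (x : X) (a : fiberAlg x) : total_space A := sval a.

(* The fibre with its algebra structure and the topology inherited from [total_space A]. *)
Definition fiber (x : X) : preTopologicalAlgType (Cplx R) :=
  HB.pack (fiberAlg x)
    (Topological.class (initial_topology (@fiber_val x))).

Definition fiberprod := set_type [set ab : total_space A * total_space A | bproj ab.1 = bproj ab.2].

Definition in_fiber (x : X) (a : total_space A) (ax : bproj a = x) : fiberAlg x :=
  exist _ a ax.

Definition fiberwise (op : forall x, fiberAlg x -> fiberAlg x -> fiberAlg x)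
    (ab : fiberprod) : total_space A :=
  fiber_val (op _ (in_fiber (erefl (bproj (\val ab).1)))
                  (in_fiber (esym (set_valP ab)))).

Definition total_add : fiberprod -> total_space A := fiberwise (fun x => +%R).
Definition total_mul : fiberprod -> total_space A := fiberwise (fun x => *%R).
Definition total_scale (la : Cplx R * total_space A) : total_space A :=
  fiber_val (la.1 *: in_fiber (erefl (bproj la.2))).

End Fibre.

Record is_frechet_bundle (R : realType) (X : topologicalType)
    (A : fibredAlgebra R X) (I : Type) (nrm : I -> total_space A -> R) : Prop := {
  base_hausdorff : hausdorff_space X;
  base_locally_compact : locally_compact [set: X];
  bproj_continuous : continuous (@bproj R X A);
  bproj_open : forall U : set (total_space A), open U -> open (@bproj R X A @` U);
  bproj_surj : forall x : X, exists a : total_space A, bproj a = x;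
  total_add_continuous : continuous (@total_add R X A);
  total_scale_continuous : continuous (@total_scale R X A);
  total_mul_continuous : continuous (@total_mul R X A);
  nrm_seminorm : forall i x, is_seminorm (fun a : fiberAlg A x => nrm i (fiber_val a));
  nrm_directed : forall i j, exists k,
    forall a, nrm i a <= nrm k a /\ nrm j a <= nrm k a;
  nrm_cofinal : exists J : set I, countable J /\
    forall i, exists2 j, J j & forall a, nrm i a <= nrm j a;
  nrm_base : forall (x : X) (W : set (total_space A)),
    nbhs (fiber_val (0 : fiberAlg A x)) W <->
    exists (i : I) (e : R) (U : set X), [/\ 0 < e, nbhs x U &
      [set a | U (bproj a) /\ nrm i a < e] `<=` W];
  fiber_hausdorff : forall x, hausdorff_space (fiber A x);
  fiber_complete : forall x, additively_complete (fiber A x) }.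

Record frechetAlgebraBundle (R : realType) (X : topologicalType) := {
  bundle :> fibredAlgebra R X;
  bundle_index : Type;
  bundle_nrm : bundle_index -> total_space bundle -> R;
  bundleP : is_frechet_bundle bundle_nrm }.

Notation multidx n := {ffun 'I_n -> nat}.

Section Multiindices.
Variable n : nat.
Implicit Types a b c : multidx n.

Definition mdelta (i : 'I_n) : multidx n := [ffun j => (i == j) : nat].

Definition mdeg a : nat := (\sum_i a i)%N.

Definition cross a b : nat :=
  (\sum_(i < n) \sum_(j < n | (i < j)%N) a i * b j)%N.

Lemma crossDl a b c : cross (a + b) c = (cross a c + cross b c)%N.
Proof.
rewrite /cross -big_split; apply: eq_bigr => i _ /=.
by rewrite -big_split; apply: eq_bigr => j _ /=; rewrite ffunE mulnDl.
Qed.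

Lemma crossDr a b c : cross a (b + c) = (cross a b + cross a c)%N.
Proof.
rewrite /cross -big_split; apply: eq_bigr => i _ /=.
by rewrite -big_split; apply: eq_bigr => j _ /=; rewrite ffunE mulnDr.
Qed.

Lemma cross0l a : cross 0 a = 0%N.
Proof.
by rewrite /cross big1// => i _; rewrite big1// => j _; rewrite ffunE.
Qed.

Lemma cross0r a : cross a 0 = 0%N.
Proof.
by rewrite /cross big1// => i _; rewrite big1// => j _; rewrite ffunE muln0.
Qed.

Lemma cross_mdelta i j : cross (mdelta i) (mdelta j) = (i < j)%N :> nat.
Proof.
rewrite /cross (bigD1 i)//= [X in (_ + X)%N]big1 ?addn0; last first.
  by move=> k ki; rewrite big1// => l _; rewrite ffunE eq_sym (negbTE ki).
case: ltnP => ij.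
  rewrite (bigD1 j)//= big1 ?addn0; first by rewrite !ffunE !eqxx.
  by move=> l /andP[_ lj]; rewrite !ffunE [j == l]eq_sym (negbTE lj) muln0.
rewrite big1// => l il; rewrite !ffunE.
have /negbTE -> : j != l by apply: contraTneq il => <-; rewrite -leqNgt.
by rewrite muln0.
Qed.

Lemma mdegD a b : mdeg (a + b) = (mdeg a + mdeg b)%N.
Proof. by rewrite /mdeg -big_split; apply: eq_bigr => i _; rewrite ffunE. Qed.

Lemma mdeg0 : mdeg 0 = 0%N.
Proof. by rewrite /mdeg big1// => i _; rewrite ffunE. Qed.

Lemma mdeg_ge a i : (a i <= mdeg a)%N.
Proof. by rewrite /mdeg (bigD1 i)//= leq_addr. Qed.

(* The multi-indices of entries at most [N]. *)
Definition box (N : nat) : seq (multidx n) :=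
  [seq [ffun i => f i : nat] | f : {ffun 'I_n -> 'I_N.+1}].

Lemma box_uniq N : uniq (box N).
Proof.
rewrite map_inj_uniq ?enum_uniq// => f g /ffunP fg; apply/ffunP => i.
by apply: val_inj; have := fg i; rewrite !ffunE.
Qed.

Lemma mem_box N a : (mdeg a <= N)%N -> a \in box N.
Proof.
move=> aN; apply/mapP; exists [ffun i => inord (a i)]; first exact: mem_enum.
apply/ffunP => i; rewrite !ffunE inordK// ltnS.
exact: leq_trans (mdeg_ge a i) aN.
Qed.

Lemma finite_splits c : finite_set [set ab : multidx n * multidx n | ab.1 + ab.2 = c].
Proof.
apply: (@sub_finite_set _ _ [set` [seq (a, b) | a <- box (mdeg c), b <- box (mdeg c)]]);
  last exact: finite_seq.
move=> [a b] /= abc; rewrite allpairs_f//; apply: mem_box;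
  by rewrite -abc mdegD ?leq_addr ?leq_addl.
Qed.

End Multiindices.

Lemma fsum_seq (V : nmodType) (T : choiceType) (A : set T) (f : T -> V) (r : seq T) :
  uniq r -> [set` r] `<=` A -> (forall i, A i -> i \notin r -> f i = 0) ->
  \sum_(i \in A) f i = \sum_(i <- r) f i.
Proof.
move=> ur rA f0; rewrite [RHS]fsbig_seq//; symmetry; apply: fsbig_widen => // i [Ai /= ir].
by rewrite /= f0//; apply/negP.
Qed.
Arguments fsum_seq {V T A f}.

Section TwistedSeries.
Variables (R : realType) (n : nat) (q : Cstar R).
Local Notation C := (Cplx R).
Implicit Types a b c d : multidx n -> C.

(* [x_j x_i = q^-1 x_i x_j] for [i < j], hence
   [x^a x^b = q^-(\sum_(i < j) a_j b_i) x^(a + b)]. *)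
Definition twist (k l : multidx n) : C := cstar_val q ^- cross l k.

Definition series_mul a b : multidx n -> C := fun m =>
  \sum_(kl \in [set kl : multidx n * multidx n | kl.1 + kl.2 = m])
    twist kl.1 kl.2 * (a kl.1 * b kl.2).

Definition monomial (k : multidx n) : multidx n -> C := fun m => (m == k)%:R.

Lemma twistDl k l m : twist (k + l) m = twist k m * twist l m.
Proof. by rewrite /twist crossDr exprD invfM. Qed.

Lemma twistDr k l m : twist k (l + m) = twist k l * twist k m.
Proof. by rewrite /twist crossDl exprD invfM. Qed.

Lemma series_mulE a b N m : (mdeg m <= N)%N ->
  series_mul a b m = \sum_(k <- box n N) \sum_(l <- box n N | k + l == m)
    twist k l * (a k * b l).
Proof.
move=> mN; rewrite /series_mul.
rewrite (fsum_seq [seq kl <- [seq (k, l) | k <- box n N, l <- box n N] |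
                   kl.1 + kl.2 == m]).
- rewrite big_filter big_mkcond big_allpairs; apply: eq_bigr => k _.
  by rewrite [RHS]big_mkcond.
- rewrite filter_uniq// allpairs_uniq ?box_uniq//.
  by move=> [? ?] [? ?] _ _ /= [-> ->].
- by move=> kl /=; rewrite mem_filter => /andP[/eqP].
- move=> [k l] /= klm; rewrite mem_filter /= klm eqxx /= allpairs_f//;
    by apply: mem_box; apply: leq_trans mN; rewrite -klm mdegD ?leq_addr ?leq_addl.
Qed.

Lemma series_mulA a b c m :
  series_mul a (series_mul b c) m = series_mul (series_mul a b) c m.
Proof.
set N := mdeg m.
pose B := box n N.
have hB k l : k + l = m -> k \in B /\ l \in B.
  by move=> klm; split; apply: mem_box; rewrite /N -klm mdegD ?leq_addr ?leq_addl.
transitivity (\sum_(k <- B) \sum_(l <- B) \sum_(p <- B | k + l + p == m)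
   twist k l * twist k p * twist l p * (a k * b l * c p)).
  rewrite (series_mulE _ _ (leqnn _)); apply: eq_bigr => k _.
  transitivity (\sum_(r <- B) \sum_(l <- B) \sum_(p <- B)
     if (k + r == m) && (l + p == r) then
       twist k l * twist k p * twist l p * (a k * b l * c p) else 0).
    rewrite big_mkcond; apply: eq_bigr => r _; case: eqP => krm; last first.
      by rewrite big1// => l _; rewrite big1.
    have rN : (mdeg r <= N)%N by rewrite /N -krm mdegD leq_addl.
    rewrite (series_mulE _ _ rN) !mulr_sumr; apply: eq_bigr => l _.
    rewrite !mulr_sumr big_mkcond; apply: eq_bigr => p _ /=.
    case: eqP => // <-; rewrite twistDr; ring.
  rewrite exchange_big; apply: eq_bigr => l _ /=.
  rewrite exchange_big [RHS]big_mkcond; apply: eq_bigr => p _ /=.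
  case: eqP => klp; last first.
    by rewrite big1// => r _; case: ifP => // /andP[/eqP krm /eqP lpr];
       case: klp; rewrite -addrA lpr.
  have lpB : l + p \in B by have [] := hB k (l + p); rewrite ?addrA.
  rewrite (bigD1_seq (l + p)) ?box_uniq//= addrA klp !eqxx/= big1 ?addr0//.
  by move=> r; rewrite eq_sym => /negbTE ->; rewrite andbF.
rewrite (series_mulE _ _ (leqnn _)); apply/esym.
transitivity (\sum_(r <- B) \sum_(k <- B) \sum_(l <- B) \sum_(p <- B)
     if (r + p == m) && (k + l == r) then
       twist k l * twist k p * twist l p * (a k * b l * c p) else 0).
  apply: eq_bigr => r _.
  transitivity (\sum_(p <- B) \sum_(k <- B) \sum_(l <- B)
     if (r + p == m) && (k + l == r) then
       twist k l * twist k p * twist l p * (a k * b l * c p) else 0).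
    rewrite big_mkcond; apply: eq_bigr => p _; case: eqP => rpm; last first.
      by rewrite big1// => k _; rewrite big1.
    have rN : (mdeg r <= N)%N by rewrite /N -rpm mdegD leq_addr.
    rewrite (series_mulE _ _ rN) mulr_suml mulr_sumr; apply: eq_bigr => k _.
    rewrite mulr_suml mulr_sumr [LHS]big_mkcond; apply: eq_bigr => l _ /=.
    case: eqP => // <-; rewrite twistDl; ring.
  rewrite exchange_big; apply: eq_bigr => k _.
  by rewrite exchange_big.
rewrite exchange_big; apply: eq_bigr => k _ /=.
rewrite exchange_big; apply: eq_bigr => l _ /=.
rewrite exchange_big [RHS]big_mkcond; apply: eq_bigr => p _ /=.
case: eqP => klp; last first.
  by rewrite big1// => r _; case: ifP => // /andP[/eqP rpm /eqP klr];
     case: klp; rewrite klr.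
have klB : k + l \in B by have [] := hB (k + l) p.
rewrite (bigD1_seq (k + l)) ?box_uniq//= klp !eqxx/= big1 ?addr0//.
by move=> r; rewrite eq_sym => /negbTE ->; rewrite andbF.
Qed.

Lemma series_mul_monomial k l :
  series_mul (monomial k) (monomial l) = (fun m => twist k l * monomial (k + l) m).
Proof.
apply: funext => m; rewrite /series_mul /monomial.
rewrite (fsum_seq (if k + l == m then [:: (k, l)] else [::])).
- rewrite [m == _]eq_sym; case: ifP; rewrite ?big_nil ?mulr0//.
  by rewrite big_seq1 /= !eqxx !mulr1.
- by case: ifP.
- by move=> kl /=; case: eqP => // klm; rewrite inE => /eqP ->.
- move=> [k' l'] /= klm; case: (k' =P k) => [ek|]; last by rewrite mul0r mulr0.
  case: (l' =P l) => [el|]; last by rewrite !mulr0.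
  by rewrite -ek -el klm eqxx inE eqxx.
Qed.

Lemma series_mul1 a : series_mul (monomial 0) a = a.
Proof.
apply: funext => m; rewrite /series_mul /monomial (fsum_seq [:: (0, m)]).
- by rewrite big_seq1 /= eqxx /twist cross0r expr0 invr1 !mul1r.
- by [].
- by move=> kl /=; rewrite inE => /eqP -> /=; rewrite add0r.
- move=> [k l] /= klm; case: (k =P 0) => [k0|]; last by rewrite mul0r mulr0.
  by rewrite -klm k0 add0r inE eqxx.
Qed.

Lemma series_mulr1 a : series_mul a (monomial 0) = a.
Proof.
apply: funext => m; rewrite /series_mul /monomial (fsum_seq [:: (m, 0)]).
- by rewrite big_seq1 /= eqxx /twist cross0l expr0 invr1 mul1r mulr1.
- by [].
- by move=> kl /=; rewrite inE => /eqP -> /=; rewrite addr0.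
- move=> [k l] /= klm; case: (l =P 0) => [l0|]; last by rewrite !mulr0.
  by rewrite -klm l0 addr0 inE eqxx.
Qed.

Lemma series_mulDl a b c :
  series_mul (fun k => a k + b k) c = (fun m => series_mul a c m + series_mul b c m).
Proof.
apply: funext => m; rewrite /series_mul -fsbig_split; last exact: finite_splits.
by apply: eq_fsbigr => kl _; rewrite mulrDl mulrDr.
Qed.

Lemma series_mulDr a b c :
  series_mul a (fun k => b k + c k) = (fun m => series_mul a b m + series_mul a c m).
Proof.
apply: funext => m; rewrite /series_mul -fsbig_split; last exact: finite_splits.
by apply: eq_fsbigr => kl _; rewrite !mulrDr.
Qed.

Lemma series_mulZl (z : C) a b :
  series_mul (fun k => z * a k) b = (fun m => z * series_mul a b m).
Proof.
apply: funext => m; rewrite /series_mul mulr_fsumr.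
apply: eq_fsbigr => kl _; ring.
Qed.

Lemma series_mulZr (z : C) a b :
  series_mul a (fun k => z * b k) = (fun m => z * series_mul a b m).
Proof.
apply: funext => m; rewrite /series_mul mulr_fsumr.
apply: eq_fsbigr => kl _; ring.
Qed.

Definition qweight (k : multidx n) : R :=
  if 1 <= cabs (cstar_val q) then 1
  else cabs (cstar_val q) ^+ cross k k.

Definition polydisk_enorm (rho : R) a : \bar R :=
  \esum_(k in [set: multidx n])
    (cabs (a k) * qweight k * rho ^+ mdeg k)%:E.

Definition polydisk_norm (rho : R) a : R := fine (polydisk_enorm rho a).

Definition polydisk_radii (r : \bar R) : set R :=
  [set rho | 0 < rho /\ (rho%:E < r)%E].

Definition in_polydisk (r : \bar R) a : Prop :=
  forall rho, polydisk_radii r rho -> (polydisk_enorm rho a < +oo)%E.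

End TwistedSeries.

Section PolydiskClosed.
Variables (R : realType) (n : nat) (q : Cstar R).
Local Notation C := (Cplx R).
Implicit Types a b c : multidx n -> C.

Let qabs_gt0 : 0 < cabs (cstar_val q).
Proof. exact/cabs_gt0/cstar_neq0. Qed.

Lemma qweight_ge0 (k : multidx n) : 0 <= qweight q k.
Proof. by rewrite /qweight; case: ifP => // _; rewrite exprn_ge0// cabs_ge0. Qed.

Lemma qweightD (k l : multidx n) :
  cabs (twist q k l) * qweight q (k + l) <= qweight q k * qweight q l.
Proof.
rewrite /twist cabsV cabsX /qweight; case: ifP => [q1|/negbT].
  by rewrite !mulr1 invf_le1 ?exprn_gt0// exprn_ege1.
rewrite -ltNge => q1; rewrite crossDl !crossDr !exprD.
set x := _ ^+ cross k k; set y := _ ^+ cross l l.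
set z := _ ^+ cross k l; set t := _ ^+ cross l k.
have t0 : t != 0 by rewrite gt_eqF// exprn_gt0.
have -> : t^-1 * (x * z * (t * y)) = x * y * z by field.
by rewrite ler_piMr ?mulr_ge0 ?exprn_ge0 ?cabs_ge0// exprn_ile1 ?cabs_ge0// ltW.
Qed.

Definition pterm (rho : R) a (k : multidx n) : R :=
  cabs (a k) * qweight q k * rho ^+ mdeg k.

Lemma pterm_ge0 rho a k : 0 < rho -> 0 <= pterm rho a k.
Proof.
by move=> rho0; rewrite !mulr_ge0 ?cabs_ge0 ?qweight_ge0// exprn_ge0// ltW.
Qed.

Lemma polydisk_enormP rho a : 0 < rho ->
  (polydisk_enorm q rho a < +oo)%E <->
  exists M : R, forall s : seq (multidx n), uniq s ->
    \sum_(k <- s) pterm rho a k <= M.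
Proof.
move=> rho0; split.
- move=> afin; exists (polydisk_norm q rho a) => s us.
  have a0 : (0 <= polydisk_enorm q rho a)%E.
    by apply: esum_ge0 => k _; rewrite lee_fin pterm_ge0.
  rewrite -lee_fin fineK ?ge0_fin_numE// -sumEFin.
  apply: ereal_sup_ubound; exists [set` s]; first by split => //; exact: finite_seq.
  by rewrite -fsbig_seq.
- move=> [M hM]; apply: (@le_lt_trans _ _ M%:E); last exact: ltry.
  apply: ge_ereal_sup => _ [A [Afin _] <-].
  by rewrite fsbig_finite//= sumEFin lee_fin hM// fset_uniq.
Qed.

Lemma in_polydisk0 r : in_polydisk q r (fun _ : multidx n => 0 : C).
Proof.
move=> rho [rho0 _]; apply/polydisk_enormP => //; exists 0 => s _.
by rewrite big1// => k _; rewrite /pterm cabs0 !mul0r.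
Qed.

Lemma in_polydiskD r a b : in_polydisk q r a -> in_polydisk q r b ->
  in_polydisk q r (fun k => a k + b k).
Proof.
move=> ha hb rho hrho; have [rho0 _] := hrho.
have /(polydisk_enormP _ rho0)[M hM] := ha _ hrho.
have /(polydisk_enormP _ rho0)[N hN] := hb _ hrho.
apply/polydisk_enormP => //; exists (M + N) => s us.
apply: le_trans (lerD (hM _ us) (hN _ us)); rewrite -big_split.
apply: ler_sum => k _; rewrite /pterm /= -!mulrDl.
by rewrite -!mulrA ler_wpM2r ?cabsD// mulr_ge0 ?qweight_ge0// exprn_ge0// ltW.
Qed.

Lemma in_polydiskZ r (z : C) a : in_polydisk q r a ->
  in_polydisk q r (fun k => z * a k).
Proof.
move=> ha rho hrho; have [rho0 _] := hrho.
have /(polydisk_enormP _ rho0)[M hM] := ha _ hrho.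
apply/polydisk_enormP => //; exists (cabs z * M) => s us.
apply: le_trans (ler_wpM2l (cabs_ge0 z) (hM _ us)); rewrite mulr_sumr.
by apply: ler_sum => k _; rewrite /pterm cabsM !mulrA.
Qed.

Lemma in_polydisk_monomial r (k : multidx n) : in_polydisk q r (monomial R k).
Proof.
move=> rho [rho0 _]; apply/polydisk_enormP => //.
exists (pterm rho (monomial R k) k) => s us.
have [ks|ks] := boolP (k \in s); last first.
  rewrite big_seq big1 ?pterm_ge0// => l ls; rewrite /pterm /monomial.
  by case: eqP ls ks => [-> ->//|_ _ _]; rewrite cabs0 !mul0r.
rewrite (bigD1_seq k)//= big1 ?addr0// => l /negbTE lk.
by rewrite /pterm /monomial lk cabs0 !mul0r.
Qed.

Lemma in_polydiskM r a b : in_polydisk q r a -> in_polydisk q r b ->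
  in_polydisk q r (series_mul q a b).
Proof.
move=> ha hb rho hrho; have [rho0 _] := hrho.
have /(polydisk_enormP _ rho0)[M hM] := ha _ hrho.
have /(polydisk_enormP _ rho0)[N hN] := hb _ hrho.
apply/polydisk_enormP => //; exists (M * N) => s us.
pose K := (\max_(m <- s) mdeg m)%N; pose B := box n K.
apply: (@le_trans _ _ ((\sum_(k <- B) pterm rho a k) * (\sum_(l <- B) pterm rho b l))).
  apply: (@le_trans _ _ (\sum_(m <- s) \sum_(k <- B) \sum_(l <- B | k + l == m)
      pterm rho a k * pterm rho b l)).
    rewrite big_seq [leRHS]big_seq; apply: ler_sum => m ms.
    have mK : (mdeg m <= K)%N by exact: leq_bigmax_seq.
    rewrite /pterm (series_mulE _ _ _ mK) -mulrA.
    apply: (@le_trans _ _ ((\sum_(k <- B) \sum_(l <- B | k + l == m)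
       cabs (twist q k l * (a k * b l))) * (qweight q m * rho ^+ mdeg m))).
      rewrite ler_wpM2r ?mulr_ge0 ?qweight_ge0 ?exprn_ge0 ?(ltW rho0)//.
      apply: le_trans (cabs_sum _ _ _) _; apply: ler_sum => k _.
      exact: cabs_sum.
    rewrite mulr_suml; apply: ler_sum => k _; rewrite mulr_suml.
    apply: ler_sum => l /eqP <-; rewrite !cabsM mdegD exprD.
    have := qweightD k l; set w := qweight q (k + l); set x := qweight q k => hw.
    set y := qweight q l in hw *.
    rewrite [leLHS](_ : _ = (cabs (twist q k l) * w) *
      (cabs (a k) * cabs (b l) * (rho ^+ mdeg k * rho ^+ mdeg l))); last by ring.
    rewrite [leRHS](_ : _ = (x * y) *
      (cabs (a k) * cabs (b l) * (rho ^+ mdeg k * rho ^+ mdeg l))); last by ring.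
    rewrite ler_wpM2r//; do ?apply: mulr_ge0; rewrite ?exprn_ge0 ?(ltW rho0)//;
      exact: cabs_ge0.
  rewrite mulr_suml exchange_big; apply: ler_sum => k _ /=.
  rewrite mulr_sumr; under eq_bigr do rewrite big_mkcond.
  rewrite exchange_big; apply: ler_sum => l _ /=.
  have [ms|ms] := boolP (k + l \in s); last first.
    rewrite big_seq_cond big1; first by apply: mulr_ge0; exact: pterm_ge0.
    by move=> m /andP[ms' _]; case: eqP => // e; rewrite e ms' in ms.
  rewrite (bigD1_seq (k + l))//= eqxx big1 ?addr0// => m.
  by rewrite eq_sym => /negbTE ->.
by apply: ler_pM; rewrite ?sumr_ge0 ?hM ?hN ?box_uniq// => *; exact: pterm_ge0.
Qed.

End PolydiskClosed.

Record polydisk (R : realType) (n : nat) (q : Cstar R) (r : \bar R) := Polydisk {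
  coef : multidx n -> Cplx R;
  coefP : in_polydisk q r coef }.

Section Polydisk.
Variables (R : realType) (n : nat) (q : Cstar R) (r : \bar R).
Local Notation C := (Cplx R).
Local Notation O := (polydisk n q r).

Lemma polydisk_ext (a b : O) : coef a =1 coef b -> a = b.
Proof.
by case: a b => [a ha] [b hb] /= /funext ab; subst b; congr Polydisk; exact: Prop_irrelevance.
Qed.

HB.instance Definition _ := gen_eqMixin O.
HB.instance Definition _ := gen_choiceMixin O.

Definition polydisk_zero : O := Polydisk (@in_polydisk0 R n q r).
Definition polydisk_add (a b : O) : O := Polydisk (in_polydiskD (coefP a) (coefP b)).
Definition polydisk_scale (z : C) (a : O) : O := Polydisk (in_polydiskZ z (coefP a)).
Definition polydisk_opp (a : O) : O := polydisk_scale (- 1) a.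
Definition polydisk_monomial (k : multidx n) : O := Polydisk (@in_polydisk_monomial R n q r k).
Definition polydisk_mul (a b : O) : O := Polydisk (in_polydiskM (coefP a) (coefP b)).

Fact polydisk_addA : associative polydisk_add.
Proof. by move=> a b c; apply: polydisk_ext => k /=; rewrite addrA. Qed.
Fact polydisk_addC : commutative polydisk_add.
Proof. by move=> a b; apply: polydisk_ext => k /=; rewrite addrC. Qed.
Fact polydisk_add0 : left_id polydisk_zero polydisk_add.
Proof. by move=> a; apply: polydisk_ext => k /=; rewrite add0r. Qed.
Fact polydisk_addN : left_inverse polydisk_zero polydisk_opp polydisk_add.
Proof. by move=> a; apply: polydisk_ext => k /=; rewrite mulN1r addNr. Qed.

HB.instance Definition _ := GRing.isZmodule.Build O
  polydisk_addA polydisk_addC polydisk_add0 polydisk_addN.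

Fact polydisk_mulA : associative polydisk_mul.
Proof. by move=> a b c; apply: polydisk_ext => k; exact: series_mulA. Qed.
Fact polydisk_mul1 : left_id (polydisk_monomial 0) polydisk_mul.
Proof. by move=> a; apply: polydisk_ext => k /=; rewrite series_mul1. Qed.
Fact polydisk_mulr1 : right_id (polydisk_monomial 0) polydisk_mul.
Proof. by move=> a; apply: polydisk_ext => k /=; rewrite series_mulr1. Qed.
Fact polydisk_mulDl : left_distributive polydisk_mul +%R.
Proof. by move=> a b c; apply: polydisk_ext => k /=; rewrite series_mulDl. Qed.
Fact polydisk_mulDr : right_distributive polydisk_mul +%R.
Proof. by move=> a b c; apply: polydisk_ext => k /=; rewrite series_mulDr. Qed.
Fact polydisk_1neq0 : polydisk_monomial 0 != 0.
Proof.
apply/eqP => /(congr1 (fun a => coef a 0)) /=; rewrite /monomial eqxx.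
by apply/eqP; exact: oner_neq0.
Qed.

HB.instance Definition _ := GRing.Zmodule_isNzRing.Build O
  polydisk_mulA polydisk_mul1 polydisk_mulr1 polydisk_mulDl polydisk_mulDr
  polydisk_1neq0.

Fact polydisk_scaleA (x y : C) (a : O) :
  polydisk_scale x (polydisk_scale y a) = polydisk_scale (x * y) a.
Proof. by apply: polydisk_ext => k /=; rewrite mulrA. Qed.
Fact polydisk_scale1 : left_id 1 polydisk_scale.
Proof. by move=> a; apply: polydisk_ext => k /=; rewrite mul1r. Qed.
Fact polydisk_scaleDr : right_distributive polydisk_scale +%R.
Proof. by move=> x a b; apply: polydisk_ext => k /=; rewrite mulrDr. Qed.
Fact polydisk_scaleDl (a : O) : {morph polydisk_scale^~ a : x y / x + y}.
Proof. by move=> x y; apply: polydisk_ext => k /=; rewrite mulrDl. Qed.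

HB.instance Definition _ := GRing.Zmodule_isLmodule.Build C O
  polydisk_scaleA polydisk_scale1 polydisk_scaleDr polydisk_scaleDl.

Fact polydisk_scaleAl (x : C) (a b : O) : x *: (a * b) = (x *: a) * b.
Proof. by apply: polydisk_ext => k /=; rewrite series_mulZl. Qed.
Fact polydisk_scaleAr (x : C) (a b : O) : x *: (a * b) = a * (x *: b).
Proof. by apply: polydisk_ext => k /=; rewrite series_mulZr. Qed.

HB.instance Definition _ := GRing.Lmodule_isLalgebra.Build C O polydisk_scaleAl.
HB.instance Definition _ := GRing.Lalgebra_isAlgebra.Build C O polydisk_scaleAr.

(* The product is determined by [x_i x_j = q x_j x_i] for [i < j]. *)
Lemma polydisk_monomialM (k l : multidx n) :
  polydisk_monomial k * polydisk_monomial l =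
  twist q k l *: polydisk_monomial (k + l).
Proof. by apply: polydisk_ext => m /=; rewrite series_mul_monomial. Qed.

Lemma polydisk_relation (i j : 'I_n) : (i < j)%N ->
  polydisk_monomial (mdelta i) * polydisk_monomial (mdelta j) =
  cstar_val q *: (polydisk_monomial (mdelta j) * polydisk_monomial (mdelta i)).
Proof.
move=> ij; rewrite !polydisk_monomialM /twist !cross_mdelta ij ltnNge (ltnW ij) /=.
by rewrite expr0 invr1 expr1 scale1r scalerA mulfV ?cstar_neq0// scale1r addrC.
Qed.

Definition polydisk_seminorm (rho : R) (a : O) : R := polydisk_norm q rho (coef a).

Lemma polydisk_enorm_fin rho (a : O) : polydisk_radii r rho ->
  polydisk_enorm q rho (coef a) \is a fin_num.
Proof.
move=> hrho; have [rho0 _] := hrho; rewrite ge0_fin_numE ?(coefP a hrho)//.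
by apply: esum_ge0 => k _; rewrite lee_fin; exact: pterm_ge0.
Qed.

Lemma polydisk_seminorm0 rho : polydisk_radii r rho -> polydisk_seminorm rho 0 = 0.
Proof.
move=> _; rewrite /polydisk_seminorm /polydisk_norm /polydisk_enorm esum1//.
by move=> k _; rewrite cabs0 !mul0r.
Qed.

Lemma polydisk_seminormD rho : polydisk_radii r rho -> forall a b : O,
  polydisk_seminorm rho (a + b) <= polydisk_seminorm rho a + polydisk_seminorm rho b.
Proof.
move=> hrho a b; have [rho0 _] := hrho.
rewrite -lee_fin EFinD !fineK ?polydisk_enorm_fin//.
rewrite /polydisk_enorm -esumD; last 2 first.
- by move=> k _; rewrite lee_fin; exact: pterm_ge0.
- by move=> k _; rewrite lee_fin; exact: pterm_ge0.
apply: le_esum => k _; rewrite -EFinD lee_fin -!mulrDl -!mulrA.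
by rewrite ler_wpM2r ?cabsD// mulr_ge0 ?qweight_ge0// exprn_ge0// ltW.
Qed.

HB.instance Definition _ := hasNbhs.Build O
  (seminorm_nbhs (polydisk_radii r) polydisk_seminorm).
HB.instance Definition _ := Nbhs_isNbhsTopological.Build O
  (seminorm_nbhs_filter polydisk_seminorm0)
  (seminorm_nbhs_singleton polydisk_seminorm0)
  (seminorm_nbhs_nbhs polydisk_seminormD).

End Polydisk.

Definition oball (R : realType) (n : nat) : set 'rV[Cplx R]_n :=
  [set z | \sum_i cabs (z 0 i) ^+ 2 < 1].
Arguments oball : clear implicits.

(* [f] is complex differentiable at every point of the ball; its values are
   extended arbitrarily to ['rV_n] to speak of [differentiable]. *)
Definition holomorphic_on_ball (R : realType) (n : nat) (f : oball R n -> Cplx R) :=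
  exists g : 'rV[Cplx R]_n -> Cplx R,
    (forall z, oball R n z -> differentiable g z) /\
    (forall z : oball R n, f z = g (\val z)).

Record hol_ball (R : realType) (n : nat) := HolBall {
  hol_fun : oball R n -> Cplx R;
  hol_funP : holomorphic_on_ball hol_fun }.

Section HolBall.
Variables (R : realType) (n : nat).
Local Notation C := (Cplx R).
Local Notation O := (hol_ball R n).

Lemma hol_ext (a b : O) : hol_fun a =1 hol_fun b -> a = b.
Proof.
by case: a b => [a ha] [b hb] /= /funext ab; subst b; congr HolBall; exact: Prop_irrelevance.
Qed.

HB.instance Definition _ := gen_eqMixin O.
HB.instance Definition _ := gen_choiceMixin O.

Lemma holomorphic_cst (c : C) : holomorphic_on_ball (fun _ : oball R n => c).
Proof. by exists (fun=> c); split. Qed.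

Lemma holomorphicD (f g : oball R n -> C) : holomorphic_on_ball f ->
  holomorphic_on_ball g -> holomorphic_on_ball (fun z => f z + g z).
Proof.
move=> [F [dF fF]] [G [dG gG]]; exists (F + G); split => [z Bz|z].
  by apply: differentiableD; [exact: dF|exact: dG].
by rewrite fF gG.
Qed.

Lemma holomorphicM (f g : oball R n -> C) : holomorphic_on_ball f ->
  holomorphic_on_ball g -> holomorphic_on_ball (fun z => f z * g z).
Proof.
move=> [F [dF fF]] [G [dG gG]]; exists (F * G); split => [z Bz|z].
  by apply: differentiableM; [exact: dF|exact: dG].
by rewrite fF gG.
Qed.

Definition hol_cst (c : C) : O := HolBall (holomorphic_cst c).
Definition hol_add (a b : O) : O := HolBall (holomorphicD (hol_funP a) (hol_funP b)).
Definition hol_mul (a b : O) : O := HolBall (holomorphicM (hol_funP a) (hol_funP b)).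
Definition hol_scale (c : C) (a : O) : O := hol_mul (hol_cst c) a.
Definition hol_opp (a : O) : O := hol_scale (- 1) a.

Fact hol_addA : associative hol_add.
Proof. by move=> a b c; apply: hol_ext => z /=; rewrite addrA. Qed.
Fact hol_addC : commutative hol_add.
Proof. by move=> a b; apply: hol_ext => z /=; rewrite addrC. Qed.
Fact hol_add0 : left_id (hol_cst 0) hol_add.
Proof. by move=> a; apply: hol_ext => z /=; rewrite add0r. Qed.
Fact hol_addN : left_inverse (hol_cst 0) hol_opp hol_add.
Proof. by move=> a; apply: hol_ext => z /=; rewrite mulN1r addNr. Qed.

HB.instance Definition _ := GRing.isZmodule.Build O hol_addA hol_addC hol_add0 hol_addN.

Lemma oball0 : oball R n 0.
Proof. by rewrite /oball /= big1// => i _; rewrite mxE cabs0 expr0n. Qed.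

Fact hol_mulA : associative hol_mul.
Proof. by move=> a b c; apply: hol_ext => z /=; rewrite mulrA. Qed.
Fact hol_mul1 : left_id (hol_cst 1) hol_mul.
Proof. by move=> a; apply: hol_ext => z /=; rewrite mul1r. Qed.
Fact hol_mulr1 : right_id (hol_cst 1) hol_mul.
Proof. by move=> a; apply: hol_ext => z /=; rewrite mulr1. Qed.
Fact hol_mulDl : left_distributive hol_mul +%R.
Proof. by move=> a b c; apply: hol_ext => z /=; rewrite mulrDl. Qed.
Fact hol_mulDr : right_distributive hol_mul +%R.
Proof. by move=> a b c; apply: hol_ext => z /=; rewrite mulrDr. Qed.
Fact hol_1neq0 : hol_cst 1 != 0.
Proof.
apply/eqP => /(congr1 (fun a => hol_fun a (exist _ 0 (mem_set oball0)))) /=.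
by apply/eqP; exact: oner_neq0.
Qed.

HB.instance Definition _ := GRing.Zmodule_isNzRing.Build O
  hol_mulA hol_mul1 hol_mulr1 hol_mulDl hol_mulDr hol_1neq0.

Fact hol_scaleA (x y : C) (a : O) : hol_scale x (hol_scale y a) = hol_scale (x * y) a.
Proof. by apply: hol_ext => z /=; rewrite mulrA. Qed.
Fact hol_scale1 : left_id 1 hol_scale.
Proof. by move=> a; apply: hol_ext => z /=; rewrite mul1r. Qed.
Fact hol_scaleDr : right_distributive hol_scale +%R.
Proof. by move=> x a b; apply: hol_ext => z /=; rewrite mulrDr. Qed.
Fact hol_scaleDl (a : O) : {morph hol_scale^~ a : x y / x + y}.
Proof. by move=> x y; apply: hol_ext => z /=; rewrite mulrDl. Qed.

HB.instance Definition _ := GRing.Zmodule_isLmodule.Build C O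
  hol_scaleA hol_scale1 hol_scaleDr hol_scaleDl.

Fact hol_scaleAl (x : C) (a b : O) : x *: (a * b) = (x *: a) * b.
Proof. by apply: hol_ext => z /=; rewrite mulrA. Qed.
Fact hol_scaleAr (x : C) (a b : O) : x *: (a * b) = a * (x *: b).
Proof. by apply: hol_ext => z /=; rewrite mulrCA. Qed.

HB.instance Definition _ := GRing.Lmodule_isLalgebra.Build C O hol_scaleAl.
HB.instance Definition _ := GRing.Lalgebra_isAlgebra.Build C O hol_scaleAr.

Definition hol_compact (a : O) : {family compact, oball R n -> C} := hol_fun a.

HB.instance Definition _ := Topological.copy O (initial_topology hol_compact).

End HolBall.

Section PolReg.
Variables (R : realType) (n : nat).
Local Notation C := (Cplx R).

Definition reg_relations (q : C) (A : algType C) (x : 'I_n -> A) : Prop :=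
  forall i j : 'I_n, (i < j)%N -> x i * x j = q *: (x j * x i).

(* Generators and relations, as a universal property: [A] is
   [O_q^reg(C^n)]. *)
Definition presents_reg (q : C) (A : algType C) (x : 'I_n -> A) : Prop :=
  reg_relations q x /\
  forall (B : algType C) (y : 'I_n -> B), reg_relations q y ->
    exists f : {lrmorphism A -> B}, (forall i, f (x i) = y i) /\
      forall g : {lrmorphism A -> B}, (forall i, g (x i) = y i) -> g =1 f.

Record starAlgebra := StarAlgebra {
  star_alg :> algType C;
  star : star_alg -> star_alg;
  star_linear : forall (c : C) u v, star (c *: u + v) = c^* *: star u + star v;
  starM : forall u v, star (u * v) = star v * star u;
  starK : involutive star }.

Definition pol_relations (q : R) (P : starAlgebra) (z : 'I_n -> P) : Prop :=
  [/\ forall i j : 'I_n, (i < j)%N -> z i * z j = realC q *: (z j * z i),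
      forall i j : 'I_n, i != j ->
        star (z i) * z j = realC q *: (z j * star (z i)) &
      forall i : 'I_n, star (z i) * z i =
        realC (q ^+ 2) *: (z i * star (z i)) +
        realC (1 - q ^+ 2) *:
          (1 - \sum_(k < n | (i < k)%N) z k * star (z k))].

(* Likewise for *-algebras: [P] is [Pol_q(C^n)]. *)
Definition presents_pol (q : R) (P : starAlgebra) (z : 'I_n -> P) : Prop :=
  pol_relations q z /\
  forall (B : starAlgebra) (y : 'I_n -> B), pol_relations q y ->
    exists f : {lrmorphism P -> B},
      [/\ forall u, f (star u) = star (f u), forall i, f (z i) = y i &
        forall g : {lrmorphism P -> B}, (forall u, g (star u) = star (g u)) ->
          (forall i, g (z i) = y i) -> g =1 f].

End PolReg.

(* The inner product is linear in its first argument. *)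
Record hilbertSpace (R : realType) := HilbertSpace {
  hilbert :> completeNormedModType (Cplx R);
  ip : hilbert -> hilbert -> Cplx R;
  ip_linear : forall (c : Cplx R) u v w, ip (c *: u + v) w = c * ip u w + ip v w;
  ip_conj : forall u v, ip v u = (ip u v)^*;
  ip_norm : forall u, ip u u = `|u| ^+ 2 }.

Definition orthonormal_basis (R : realType) (H : hilbertSpace R) (I : choiceType)
    (e : I -> H) : Prop :=
  (forall i j, ip (e i) (e j) = (i == j)%:R) /\
  dense [set v : H | exists (s : seq I) (c : I -> Cplx R), v = \sum_(i <- s) c i *: e i].

Definition op_norm (R : realType) (H : hilbertSpace R) (T : H -> H) : R :=
  sup [set complex.Re `|T v| | v in [set v : H | `|v| <= 1]].

(* Representation by bounded operators, [ip]-adjoints representing [star]. *)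
Definition star_representation (R : realType) (P : starAlgebra R)
    (H : hilbertSpace R) (pi : P -> H -> H) : Prop :=
  [/\ forall a, linear (pi a) /\ continuous (pi a),
      forall (c : Cplx R) a b v, pi (c *: a + b) v = c *: pi a v + pi b v,
      forall v, pi 1 v = v,
      forall a b v, pi (a * b) v = pi a (pi b v) &
      forall a u v, ip (pi (star a) u) v = ip u (pi a v)].

Section QuantumBall.
Variables (R : realType) (n : nat) (q : R).
Local Notation C := (Cplx R).

Definition qint (k : nat) : R := \sum_(i < k) q ^+ (2 * i).

Record qballModel := QballModel {
  reg : algType C;
  reg_gen : 'I_n -> reg;
  regP : presents_reg (realC q) reg_gen;
  pol : starAlgebra R;
  pol_gen : 'I_n -> pol;
  polP : presents_pol q pol_gen;
  reg_pol : {lrmorphism reg -> pol};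
  reg_pol_gen : forall i, reg_pol (reg_gen i) = pol_gen i;
  fock : hilbertSpace R;
  fock_basis : multidx n -> fock;
  fock_basisP : orthonormal_basis fock_basis;
  rep : pol -> fock -> fock;
  repP : star_representation rep;
  rep_gen : forall (j : 'I_n) (k : multidx n),
    rep (pol_gen j) (fock_basis k) =
    realC (Num.sqrt (1 - q ^+ 2) * Num.sqrt (qint (k j).+1) *
      q ^+ (\sum_(i < n | (j < i)%N) k i)) *: fock_basis (k + mdelta j);
  dilation : R -> {lrmorphism reg -> reg};
  dilation_gen : forall s, 0 < s < 1 ->
    forall i, dilation s (reg_gen i) = realC s *: reg_gen i }.

Definition qball_norm (M : qballModel) (s : R) (a : reg M) : R :=
  op_norm (rep (reg_pol M (dilation M s a))).

End QuantumBall.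

(* [E], with [j], is the completion of [A] for the seminorms [p i], [D i]. *)
Definition is_completion (R : realType) (A : algType (Cplx R)) (I : eqType)
    (D : set I) (p : I -> A -> R) (E : preTopologicalAlgType (Cplx R))
    (j : {lrmorphism A -> E}) : Prop :=
  [/\ is_topological_algebra E, hausdorff_space E, additively_complete E,
      dense (range j) &
      forall (a : A) (W : set A), seminorm_nbhs D p a W <->
        exists2 U : set E, nbhs (j a) U & j @^-1` U `<=` W].

(* [E] is a model of [O_q^hol(B^n)]. Up to isomorphism it does not depend on
   [M]: presentations, the representation determined by [rep_gen], the
   dilations and completions are all unique. *)
Definition is_qball (R : realType) (n : nat) (q : R)
    (E : preTopologicalAlgType (Cplx R)) : Prop :=
  exists (M : qballModel n q) (j : {lrmorphism reg M -> E}),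
    is_completion [set s : R | 0 < s < 1] (@qball_norm R n q M) j.

(* Main.v *)
Require Import Defs.
From HB Require Import structures.
From mathcomp Require Import all_boot all_order all_algebra finmap complex ring lra.
From mathcomp Require Import all_classical all_reals all_analysis.

Set Implicit Arguments.
Unset Strict Implicit.
Unset Printing Implicit Defensive.

Import Order.TTheory GRing.Theory Num.Theory numFieldNormedType.Exports.
Import ComplexField.

Local Open Scope classical_set_scope.
Local Open Scope ring_scope.

(** Both bundles come from one construction. The ordered monomials trivialise all the
    algebras at once: in each of them an element is a family of coefficients [c_k], the
    product is a convolution twisted by [q], and only the weights in the norms, the sums of
    [|c_k| u(q, k) rho^|k|], depend on [q] besides the twist. If [u] is positive, continuous
    in [q] and submultiplicative for the twisted product, then the spaces of series whose
    norms are finite for all [rho < r] form a Fréchet algebra bundle, [weighted_bundle]. The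
    neighbourhoods in its total space are tubes around polynomials. The norm of a polynomial
    is a finite sum, continuous in [q], and polynomials are dense in every fibre; this
    reduces the continuity of the operations to that of finitely many coefficients.

    For the polydisk the weight of its definition has these properties, [polydisk_iso].

    For the ball the weight is [|q|^(sum of k_i k_j over i < j)] divided by the square root
    of the [|q|^2]-multinomial coefficient of [k]. It is submultiplicative because these
    coefficients, which count words by inversions, are supermultiplicative, [qmulti_supmul].
    For [0 < q < 1] the norms so defined are equivalent to the operator norms in the Fock
    representation: an ordered monomial acts with norm at most [q^(sum of k_i k_j over i <
    j)], the vacuum vector returns each coefficient of an element up to an explicit factor,
    and the multinomial coefficients grow slower than any exponential. Hence the fibre is
    the completion that defines the quantum ball, [fiber_is_qball].

    For [q = 1] the fibre is an algebra of power series in commuting variables. By the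
    multinomial theorem its norms dominate the suprema on closed balls, so evaluation maps
    it to holomorphic functions, [ball_fun]. Conversely a holomorphic function on the ball
    expands into a power series on each polydisc inside it, [hol_expansion], with Cauchy's
    estimates. The best polydisc for the coefficient [c_k] has radii with [r_i^2]
    proportional to [k_i], and there Stirling's formula turns the estimate for [c_k] into
    the bound by the weight of [k] that is needed, up to a polynomial factor,
    [optimal_radii] and [wnorm_of_estimates]. So evaluation is an isomorphism of topological
    algebras, [ball_iso].

    The expansion uses Cauchy's theory for functions that are complex differentiable at each
    point, without continuity of the derivative. Goursat's bisection argument works for the
    midpoint rule, which is exact on affine functions and halves along with the rectangle,
    [goursat]. On rectangles in the coordinate [log z] it shows that the averages of a
    holomorphic function over [2^n] equidistant points of a circle become independent of the
    radius, [mean_annulus]. Hence the polynomials whose coefficients are such averages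
    converge to the function, [tayl_cvg], with an explicit error, [tayl_error]; applied in
    one variable after the other they show that polynomials are uniformly dense,
    [polyfun_dense]. *)

(** * Complex numbers *)

Section ComplexBasics.
Variable R : realType.
Local Notation C := (Cplx R).
Implicit Types (x y : R) (z w : C).

Lemma norm_cabs z : `|z| = realC (cabs z). Proof. by []. Qed.

Lemma realC0 : realC (0 : R) = 0. Proof. by []. Qed.
Lemma realC1 : realC (1 : R) = 1. Proof. by []. Qed.
Lemma realCD x y : realC (x + y) = realC x + realC y.
Proof. exact: (rmorphD (real_complex R)). Qed.
Lemma realCB x y : realC (x - y) = realC x - realC y.
Proof. exact: (rmorphB (real_complex R)). Qed.
Lemma realCN x : realC (- x) = - realC x.
Proof. exact: (rmorphN (real_complex R)). Qed.
Lemma realCM x y : realC (x * y) = realC x * realC y.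
Proof. exact: (rmorphM (real_complex R)). Qed.
Lemma realCV x : realC (x^-1) = (realC x)^-1.
Proof. exact: (fmorphV (real_complex R)). Qed.
Lemma realCX x k : realC (x ^+ k) = realC x ^+ k.
Proof. exact: (rmorphXn (real_complex R)). Qed.
Lemma realC_sum (I : Type) (s : seq I) (P : pred I) (F : I -> R) :
  realC (\sum_(i <- s | P i) F i) = \sum_(i <- s | P i) realC (F i).
Proof. exact: (rmorph_sum (real_complex R)). Qed.
Lemma realC_nat k : realC (k%:R : R) = k%:R.
Proof. exact: (rmorph_nat (real_complex R)). Qed.
Lemma realC_inj : injective (@realC R).
Proof. exact: (fmorph_inj (real_complex R)). Qed.
Lemma realC_eq0 x : (realC x == 0) = (x == 0).
Proof. exact: (fmorph_eq0 (real_complex R)). Qed.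
Lemma realC_le x y : (realC x <= realC y) = (x <= y).
Proof. by rewrite /realC lecR. Qed.
Lemma realC_lt x y : (realC x < realC y) = (x < y).
Proof. by rewrite /realC ltcR. Qed.
Lemma realC_conj x : (realC x)^* = realC x.
Proof. by apply: conj_Creal; rewrite complex_real. Qed.

Lemma cabs_realC x : cabs (realC x) = `|x|.
Proof. by apply: realC_inj; rewrite -norm_cabs /realC normc_def /= expr0n addr0 sqrtr_sqr. Qed.
Lemma cabs_conj z : cabs z^* = cabs z.
Proof. by apply: realC_inj; rewrite -!norm_cabs norm_conjC. Qed.
Lemma cabs_eq0 z : (cabs z == 0) = (z == 0).
Proof. by rewrite -realC_eq0 -norm_cabs normr_eq0. Qed.
Lemma mul_conj_cabs z : z * z^* = realC (cabs z ^+ 2).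
Proof. by rewrite -normCK norm_cabs realCX. Qed.
Lemma cabsB z w : cabs (z - w) = cabs (w - z).
Proof. by rewrite -cabsN opprB. Qed.
Lemma cabs_triangle z w : `|cabs z - cabs w| <= cabs (z - w).
Proof.
have h1 := cabsD (z - w) w; have h2 := cabsD (w - z) z.
rewrite !subrK (cabsB w) in h1 h2.
by rewrite ler_norml; apply/andP; split; lra.
Qed.
Lemma cabs_prod (I : Type) (s : seq I) (P : pred I) (F : I -> C) :
  cabs (\prod_(i <- s | P i) F i) = \prod_(i <- s | P i) cabs (F i).
Proof. by apply: (big_morph _ (@cabsM R) (cabs1 R)). Qed.

Lemma nbhs_cabsP z (W : set C) :
  nbhs z W <-> exists2 e : R, 0 < e & forall w, cabs (w - z) < e -> W w.
Proof.
split.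
  move=> /nbhs_ballP[e e0 eW].
  have eR : e = realC (complex.Re e).
    by move: e0; case: e {eW} => a b /=; rewrite lt_def/= => /andP[_ /andP[/eqP -> _]].
  exists (complex.Re e); first by rewrite -realC_lt -eR.
  move=> w zw; apply: eW; rewrite /ball/= distrC norm_cabs eR realC_lt//.
move=> [e e0 eW]; apply/nbhs_ballP; exists (realC e); first by rewrite /= -realC0 realC_lt.
by move=> w; rewrite /ball/= distrC norm_cabs realC_lt => /eW.
Qed.

Lemma nbhs_cabs_ball z (e : R) : 0 < e -> nbhs z [set w | cabs (w - z) < e].
Proof. by move=> e0; apply/nbhs_cabsP; exists e. Qed.

Lemma cabs_Re z : `|complex.Re z| <= cabs z.
Proof. by rewrite -realC_le; exact: normc_ge_Re. Qed.

Lemma cabs_Im z : `|complex.Im z| <= cabs z.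
Proof. by case: z => a b /=; rewrite -sqrtr_sqr ler_wsqrtr// lerDr sqr_ge0. Qed.

Lemma cabs_ReIm z : cabs z <= `|complex.Re z| + `|complex.Im z|.
Proof.
have E : z = realC (complex.Re z) + 'i%C * realC (complex.Im z).
  by case: z => a b; rewrite /realC; simpc.
rewrite [X in cabs X <= _]E; apply: le_trans (cabsD _ _) _; rewrite cabsM !cabs_realC.
have -> : cabs ('i%C : C) = 1 by rewrite /cabs /= expr0n add0r expr1n sqrtr1.
by rewrite mul1r.
Qed.

Lemma cabs_continuous : continuous (@cabs R).
Proof.
move=> z W /nbhs_ballP[e e0 eW]; apply/nbhs_cabsP; exists e => // w zw.
by apply: eW; rewrite /ball/=; apply: le_lt_trans (cabs_triangle _ _) _; rewrite cabsB.
Qed.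

Lemma realC_continuous : continuous (@realC R).
Proof.
move=> x W /nbhs_cabsP[e e0 eW]; apply/nbhs_ballP; exists e => // y xy.
by apply: eW; rewrite -realCB cabs_realC distrC.
Qed.

End ComplexBasics.

Lemma cvg_nsum (K : numFieldType) (V : pseudoMetricNormedZmodType K) (T : Type)
    (F : set_system T) (FF : Filter F) (I : Type) (s : seq I) (P : pred I)
    (f : I -> T -> V) (l : I -> V) :
  (forall i, f i x @[x --> F] --> l i) ->
  \sum_(i <- s | P i) f i x @[x --> F] --> \sum_(i <- s | P i) l i.
Proof.
move=> h; elim: s => [|i s IH].
  by under eq_fun do rewrite big_nil; rewrite big_nil; exact: cvg_cst.
under eq_fun do rewrite big_cons; rewrite big_cons.
by case: (P i); [apply: cvgD|exact: IH].
Qed.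

Lemma exp_continuous (K : numFieldType) j : continuous (fun z : K => z ^+ j).
Proof.
move=> z; elim: j => [|j IH]; first exact: cst_continuous.
rewrite (_ : (fun z => z ^+ j.+1) = (fun z => z * z ^+ j)).
  by apply: (@continuousM K K idfun (fun z => z ^+ j)); [exact: cvg_id|exact: IH].
by apply/funext => w; rewrite exprS.
Qed.

(** * Subspaces and compactness *)

Lemma nbhs_initialP (S : choiceType) (T : topologicalType) (f : S -> T)
    (x : initial_topology f) (W : set S) :
  nbhs x W <-> exists2 V, nbhs (f x) V & f @^-1` V `<=` W.
Proof.
split=> [[_ [[A oA <-] Ax AW]]|[V fxV VW]].
  by exists A => //; exact: open_nbhs_nbhs.
by apply: (filterS VW); exact: (@initial_continuous _ _ f x V fxV).
Qed.

Lemma nbhs_set_typeP (T : topologicalType) (A : set T) (x : set_type A) (W : set (set_type A)) :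
  nbhs x W <-> exists2 V, nbhs (set_val x) V & set_val @^-1` V `<=` W.
Proof.
split=> [[_ [[B oB <-] Bx BW]]|[V fxV VW]].
  by exists B => //; exact: open_nbhs_nbhs.
have xV : nbhs x (set_val @^-1` V) by exact: (@initial_continuous _ _ (set_val : set_type A -> T) x V fxV).
exact (filterS VW xV).
Qed.

Lemma hausdorff_set_type (T : topologicalType) (A : set T) :
  hausdorff_space T -> hausdorff_space (set_type A).
Proof.
move=> hT x y xy; apply: val_inj; apply: hT => U V xU yV.
have xU' : nbhs x (set_val @^-1` U) by apply/(nbhs_set_typeP x); exists U.
have yV' : nbhs y (set_val @^-1` V) by apply/(nbhs_set_typeP y); exists V.
by have [z [zU zV]] := xy _ _ xU' yV'; exists (set_val z).
Qed.

Lemma compact_set_type (T : topologicalType) (A K : set T) : compact K -> K `<=` A ->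
  compact ((set_val : set_type A -> T) @^-1` K).
Proof.
move=> cK KA F FF FK; have FvF := fmap_proper_filter (set_val : set_type A -> T) FF.
have [p [Kp pF]] := cK _ FvF FK; pose s : set_type A := SigSub (mem_set (KA _ Kp)).
exists s; split => // U V FU /nbhs_set_typeP[W sW WV].
have [_ [[z Uz <-] Wz]] := pF (set_val @` U) W
  (filterS (fun z (Uz : U z) => ex_intro2 _ _ z Uz erefl) FU) sW.
by exists z; split => //; exact: WV.
Qed.

Section ComplexCompact.
Variable R : realType.
Local Notation C := (Cplx R).

Lemma compact_cdisc (c : C) (e : R) : compact [set z : C | cabs (z - c) <= e].
Proof.
pose f (ab : R * R) : C := realC ab.1 + 'i%C * realC ab.2.
have fcont : continuous f.
  move=> ab; apply: cvgD.
    by apply: continuous_cvg; [exact: realC_continuous|exact: cvg_fst].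
  apply: cvgM; first exact: cvg_cst.
  by apply: continuous_cvg; [exact: realC_continuous|exact: cvg_snd].
have cK a b : compact (`[a - e, a + e] `*` `[b - e, b + e])%classic.
  by apply: compact_setX; exact: segment_compact.
apply: (subclosed_compact _ (continuous_compact (continuous_subspaceT fcont)
   (cK (complex.Re c) (complex.Im c)))).
- have gcont : continuous (fun z : C => cabs (z - c)).
    move=> z; apply: (@continuous_comp C C R (fun z => z - c) (@cabs R)).
      by apply: (@continuousB C C C); [move=> ?; exact: cvg_id|exact: cst_continuous].
    exact: cabs_continuous.
  exact: (closed_comp (fun z _ => gcont z) (@closed_le R e)).
- move=> z /= zc; exists (complex.Re z, complex.Im z).
    have h1 := le_trans (cabs_Re (z - c)) zc; have h2 := le_trans (cabs_Im (z - c)) zc.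
    move: h1 h2; rewrite !raddfB/= !ler_norml !in_itv/= => /andP[? ?] /andP[? ?].
    by split; apply/andP; split; lra.
  by rewrite /f /=; case: (z) => a b; rewrite /realC; simpc.
Qed.

End ComplexCompact.

Section Cstar.
Variable R : realType.

Lemma Cstar_hausdorff : hausdorff_space (Cstar R).
Proof. by apply: hausdorff_set_type; exact: norm_hausdorff. Qed.

Lemma Cstar_locally_compact : locally_compact [set: Cstar R].
Proof.
move=> q _; rewrite withinET.
have q0 := cabs_gt0 (cstar_neq0 q).
pose e := cabs (cstar_val q) / 2; have e0 : 0 < e by rewrite /e; lra.
exists ((set_val : Cstar R -> _) @^-1` [set z | cabs (z - cstar_val q) <= e]).
  apply/(nbhs_set_typeP q); exists [set z | cabs (z - cstar_val q) < e].
    exact: nbhs_cabs_ball.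
  by move=> z /= /ltW.
suff cK : compact ((set_val : Cstar R -> _) @^-1` [set z | cabs (z - cstar_val q) <= e]).
  by split => //; exact: (compact_closed Cstar_hausdorff).
apply: compact_set_type; first exact: compact_cdisc.
move=> z /= zq; apply/eqP => z0; move: zq; rewrite z0 sub0r cabsN /e; lra.
Qed.

Lemma cstar_val_continuous : continuous (@cstar_val R).
Proof. by apply: (@initial_continuous _ _ set_val). Qed.

End Cstar.

(** * Sums of nonnegative families *)

Section NonnegSums.
Variables (R : realType) (I : choiceType).
Implicit Types (t : I -> R) (M : R) (s : seq I).

Definition tsummable t : Prop := (\esum_(k in [set: I]) (t k)%:E < +oo)%E.
Definition tsum t : R := fine (\esum_(k in [set: I]) (t k)%:E).

Lemma tsum_fin_num t : (forall k, 0 <= t k) -> tsummable t ->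
  \esum_(k in [set: I]) (t k)%:E \is a fin_num.
Proof.
by move=> t0 ts; rewrite ge0_fin_numE//; apply: esum_ge0 => k _; rewrite lee_fin.
Qed.

Lemma sum_le_tsum t s : (forall k, 0 <= t k) -> tsummable t -> uniq s ->
  \sum_(k <- s) t k <= tsum t.
Proof.
move=> t0 ts us; rewrite -lee_fin fineK ?tsum_fin_num// -sumEFin.
apply: ereal_sup_ubound; exists [set` s]; first by split => //; exact: finite_seq.
by rewrite -fsbig_seq.
Qed.

Lemma tsum_bound t M : (forall s, uniq s -> \sum_(k <- s) t k <= M) ->
  (\esum_(k in [set: I]) (t k)%:E <= M%:E)%E.
Proof.
move=> tM; apply: ge_ereal_sup => _ [A [Afin _] <-].
by rewrite fsbig_finite//= sumEFin lee_fin tM// fset_uniq.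
Qed.

Lemma tsummableW t M : (forall s, uniq s -> \sum_(k <- s) t k <= M) -> tsummable t.
Proof. by move=> /tsum_bound h; apply: le_lt_trans h _; exact: ltry. Qed.

Lemma tsum_le t M : (forall k, 0 <= t k) ->
  (forall s, uniq s -> \sum_(k <- s) t k <= M) -> tsum t <= M.
Proof.
move=> t0 tM; rewrite -lee_fin fineK ?tsum_bound//.
exact: tsum_fin_num (tsummableW tM).
Qed.

Lemma tsum_ge0 t : (forall k, 0 <= t k) -> 0 <= tsum t.
Proof. by move=> t0; apply: fine_ge0; apply: esum_ge0 => k _; rewrite lee_fin. Qed.

Lemma tsummable_le t t' : (forall k, 0 <= t k <= t' k) -> tsummable t' -> tsummable t.
Proof.
move=> tt' ts; apply: (@tsummableW t (tsum t')) => s us.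
apply: le_trans (sum_le_tsum _ ts us); last first.
  by move=> k; have /andP[] := tt' k; exact: le_trans.
by apply: ler_sum => k _; have /andP[] := tt' k.
Qed.

Lemma le_tsum t t' : (forall k, 0 <= t k <= t' k) -> tsummable t' -> tsum t <= tsum t'.
Proof.
move=> tt' ts; apply: tsum_le => [k|s us]; first by have /andP[] := tt' k.
apply: le_trans (sum_le_tsum _ ts us); last first.
  by move=> k; have /andP[] := tt' k; exact: le_trans.
by apply: ler_sum => k _; have /andP[] := tt' k.
Qed.

Lemma tsummableD t t' : (forall k, 0 <= t k) -> (forall k, 0 <= t' k) ->
  tsummable t -> tsummable t' -> tsummable (fun k => t k + t' k).
Proof.
move=> t0 t0' ts ts'; apply: (@tsummableW _ (tsum t + tsum t')) => s us.
by rewrite big_split lerD// sum_le_tsum.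
Qed.

Lemma tsumD_le t t' : (forall k, 0 <= t k) -> (forall k, 0 <= t' k) ->
  tsummable t -> tsummable t' -> tsum (fun k => t k + t' k) <= tsum t + tsum t'.
Proof.
move=> t0 t0' ts ts'; apply: tsum_le => [k|s us]; first by rewrite addr_ge0.
by rewrite big_split lerD// sum_le_tsum.
Qed.

Lemma tsummableZ (c : R) t : 0 <= c -> (forall k, 0 <= t k) ->
  tsummable t -> tsummable (fun k => c * t k).
Proof.
move=> c0 t0 ts; apply: (@tsummableW _ (c * tsum t)) => s us.
by rewrite -mulr_sumr ler_wpM2l// sum_le_tsum.
Qed.

Lemma tsumZ_le (c : R) t : 0 <= c -> (forall k, 0 <= t k) ->
  tsummable t -> tsum (fun k => c * t k) <= c * tsum t.
Proof.
move=> c0 t0 ts; apply: tsum_le => [k|s us]; first by rewrite mulr_ge0.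
by rewrite -mulr_sumr ler_wpM2l// sum_le_tsum.
Qed.

Lemma tsum_ge1 t k : (forall k, 0 <= t k) -> tsummable t -> t k <= tsum t.
Proof. by move=> t0 ts; have := sum_le_tsum t0 ts (isT : uniq [:: k]); rewrite big_seq1. Qed.

Lemma sum_finsupp t s s' : uniq s -> uniq s' -> (forall k, 0 <= t k) ->
  (forall k, k \notin s -> t k = 0) -> \sum_(k <- s') t k <= \sum_(k <- s) t k.
Proof.
move=> us us' t0 ts; rewrite (bigID (mem s))/= [X in _ + X]big1 ?addr0//.
rewrite -big_filter [leRHS](bigID (mem s'))/= -[leLHS]addr0 lerD ?sumr_ge0//.
rewrite -[in leRHS]big_filter le_eqVlt; apply/orP; left; apply/eqP.
apply: perm_big; apply: uniq_perm; rewrite ?filter_uniq// => k.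
by rewrite !mem_filter andbC.
Qed.

Lemma tsummable_finsupp t s : uniq s -> (forall k, 0 <= t k) ->
  (forall k, k \notin s -> t k = 0) -> tsummable t.
Proof.
move=> us t0 ts; apply: (@tsummableW _ (\sum_(k <- s) t k)) => s' us'.
exact: sum_finsupp.
Qed.

Lemma tsum_finsupp t s : uniq s -> (forall k, 0 <= t k) ->
  (forall k, k \notin s -> t k = 0) -> tsum t = \sum_(k <- s) t k.
Proof.
move=> us t0 ts; apply/eqP; rewrite eq_le; apply/andP; split.
  by apply: tsum_le => // s' us'; exact: sum_finsupp.
by apply: sum_le_tsum => //; exact: tsummable_finsupp us t0 ts.
Qed.

Lemma tsum_tail t (e : R) : (forall k, 0 <= t k) -> tsummable t -> 0 < e ->
  exists s, uniq s /\ tsum t - e < \sum_(k <- s) t k.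
Proof.
move=> t0 ts e0; apply: contrapT => /forallNP h.
suff : tsum t <= tsum t - e by lra.
apply: tsum_le => // s us; rewrite leNgt; apply/negP => hs.
by apply: (h s).
Qed.

Lemma tsum0 : tsum (fun=> 0) = 0.
Proof. by rewrite (@tsum_finsupp _ [::]) ?big_nil. Qed.

End NonnegSums.

(** * Box sums of complex families *)

Section BoxSums.
Variables (R : realType) (n : nat).
Local Notation C := (Cplx R).
Implicit Types (f g : multidx n -> C) (N : nat).

Lemma mem_boxP N (k : multidx n) : reflect (forall i, (k i <= N)%N) (k \in box n N).
Proof.
apply: (iffP mapP) => [[f _ ->] i|kN]; first by rewrite ffunE -ltnS ltn_ord.
exists [ffun i => inord (k i)]; first exact: mem_enum.
by apply/ffunP => i; rewrite !ffunE inordK// ltnS.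
Qed.

Lemma box_sub N M : (N <= M)%N -> {subset box n N <= box n M}.
Proof. by move=> NM k /mem_boxP kN; apply/mem_boxP => i; apply: leq_trans NM. Qed.

Lemma box_exhaust (s : seq (multidx n)) : exists N, forall M, (N <= M)%N ->
  {subset s <= box n M}.
Proof.
exists (\max_(k <- s) mdeg k)%N => M NM k ks; apply: mem_box.
by apply: leq_trans NM; exact: leq_bigmax_seq.
Qed.

Lemma sum_box_prod (K : comPzSemiRingType) N (F : 'I_n -> nat -> K) :
  \sum_(k <- box n N) \prod_i F i (k i) = \prod_i \sum_(m < N.+1) F i m.
Proof.
rewrite bigA_distr_bigA big_map big_enum/=; apply: eq_bigr => f _.
by apply: eq_bigr => i _; rewrite ffunE.
Qed.

Definition bsum f N : C := \sum_(k <- box n N) f k.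

Definition csum f : C := lim (bsum f @ \oo).

Lemma subseq_sum (t : multidx n -> R) (s s' : seq (multidx n)) : (forall k, 0 <= t k) ->
  uniq s -> uniq s' -> {subset s <= s'} ->
  \sum_(k <- s) t k + \sum_(k <- s' | k \notin s) t k = \sum_(k <- s') t k.
Proof.
move=> t0 us us' ss'; rewrite [RHS](bigID (mem s))/=; congr (_ + _).
rewrite -[RHS]big_filter; apply: perm_big; apply: uniq_perm; rewrite ?filter_uniq// => k.
by rewrite mem_filter; case: (boolP (k \in s)) => //= /ss' ->.
Qed.

Lemma box_tail (t : multidx n -> R) (e : R) : (forall k, 0 <= t k) -> tsummable t ->
  0 < e -> exists N, forall M (s' : seq (multidx n)), (N <= M)%N -> uniq s' ->
    \sum_(k <- s' | k \notin box n M) t k < e.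
Proof.
move=> t0 ts e0; have [s [us hs]] := tsum_tail t0 ts e0.
have [N hN] := box_exhaust s; exists N => M s' NM us'.
have h : uniq (s ++ [seq k <- s' | k \notin box n M]).
  rewrite cat_uniq us filter_uniq// andbT /=; apply/hasPn => k.
  by rewrite mem_filter => /andP[kM _]; apply: contra kM; exact: hN.
have := sum_le_tsum t0 ts h; rewrite big_cat /= big_filter; lra.
Qed.

Lemma bsum_dist f (N M : nat) : (N <= M)%N ->
  cabs (bsum f M - bsum f N) <= \sum_(k <- box n M | k \notin box n N) cabs (f k).
Proof.
move=> NM; rewrite /bsum (bigID (mem (box n N)))/=.
have -> : \sum_(k <- box n M | k \in box n N) f k = \sum_(k <- box n N) f k.
  rewrite -[LHS]big_filter; apply: perm_big; apply: uniq_perm; rewrite ?filter_uniq ?box_uniq//.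
  by move=> k; rewrite mem_filter; case: (boolP (k \in box n N)) => //= /(box_sub NM) ->.
rewrite addrAC subrr add0r; exact: cabs_sum.
Qed.

Lemma cvg_cabsP (u : nat -> C) (l : C) : u @ \oo --> l <->
  forall e : R, 0 < e -> exists N, forall M, (N <= M)%N -> cabs (u M - l) < e.
Proof.
split=> [ul e e0|h].
  have [N _ hN] := ul _ (nbhs_cabs_ball l e0).
  by exists N => M NM; apply: hN.
move=> W /nbhs_cabsP[e e0 eW]; have [N hN] := h e e0.
by exists N => // M /= NM; apply: eW; exact: hN.
Qed.

Lemma cauchy_cabs_cvg (F : set_system C) : ProperFilter F ->
  (forall e : R, 0 < e -> exists2 A, F A & forall x y, A x -> A y -> cabs (x - y) < e) ->
  exists l : C, forall e : R, 0 < e -> F [set x | cabs (x - l) < e].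
Proof.
move=> FF hF.
have hRe := @cabs_Re R; have hIm := @cabs_Im R.
have cvgP (p : {additive C -> R}) : (forall z, `|p z| <= cabs z) -> exists l : R, p @ F --> l.
  move=> hp; apply/cvg_ex; apply: cauchy_cvg; apply/cauchy_ballP => e e0.
  have [A FA hA] := hF e e0.
  have FpA : F (p @^-1` (p @` A)) by apply: filterS FA => x Ax; exists x.
  exists (p @` A, p @` A) => //=.
  move=> [_ _] /= [[x Ax <-] [y Ay <-]]; rewrite /ball /= -raddfB.
  exact: le_lt_trans (hp _) (hA _ _ Ax Ay).
have [a ha] := cvgP (@complex.Re R) hRe; have [b hb] := cvgP (@complex.Im R) hIm.
exists (Complex a b) => e e0; have e2 : 0 < e / 2 by lra.
move/cvgrPdist_lt : ha => /(_ _ e2) ha; move/cvgrPdist_lt : hb => /(_ _ e2) hb.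
apply: filterS2 ha hb => z /= hx hy; apply: le_lt_trans (cabs_ReIm _) _.
by rewrite !raddfB/= distrC (distrC (complex.Im z)) [ltRHS](splitr e) ltrD.
Qed.

Section Csum.
Variable f : multidx n -> C.
Hypothesis fs : tsummable (fun k => cabs (f k)).

Lemma bsum_cauchy (e : R) : 0 < e -> exists N, forall M, (N <= M)%N ->
  cabs (bsum f M - bsum f N) < e.
Proof.
move=> e0; have [N hN] := box_tail (fun k => cabs_ge0 (f k)) fs e0.
exists N => M NM; apply: le_lt_trans (bsum_dist _ NM) _.
by apply: hN; rewrite ?box_uniq.
Qed.

Lemma csum_cvg : bsum f @ \oo --> csum f.
Proof.
have [|l hl] := @cauchy_cabs_cvg (bsum f @ \oo) _.
  move=> e e0; have e2 : 0 < e / 2 by lra.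
  have [N hN] := bsum_cauchy e2.
  exists [set x | cabs (x - bsum f N) < e / 2].
    by exists N => // M /= NM; exact: hN.
  move=> x y /= hx hy; rewrite [x - y](_ : _ = (x - bsum f N) - (y - bsum f N)); last by ring.
  by apply: le_lt_trans (cabsD _ _) _; rewrite cabsN; lra.
have hc : bsum f @ \oo --> l.
  by move=> W /nbhs_cabsP[e e0 eW]; apply: filterS (hl e e0) => x; exact: eW.
by rewrite /csum (cvg_lim _ hc)//; exact: norm_hausdorff.
Qed.

Lemma csum_near (e : R) : 0 < e -> exists N, forall M, (N <= M)%N -> cabs (bsum f M - csum f) < e.
Proof. by move=> e0; have /cvg_cabsP := csum_cvg; exact. Qed.

End Csum.

Lemma csum_eq f (l : C) : tsummable (fun k => cabs (f k)) -> bsum f @ \oo --> l -> csum f = l.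
Proof. by move=> fs fl; apply: cvg_lim fl; exact: norm_hausdorff. Qed.

Lemma cabs_csum f : tsummable (fun k => cabs (f k)) -> cabs (csum f) <= tsum (fun k => cabs (f k)).
Proof.
move=> fs; apply/ler_addgt0Pr => e e0; have [N /(_ N (leqnn _)) hN] := csum_near fs e0.
have h : cabs (bsum f N) <= tsum (fun k => cabs (f k)).
  apply: le_trans (cabs_sum _ _ _) _.
  by apply: sum_le_tsum => //; [move=> k; exact: cabs_ge0|exact: box_uniq].
rewrite -(subrK (bsum f N) (csum f)) addrC; apply: le_trans (cabsD _ _) _.
by rewrite lerD// cabsB ltW.
Qed.

Lemma csumD f g : tsummable (fun k => cabs (f k)) -> tsummable (fun k => cabs (g k)) ->
  csum (fun k => f k + g k) = csum f + csum g.
Proof.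
move=> fs gs; apply: cvg_lim; first exact: norm_hausdorff.
rewrite (_ : bsum _ = (fun N => bsum f N + bsum g N)).
  by apply: cvgD; exact: csum_cvg.
by apply/funext => N; rewrite /bsum big_split.
Qed.

Lemma csumZ (c : C) f : tsummable (fun k => cabs (f k)) ->
  csum (fun k => c * f k) = c * csum f.
Proof.
move=> fs; apply: cvg_lim; first exact: norm_hausdorff.
rewrite (_ : bsum _ = (fun N => c * bsum f N)).
  by apply: cvgM; [exact: cvg_cst|exact: csum_cvg].
by apply/funext => N; rewrite /bsum mulr_sumr.
Qed.

Lemma csum_finsupp f (s : seq (multidx n)) : uniq s -> (forall k, k \notin s -> f k = 0) ->
  csum f = \sum_(k <- s) f k.
Proof.
move=> us fs; apply: cvg_lim; first exact: norm_hausdorff.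
apply/cvg_cabsP => e e0; have [N hN] := box_exhaust s; exists N => M NM.
suff -> : bsum f M = \sum_(k <- s) f k by rewrite subrr cabs0.
rewrite /bsum (bigID (mem s))/= [X in _ + X]big1 ?addr0//.
rewrite -big_filter; apply: perm_big; apply: uniq_perm; rewrite ?filter_uniq ?box_uniq//.
by move=> k; rewrite mem_filter; case: (boolP (k \in s)) => //= /(hN _ NM) ->.
Qed.

End BoxSums.

(** * Weighted spaces of twisted power series *)

(** The datum from which a bundle is built: the last field makes the weighted l1-norm
    submultiplicative for the twisted product, and the continuity in the base point makes
    the norm of a polynomial a continuous function on the base. *)
Record weight (R : realType) (n : nat) := Weight {
  wt :> Cstar R -> multidx n -> R;
  wt_gt0 : forall q k, 0 < wt q k;
  wt_continuous : forall k, continuous (wt ^~ k);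
  wt_submul : forall q k l, cabs (twist q k l) * wt q (k + l) <= wt q k * wt q l }.

Section WeightedNorms.
Variables (R : realType) (n : nat) (u : weight R n) (r : \bar R).
Local Notation C := (Cplx R).
Implicit Types (q x y : Cstar R) (rho : R) (a b p : multidx n -> C).

Definition wterm q rho a (k : multidx n) : R := cabs (a k) * u q k * rho ^+ mdeg k.
Definition wsummable q rho a : Prop := tsummable (wterm q rho a).
Definition wnorm q rho a : R := tsum (wterm q rho a).
Definition in_weighted q a : Prop := forall rho, polydisk_radii r rho -> wsummable q rho a.
Definition fsupp a : Prop := exists s : seq (multidx n), forall k, k \notin s -> a k = 0.

Lemma wterm_ge0 q rho a k : 0 <= rho -> 0 <= wterm q rho a k.
Proof. by move=> r0; rewrite !mulr_ge0 ?cabs_ge0 ?exprn_ge0// ltW// wt_gt0. Qed.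
Hint Extern 0 (is_true (0 <= wterm _ _ _ _)) => (apply: wterm_ge0; by []) : core.

Lemma wnorm_ge0 q rho a : 0 <= rho -> 0 <= wnorm q rho a.
Proof. by move=> r0; apply: tsum_ge0. Qed.

Lemma wtermD q rho a b k : 0 <= rho ->
  wterm q rho (fun k => a k + b k) k <= wterm q rho a k + wterm q rho b k.
Proof.
move=> r0; rewrite /wterm -!mulrA -mulrDl ler_wpM2r ?cabsD//.
by rewrite mulr_ge0 ?exprn_ge0// ltW ?wt_gt0.
Qed.

Lemma wsummableD q rho a b : 0 <= rho -> wsummable q rho a -> wsummable q rho b ->
  wsummable q rho (fun k => a k + b k).
Proof.
move=> r0 sa sb; apply: (tsummable_le (t' := fun k => wterm q rho a k + wterm q rho b k)).
  by move=> k; rewrite wterm_ge0//= wtermD.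
by apply: tsummableD.
Qed.

Lemma wnormD q rho a b : 0 <= rho -> wsummable q rho a -> wsummable q rho b ->
  wnorm q rho (fun k => a k + b k) <= wnorm q rho a + wnorm q rho b.
Proof.
move=> r0 sa sb; apply: le_trans (tsumD_le _ _ sa sb) => //.
apply: le_tsum; first by move=> k; rewrite wterm_ge0//= wtermD.
by apply: tsummableD.
Qed.

Lemma wtermZ q rho (c : C) a :
  wterm q rho (fun k => c * a k) = (fun k => cabs c * wterm q rho a k).
Proof. by apply/funext => k; rewrite /wterm cabsM !mulrA. Qed.

Lemma wsummableZ q rho (c : C) a : 0 <= rho -> wsummable q rho a ->
  wsummable q rho (fun k => c * a k).
Proof. by move=> r0 sa; rewrite /wsummable wtermZ; apply: tsummableZ => //; exact: cabs_ge0. Qed.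

Lemma wnormZ_le q rho (c : C) a : 0 <= rho -> wsummable q rho a ->
  wnorm q rho (fun k => c * a k) <= cabs c * wnorm q rho a.
Proof. by move=> r0 sa; rewrite /wnorm wtermZ; apply: tsumZ_le => //; exact: cabs_ge0. Qed.

Lemma wnormZ q rho (c : C) a : 0 <= rho -> wsummable q rho a ->
  wnorm q rho (fun k => c * a k) = cabs c * wnorm q rho a.
Proof.
move=> r0 sa; apply/eqP; rewrite eq_le wnormZ_le//=.
have [->|c0] := eqVneq c 0; first by rewrite cabs0 mul0r wnorm_ge0.
have := wnormZ_le c^-1 r0 (wsummableZ c r0 sa).
under [X in wnorm _ _ X]eq_fun do rewrite mulKf//.
by rewrite cabsV ler_pdivlMl ?cabs_gt0.
Qed.

Lemma wnormN q rho a : wnorm q rho (fun k => - a k) = wnorm q rho a.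
Proof. by congr tsum; apply/funext => k; rewrite /wterm cabsN. Qed.

Lemma wsummableN q rho a : wsummable q rho a -> wsummable q rho (fun k => - a k).
Proof.
rewrite /wsummable; suff -> : wterm q rho (fun k => - a k) = wterm q rho a by [].
by apply/funext => k; rewrite /wterm cabsN.
Qed.

Lemma wsummableB q rho a b : 0 <= rho -> wsummable q rho a -> wsummable q rho b ->
  wsummable q rho (fun k => a k - b k).
Proof. by move=> r0 sa sb; apply: wsummableD => //; exact: wsummableN. Qed.

Lemma wnormB q rho a b : wnorm q rho (fun k => a k - b k) = wnorm q rho (fun k => b k - a k).
Proof. by rewrite -wnormN; congr wnorm; apply/funext => k; rewrite opprB. Qed.

Lemma wnorm_trans q rho b a c : 0 <= rho ->
  wsummable q rho a -> wsummable q rho b -> wsummable q rho c ->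
  wnorm q rho (fun k => a k - c k) <=
  wnorm q rho (fun k => a k - b k) + wnorm q rho (fun k => b k - c k).
Proof.
move=> r0 sa sb sc; apply: le_trans (wnormD r0 (wsummableB r0 sa sb) (wsummableB r0 sb sc)).
by rewrite le_eqVlt; apply/orP; left; apply/eqP; congr wnorm; apply/funext => k; rewrite subrKA.
Qed.

Lemma wterm_mono q rho rho' a k : 0 <= rho <= rho' -> wterm q rho a k <= wterm q rho' a k.
Proof.
move=> /andP[r0 rr]; rewrite ler_wpM2l ?mulr_ge0 ?cabs_ge0//; first by rewrite ltW ?wt_gt0.
by rewrite lerXn2r// nnegrE// (le_trans r0).
Qed.

Lemma wnorm_mono q rho rho' a : 0 <= rho <= rho' -> wsummable q rho' a ->
  wnorm q rho a <= wnorm q rho' a.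
Proof.
move=> rr; apply: le_tsum => k; rewrite wterm_mono// wterm_ge0//.
by have /andP[] := rr.
Qed.

Lemma wterm0 q rho a k : a k = 0 -> wterm q rho a k = 0.
Proof. by move=> ak; rewrite /wterm ak cabs0 !mul0r. Qed.

Lemma fsupp_uniq a : fsupp a -> exists2 s, uniq s & forall k, k \notin s -> a k = 0.
Proof.
by move=> [s hs]; exists (undup s); [exact: undup_uniq|move=> k; rewrite mem_undup; exact: hs].
Qed.

Lemma fsupp_box a : fsupp a -> exists N, forall k, k \notin box n N -> a k = 0.
Proof.
move=> [s hs]; have [N /(_ N (leqnn _)) hN] := box_exhaust s; exists N => k kN.
by apply: hs; apply: contra kN; exact: hN.
Qed.

Lemma fsupp_wsummable q rho a : 0 <= rho -> fsupp a -> wsummable q rho a.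
Proof.
move=> r0 /fsupp_uniq[s us hs]; apply: (tsummable_finsupp us) => // k ks.
by rewrite wterm0// hs.
Qed.

Lemma wnorm_finsupp q rho a s : 0 <= rho -> uniq s -> (forall k, k \notin s -> a k = 0) ->
  wnorm q rho a = \sum_(k <- s) wterm q rho a k.
Proof. by move=> r0 us hs; apply: tsum_finsupp => // k ks; rewrite wterm0// hs. Qed.

Lemma wnorm0 q rho : wnorm q rho (fun=> 0) = 0.
Proof.
rewrite /wnorm (_ : wterm _ _ _ = fun=> 0) ?tsum0//.
by apply/funext => k; rewrite wterm0.
Qed.

Lemma radii_ge0 rho : polydisk_radii r rho -> 0 <= rho. Proof. by case=> /ltW. Qed.

Lemma radii_max rho rho' : polydisk_radii r rho -> polydisk_radii r rho' ->
  polydisk_radii r (Num.max rho rho').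
Proof. by move=> h h'; rewrite /Num.max; case: ifP. Qed.

Lemma fsupp_in_weighted q a : fsupp a -> in_weighted q a.
Proof. by move=> fa rho hrho; apply: fsupp_wsummable => //; exact: radii_ge0 hrho. Qed.

Lemma fsupp0 : fsupp (fun=> 0). Proof. by exists [::]. Qed.

Lemma fsuppD a b : fsupp a -> fsupp b -> fsupp (fun k => a k + b k).
Proof.
move=> [s hs] [t ht]; exists (s ++ t) => k; rewrite mem_cat negb_or => /andP[ks kt].
by rewrite hs// ht// addr0.
Qed.

Lemma fsuppZ c a : fsupp a -> fsupp (fun k => c * a k).
Proof. by move=> [s hs]; exists s => k ks; rewrite hs// mulr0. Qed.

Lemma fsupp_monomial k : fsupp (monomial R k).
Proof. by exists [:: k] => l; rewrite inE /monomial => /negbTE ->. Qed.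

Lemma series_mul_supp q a b N : (forall k, k \notin box n N -> a k = 0) ->
  (forall k, k \notin box n N -> b k = 0) ->
  forall m, m \notin box n (N + N) -> series_mul q a b m = 0.
Proof.
move=> ha hb m hm; rewrite /series_mul fsbig1// => -[k l] /= klm.
have [/mem_boxP kN|/ha ->] := boolP (k \in box n N); last by rewrite mul0r mulr0.
have [/mem_boxP lN|/hb ->] := boolP (l \in box n N); last by rewrite !mulr0.
by case/negP: hm; apply/mem_boxP => i; rewrite -klm ffunE leq_add.
Qed.

(** Submultiplicativity of the weight passes to the norm, because the product sums the terms
    indexed by the pairs [(k, l)] along the fibres of [(k, l) |-> k + l]. *)
Lemma series_mul_sums q rho a b : 0 <= rho -> wsummable q rho a -> wsummable q rho b ->
  forall s, uniq s ->
  \sum_(m <- s) wterm q rho (series_mul q a b) m <= wnorm q rho a * wnorm q rho b.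
Proof.
move=> r0 sa sb s us; pose K := (\max_(m <- s) mdeg m)%N; pose B := box n K.
set A := wterm q rho a; set D := wterm q rho b.
have A0 k : 0 <= A k by exact: wterm_ge0.
have D0 k : 0 <= D k by exact: wterm_ge0.
apply: (@le_trans _ _ (\sum_(m <- s) \sum_(k <- B) \sum_(l <- B | k + l == m) A k * D l)).
  rewrite big_seq [leRHS]big_seq; apply: ler_sum => m ms.
  have mK : (mdeg m <= K)%N by exact: leq_bigmax_seq.
  rewrite /wterm (series_mulE _ _ _ mK) -mulrA.
  apply: (@le_trans _ _ ((\sum_(k <- B) \sum_(l <- B | k + l == m)
     cabs (twist q k l * (a k * b l))) * (u q m * rho ^+ mdeg m))).
    rewrite ler_wpM2r ?mulr_ge0 ?exprn_ge0//; first by rewrite ltW ?wt_gt0.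
    by apply: le_trans (cabs_sum _ _ _) _; apply: ler_sum => k _; exact: cabs_sum.
  rewrite mulr_suml; apply: ler_sum => k _; rewrite mulr_suml.
  apply: ler_sum => l /eqP <-; rewrite !cabsM mdegD exprD.
  rewrite [leLHS](_ : _ = (cabs (twist q k l) * u q (k + l)) *
    (cabs (a k) * cabs (b l) * (rho ^+ mdeg k * rho ^+ mdeg l))); last by ring.
  rewrite [leRHS](_ : _ = (u q k * u q l) *
    (cabs (a k) * cabs (b l) * (rho ^+ mdeg k * rho ^+ mdeg l))); last first.
    by rewrite /A /D /wterm; ring.
  by rewrite ler_wpM2r ?wt_submul// !mulr_ge0 ?exprn_ge0 ?cabs_ge0.
apply: (@le_trans _ _ ((\sum_(k <- B) A k) * (\sum_(l <- B) D l))); last first.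
  by rewrite ler_pM ?sumr_ge0// sum_le_tsum ?box_uniq.
rewrite mulr_suml exchange_big; apply: ler_sum => k _ /=.
rewrite mulr_sumr; under eq_bigr do rewrite big_mkcond.
rewrite exchange_big; apply: ler_sum => l _ /=.
have [kls|kls] := boolP (k + l \in s).
  rewrite (bigD1_seq (k + l))//= eqxx big1 ?addr0// => m.
  by rewrite eq_sym => /negbTE ->.
rewrite big_seq big1; first exact: mulr_ge0.
by move=> m ms; case: eqP => // e; rewrite e ms in kls.
Qed.

Lemma wsummableM q rho a b : 0 <= rho -> wsummable q rho a -> wsummable q rho b ->
  wsummable q rho (series_mul q a b).
Proof.
move=> r0 sa sb; apply: (tsummableW (M := wnorm q rho a * wnorm q rho b)).
exact: series_mul_sums.
Qed.

Lemma wnormM q rho a b : 0 <= rho -> wsummable q rho a -> wsummable q rho b ->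
  wnorm q rho (series_mul q a b) <= wnorm q rho a * wnorm q rho b.
Proof. by move=> r0 sa sb; apply: tsum_le => //; exact: series_mul_sums. Qed.

Lemma wnorm_eq0 q rho a : 0 < rho -> wsummable q rho a -> wnorm q rho a = 0 ->
  a =1 fun=> 0.
Proof.
move=> r0 sa a0 k; have := tsum_ge1 k (fun k => wterm_ge0 q a k (ltW r0)) sa.
rewrite -/(wnorm q rho a) a0 /wterm -mulrA pmulr_lle0 ?mulr_gt0 ?exprn_gt0 ?wt_gt0// => h.
by apply/eqP; rewrite -cabs_eq0 eq_le h; exact: cabs_ge0.
Qed.

Lemma coef_le_wnorm q rho a k : 0 < rho -> wsummable q rho a ->
  cabs (a k) <= (u q k * rho ^+ mdeg k)^-1 * wnorm q rho a.
Proof.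
move=> r0 sa; have := tsum_ge1 k (fun k => wterm_ge0 q a k (ltW r0)) sa.
by rewrite /wterm -mulrA mulrC ler_pdivlMl// mulr_gt0 ?exprn_gt0 ?wt_gt0.
Qed.

(** Box sums of the series itself will do. *)
Lemma fsupp_dense q rho a (e : R) : 0 <= rho -> wsummable q rho a -> 0 < e ->
  exists2 p, fsupp p & wnorm q rho (fun k => a k - p k) < e.
Proof.
move=> r0 sa e0; have e2 : 0 < e / 2 by lra.
have [N hN] := box_tail (fun k => wterm_ge0 q a k r0) sa e2.
pose p k := if k \in box n N then a k else 0.
exists p; first by exists (box n N) => k /negbTE kN; rewrite /p kN.
have hp k : wterm q rho (fun k => a k - p k) k =
    if k \in box n N then 0 else wterm q rho a k.
  by rewrite /wterm /p; case: ifP => _; rewrite ?subrr ?cabs0 ?mul0r ?subr0.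
apply: (@le_lt_trans _ _ (e / 2)); last lra.
apply: tsum_le => // s us; under eq_bigr do rewrite hp -if_neg.
by rewrite -big_mkcond /= ltW// hN.
Qed.

(** Only finitely many terms occur, and each is continuous in the base point. *)
Lemma wnorm_section_cvg rho (c : Cstar R -> multidx n -> C) x (s : seq (multidx n)) :
  0 <= rho -> (forall y k, k \notin s -> c y k = 0) -> (forall k, {for x, continuous (c ^~ k)}) ->
  wnorm y rho (c y) @[y --> x] --> wnorm x rho (c x).
Proof.
move=> r0 hs hc; set t := undup s.
have ht y k : k \notin t -> c y k = 0 by rewrite mem_undup; exact: hs.
have E y : wnorm y rho (c y) = \sum_(k <- t) wterm y rho (c y) k.
  by rewrite (wnorm_finsupp _ r0 (undup_uniq s) (ht y)).
rewrite (_ : (fun y => wnorm y rho (c y)) = fun y => \sum_(k <- t) wterm y rho (c y) k); last first.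
  by apply/funext.
rewrite E; apply: (@cvg_nsum R R^o _ (nbhs x) _ _ t xpredT (fun k y => wterm y rho (c y) k)) => k.
 apply: cvgM; last exact: cvg_cst.
apply: cvgM; last exact: wt_continuous.
by apply: continuous_cvg; [exact: cabs_continuous|exact: hc].
Qed.

End WeightedNorms.

(** * The bundle of weighted spaces *)

Record pradius (R : realType) := PRadius { prad :> \bar R; prad_gt0 : (0 < prad)%E }.

Record wtotal (R : realType) (n : nat) (u : weight R n) (r : pradius R) := WTotal {
  wbase : Cstar R;
  wcoef : multidx n -> Cplx R;
  wcoefP : in_weighted u r wbase wcoef }.

Section Total.
Variables (R : realType) (n : nat) (u : weight R n) (r : pradius R).
Local Notation C := (Cplx R).
Local Notation T := (wtotal u r).
Implicit Types (x y : Cstar R) (rho : R) (p : multidx n -> C) (a b : T).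

HB.instance Definition _ := gen_eqMixin T.
HB.instance Definition _ := gen_choiceMixin T.

Definition tube p rho (e : R) (U : set (Cstar R)) : set T :=
  [set b | U (wbase b) /\ wnorm u (wbase b) rho (fun k => wcoef b k - p k) < e].

(** Tubes are drawn around polynomials, because the norm of the difference of two
    polynomials is continuous in the base point whereas that of general series is not; as
    polynomials are dense in each fibre, every point has small tubes around it. *)
Definition wnbhs a : set_system T := [set W | exists p rho e U,
  [/\ fsupp p, polydisk_radii r rho, nbhs (wbase a) U,
      wnorm u (wbase a) rho (fun k => wcoef a k - p k) < e & tube p rho e U `<=` W]].

(** If the section [c] passes close to [a], every point close to [c] in a nearby fibre stays
    in a given tube around [a]: only here does the continuity of the norms of polynomial
    sections enter. *)
Lemma tube_refine x (c : Cstar R -> multidx n -> C) (s : seq (multidx n)) rho p (e : R) :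
  polydisk_radii r rho -> fsupp p -> (forall y k, k \notin s -> c y k = 0) ->
  (forall k, {for x, continuous (c ^~ k)}) ->
  forall (a : multidx n -> C) (eta : R), in_weighted u r x a ->
  wnorm u x rho (fun k => a k - p k) + eta + eta <= e ->
  wnorm u x rho (fun k => a k - c x k) < eta ->
  exists2 U, nbhs x U & forall y (b : multidx n -> C), U y -> in_weighted u r y b ->
    wnorm u y rho (fun k => b k - c y k) < eta -> wnorm u y rho (fun k => b k - p k) < e.
Proof.
move=> hrho fp hs hc a eta ha ape ace; have r0 := radii_ge0 hrho.
have fc y : fsupp (c y) by exists s => k; exact: hs.
have hcp : wnorm u x rho (fun k => c x k - p k) < e - eta.
  have := wnorm_trans r0 (fsupp_wsummable u x r0 (fc x)) (ha _ hrho) (fsupp_wsummable u x r0 fp).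
  rewrite (wnormB u x rho (c x) a); lra.
have [t ht] := fp.
have hcv : wnorm u y rho (fun k => c y k - p k) @[y --> x] --> wnorm u x rho (fun k => c x k - p k).
  apply: (@wnorm_section_cvg _ _ u rho (fun y k => c y k - p k) x (s ++ t) r0).
    by move=> y k; rewrite mem_cat negb_or => /andP[ks kt]; rewrite hs// ht// subr0.
  by move=> k; apply: (@cvgB _ _ _ (nbhs x) _ (fun y => c y k) (fun=> p k) _ _ (hc k)); exact: cvg_cst.
exists [set y | wnorm u y rho (fun k => c y k - p k) < e - eta].
  exact: (cvgr_lt _ hcv).
move=> y b /= hy hb bce.
have := wnorm_trans r0 (hb _ hrho) (fsupp_wsummable u y r0 (fc y)) (fsupp_wsummable u y r0 fp).
lra.
Qed.

Lemma tube_margin a p rho (e : R) : wnorm u (wbase a) rho (fun k => wcoef a k - p k) < e ->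
  exists2 eta : R, 0 < eta & wnorm u (wbase a) rho (fun k => wcoef a k - p k) + eta + eta <= e.
Proof.
by move=> h; exists ((e - wnorm u (wbase a) rho (fun k => wcoef a k - p k)) / 2); lra.
Qed.

(** Neighbourhoods of [a] absorb small tubes around any polynomial section through a point
    close enough to [a]. *)
Lemma wnbhs_section a W : wnbhs a W -> exists rho (eta : R),
  [/\ polydisk_radii r rho, 0 < eta & forall (s : seq (multidx n)) (c : Cstar R -> multidx n -> C),
    (forall y k, k \notin s -> c y k = 0) ->
    (forall k, {for wbase a, continuous (c ^~ k)}) ->
    wnorm u (wbase a) rho (fun k => wcoef a k - c (wbase a) k) < eta ->
    exists2 U, nbhs (wbase a) U & forall b, U (wbase b) ->
      wnorm u (wbase b) rho (fun k => wcoef b k - c (wbase b) k) < eta -> W b].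
Proof.
move=> [p [rho [e [U [fp hrho xU ape UW]]]]].
have [eta eta0 heta] := tube_margin ape.
exists rho, eta; split => // s c hs hc ac.
have [V xV hV] := tube_refine hrho fp hs hc (@wcoefP _ _ _ _ a) heta ac.
exists (U `&` V); first exact: filterI.
by move=> b [bU bV] bc; apply: UW; split => //; apply: hV => //; exact: wcoefP.
Qed.

Lemma wnbhs_section_cst a W : wnbhs a W -> exists rho (eta : R),
  [/\ polydisk_radii r rho, 0 < eta & forall p, fsupp p ->
    wnorm u (wbase a) rho (fun k => wcoef a k - p k) < eta ->
    exists2 U, nbhs (wbase a) U & tube p rho eta U `<=` W].
Proof.
move=> /wnbhs_section[rho [eta [hrho eta0 h]]]; exists rho, eta; split => // p [s hs] ap.
have [||U xU UW] := h s (fun=> p) _ _ ap; first by move=> _; exact: hs.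
  by move=> k; exact: cst_continuous.
by exists U => // b [bU bp]; exact: UW.
Qed.

Lemma tube_mono p rho rho' (e : R) U : polydisk_radii r rho -> polydisk_radii r rho' -> rho <= rho' ->
  fsupp p -> tube p rho' e U `<=` tube p rho e U.
Proof.
move=> hrho hrho' rr fp b [bU bp]; split => //; apply: le_lt_trans bp.
have r0 := radii_ge0 hrho'.
apply: wnorm_mono; first by rewrite (radii_ge0 hrho).
by apply: wsummableB => //; [exact: wcoefP|exact: fsupp_wsummable].
Qed.

Lemma wnbhs_singleton a W : wnbhs a W -> W a.
Proof.
by move=> [p [rho [e [U [fp hrho xU ape UW]]]]]; apply: UW; split => //; exact: nbhs_singleton.
Qed.

Lemma radii_exists : exists rho, polydisk_radii r rho.
Proof.
case: r => -[s||] /= r0 //.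
  move: r0; rewrite lte_fin => s0; exists (s / 2); split; rewrite ?lte_fin; lra.
by exists 1; split; rewrite /= ?ltry.
Qed.

Lemma wnbhs_filter a : ProperFilter (wnbhs a).
Proof.
split; first by move=> /wnbhs_singleton.
split.
- have [rho hrho] := radii_exists.
  exists (fun=> 0), rho, (wnorm u (wbase a) rho (fun k => wcoef a k - 0) + 1), setT.
  split => //; [exact: fsupp0|exact: filterT|lra].
- move=> P Q /wnbhs_section_cst[rho [e [hrho e0 hP]]] /wnbhs_section_cst[rho' [e' [hrho' e0' hQ]]].
  have hm := radii_max hrho hrho'; set m := Num.max rho rho' in hm.
  have d0 : 0 < Num.min e e' by rewrite lt_min e0.
  have [p fp ap] := fsupp_dense (radii_ge0 hm) (@wcoefP _ _ _ _ a _ hm) d0.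
  have rm : rho <= m by rewrite le_max lexx.
  have rm' : rho' <= m by rewrite le_max lexx orbT.
  have hsm : wsummable u (wbase a) m (fun k => wcoef a k - p k).
    apply: wsummableB (radii_ge0 hm) _ _; first exact: wcoefP.
    by apply: fsupp_wsummable fp; exact: radii_ge0 hm.
  move: ap; rewrite lt_min => /andP[ap ap'].
  have [|U xU UP] := hP p fp.
    by apply: le_lt_trans ap; apply: wnorm_mono; rewrite ?(radii_ge0 hrho).
  have [|V xV VQ] := hQ p fp.
    by apply: le_lt_trans ap'; apply: wnorm_mono; rewrite ?(radii_ge0 hrho').
  exists p, m, (Num.min e e'), (U `&` V); split => //.
  + exact: filterI.
  + by rewrite lt_min ap.
  + move=> b [[bU bV]]; rewrite lt_min => /andP[bp bp']; split.
      by apply/UP/(tube_mono hrho hm rm fp).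
    by apply/VQ/(tube_mono hrho' hm rm' fp).
- move=> P Q PQ [p [rho [e [U [fp hrho xU ape UW]]]]]; exists p, rho, e, U; split => //.
  exact: subset_trans PQ.
Qed.

Lemma wnbhs_nbhs a W : wnbhs a W -> wnbhs a (wnbhs^~ W).
Proof.
move=> [p [rho [e [U [fp hrho xU ape UW]]]]].
exists p, rho, e, (nbhs^~ U); split => //; first exact: nbhs_interior.
by move=> b [bU bp]; exists p, rho, e, U; split.
Qed.

End Total.

HB.instance Definition _ (R : realType) (n : nat) (u : weight R n) (r : pradius R) :=
  hasNbhs.Build (wtotal u r) (@wnbhs R n u r).
HB.instance Definition _ (R : realType) (n : nat) (u : weight R n) (r : pradius R) :=
  Nbhs_isNbhsTopological.Build (wtotal u r)
    (@wnbhs_filter R n u r) (@wnbhs_singleton R n u r) (@wnbhs_nbhs R n u r).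

(** The fibre, carrying the twisted product; the algebra structure is put directly on the
    subtype demanded by [fibredAlgebra]. *)
Definition wfiber (R : realType) (n : nat) (u : weight R n) (r : pradius R) (x : Cstar R) :=
  {a : wtotal u r | wbase a = x}.

Section Fiber.
Variables (R : realType) (n : nat) (u : weight R n) (r : pradius R) (x : Cstar R).
Local Notation C := (Cplx R).
Local Notation F := (wfiber u r x).

Definition fcoef (a : F) : multidx n -> C := wcoef (sval a).

Lemma fcoefP (a : F) : in_weighted u r x (fcoef a).
Proof. by case: a => a ax; rewrite -[X in in_weighted _ _ X]ax; exact: wcoefP. Qed.

Definition mkfib (c : multidx n -> C) (H : in_weighted u r x c) : F :=
  exist _ (WTotal H) erefl.

Lemma fiber_ext (a b : F) : fcoef a =1 fcoef b -> a = b.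
Proof.
case: a => -[xa a Ha] ea; case: b => -[xb b Hb] eb; rewrite /fcoef /= => /funext ab.
move: (ea) (eb) => /= ea' eb'; subst xa xb b.
have -> : Ha = Hb by exact: Prop_irrelevance.
by congr exist; exact: Prop_irrelevance.
Qed.

Lemma in_weightedD a b : in_weighted u r x a -> in_weighted u r x b ->
  in_weighted u r x (fun k => a k + b k).
Proof. by move=> ha hb rho h; apply: wsummableD (radii_ge0 h) (ha _ h) (hb _ h). Qed.
Lemma in_weightedN a : in_weighted u r x a -> in_weighted u r x (fun k => - a k).
Proof. by move=> ha rho h; apply: wsummableN (ha _ h). Qed.
Lemma in_weightedZ c a : in_weighted u r x a -> in_weighted u r x (fun k => c * a k).
Proof. by move=> ha rho h; apply: wsummableZ (radii_ge0 h) (ha _ h). Qed.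
Lemma in_weightedM a b : in_weighted u r x a -> in_weighted u r x b ->
  in_weighted u r x (series_mul x a b).
Proof. by move=> ha hb rho h; apply: wsummableM (radii_ge0 h) (ha _ h) (hb _ h). Qed.

HB.instance Definition _ := gen_eqMixin F.
HB.instance Definition _ := gen_choiceMixin F.

Definition fib_zero : F := mkfib (fsupp_in_weighted u x (@fsupp0 R n)).
Definition fib_add (a b : F) : F := mkfib (in_weightedD (fcoefP a) (fcoefP b)).
Definition fib_opp (a : F) : F := mkfib (in_weightedN (fcoefP a)).
Definition fib_scale (c : C) (a : F) : F := mkfib (in_weightedZ c (fcoefP a)).
Definition fib_monomial k : F := mkfib (fsupp_in_weighted u x (fsupp_monomial R k)).
Definition fib_mul (a b : F) : F := mkfib (in_weightedM (fcoefP a) (fcoefP b)).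

Fact fib_addA : associative fib_add.
Proof. by move=> a b c; apply: fiber_ext => k; exact: addrA. Qed.
Fact fib_addC : commutative fib_add.
Proof. by move=> a b; apply: fiber_ext => k; exact: addrC. Qed.
Fact fib_add0 : left_id fib_zero fib_add.
Proof. by move=> a; apply: fiber_ext => k; exact: add0r. Qed.
Fact fib_addN : left_inverse fib_zero fib_opp fib_add.
Proof. by move=> a; apply: fiber_ext => k; exact: addNr. Qed.
HB.instance Definition _ := GRing.isZmodule.Build F fib_addA fib_addC fib_add0 fib_addN.

Fact fib_mulA : associative fib_mul.
Proof. by move=> a b c; apply: fiber_ext => k; exact: series_mulA. Qed.
Fact fib_mul1 : left_id (fib_monomial 0) fib_mul.
Proof. by move=> a; apply: fiber_ext => k; rewrite /fcoef /= series_mul1. Qed.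
Fact fib_mulr1 : right_id (fib_monomial 0) fib_mul.
Proof. by move=> a; apply: fiber_ext => k; rewrite /fcoef /= series_mulr1. Qed.
Fact fib_mulDl : left_distributive fib_mul +%R.
Proof. by move=> a b c; apply: fiber_ext => k; rewrite /fcoef /= series_mulDl. Qed.
Fact fib_mulDr : right_distributive fib_mul +%R.
Proof. by move=> a b c; apply: fiber_ext => k; rewrite /fcoef /= series_mulDr. Qed.
Fact fib_1neq0 : fib_monomial 0 != 0.
Proof.
apply/eqP => /(congr1 (fun a => fcoef a 0)); rewrite /fcoef /= /monomial eqxx.
by apply/eqP; exact: oner_neq0.
Qed.
HB.instance Definition _ := GRing.Zmodule_isNzRing.Build F
  fib_mulA fib_mul1 fib_mulr1 fib_mulDl fib_mulDr fib_1neq0.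

Fact fib_scaleA (c d : C) (a : F) : fib_scale c (fib_scale d a) = fib_scale (c * d) a.
Proof. by apply: fiber_ext => k; exact: mulrA. Qed.
Fact fib_scale1 : left_id 1 fib_scale.
Proof. by move=> a; apply: fiber_ext => k; exact: mul1r. Qed.
Fact fib_scaleDr : right_distributive fib_scale +%R.
Proof. by move=> c a b; apply: fiber_ext => k; exact: mulrDr. Qed.
Fact fib_scaleDl (a : F) : {morph fib_scale^~ a : c d / c + d}.
Proof. by move=> c d; apply: fiber_ext => k; exact: mulrDl. Qed.
HB.instance Definition _ := GRing.Zmodule_isLmodule.Build C F
  fib_scaleA fib_scale1 fib_scaleDr fib_scaleDl.

Fact fib_scaleAl (c : C) (a b : F) : c *: (a * b) = (c *: a) * b.
Proof. by apply: fiber_ext => k; rewrite /fcoef /= series_mulZl. Qed.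
Fact fib_scaleAr (c : C) (a b : F) : c *: (a * b) = a * (c *: b).
Proof. by apply: fiber_ext => k; rewrite /fcoef /= series_mulZr. Qed.
HB.instance Definition _ := GRing.Lmodule_isLalgebra.Build C F fib_scaleAl.
HB.instance Definition _ := GRing.Lalgebra_isAlgebra.Build C F fib_scaleAr.

Lemma fcoefM (a b : F) : fcoef (a * b) = series_mul x (fcoef a) (fcoef b). Proof. by []. Qed.
Lemma fcoef_sum (I : Type) (s : seq I) (P : pred I) (f : I -> F) k :
  fcoef (\sum_(i <- s | P i) f i) k = \sum_(i <- s | P i) fcoef (f i) k.
Proof. by elim/big_rec2: _ => // i y1 y2 _ <-. Qed.

Lemma fib_monomialM k l : fib_monomial k * fib_monomial l = twist x k l *: fib_monomial (k + l).
Proof. by apply: fiber_ext => m; rewrite fcoefM /fcoef /= series_mul_monomial. Qed.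

End Fiber.

Definition wbundle (R : realType) (n : nat) (u : weight R n) (r : pradius R) :
    fibredAlgebra R (Cstar R) :=
  @FibredAlgebra R (Cstar R) (wtotal u r) (@wbase R n u r)
    (fun x => GRing.Algebra.class (wfiber u r x : algType (Cplx R))).

Section Bundle.
Variables (R : realType) (n : nat) (u : weight R n) (r : pradius R).
Local Notation C := (Cplx R).
Local Notation A := (wbundle u r).
Implicit Types (x y : Cstar R).

Definition wbundle_index := {rho : R | polydisk_radii r rho}.
Definition wbundle_norm (i : wbundle_index) (a : total_space A) : R :=
  wnorm u (wbase a) (sval i) (wcoef a).

Definition fibcoef x (a : fiber A x) : multidx n -> C := @fcoef R n u r x a.

(** Inside one fibre, tubes around polynomials and balls around the point itself generate
    the same topology, by density of the polynomials. *)
Lemma nbhs_fiberP x (a : fiber A x) (W : set (fiber A x)) : nbhs a W <->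
  exists rho (e : R), [/\ polydisk_radii r rho, 0 < e &
    [set b : fiber A x | wnorm u x rho (fun k => fibcoef b k - fibcoef a k) < e] `<=` W].
Proof.
case: a => a ax; have ax' : wbase a = x := ax; split.
- move=> /(@nbhs_initialP _ _ (@fiber_val _ _ A x))[V /= aV VW].
  have [p [rho [e [U [fp hrho aU ap UV]]]]] : wnbhs a V by [].
  have r0 := radii_ge0 hrho; have sa := @wcoefP _ _ _ _ a _ hrho.
  exists rho, (e - wnorm u x rho (fun k => wcoef a k - p k)); split => //.
    by rewrite subr_gt0 -ax'.
  move=> [b bx] /= hb; have bx' : wbase b = x := bx.
  apply: VW; apply: UV; split => /=; first by rewrite bx' -ax'; exact: nbhs_singleton.
  have sb := @wcoefP _ _ _ _ b _ hrho; rewrite ax' in sa ap; rewrite bx' in sb *.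
  have := wnorm_trans r0 sb sa (fsupp_wsummable u x r0 fp).
  by rewrite /fibcoef /fcoef /= in hb; lra.
- move=> [rho [e [hrho e0 hW]]]; apply/(@nbhs_initialP _ _ (@fiber_val _ _ A x)) => /=.
  have r0 := radii_ge0 hrho; have sa := @wcoefP _ _ _ _ a _ hrho.
  have e2 : 0 < e / 2 by lra.
  have [p fp ap] := fsupp_dense r0 sa e2.
  exists (tube p rho (e / 2) setT); first by exists p, rho, (e / 2), setT; split => //; exact: filterT.
  move=> [b bx] [_ /= hb]; have bx' : wbase b = x := bx; apply: hW; rewrite /= /fibcoef /fcoef /=.
  have sb := @wcoefP _ _ _ _ b _ hrho; rewrite bx' in sb hb; rewrite ax' in sa ap.
  have := wnorm_trans r0 sb (fsupp_wsummable u x r0 fp) sa.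
  rewrite (wnormB _ _ _ p); lra.
Qed.

End Bundle.

Section BundleAxioms.
Variables (R : realType) (n : nat) (u : weight R n) (r : pradius R).
Local Notation C := (Cplx R).
Local Notation T := (wtotal u r).
Local Notation A := (wbundle u r).
Implicit Types (x y : Cstar R) (p : multidx n -> C).

Lemma wbase_continuous : continuous (@wbase R n u r : T -> Cstar R).
Proof.
move=> a U aU; have [rho hrho] := radii_exists r.
exists (fun=> 0), rho, (wnorm u (wbase a) rho (fun k => wcoef a k - 0) + 1), U.
by split => //; [exact: fsupp0|lra|move=> b []].
Qed.

Lemma wbase_open (U : set T) : open U -> open (@wbase R n u r @` U).
Proof.
rewrite !openE => oU _ [a Ua <-]; have [p [rho [e [V [fp hrho aV ap VU]]]]] := oU a Ua.
rewrite /interior; apply: filterS aV => y Vy; have r0 := radii_ge0 hrho.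
exists (WTotal (fsupp_in_weighted u y fp)) => //; apply: VU; split => //=.
under eq_fun do rewrite subrr.
by rewrite wnorm0; apply: le_lt_trans ap; exact: wnorm_ge0.
Qed.

Lemma nbhs_tube (a : T) p rho (e : R) : fsupp p -> polydisk_radii r rho ->
  wnorm u (wbase a) rho (fun k => wcoef a k - p k) < e -> nbhs a (tube p rho e setT).
Proof. by move=> fp hrho ap; exists p, rho, e, setT; split => //; exact: filterT. Qed.

Lemma nbhs_wbase (a : T) U : nbhs (wbase a) U -> nbhs a (@wbase R n u r @^-1` U).
Proof. exact: wbase_continuous. Qed.

Lemma fiberprod_wbase (ab : fiberprod A) : wbase (\val ab).1 = wbase (\val ab).2 :> Cstar R.
Proof. exact: (set_valP ab). Qed.

Lemma nbhs_fiberprod (ab : fiberprod A) (V W : set T) (Q : set (fiberprod A)) :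
  nbhs ((\val ab).1 : T) V -> nbhs ((\val ab).2 : T) W ->
  (forall cd : fiberprod A, V (\val cd).1 -> W (\val cd).2 -> Q cd) -> nbhs ab Q.
Proof.
move=> aV bW VWQ; apply/(nbhs_set_typeP ab); exists (V `*` W); last by move=> cd [? ?]; exact: VWQ.
by exists (V, W).
Qed.

Lemma wtotal_add_continuous : continuous (@total_add R _ A).
Proof.
move=> ab W /wnbhs_section_cst[rho [eta [hrho eta0 hW]]].
set a : T := (\val ab).1; set b : T := (\val ab).2; have r0 := radii_ge0 hrho.
have abE : wbase a = wbase b by exact: fiberprod_wbase.
have sa := @wcoefP _ _ _ _ a _ hrho; have sb := @wcoefP _ _ _ _ b _ hrho.
have e2 : 0 < eta / 2 by lra.
have [p fp ap] := fsupp_dense r0 sa e2; have [p' fp' bp'] := fsupp_dense r0 sb e2.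
(* The sum of two series is approximated by the sum of approximations. *)
have key y (c d : multidx n -> C) : wsummable u y rho c -> wsummable u y rho d ->
    wnorm u y rho (fun k => c k - p k) < eta / 2 ->
    wnorm u y rho (fun k => d k - p' k) < eta / 2 ->
    wnorm u y rho (fun k => c k + d k - (p k + p' k)) < eta.
  move=> sc sd cp dp; under eq_fun do rewrite opprD addrACA.
  apply: le_lt_trans (wnormD r0 _ _) _; last lra.
    exact: wsummableB r0 sc (fsupp_wsummable u y r0 fp).
  exact: wsummableB r0 sd (fsupp_wsummable u y r0 fp').
have [|U xU UW] := hW _ (fsuppD fp fp').
  suff : wnorm u (wbase a) rho (fun k => wcoef a k + wcoef b k - (p k + p' k)) < eta by [].
  by apply: key; rewrite // abE.
apply: (nbhs_fiberprod (filterI (nbhs_tube fp hrho ap) (@nbhs_wbase a U xU)) (nbhs_tube fp' hrho bp')) => cd [[_ cp] cU] [_ dp].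
apply: UW; split; first exact: cU.
pose c : T := (\val cd).1; pose d : T := (\val cd).2.
have cdE : wbase c = wbase d by exact: fiberprod_wbase.
suff : wnorm u (wbase c) rho (fun k => wcoef c k + wcoef d k - (p k + p' k)) < eta by [].
have sc := @wcoefP _ _ _ _ c _ hrho; have sd := @wcoefP _ _ _ _ d _ hrho.
by apply: key; rewrite // cdE.
Qed.

Lemma wtotal_scale_continuous : continuous (@total_scale R _ A).
Proof.
move=> [z a] W /wnbhs_section_cst[rho [eta [hrho eta0 hW]]]; have r0 := radii_ge0 hrho.
have sa := @wcoefP _ _ _ _ a _ hrho.
set N := wnorm u (wbase a) rho (wcoef a); have N0 : 0 <= N by exact: wnorm_ge0.
pose d := Num.min 1 (eta / (cabs z + N + 4)).
have D0 : 0 < cabs z + N + 4 by have := cabs_ge0 z; lra.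
have d0 : 0 < d by rewrite lt_min ltr01 divr_gt0.
have d1 : d <= 1 by rewrite ge_min lexx.
have dE : d * (cabs z + N + 4) <= eta by rewrite -ler_pdivlMr// ge_min lexx orbT.
have [p fp ap] := fsupp_dense r0 sa d0.
have pN : wnorm u (wbase a) rho p < N + 1.
  have := wnormD r0 sa (wsummableB r0 (fsupp_wsummable u (wbase a) r0 fp) sa).
  under [X in wnorm _ _ _ X <= _]eq_fun do rewrite addrC subrK.
  rewrite wnormB -/N; lra.
have key y w (c : multidx n -> C) : wsummable u y rho c -> cabs (w - z) < d ->
    wnorm u y rho p < N + 1 -> wnorm u y rho (fun k => c k - p k) < d ->
    wnorm u y rho (fun k => w * c k - z * p k) < eta.
  move=> sc wz pN' cp; have sp := fsupp_wsummable u y r0 fp.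
  under eq_fun => k do rewrite -[w * c k - _](subrKA (w * p k)) -mulrBr -mulrBl.
  have scp := wsummableB r0 sc sp.
  apply: le_lt_trans (wnormD r0 (wsummableZ w r0 scp) (wsummableZ (w - z) r0 sp)) _.
  rewrite !wnormZ//.
  have wz' : cabs w < cabs z + 1.
    by have := cabsD (w - z) z; rewrite subrK; lra.
  have := wnorm_ge0 u y p r0; have := wnorm_ge0 u y (fun k => c k - p k) r0.
  have := cabs_ge0 w; have := cabs_ge0 (w - z).
  nra.
have [|U xU UW] := hW _ (fsuppZ z fp).
  suff : wnorm u (wbase a) rho (fun k => z * wcoef a k - z * p k) < eta by [].
  by apply: key; rewrite // subrr cabs0.
have [s hs] := fp.
have hcv := @wnorm_section_cvg _ _ u rho (fun=> p) (wbase a) s r0 (fun _ => hs)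
  (fun k => @cst_continuous _ _ (p k) _).
have xN : nbhs (wbase a) [set y | wnorm u y rho p < N + 1] by exact: (cvgr_lt _ hcv).
have aB : nbhs (a : T) (tube p rho d setT `&` (@wbase R n u r @^-1`
   (U `&` [set y | wnorm u y rho p < N + 1]))).
  have h1 := @nbhs_tube a _ _ _ fp hrho ap.
  have h2 : nbhs (wbase a) (U `&` [set y | wnorm u y rho p < N + 1]) by exact: filterI.
  exact (filterI h1 (@nbhs_wbase a _ h2)).
exists ([set w | cabs (w - z) < d], tube p rho d setT `&` (@wbase R n u r @^-1`
   (U `&` [set y | wnorm u y rho p < N + 1]))); first by split; [exact: nbhs_cabs_ball|].
move=> [w c] /= [wz [[_ cp] [cU cN]]]; apply: UW; split => //.
suff : wnorm u (wbase c) rho (fun k => w * wcoef c k - z * p k) < eta by [].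
by apply: key => //; exact: (@wcoefP _ _ _ _ c _ hrho).
Qed.

Lemma series_mul_section_continuous (p p' : multidx n -> C) x m :
  {for x, continuous (fun y => series_mul y p p' m)}.
Proof.
rewrite (_ : (fun y => series_mul y p p' m) = (fun y => \sum_(k <- box n (mdeg m))
   \sum_(l <- box n (mdeg m) | k + l == m) twist y k l * (p k * p' l))); last first.
  by apply/funext => y; rewrite (series_mulE _ _ _ (leqnn _)).
rewrite forE /continuous_at.
apply: (@cvg_nsum C C _ (nbhs x) _ _ _ xpredT (fun k y => _) (fun k => _)) => k.
apply: (@cvg_nsum C C _ (nbhs x) _ _ _ _ (fun k y => _) (fun k => _)) => l.
apply: cvgM; last exact: cvg_cst.
rewrite /twist; apply: cvgV; first by rewrite expf_neq0// cstar_neq0.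
exact: (@continuous_comp _ C C (@cstar_val R) (fun z => z ^+ cross l k) x
  (@cstar_val_continuous R x) (@exp_continuous C (cross l k) _)).
Qed.

Lemma wnorm_mul_dist y rho (c d p p' : multidx n -> C) : 0 <= rho ->
  wsummable u y rho c -> wsummable u y rho d -> wsummable u y rho p -> wsummable u y rho p' ->
  wnorm u y rho (fun k => series_mul y c d k - series_mul y p p' k) <=
  wnorm u y rho (fun k => c k - p k) * wnorm u y rho d +
  wnorm u y rho p * wnorm u y rho (fun k => d k - p' k).
Proof.
move=> r0 sc sd sp sp'.
have scp := wsummableB r0 sc sp; have sdp := wsummableB r0 sd sp'.
have -> : (fun k => series_mul y c d k - series_mul y p p' k) =
    (fun k => series_mul y (fun k => c k - p k) d k + series_mul y p (fun k => d k - p' k) k).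
  have Nm (a : multidx n -> C) : (fun k => - a k) = (fun k => (-1) * a k).
    by apply/funext => k; rewrite mulN1r.
  apply/funext => k; rewrite series_mulDl series_mulDr.
  rewrite (Nm p) (Nm p') series_mulZl series_mulZr.
  by rewrite !mulN1r addrA subrK.
apply: le_trans (wnormD r0 (wsummableM r0 scp sd) (wsummableM r0 sp sdp)) _.
by rewrite lerD// wnormM.
Qed.

(** Near a pair of points both factors are close to polynomials [p] and [p'], and the
    product is close to the section [y |-> p p'], the product being that of the fibre at
    [y]; its finitely many coefficients are continuous in [y]. *)
Lemma wtotal_mul_continuous : continuous (@total_mul R _ A).
Proof.
move=> ab W /wnbhs_section[rho [eta [hrho eta0 hW]]].
set a : T := (\val ab).1; set b : T := (\val ab).2; have r0 := radii_ge0 hrho.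
have abE : wbase a = wbase b by exact: fiberprod_wbase.
have sa := @wcoefP _ _ _ _ a _ hrho.
have sb : wsummable u (wbase a) rho (wcoef b) by rewrite abE; exact: (@wcoefP _ _ _ _ b _ hrho).
set N := wnorm u (wbase a) rho (wcoef a); set M := wnorm u (wbase a) rho (wcoef b).
have N0 : 0 <= N by exact: wnorm_ge0. have M0 : 0 <= M by exact: wnorm_ge0.
pose d := Num.min 1 (eta / (N + M + 6)).
have D0 : 0 < N + M + 6 by lra.
have d0 : 0 < d by rewrite lt_min ltr01 divr_gt0.
have d1 : d <= 1 by rewrite ge_min lexx.
have dE : d * (N + M + 6) <= eta by rewrite -ler_pdivlMr// ge_min lexx orbT.
have [p fp ap] := fsupp_dense r0 sa d0; have [p' fp' bp'] := fsupp_dense r0 sb d0.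
have near_norm y (c q : multidx n -> C) : wsummable u y rho c -> fsupp q ->
    wnorm u y rho (fun k => c k - q k) < d -> wnorm u y rho q < wnorm u y rho c + 1.
  move=> sc fq cq; have sq := fsupp_wsummable u y r0 fq.
  have := wnormD r0 sc (wsummableB r0 sq sc).
  under [X in wnorm _ _ _ X <= _]eq_fun do rewrite addrC subrK.
  rewrite (wnormB u y rho q c); lra.
have near_norm' y (c q : multidx n -> C) : wsummable u y rho c -> fsupp q ->
    wnorm u y rho (fun k => c k - q k) < d -> wnorm u y rho c < wnorm u y rho q + 1.
  move=> sc fq cq; have sq := fsupp_wsummable u y r0 fq.
  have := wnormD r0 sq (wsummableB r0 sc sq).
  under [X in wnorm _ _ _ X <= _]eq_fun do rewrite addrC subrK.
  lra.
have pN : wnorm u (wbase a) rho p < N + 1 by apply: near_norm.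
have pM : wnorm u (wbase a) rho p' < M + 1 by apply: near_norm.
have key y (c e : multidx n -> C) : wsummable u y rho c -> wsummable u y rho e ->
    wnorm u y rho p < N + 1 -> wnorm u y rho p' < M + 1 ->
    wnorm u y rho (fun k => c k - p k) < d -> wnorm u y rho (fun k => e k - p' k) < d ->
    wnorm u y rho (fun k => series_mul y c e k - series_mul y p p' k) < eta.
  move=> sc se hN hM cp ep.
  have sp := fsupp_wsummable u y r0 fp; have sp' := fsupp_wsummable u y r0 fp'.
  apply: le_lt_trans (wnorm_mul_dist r0 sc se sp sp') _.
  have he := near_norm' _ _ _ se fp' ep.
  have := wnorm_ge0 u y p r0; have := wnorm_ge0 u y e r0.
  have := wnorm_ge0 u y (fun k => c k - p k) r0; have := wnorm_ge0 u y (fun k => e k - p' k) r0.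
  nra.
have [N1 hN1] := fsupp_box fp; have [N2 hN2] := fsupp_box fp'.
set B := maxn N1 N2.
have hp k : k \notin box n B -> p k = 0.
  by move=> kB; apply: hN1; apply: contra kB; apply: box_sub; exact: leq_maxl.
have hp' k : k \notin box n B -> p' k = 0.
  by move=> kB; apply: hN2; apply: contra kB; apply: box_sub; exact: leq_maxr.
have [|||U xU UW] := hW (box n (B + B)) (fun y => series_mul y p p').
- by move=> y k; exact: series_mul_supp.
- by move=> k; exact: series_mul_section_continuous.
- suff : wnorm u (wbase a) rho (fun k => series_mul (wbase a) (wcoef a) (wcoef b) k -
      series_mul (wbase a) p p' k) < eta by [].
  exact: key.
have [s hs] := fp; have [s' hs'] := fp'.
have xN : nbhs (wbase a) [set y | wnorm u y rho p < N + 1].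
  exact: (cvgr_lt _ (@wnorm_section_cvg _ _ u rho (fun=> p) (wbase a) s r0 (fun _ => hs)
    (fun k => @cst_continuous _ _ (p k) _))).
have xM : nbhs (wbase a) [set y | wnorm u y rho p' < M + 1].
  exact: (cvgr_lt _ (@wnorm_section_cvg _ _ u rho (fun=> p') (wbase a) s' r0 (fun _ => hs')
    (fun k => @cst_continuous _ _ (p' k) _))).
have xV : nbhs (wbase a) (U `&` ([set y | wnorm u y rho p < N + 1] `&`
    [set y | wnorm u y rho p' < M + 1])).
  by apply: filterI xU _; exact: filterI.
have bp'' : wnorm u (wbase b) rho (fun k => wcoef b k - p' k) < d by rewrite -abE.
apply: (nbhs_fiberprod (filterI (nbhs_tube fp hrho ap) (@nbhs_wbase a _ xV))
  (nbhs_tube fp' hrho bp'')) => cd [[_ cp] [cU [cN cM]]] [_ dp].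
pose c : T := (\val cd).1; pose e : T := (\val cd).2.
have ceE : wbase c = wbase e by exact: fiberprod_wbase.
suff : wnorm u (wbase c) rho (fun k => series_mul (wbase c) (wcoef c) (wcoef e) k -
    series_mul (wbase c) p p' k) < eta by move=> h; apply: UW; [exact: cU|exact: h].
have sc := @wcoefP _ _ _ _ c _ hrho; have se := @wcoefP _ _ _ _ e _ hrho.
by apply: key; rewrite // ceE.
Qed.

End BundleAxioms.

Section BundleAxioms2.
Variables (R : realType) (n : nat) (u : weight R n) (r : pradius R).
Local Notation C := (Cplx R).
Local Notation T := (wtotal u r).
Local Notation A := (wbundle u r).
Implicit Types (x y : Cstar R) (p : multidx n -> C).

Lemma wbundle_normE i x (a : fiberAlg A x) :
  wbundle_norm i (fiber_val a) = wnorm u x (sval i) (fcoef a).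
Proof.
case: a => a ax; have ax' : wbase a = x := ax.
by transitivity (wnorm u (wbase a) (sval i) (wcoef a)); [|rewrite ax'].
Qed.

Lemma wbundle_seminorm i x :
  is_seminorm (fun a : fiberAlg A x => wbundle_norm i (fiber_val a)).
Proof.
have r0 := radii_ge0 (svalP i).
split=> [a|a b|c a]; rewrite !wbundle_normE.
- exact: wnorm_ge0.
- exact: (wnormD r0 (fcoefP a (svalP i)) (fcoefP b (svalP i))).
- exact: (wnormZ c r0 (fcoefP a (svalP i))).
Qed.

Lemma wbundle_norm_mono (i j : wbundle_index r) (a : total_space A) :
  sval i <= sval j -> wbundle_norm i a <= wbundle_norm j a.
Proof.
move=> ij; apply: wnorm_mono; first by rewrite (radii_ge0 (svalP i)).
exact: (@wcoefP _ _ _ _ a _ (svalP j)).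
Qed.

Lemma wbundle_directed (i j : wbundle_index r) : exists k,
  forall a : total_space A, wbundle_norm i a <= wbundle_norm k a /\
                            wbundle_norm j a <= wbundle_norm k a.
Proof.
exists (exist _ _ (radii_max (svalP i) (svalP j))) => a.
by split; apply: wbundle_norm_mono; rewrite /= le_max lexx ?orbT.
Qed.

Lemma radii_lt rho : polydisk_radii r rho ->
  exists2 q : rat, polydisk_radii r (ratr q) & rho <= ratr q.
Proof.
move=> [rho0 rhor].
have [s [rs sr]] : exists s : R, rho < s /\ (s%:E <= r)%E.
  move: rhor; case: (prad r) => [s||//]; first by rewrite lte_fin; exists s.
  by exists (rho + 1); rewrite leey; split => //; lra.
have [q] := rat_in_itvoo rs; rewrite in_itv/= => /andP[q1 q2].
exists q; last exact: ltW.
split; first exact: lt_trans q1.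
by apply: lt_le_trans sr; rewrite lte_fin.
Qed.

(** Norms with rational radii. *)
Lemma wbundle_cofinal : exists J : set (wbundle_index r), countable J /\
  forall i, exists2 j, J j & forall a : total_space A, wbundle_norm i a <= wbundle_norm j a.
Proof.
exists [set i | exists q : rat, ratr q = sval i]; split; last first.
  move=> i; have [q hq iq] := radii_lt (svalP i).
  by exists (exist _ _ hq); [exists q|move=> a; exact: wbundle_norm_mono].
pose f (i : wbundle_index r) := choice.pickle (xget (0 : rat) [set q : rat | ratr q = sval i]).
apply/countable_injP; exists f => i j.
rewrite !inE /= => -[q hq] [q' hq'] /(pcan_inj choice.pickleK) ij.
have Ei : ratr (xget (0 : rat) [set q : rat | ratr q = sval i]) = sval i.
  by apply: (@xgetPex _ 0 [set q : rat | ratr q = sval i]); exists q.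
have Ej : ratr (xget (0 : rat) [set q : rat | ratr q = sval j]) = sval j.
  by apply: (@xgetPex _ 0 [set q : rat | ratr q = sval j]); exists q'.
have : sval i = sval j by rewrite -Ei -Ej ij.
clear; case: i j => [i Pi] [j Pj] /= e; subst j.
by congr exist; exact: Prop_irrelevance.
Qed.

Lemma wbundle_base x (W : set (total_space A)) :
  nbhs (fiber_val (0 : fiberAlg A x)) W <->
  exists (i : wbundle_index r) (e : R) (U : set (Cstar R)),
    [/\ 0 < e, nbhs x U & [set a | U (bproj a) /\ wbundle_norm i a < e] `<=` W].
Proof.
have sub0 (f : multidx n -> C) : (fun k => f k - 0) = f by apply/funext => k; rewrite subr0.
split.
- move=> h.
  have /wnbhs_section_cst[rho [eta [hrho eta0 /(_ _ (@fsupp0 R n))[|U xU UW]]]] :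
     wnbhs (fiber_val (0 : fiberAlg A x) : T) W by exact: h.
    by rewrite sub0 /= wnorm0.
  exists (exist _ rho hrho), eta, U; split => // a [aU ah]; apply: UW; split => //.
  by rewrite sub0.
- move=> [i [e [U [e0 xU UW]]]]; exists (fun=> 0), (sval i), e, U; split => //.
  + exact: fsupp0.
  + exact: svalP i.
  + by rewrite sub0 /= wnorm0.
  + by move=> a [aU ah]; apply: UW; split => //; move: ah; rewrite sub0.
Qed.

Lemma wfiber_hausdorff x : hausdorff_space (fiber A x).
Proof.
move=> a b ab; have [rho hrho] := radii_exists r; have r0 := radii_ge0 hrho.
have sa := fcoefP a hrho; have sb := fcoefP b hrho.
have h (e : R) : 0 < e -> wnorm u x rho (fun k => fibcoef a k - fibcoef b k) <= e.
  move=> e0; have e2 : 0 < e / 2 by lra.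
  have [c /= [ca cb]] := ab [set c | wnorm u x rho (fun k => fibcoef c k - fibcoef a k) < e / 2]
    [set c | wnorm u x rho (fun k => fibcoef c k - fibcoef b k) < e / 2]
    ((nbhs_fiberP a _).2 (ex_intro _ rho (ex_intro _ (e / 2) (And3 hrho e2 (@subset_refl _ _)))))
    ((nbhs_fiberP b _).2 (ex_intro _ rho (ex_intro _ (e / 2) (And3 hrho e2 (@subset_refl _ _))))).
  have sc := fcoefP c hrho.
  have := wnorm_trans r0 sa sc sb.
  rewrite (wnormB _ _ _ (fcoef a) (fcoef c)) => h.
  by apply: le_trans h _; rewrite /fibcoef in ca cb *; lra.
have := wnorm_eq0 hrho.1 (wsummableB r0 sa sb) _; rewrite -/(fibcoef a) -/(fibcoef b) => hab.
apply: fiber_ext => k; apply/eqP; rewrite -subr_eq0; apply/eqP; apply: hab.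
apply/eqP; rewrite eq_le wnorm_ge0// andbT; apply/ler_addgt0Pr => e e0.
by rewrite add0r h.
Qed.

(** Coefficientwise limits of a Cauchy filter are norm limits, because each finite partial
    sum of the norm is continuous in the coefficients. *)
Lemma wnorm_le_lim x rho (F : set_system (fiber A x)) (l a : multidx n -> C) (S : set (fiber A x)) (e : R) :
  ProperFilter F -> 0 <= rho ->
  (forall k (d : R), 0 < d -> F [set b | cabs (fibcoef b k - l k) < d]) ->
  F S -> (forall b, S b -> wsummable u x rho (fun k => a k - fibcoef b k) /\
                      wnorm u x rho (fun k => a k - fibcoef b k) <= e) ->
  forall s, uniq s -> \sum_(k <- s) wterm u x rho (fun k => a k - l k) k <= e.
Proof.
move=> FF r0 hl FS hS s us.
set V := \sum_(k <- s) u x k * rho ^+ mdeg k.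
have V0 : 0 <= V by apply: sumr_ge0 => k _; rewrite mulr_ge0 ?exprn_ge0// ltW ?wt_gt0.
apply/ler_addgt0Pr => d d0; pose d' := d / (V + 1).
have d'0 : 0 < d' by rewrite divr_gt0//; lra.
have [b [Sb hb]] : exists b, S b /\ forall k, k \in s -> cabs (fibcoef b k - l k) < d'.
  have : F (S `&` [set b | forall k, k \in s -> cabs (fibcoef b k - l k) < d']).
    apply: filterI => //; elim: (s) => [|k t IH]; first by apply: filterS filterT => b _ k.
    apply: filterS2 IH (hl k _ d'0) => b hb bk j; rewrite inE => /orP[/eqP ->//|]; exact: hb.
  by move=> /filter_ex[b [Sb hb]]; exists b.
have [sb nb] := hS b Sb.
apply: (@le_trans _ _ (\sum_(k <- s) (wterm u x rho (fun k => a k - fibcoef b k) k +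
   d' * (u x k * rho ^+ mdeg k)))).
  rewrite big_seq [leRHS]big_seq; apply: ler_sum => k ks.
  set v := u x k * rho ^+ mdeg k.
  have v0 : 0 <= v by rewrite mulr_ge0 ?exprn_ge0// ltW ?wt_gt0.
  rewrite /wterm -![_ * u x k * _]mulrA -/v -mulrDl ler_wpM2r//.
  rewrite -[a k - l k](subrKA (fibcoef b k)); apply: le_trans (cabsD _ _) _.
  by rewrite lerD2l ltW// hb.
rewrite big_split /= -mulr_sumr lerD//.
  by apply: le_trans nb; apply: sum_le_tsum => // k; exact: wterm_ge0.
by rewrite -/V /d' mulrAC ler_pdivrMr; [nra|lra].
Qed.

(** A Cauchy filter converges in every coefficient, the coefficients being continuous; the
    family of the limits is its limit in norm. *)
Lemma wfiber_complete x : additively_complete (fiber A x).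
Proof.
move=> F FF hF.
have hF' rho (e : R) : polydisk_radii r rho -> 0 < e -> exists2 S, F S & forall a b, S a -> S b ->
    wnorm u x rho (fun k => fibcoef a k - fibcoef b k) < e.
  move=> hrho e0; have [|S FS hS] := hF [set c | wnorm u x rho (fibcoef c) < e].
    apply/nbhs_fiberP; exists rho, e; split => // c /=.
    by under eq_fun do rewrite subr0.
  by exists S => // a b Sa Sb; have := hS a b Sa Sb.
have [rho0 hrho0] := radii_exists r.
have /choice[l hl] (k : multidx n) : exists l : C, forall d : R, 0 < d -> F [set b | cabs (fibcoef b k - l) < d].
  have := @cauchy_cabs_cvg R ((fun b => fibcoef b k) @ F) _.
  case=> [d d0|l hl]; last by exists l.
  set c := (u x k * rho0 ^+ mdeg k)^-1.
  have c0 : 0 < c by rewrite invr_gt0 mulr_gt0 ?wt_gt0// exprn_gt0// hrho0.1.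
  have [S FS hS] := hF' _ _ hrho0 (divr_gt0 d0 c0).
  have FS' : F ((fun b => fibcoef b k) @^-1` ((fun b => fibcoef b k) @` S)).
    by apply: filterS FS => b Sb; exists b.
  exists ((fun b => fibcoef b k) @` S) => //.
  move=> _ _ [a Sa <-] [b Sb <-].
  have := coef_le_wnorm k hrho0.1 (wsummableB (ltW hrho0.1) (fcoefP a hrho0) (fcoefP b hrho0)).
  rewrite -/c; move/le_lt_trans; apply.
  by rewrite mulrC -ltr_pdivlMr//; exact: hS.
have key rho (e : R) : polydisk_radii r rho -> 0 < e -> exists2 S, F S & forall a, S a ->
    forall s, uniq s -> \sum_(k <- s) wterm u x rho (fun k => fibcoef a k - l k) k <= e.
  move=> hrho e0; have r0 := radii_ge0 hrho; have [S FS hS] := hF' _ _ hrho e0.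
  exists S => // a Sa s us; apply: (wnorm_le_lim FF r0 hl FS) => // b Sb; split.
    exact: wsummableB r0 (fcoefP a hrho) (fcoefP b hrho).
  exact/ltW/hS.
have lP : in_weighted u r x l.
  move=> rho hrho; have r0 := radii_ge0 hrho; have [S FS hS] := key _ _ hrho ltr01.
  have [a Sa] := filter_ex FS.
  have := wsummableB r0 (fcoefP a hrho) (tsummableW (hS a Sa)).
  by under [X in wsummable _ _ _ X -> _]eq_fun do rewrite subKr.
exists (mkfib lP : wfiber u r x) => W /nbhs_fiberP[rho [e [hrho e0 hW]]].
have r0 := radii_ge0 hrho; have e2 : 0 < e / 2 by lra.
have [S FS hS] := key _ _ hrho e2; apply: filterS FS => a Sa; apply: hW => /=.
apply: (@le_lt_trans _ _ (e / 2)); last lra.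
by apply: tsum_le => [k|]; [exact: wterm_ge0|exact: hS].
Qed.

Lemma wbundle_frechet : is_frechet_bundle (@wbundle_norm R n u r).
Proof.
split.
- exact: Cstar_hausdorff.
- exact: Cstar_locally_compact.
- exact: wbase_continuous.
- exact: wbase_open.
- by move=> x; exists (WTotal (fsupp_in_weighted u x (@fsupp0 R n))).
- exact: wtotal_add_continuous.
- exact: wtotal_scale_continuous.
- exact: wtotal_mul_continuous.
- exact: wbundle_seminorm.
- exact: wbundle_directed.
- exact: wbundle_cofinal.
- exact: wbundle_base.
- exact: wfiber_hausdorff.
- exact: wfiber_complete.
Qed.

Definition weighted_bundle : frechetAlgebraBundle R (Cstar R) :=
  Build_frechetAlgebraBundle wbundle_frechet.

End BundleAxioms2.

Lemma lrmorphism_exists (K : nzRingType) (U V : algType K) (f : U -> V) :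
  {morph f : a b / a - b} -> f 1 = 1 -> {morph f : a b / a * b} ->
  (forall c, {morph f : a / c *: a}) -> exists g : {lrmorphism U -> V}, g =1 f.
Proof.
move=> fB f1 fM fZ.
pose aM := GRing.isZmodMorphism.Build U V f fB.
pose mM := GRing.isMonoidMorphism.Build U V f (conj f1 fM).
pose sM := GRing.isScalable.Build K U V *:%R f fZ.
pose g : {lrmorphism U -> V} := HB.pack f aM mM sM.
by exists g.
Qed.

Lemma radii_seq_bound (R : realType) (r : pradius R) (s : seq R) :
  (forall i, i \in s -> polydisk_radii r i) ->
  exists2 rho, polydisk_radii r rho & forall i, i \in s -> i <= rho.
Proof.
elim: s => [_|i s IH hs]; first by have [rho hrho] := radii_exists r; exists rho.
have [|rho hrho hle] := IH; first by move=> j js; apply: hs; rewrite inE js orbT.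
exists (Num.max i rho); first by apply: radii_max => //; apply: hs; rewrite mem_head.
by move=> j; rewrite inE le_max => /orP[/eqP ->|/hle ->]; rewrite ?lexx ?orbT.
Qed.

Section FiberTopology.
Variables (R : realType) (n : nat) (u : weight R n) (r : pradius R) (x : Cstar R).
Local Notation C := (Cplx R).
Local Notation A := (wbundle u r).
Local Notation F := (fiber A x).
Local Notation norm rho a := (wnorm u x rho (fibcoef a)).

Lemma nbhs_fiber_ball (a : F) rho (e : R) : polydisk_radii r rho -> 0 < e ->
  nbhs a [set b : F | norm rho (b - a) < e].
Proof. by move=> hrho e0; apply/nbhs_fiberP; exists rho, e; split. Qed.

Lemma nbhs_fiber_ballP (a : F) (W : set F) : nbhs a W <->
  exists rho (e : R), [/\ polydisk_radii r rho, 0 < e &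
    [set b : F | norm rho (b - a) < e] `<=` W].
Proof. exact: nbhs_fiberP. Qed.

Lemma nbhs_fiber_seminorm (a : F) (W : set F) : nbhs a W <->
  seminorm_nbhs (polydisk_radii r) (fun rho (b : F) => norm rho b) a W.
Proof.
split.
  move=> /nbhs_fiberP[rho [e [hrho e0 hW]]]; exists [:: rho], e; split => //.
    by move=> i; rewrite inE => /eqP ->.
  by move=> b hb; apply: hW; apply: hb; rewrite mem_head.
move=> [s [e [sD e0 hW]]]; have [rho hrho hs] := radii_seq_bound sD; apply/nbhs_fiberP.
exists rho, e; split => // b hb; apply: hW => i si; apply: le_lt_trans hb.
by apply: wnorm_mono; [rewrite hs// (radii_ge0 (sD _ si))|exact: (fcoefP (b - a : F) hrho)].
Qed.

Lemma fiber_norm_ge0 rho (a : F) : polydisk_radii r rho -> 0 <= norm rho a.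
Proof. by move=> h; apply: wnorm_ge0; exact: radii_ge0 h. Qed.

Lemma fiber_normD rho (a b : F) : polydisk_radii r rho -> norm rho (a + b) <= norm rho a + norm rho b.
Proof. by move=> h; apply: (wnormD (radii_ge0 h) (fcoefP a h) (fcoefP b h)). Qed.

Lemma fiber_normZ rho (c : C) (a : F) : polydisk_radii r rho ->
  norm rho (c *: a) = cabs c * norm rho a.
Proof. by move=> h; apply: (wnormZ c (radii_ge0 h) (fcoefP a h)). Qed.

Lemma fiber_normM rho (a b : F) : polydisk_radii r rho -> norm rho (a * b) <= norm rho a * norm rho b.
Proof. by move=> h; apply: (wnormM (radii_ge0 h) (fcoefP a h) (fcoefP b h)). Qed.

Lemma fiber_topological_algebra : is_topological_algebra F.
Proof.
split.
- move=> [a b] W /nbhs_fiber_ballP[rho [e [hrho e0 hW]]]; have e2 : 0 < e / 2 by lra.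
  exists ([set c : F | norm rho (c - a) < e / 2], [set c : F | norm rho (c - b) < e / 2]).
    by split; exact: nbhs_fiber_ball.
  move=> [c d] /= [ca db]; apply: hW => /=.
  rewrite (_ : c + d - (a + b) = (c - a) + (d - b)); last by rewrite opprD addrACA.
  by apply: le_lt_trans (fiber_normD _ _ hrho) _; lra.
- move=> [z a] W /nbhs_fiber_ballP[rho [e [hrho e0 hW]]]; set N := norm rho a.
  have N0 : 0 <= N by exact: fiber_norm_ge0.
  have z0 := cabs_ge0 z; pose d := Num.min 1 (e / (cabs z + N + 2)).
  have D0 : 0 < cabs z + N + 2 by lra.
  have d0 : 0 < d by rewrite lt_min ltr01 divr_gt0.
  have d1 : d <= 1 by rewrite ge_min lexx.
  have dE : d * (cabs z + N + 2) <= e by rewrite -ler_pdivlMr// ge_min lexx orbT.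
  exists ([set w | cabs (w - z) < d], [set c : F | norm rho (c - a) < d]).
    by split; [exact: nbhs_cabs_ball|exact: nbhs_fiber_ball].
  move=> [w c] /= [wz ca]; apply: hW => /=.
  rewrite (_ : w *: c - z *: a = w *: (c - a) + (w - z) *: a); last first.
    by rewrite scalerBr scalerBl addrA subrK.
  apply: le_lt_trans (fiber_normD _ _ hrho) _; rewrite !fiber_normZ//.
  have wz' : cabs w < cabs z + 1.
    by have := cabsD (w - z) z; rewrite subrK; lra.
  have := fiber_norm_ge0 (c - a) hrho; have := cabs_ge0 w; have := cabs_ge0 (w - z).
  rewrite -/N; nra.
- move=> [a b] W /nbhs_fiber_ballP[rho [e [hrho e0 hW]]].
  set N := norm rho a; set M := norm rho b.
  have N0 : 0 <= N by exact: fiber_norm_ge0.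
  have M0 : 0 <= M by exact: fiber_norm_ge0.
  pose d := Num.min 1 (e / (N + M + 2)).
  have D0 : 0 < N + M + 2 by lra.
  have d0 : 0 < d by rewrite lt_min ltr01 divr_gt0.
  have d1 : d <= 1 by rewrite ge_min lexx.
  have dE : d * (N + M + 2) <= e by rewrite -ler_pdivlMr// ge_min lexx orbT.
  exists ([set c : F | norm rho (c - a) < d], [set c : F | norm rho (c - b) < d]).
    by split; exact: nbhs_fiber_ball.
  move=> [c f] /= [ca fb]; apply: hW => /=.
  rewrite (_ : c * f - a * b = (c - a) * f + a * (f - b)); last first.
    by rewrite mulrBl mulrBr addrA subrK.
  apply: le_lt_trans (fiber_normD _ _ hrho) _.
  have h1 := fiber_normM (c - a) f hrho; have h2 := fiber_normM a (f - b) hrho.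
  have hf : norm rho f < M + 1.
    by have := fiber_normD (f - b) b hrho; rewrite subrK -/M; lra.
  have := fiber_norm_ge0 (c - a) hrho; have := fiber_norm_ge0 f hrho.
  have := fiber_norm_ge0 (f - b) hrho; rewrite -/N in h2 *; nra.
Qed.

End FiberTopology.

(** * The quantum polydisk *)

Section PolydiskWeight.
Variables (R : realType) (n : nat).

Lemma qweight_min (q : Cstar R) (k : multidx n) :
  qweight q k = Num.min 1 (cabs (cstar_val q)) ^+ cross k k.
Proof. by rewrite /qweight; case: leP => [|h]; rewrite ?expr1n. Qed.

Lemma qweight_gt0 (q : Cstar R) (k : multidx n) : 0 < qweight q k.
Proof. by rewrite qweight_min exprn_gt0// lt_min ltr01 cabs_gt0// cstar_neq0. Qed.

Lemma cabs_cstar_continuous : continuous (fun q : Cstar R => cabs (cstar_val q)).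
Proof.
move=> q; apply: (@continuous_comp _ _ _ (@cstar_val R) (@cabs R)).
  exact: cstar_val_continuous.
exact: cabs_continuous.
Qed.

Lemma qweight_continuous (k : multidx n) : continuous (fun q : Cstar R => qweight q k).
Proof.
rewrite (_ : (fun q => _) = (fun q : Cstar R => Num.min 1 (cabs (cstar_val q)) ^+ cross k k)).
  move=> q; apply: (@continuous_comp _ R R (fun q : Cstar R => Num.min 1 (cabs (cstar_val q)))
    (fun t => t ^+ cross k k)); last exact: exp_continuous.
  apply: (@continuous_min R _ (fun=> 1)); first exact: cst_continuous.
  exact: cabs_cstar_continuous.
by apply/funext => q; exact: qweight_min.
Qed.

Definition polydisk_weight : weight R n :=
  Weight qweight_gt0 qweight_continuous (@qweightD R n).

(** Both algebras consist of the same series, with the same seminorms. *)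
Lemma polydisk_iso (r : pradius R) (q : Cstar R) :
  topalg_iso (fiber (weighted_bundle polydisk_weight r) q) (polydisk n q r).
Proof.
pose F := fiber (wbundle polydisk_weight r) q.
pose f (a : F) : polydisk n q r := Polydisk (fcoefP a : in_polydisk q r (fcoef a)).
pose g (b : polydisk n q r) : F :=
  mkfib (coefP b : in_weighted polydisk_weight r q (coef b)).
have [|||c a|h hf] := @lrmorphism_exists _ F (polydisk n q r) f.
- by move=> a b; apply: polydisk_ext => k /=; rewrite mulN1r.
- exact: polydisk_ext.
- by move=> a b; exact: polydisk_ext.
- exact: polydisk_ext.
exists h, g; split.
- by move=> a; rewrite hf; exact: fiber_ext.
- by move=> b; rewrite hf; exact: polydisk_ext.
- move=> a W; rewrite hf => -[s [e [sD e0 hW]]].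
  apply/nbhs_fiber_seminorm; exists s, e; split => // b hb; rewrite /= hf; apply: hW => i si.
  have -> : f b - f a = f (b - a) by apply: polydisk_ext => k /=; rewrite mulN1r.
  exact: hb i si.
- move=> b W /nbhs_fiber_seminorm[s [e [sD e0 hW]]].
  exists s, e; split => // c hc; apply: hW => i si.
  suff : coef (c - b) = fcoef (g c - g b) by move=> E; have := hc i si; rewrite /polydisk_seminorm E.
  by apply/funext => k /=; rewrite mulN1r.
Qed.

End PolydiskWeight.

(** * q-multinomial weights *)

Section QMultinomial.
Variables (R : realType) (n : nat).
Implicit Types (p : R) (k l : multidx n).

Definition qnum p m : R := \sum_(i < m) p ^+ i.
Definition qfact p m : R := \prod_(i < m) qnum p i.+1.
(** The [p]-multinomial coefficient of [|k|] over [k_1, ..., k_n]. It is the generating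
    function, by inversions, of the words with [k_i] letters [i]. *)
Definition qmulti p k : R := qfact p (mdeg k) / \prod_i qfact p (k i).

Lemma qnum0 p : qnum p 0 = 0. Proof. by rewrite /qnum big_ord0. Qed.
Lemma qnumD p a b : qnum p (a + b) = qnum p a + p ^+ a * qnum p b.
Proof.
rewrite /qnum big_split_ord/= mulr_sumr; congr (_ + _).
by apply: eq_bigr => i _; rewrite exprD.
Qed.
Lemma qnum_gt0 p m : 0 < p -> 0 < qnum p m.+1.
Proof.
move=> p0; rewrite /qnum big_ord_recl expr0 ltr_pwDl// sumr_ge0// => i _.
by rewrite exprn_ge0// ltW.
Qed.
Lemma qfact0 p : qfact p 0 = 1. Proof. by rewrite /qfact big_ord0. Qed.
Lemma qfactS p m : qfact p m.+1 = qfact p m * qnum p m.+1.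
Proof. by rewrite /qfact big_ord_recr. Qed.
Lemma qfact_gt0 p m : 0 < p -> 0 < qfact p m.
Proof. by move=> p0; apply: prodr_gt0 => i _; exact: qnum_gt0. Qed.
Lemma qmulti_gt0 p k : 0 < p -> 0 < qmulti p k.
Proof. by move=> p0; rewrite divr_gt0 ?qfact_gt0// prodr_gt0// => i _; exact: qfact_gt0. Qed.

Definition below k (j : 'I_n) : nat := (\sum_(i < n | (i < j)%N) k i)%N.

Lemma cross_mdelta_r k j : cross k (mdelta j) = below k j.
Proof.
rewrite /cross /below [RHS]big_mkcond; apply: eq_bigr => i _.
case: ifP => ij; last first.
  rewrite big1// => l il; rewrite ffunE; case: eqP => [e|_]; last by rewrite muln0.
  by rewrite -e ij in il.
rewrite (bigD1 j)//= ffunE eqxx muln1 big1 ?addn0// => l /andP[_ /negbTE lj].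
by rewrite ffunE eq_sym lj muln0.
Qed.

Lemma cross_mdelta_l k j : cross (mdelta j) k = (\sum_(i < n | (j < i)%N) k i)%N.
Proof.
rewrite /cross (bigD1 j)//= [X in (_ + X)%N]big1 ?addn0; last first.
  by move=> i /negbTE ij; rewrite big1// => l _; rewrite ffunE eq_sym ij.
by apply: eq_bigr => l _; rewrite ffunE eqxx mul1n.
Qed.

Lemma mdeg_mdelta (j : 'I_n) : mdeg (mdelta j) = 1%N.
Proof.
rewrite /mdeg (bigD1 j)//= ffunE eqxx big1 ?addn0// => i /negbTE ij.
by rewrite ffunE eq_sym ij.
Qed.

Lemma qnum_nat_sum p (K : nat -> nat) m :
  \sum_(j < m) p ^+ (\sum_(i < j) K i)%N * qnum p (K j) = qnum p (\sum_(i < m) K i).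
Proof.
elim: m => [|m IH]; first by rewrite !big_ord0 qnum0.
by rewrite big_ord_recr IH [in RHS]big_ord_recr qnumD.
Qed.

(** Cut the geometric sum [1 + p + ...] of length [|k|] into consecutive blocks of lengths
    [k_1, ..., k_n]. *)
Lemma qnum_mdeg p k : \sum_j p ^+ below k j * qnum p (k j) = qnum p (mdeg k).
Proof.
pose K m := oapp k 0%N (insub m : option 'I_n).
have KE (i : 'I_n) : K i = k i by rewrite /K valK.
have := qnum_nat_sum p K n; rewrite (eq_bigr _ (fun i _ => KE i)) => <-.
apply: eq_bigr => j _; rewrite KE; congr (p ^+ _ * _).
rewrite /below [RHS](big_ord_widen _ _ (ltnW (ltn_ord j))).
by apply: eq_bigr => i _; rewrite KE.
Qed.

Definition mpred k (j : 'I_n) : multidx n := [ffun i => k i - (i == j)]%N.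

Lemma mpredK k (j : 'I_n) : (0 < k j)%N -> mpred k j + mdelta j = k.
Proof.
move=> kj; apply/ffunP => i; rewrite !ffunE [j == i]eq_sym.
have [->|_] := eqVneq i j; first exact: (subnK kj).
by rewrite subn0; exact: addn0.
Qed.

Lemma mpredD k l j : (0 < l j)%N -> mpred (k + l) j = k + mpred l j.
Proof.
move=> lj; apply/ffunP => i; rewrite !ffunE.
have [->|_] := eqVneq i j; last by rewrite !subn0.
exact: (esym (addnBA _ lj)).
Qed.

Lemma qmulti_mdelta p k (j : 'I_n) : 0 < p ->
  qnum p ((k + mdelta j)%R j) * qmulti p (k + mdelta j) = qnum p (mdeg k).+1 * qmulti p k.
Proof.
move=> p0; have f0 m : qfact p m != 0 by rewrite gt_eqF// qfact_gt0.
have q0 m : qnum p m.+1 != 0 by rewrite gt_eqF// qnum_gt0.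
have kj : (k + mdelta j) j = (k j).+1 by rewrite !ffunE eqxx; exact: addn1.
rewrite /qmulti mdegD mdeg_mdelta addn1 qfactS.
rewrite (bigD1 j)//= [in RHS](bigD1 j)//= kj qfactS.
rewrite (eq_bigr (fun i => qfact p (k i))); last first.
  by move=> i /negbTE ij; rewrite !ffunE eq_sym ij; congr qfact; exact: addn0.
set P := \prod_(i < n | _) _; have P0 : P != 0 by apply/prodf_neq0 => i _; exact: f0.
by field; rewrite P0 q0 !f0.
Qed.

(** The Pascal rule: split the words according to one end letter. *)
Lemma qmulti_rec p k : 0 < p -> (0 < mdeg k)%N ->
  qmulti p k = \sum_(j | (0 < k j)%N) p ^+ below k j * qmulti p (mpred k j).
Proof.
move=> p0 k0; have kE := prednK k0.
have q0 : qnum p (mdeg k) != 0 by rewrite -kE gt_eqF// qnum_gt0.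
apply: (mulfI q0); rewrite -{1}qnum_mdeg mulr_suml mulr_sumr [RHS]big_mkcond.
apply: eq_bigr => j _; case: posnP => [->|kj]; first by rewrite qnum0 mulr0 mul0r.
have := qmulti_mdelta (mpred k j) j p0; rewrite mpredK//.
have -> : (mdeg (mpred k j)).+1 = mdeg k.
  by rewrite -{2}(mpredK kj) mdegD mdeg_mdelta addn1.
by move=> E; rewrite -mulrA E; ring.
Qed.

Lemma qmulti0 p : qmulti p 0 = 1.
Proof.
rewrite /qmulti mdeg0 qfact0 big1 ?divr1// => i _.
by rewrite ffunE qfact0.
Qed.

Lemma belowD k l j : below (k + l) j = (below k j + below l j)%N.
Proof. by rewrite /below -big_split; apply: eq_bigr => i _; rewrite ffunE. Qed.

(** Concatenating the words counted by [qmulti p k] and [qmulti p l] yields distinct words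
    counted by [qmulti p (k + l)]; here, by induction on the last letter. *)
Lemma qmulti_supmul p k l : 0 < p ->
  p ^+ cross k l * (qmulti p k * qmulti p l) <= qmulti p (k + l).
Proof.
move=> p0; have [m] := ubnP (mdeg l); elim: m k l => // m IH k l lm.
have [l0|l0] := posnP (mdeg l).
  have -> : l = 0.
    by apply/ffunP => i; rewrite ffunE; apply/eqP; rewrite -leqn0 -l0 mdeg_ge.
  by rewrite cross0r expr0 mul1r qmulti0 mulr1 addr0.
rewrite (qmulti_rec p0 l0) [leRHS]qmulti_rec//; last by rewrite mdegD addn_gt0 l0 orbT.
rewrite !mulr_sumr.
apply: (@le_trans _ _ (\sum_(j | (0 < l j)%N)
    p ^+ below (k + l) j * qmulti p (mpred (k + l) j))).
  apply: ler_sum => j lj; rewrite mpredD// belowD.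
  have E : cross k l = (cross k (mpred l j) + below k j)%N.
    by rewrite -{1}(mpredK lj) crossDr cross_mdelta_r.
  have h : (mdeg (mpred l j) < m)%N.
    by rewrite -ltnS; apply: leq_trans lm; rewrite ltnS -{2}(mpredK lj) mdegD mdeg_mdelta addn1.
  have {h}h := IH k (mpred l j) h.
  rewrite E !exprD [leLHS](_ : _ = p ^+ below k j * p ^+ below l j *
    (p ^+ cross k (mpred l j) * (qmulti p k * qmulti p (mpred l j)))); last by ring.
  by rewrite ler_wpM2l// mulr_ge0// exprn_ge0// ltW.
rewrite big_mkcond [leRHS]big_mkcond; apply: ler_sum => j _; rewrite !ffunE.
case: posnP => lj; case: posnP => // klj.
- by rewrite mulr_ge0 ?exprn_ge0 ?(ltW p0)// ltW// qmulti_gt0.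
- by move/eqP: klj; rewrite addn_eq0 (gtn_eqF lj) andbF.
Qed.

(** At [0 < q < 1] the weight of [k] is, up to factors that grow slower than any exponential
    in [|k|], the operator norm of the ordered monomial with exponent [k]; at [q = 1] it is,
    up to a polynomial factor, the supremum of that monomial on the unit ball. Unlike either
    of these it is defined for all [q] by one continuous and submultiplicative formula. *)
Definition ball_wt (q : Cstar R) k : R := cabs (cstar_val q) ^+ cross k k *
  Num.sqrt (qmulti (cabs (cstar_val q) ^+ 2) k)^-1.

Lemma ball_wt_gt0 q k : 0 < ball_wt q k.
Proof.
have q0 := cabs_gt0 (cstar_neq0 q).
by rewrite mulr_gt0 ?exprn_gt0// sqrtr_gt0 invr_gt0 qmulti_gt0// exprn_gt0.
Qed.

(** Squared, and with the powers of [|q|] from both crossing numbers and from the twist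
    collected, this is [qmulti_supmul]. *)
Lemma ball_wt_submul q k l :
  cabs (twist q k l) * ball_wt q (k + l) <= ball_wt q k * ball_wt q l.
Proof.
rewrite /twist cabsV cabsX /ball_wt; set t := cabs (cstar_val q).
have t0 : 0 < t by exact/cabs_gt0/cstar_neq0.
have p0 : 0 < t ^+ 2 by rewrite exprn_gt0.
have g0 m : 0 < qmulti (t ^+ 2) m by exact: qmulti_gt0.
rewrite crossDl !crossDr !exprD.
have tn0 m : t ^+ m != 0 by rewrite gt_eqF// exprn_gt0.
rewrite [leLHS](_ : _ = t ^+ cross k k * t ^+ cross l l *
   (t ^+ cross k l * Num.sqrt (qmulti (t ^+ 2) (k + l))^-1)); last by field.
rewrite [leRHS](_ : _ = t ^+ cross k k * t ^+ cross l l *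
   (Num.sqrt (qmulti (t ^+ 2) k)^-1 * Num.sqrt (qmulti (t ^+ 2) l)^-1)); last by ring.
rewrite ler_wpM2l ?mulr_ge0 ?exprn_ge0 ?(ltW t0)//.
rewrite -[t ^+ cross k l]gtr0_norm ?exprn_gt0// -sqrtr_sqr.
rewrite -!sqrtrM ?sqr_ge0 ?invr_ge0 ?(ltW (g0 _))// ler_wsqrtr//.
rewrite -invfM ler_pdivrMr; last exact: g0.
rewrite [leRHS]mulrC ler_pdivlMr; last by apply: mulr_gt0; exact: g0.
rewrite -exprM mulnC exprM.
exact: qmulti_supmul.
Qed.

Lemma cvg_nprod (T : Type) (F : set_system T) (FF : Filter F) (I : Type)
    (s : seq I) (f : I -> T -> R) (l : I -> R) :
  (forall i, f i x @[x --> F] --> l i) ->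
  \prod_(i <- s) f i x @[x --> F] --> \prod_(i <- s) l i.
Proof.
move=> h; elim: s => [|i s IH].
  by under eq_fun do rewrite big_nil; rewrite big_nil; exact: cvg_cst.
by under eq_fun do rewrite big_cons; rewrite big_cons; apply: cvgM.
Qed.

Lemma qfact_continuous m : continuous (fun p : R => qfact p m).
Proof.
move=> p; apply: (@cvg_nprod _ (nbhs p) _ _ _ (fun i : 'I_m => fun p => qnum p i.+1)) => i.
apply: (@cvg_nsum R R^o _ (nbhs p) _ _ _ xpredT (fun j : 'I_i.+1 => fun p => p ^+ j)) => j.
exact: exp_continuous.
Qed.

Lemma ball_wt_continuous k : continuous (fun q : Cstar R => ball_wt q k).
Proof.
have hG (p : R) : 0 < p -> {for p, continuous (fun p : R => (qmulti p k)^-1)}.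
  move=> p0; apply: (@cvgV _ _ (nbhs p) _ (fun p => qmulti p k)).
    by rewrite gt_eqF// qmulti_gt0.
  apply: (@cvgM _ _ (nbhs p) _ (fun p => qfact p (mdeg k)) (fun p => (\prod_i qfact p (k i))^-1)).
    exact: qfact_continuous.
  apply: (@cvgV _ _ (nbhs p) _ (fun p => \prod_i qfact p (k i))).
    by apply/prodf_neq0 => i _; rewrite gt_eqF// qfact_gt0.
  apply: (@cvg_nprod _ (nbhs p) _ _ _ (fun i p => qfact p (k i))) => i.
  exact: qfact_continuous.
have h (t : R) : 0 < t -> {for t, continuous (fun t : R => t ^+ cross k k *
    Num.sqrt (qmulti (t ^+ 2) k)^-1)}.
  move=> t0; have p0 : 0 < t ^+ 2 by rewrite exprn_gt0.
  apply: (@cvgM _ _ (nbhs t) _ (fun t => t ^+ cross k k)); first exact: exp_continuous.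
  have h1 := @continuous_comp R R R (fun t => t ^+ 2) (fun p => (qmulti p k)^-1) t
    (@exp_continuous R 2 t) (hG _ p0).
  exact: (@continuous_comp R R R _ (@Num.sqrt R) t h1 (@sqrt_continuous R _)).
move=> q; apply: (@continuous_comp _ R R (fun q : Cstar R => cabs (cstar_val q)) _ _
   (@cabs_cstar_continuous R q) (h _ (cabs_gt0 (cstar_neq0 q)))).
Qed.

Definition ball_weight : weight R n := Weight ball_wt_gt0 ball_wt_continuous ball_wt_submul.

End QMultinomial.

(** * Algebras presented by generators and relations *)

Section Terms.
Variables (C : comNzRingType) (G : Type).

Inductive term := Gen of G | Cst of C | Add of term & term | Mul of term & term.

Fixpoint teval (B : algType C) (y : G -> B) (t : term) : B :=
  match t with
  | Gen g => y g
  | Cst c => c%:A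
  | Add s t => teval y s + teval y t
  | Mul s t => teval y s * teval y t
  end.

Definition sum_term (I : Type) (r : seq I) (F : I -> term) : term :=
  foldr (fun k t => Add (F k) t) (Cst 0) r.

Lemma teval_sum (B : algType C) (y : G -> B) (I : Type) (r : seq I) (F : I -> term) :
  teval y (sum_term r F) = \sum_(k <- r) teval y (F k).
Proof.
elim: r => [|k r IH] /=; first by rewrite big_nil scale0r.
by rewrite big_cons IH.
Qed.

(** The relations are given semantically, by the equalities of terms that they force: a
    congruence that contains the algebra axioms, in the form of [teqv_free], and does not
    collapse the quotient. *)
Record presentation := Presentation {
  teqv :> term -> term -> Prop;
  teqv_refl : forall t, teqv t t;
  teqv_sym : forall s t, teqv s t -> teqv t s;
  teqv_trans : forall s t v, teqv s t -> teqv t v -> teqv s v;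
  teqv_add : forall s t s' t', teqv s s' -> teqv t t' -> teqv (Add s t) (Add s' t');
  teqv_mul : forall s t s' t', teqv s s' -> teqv t t' -> teqv (Mul s t) (Mul s' t');
  teqv_free : forall s t, (forall (B : algType C) (y : G -> B), teval y s = teval y t) ->
    teqv s t;
  teqv_01 : ~ teqv (Cst 0) (Cst 1) }.

End Terms.
Arguments Gen {C G}. Arguments Cst {C G}.

Section PresentedAlgebra.
Variables (C : comNzRingType) (G : Type) (P : presentation C G).
Local Notation T := (term C G).
Implicit Types (s t : T).

Record presented := Presented {
  pcls : T -> Prop;
  pclsP : exists t, pcls = P t }.
Implicit Types (x y z : presented).

HB.instance Definition _ := gen_eqMixin presented.
HB.instance Definition _ := gen_choiceMixin presented.

Definition pproj t : presented := @Presented (P t) (ex_intro _ t erefl).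
Definition prep x : T := sval (cid (pclsP x)).

Lemma presented_ext x y : pcls x = pcls y -> x = y.
Proof.
case: x y => [X HX] [Y HY] /= e; subst Y; congr Presented; exact: Prop_irrelevance.
Qed.

Lemma proj_prep x : pproj (prep x) = x.
Proof. by apply: presented_ext; rewrite /= /prep; case: cid => t /= ->. Qed.

Lemma projE s t : pproj s = pproj t <-> P s t.
Proof.
split=> [/(congr1 pcls) /= ->|st]; first exact: teqv_refl.
apply: presented_ext => /=; apply/funext => v; apply/propext; split=> h.
  exact: teqv_trans (teqv_sym st) h.
exact: teqv_trans st h.
Qed.

Lemma prep_proj t : P (prep (pproj t)) t.
Proof. by apply/projE; rewrite proj_prep. Qed.

Lemma projW (Q : presented -> Prop) : (forall t, Q (pproj t)) -> forall x, Q x.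
Proof. by move=> h x; rewrite -(proj_prep x). Qed.

Definition padd x y := pproj (Add (prep x) (prep y)).
Definition pmul x y := pproj (Mul (prep x) (prep y)).
Definition pcst c := pproj (Cst c).

Lemma paddE s t : padd (pproj s) (pproj t) = pproj (Add s t).
Proof. by apply/projE/teqv_add; exact: prep_proj. Qed.
Lemma pmulE s t : pmul (pproj s) (pproj t) = pproj (Mul s t).
Proof. by apply/projE/teqv_mul; exact: prep_proj. Qed.

Local Ltac free := rewrite /pcst ?(paddE, pmulE); apply/projE/teqv_free; intros; rewrite /=.

Fact paddA : associative padd.
Proof. by elim/projW=> x; elim/projW=> y; elim/projW=> z; free; exact: addrA. Qed.
Fact paddC : commutative padd.
Proof. by elim/projW=> x; elim/projW=> y; free; exact: addrC. Qed.
Fact padd0 : left_id (pcst 0) padd.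
Proof. by elim/projW=> x; free; rewrite scale0r add0r. Qed.
Fact paddN : left_inverse (pcst 0) (pmul (pcst (-1))) padd.
Proof. by elim/projW=> x; free; rewrite scale0r scaleN1r mulN1r addNr. Qed.
HB.instance Definition _ := GRing.isZmodule.Build presented paddA paddC padd0 paddN.

Fact pmulA : associative pmul.
Proof. by elim/projW=> x; elim/projW=> y; elim/projW=> z; free; exact: mulrA. Qed.
Fact pmul1 : left_id (pcst 1) pmul.
Proof. by elim/projW=> x; free; rewrite scale1r mul1r. Qed.
Fact pmulr1 : right_id (pcst 1) pmul.
Proof. by elim/projW=> x; free; rewrite scale1r mulr1. Qed.
Fact pmulDl : left_distributive pmul padd.
Proof. by elim/projW=> x; elim/projW=> y; elim/projW=> z; free; exact: mulrDl. Qed.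
Fact pmulDr : right_distributive pmul padd.
Proof. by elim/projW=> x; elim/projW=> y; elim/projW=> z; free; exact: mulrDr. Qed.
Fact p1neq0 : pcst 1 != 0.
Proof. by apply/eqP => /esym/projE; exact: teqv_01. Qed.
HB.instance Definition _ := GRing.Zmodule_isNzRing.Build presented
  pmulA pmul1 pmulr1 pmulDl pmulDr p1neq0.

Definition pscale c x := pmul (pcst c) x.
Fact pscaleA (a b : C) x : pscale a (pscale b x) = pscale (a * b) x.
Proof.
rewrite /pscale; elim/projW: x => x; free.
by rewrite mulrA -scalerAl mul1r scalerA.
Qed.
Fact pscale1 : left_id 1 pscale.
Proof. exact: pmul1. Qed.
Fact pscaleDr : right_distributive pscale +%R.
Proof. by move=> a x y; exact: pmulDr. Qed.
Fact pscaleDl x : {morph pscale^~ x : a b / a + b}.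
Proof.
move=> a b; rewrite /pscale; elim/projW: x => x.
rewrite -[RHS]/(padd _ _); free; by rewrite scalerDl mulrDl.
Qed.
HB.instance Definition _ := GRing.Zmodule_isLmodule.Build C presented
  pscaleA pscale1 pscaleDr pscaleDl.

Fact pscaleAl (c : C) x y : c *: (x * y) = (c *: x) * y.
Proof. exact: pmulA. Qed.
Fact pscaleAr (c : C) x y : c *: (x * y) = x * (c *: y).
Proof.
elim/projW: x => x; elim/projW: y => y.
rewrite -[LHS]/(pmul _ (pmul _ _)) -[RHS]/(pmul _ (pmul _ _)); free.
by rewrite -!scalerAl -!scalerAr !mul1r.
Qed.
HB.instance Definition _ := GRing.Lmodule_isLalgebra.Build C presented pscaleAl.
HB.instance Definition _ := GRing.Lalgebra_isAlgebra.Build C presented pscaleAr.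

Definition pgen g : presented := pproj (Gen g).

Lemma projD s t : pproj (Add s t) = pproj s + pproj t. Proof. by rewrite -paddE. Qed.
Lemma projM s t : pproj (Mul s t) = pproj s * pproj t. Proof. by rewrite -pmulE. Qed.
Lemma projC (c : C) : pproj (Cst c) = c%:A.
Proof. by rewrite -[RHS]/(pmul _ _); free; rewrite scale1r mulr1. Qed.

Lemma teval_proj t : teval pgen t = pproj t.
Proof.
elim: t => [g|c|s IHs t IHt|s IHs t IHt] //=.
- by rewrite projC.
- by rewrite IHs IHt projD.
- by rewrite IHs IHt projM.
Qed.

Lemma presented_eq s t : P s t -> teval pgen s = teval pgen t.
Proof. by move=> st; rewrite !teval_proj; apply/projE. Qed.

Lemma lrmorph_teval (B : algType C) (f : {lrmorphism presented -> B}) t :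
  f (pproj t) = teval (fun g => f (pgen g)) t.
Proof.
elim: t => [g|c|s IHs t IHt|s IHs t IHt] //=.
- by rewrite projC linearZ rmorph1.
- by rewrite projD rmorphD /= IHs IHt.
- by rewrite projM rmorphM /= IHs IHt.
Qed.

(** The universal property of the quotient. *)
Lemma presented_lift (B : algType C) (y : G -> B) :
  (forall s t, P s t -> teval y s = teval y t) ->
  exists f : {lrmorphism presented -> B}, forall t, f (pproj t) = teval y t.
Proof.
move=> hy; pose f x := teval y (prep x).
have fE t : f (pproj t) = teval y t by apply: hy; exact: prep_proj.
have fD x z : f (x + z) = f x + f z.
  by elim/projW: x => x; elim/projW: z => z; rewrite -projD !fE.
have fM : {morph f : x z / x * z}.
  by move=> x z; elim/projW: x => x; elim/projW: z => z; rewrite -projM !fE.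
have fZ c : {morph f : x / c *: x}.
  move=> x; elim/projW: x => x; rewrite -mulr_algl -projC -projM !fE /=.
  by rewrite mulr_algl.
have [|||//|g gf] := @lrmorphism_exists _ presented B f.
- by move=> x z; rewrite -scaleN1r fD fZ scaleN1r.
- by rewrite -[1]scale1r -projC fE /= scale1r.
- exact: fM.
- by exists g => t; rewrite gf fE.
Qed.

End PresentedAlgebra.

Arguments pproj {C G P}. Arguments pgen {C G P}.

Section ModelPresentation.
Variables (C : comNzRingType) (G J : Type) (B : J -> algType C) (y : forall j, G -> B j).
Hypothesis J0 : J.

(** Terms are identified if every model identifies them. Over all models of some relations
    this is the congruence that the relations generate; one model suffices to see that it is
    not trivial. *)
Definition model_eqv (s t : term C G) : Prop := forall j, teval (y j) s = teval (y j) t.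

Lemma model_eqv_01 : ~ model_eqv (Cst 0) (Cst 1).
Proof.
by move=> /(_ J0) /=; rewrite scale0r scale1r => /esym/eqP; rewrite oner_eq0.
Qed.

Definition model_presentation : presentation C G.
Proof.
refine (@Presentation C G model_eqv _ _ _ _ _ _ model_eqv_01).
- by [].
- by move=> s t h j; rewrite h.
- by move=> s t v h k j; rewrite h.
- by move=> s t s' t' h k j /=; rewrite h k.
- by move=> s t s' t' h k j /=; rewrite h k.
- by move=> s t h j.
Defined.

End ModelPresentation.

Section Reg.
Variables (R : realType) (n : nat) (q : Cplx R).
Local Notation C := (Cplx R).

Definition reg_model := {B : algType C & {y : 'I_n -> B | reg_relations q y}}.

Lemma reg_model0 : reg_model.
Proof.
exists (C^o : algType C), (fun=> 0) => i j _.
by rewrite mul0r scaler0.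
Qed.

Definition reg_presentation : presentation C 'I_n :=
  model_presentation (fun J : reg_model => sval (projT2 J)) reg_model0.

Definition reg_alg : algType C := presented reg_presentation.

Lemma reg_alg_presents : presents_reg q (@pgen _ _ reg_presentation : 'I_n -> reg_alg).
Proof.
split.
  move=> i j ij; rewrite -mulr_algl.
  apply: (@presented_eq _ _ reg_presentation (Mul (Gen i) (Gen j))
    (Mul (Cst q) (Mul (Gen j) (Gen i)))) => -[B [y hy]] /=.
  by rewrite mulr_algl hy.
move=> B y hy; have [|f hf] := @presented_lift _ _ reg_presentation B y.
  by move=> s t h; exact: (h (existT _ B (exist _ y hy))).
exists f; split=> [i|g hg]; first by rewrite hf.
elim/projW => t; rewrite hf lrmorph_teval; congr teval; exact/funext.
Qed.

End Reg.

Lemma reg_relationsZ (R : realType) (n : nat) (q c : Cplx R) (B : algType (Cplx R))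
    (x : 'I_n -> B) : reg_relations q x -> reg_relations q (fun i => c *: x i).
Proof.
move=> h i j ij; rewrite -!scalerAl -!scalerAr h// !scalerA; congr (_ *: _); ring.
Qed.

Section StarAlgebraTheory.
Variables (R : realType) (A : starAlgebra R).
Local Notation C := (Cplx R).

Lemma starD (a b : A) : star (a + b) = star a + star b.
Proof. by have := star_linear 1 a b; rewrite scale1r conjC1 scale1r. Qed.
Lemma star0 : star (0 : A) = 0.
Proof. by apply: (@addrI _ (star 0)); rewrite -starD !addr0. Qed.
Lemma starZ (c : C) (a : A) : star (c *: a) = c^* *: star a.
Proof. by have := star_linear c a 0; rewrite star0 !addr0. Qed.
Lemma star1 : star (1 : A) = 1.
Proof. by rewrite -[LHS]mul1r -{1}(starK 1) -starM mul1r starK. Qed.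

End StarAlgebraTheory.

Section Pol.
Variables (R : realType) (n : nat) (q : R).
Local Notation C := (Cplx R).
Local Notation T := (term C ('I_n * bool)).

Definition pol_model := {B : starAlgebra R & {y : 'I_n -> B | pol_relations q y}}.
(** A generator and its adjoint are independent letters; the models interpret the second one
    by the star. *)
Definition star_gens (B : starAlgebra R) (y : 'I_n -> B) (g : 'I_n * bool) : B :=
  if g.2 then star (y g.1) else y g.1.

Hypothesis pol_model0 : pol_model.

Definition pol_presentation : presentation C ('I_n * bool)%type :=
  model_presentation (fun J : pol_model => star_gens (sval (projT2 J))) pol_model0.
Local Notation P := pol_presentation.

Fixpoint tstar (t : T) : T :=
  match t with
  | Gen g => Gen (g.1, ~~ g.2)
  | Cst c => Cst c^*
  | Add s t => Add (tstar s) (tstar t)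
  | Mul s t => Mul (tstar t) (tstar s)
  end.

Lemma teval_tstar (B : starAlgebra R) (y : 'I_n -> B) t :
  teval (star_gens y) (tstar t) = star (teval (star_gens y) t).
Proof.
elim: t => [[g b]|c|s IHs t IHt|s IHs t IHt] /=.
- by case: b; rewrite /star_gens /= ?starK.
- by rewrite starZ star1.
- by rewrite IHs IHt starD.
- by rewrite IHs IHt starM.
Qed.

Definition pstar (x : presented P) : presented P := pproj (tstar (prep x)).

Lemma pstarE t : pstar (pproj t) = pproj (tstar t).
Proof. by apply/projE => -[B [y hy]]; rewrite !teval_tstar; congr star; exact: (prep_proj P t (existT _ B (exist _ y hy))). Qed.

Fact pstar_linear (c : C) x y : pstar (c *: x + y) = c^* *: pstar x + pstar y.
Proof.
elim/projW: x => x; elim/projW: y => y.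
have -> : c *: pproj x + pproj y = pproj (Add (Mul (Cst c) x) y) :> presented P.
  by rewrite projD projM projC mulr_algl.
by rewrite !pstarE /= projD projM projC -scalerAr mulr1.
Qed.
Fact pstarM x y : pstar (x * y) = pstar y * pstar x.
Proof. by elim/projW: x => x; elim/projW: y => y; rewrite -projM !pstarE -projM. Qed.
Fact pstarK : involutive pstar.
Proof.
elim/projW=> x; rewrite !pstarE; apply/projE => J.
by rewrite !teval_tstar starK.
Qed.

Definition pol_alg : starAlgebra R := @StarAlgebra R (presented P) pstar pstar_linear pstarM pstarK.

Definition pol_alg_gen (i : 'I_n) : pol_alg := @pgen _ _ P (i, false).

Lemma pol_alg_starE (t : T) : star (pproj t : pol_alg) = pproj (tstar t).
Proof. exact: pstarE. Qed.

Lemma pol_alg_presents : presents_pol q pol_alg_gen.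
Proof.
have sg i : star (pol_alg_gen i) = (@pgen _ _ P (i, true) : pol_alg) by rewrite pol_alg_starE.
split.
  split.
  - move=> i j ij; rewrite -mulr_algl.
    apply: (@presented_eq _ _ P (Mul (Gen (i, false)) (Gen (j, false)))
      (Mul (Cst (realC q)) (Mul (Gen (j, false)) (Gen (i, false))))) => -[B [y [hy _ _]]] /=.
    by rewrite mulr_algl; exact: hy.
  - move=> i j ij; rewrite sg -mulr_algl.
    apply: (@presented_eq _ _ P (Mul (Gen (i, true)) (Gen (j, false)))
      (Mul (Cst (realC q)) (Mul (Gen (j, false)) (Gen (i, true))))) => -[B [y [_ hy _]]] /=.
    by rewrite mulr_algl; exact: hy.
  - move=> i; pose F k : T := Mul (Gen (k, false)) (Gen (k, true)).
    pose r := [seq k : 'I_n <- index_enum 'I_n | (i < k)%N].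
    have E : P (Mul (Gen (i, true)) (Gen (i, false)))
      (Add (Mul (Cst (realC (q ^+ 2))) (Mul (Gen (i, false)) (Gen (i, true))))
           (Mul (Cst (realC (1 - q ^+ 2))) (Add (Cst 1) (Mul (Cst (- 1)) (sum_term r F))))).
      move=> -[B [y hy]] /=; rewrite teval_sum !mulr_algl scale1r scaleN1r big_filter.
      by have [_ _ /(_ i)] := hy.
    have E' := presented_eq E.
    rewrite /= teval_sum !mulr_algl scale1r scaleN1r big_filter in E'.
    by rewrite sg; under [in RHS]eq_bigr do rewrite sg.
move=> B y hy; have [|f hf] := @presented_lift _ _ P B (star_gens y).
  by move=> s t h; exact: (h (existT _ B (exist _ y hy))).
exists f; split=> [u|i|g gs hg].
- elim/projW: u => u; rewrite pol_alg_starE !hf; exact: teval_tstar.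
- by rewrite hf.
- elim/projW => t; rewrite hf lrmorph_teval; congr teval; apply/funext => -[i []] /=.
    by rewrite /star_gens /= -hg -gs sg.
  exact: hg.
Qed.

End Pol.

(** * Square-summable families *)

Section CsumMore.
Variables (R : realType) (n : nat).
Local Notation C := (Cplx R).
Implicit Types (f g : multidx n -> C).

(** Absolutely summable families may be summed along any exhaustion, which allows to
    reindex. *)
Lemma csum_unconditional f (e : R) : tsummable (fun k => cabs (f k)) -> 0 < e ->
  exists N, forall s, uniq s -> {subset box n N <= s} -> cabs (\sum_(k <- s) f k - csum f) < e.
Proof.
move=> fs e0; have e2 : 0 < e / 2 by lra.
have [N1 h1] := box_tail (fun k => cabs_ge0 (f k)) fs e2.
have [N2 h2] := csum_near fs e2; set N := maxn N1 N2.
exists N => s us sN; rewrite -(subrKA (bsum f N)).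
apply: le_lt_trans (cabsD _ _) _; rewrite (splitr e) ltrD//; last by apply: h2; exact: leq_maxr.
apply: le_lt_trans (h1 N s (leq_maxl _ _) us); rewrite /bsum.
rewrite (bigID (mem (box n N)))/=.
have -> : \sum_(k <- s | k \in box n N) f k = \sum_(k <- box n N) f k.
  rewrite -[LHS]big_filter; apply: perm_big; apply: uniq_perm; rewrite ?filter_uniq ?box_uniq//.
  by move=> k; rewrite mem_filter; case: (boolP (k \in box n N)) => //= /sN ->.
rewrite addrAC subrr add0r; exact: cabs_sum.
Qed.

Lemma csum_reindex f (phi : multidx n -> multidx n) : injective phi ->
  tsummable (fun k => cabs (f k)) -> (forall m, (forall k, m <> phi k) -> f m = 0) ->
  csum f = csum (f \o phi).
Proof.
move=> iphi fs f0; apply/esym/cvg_lim; first exact: norm_hausdorff.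
apply/cvg_cabsP => e e0; have [N hN] := csum_unconditional fs e0.
have [K hK] : exists K, forall k, phi k \in box n N -> k \in box n K.
  pose inv m := xget 0 [set k | phi k = m].
  have invK k : inv (phi k) = k.
    by apply: iphi; exact: (@xgetPex _ 0 [set k' | phi k' = phi k] (ex_intro _ k erefl)).
  have [K hK] := box_exhaust [seq inv m | m <- box n N]; exists K => k kN.
  by apply: (hK K (leqnn _)); apply/mapP; exists (phi k).
exists K => M KM; set s := [seq phi k | k <- box n M].
have us : uniq s by rewrite map_inj_uniq ?box_uniq.
pose s' := s ++ [seq k <- box n N | k \notin s].
have us' : uniq s'.
  rewrite cat_uniq us filter_uniq ?box_uniq// andbT /=; apply/hasPn => k.
  by rewrite mem_filter => /andP[].
have := hN s' us'; rewrite /s' big_cat /= [X in _ + X - _]big1_seq ?addr0; last first.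
  move=> m; rewrite mem_filter => /andP[_ /andP[ms mN]]; apply: f0 => k mk.
  case/negP: ms; apply/mapP; exists k => //; apply: (box_sub KM); apply: hK.
  by rewrite -mk.
rewrite big_map; apply=> k kN; rewrite mem_cat mem_filter kN andbT.
exact: orbN.
Qed.

Lemma csum_conj f : tsummable (fun k => cabs (f k)) -> csum (fun k => (f k)^*) = (csum f)^*.
Proof.
move=> fs; apply: cvg_lim; first exact: norm_hausdorff.
apply/cvg_cabsP => e e0; have [N hN] := csum_near fs e0; exists N => M NM.
by rewrite /bsum -rmorph_sum -rmorphB cabs_conj; exact: hN.
Qed.

Lemma csum_realC (t : multidx n -> R) : (forall k, 0 <= t k) -> tsummable t ->
  csum (fun k => realC (t k)) = realC (tsum t).
Proof.
move=> t0 ts; apply: cvg_lim; first exact: norm_hausdorff.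
apply/cvg_cabsP => e e0; have [s [us hs]] := tsum_tail t0 ts e0.
have [N hN] := box_exhaust s; exists N => M NM.
rewrite /bsum -realC_sum -realCB cabs_realC distrC ger0_norm; last first.
  by rewrite subr_ge0 sum_le_tsum// box_uniq.
rewrite ltrBlDr -ltrBlDl; apply: lt_le_trans hs _.
rewrite -(subseq_sum t0 us (box_uniq _ M) (hN M NM)) lerDl; exact: sumr_ge0.
Qed.

End CsumMore.

Record l2 (R : realType) (n : nat) := L2 {
  l2f :> multidx n -> Cplx R;
  l2P : tsummable (fun k => cabs (l2f k) ^+ 2) }.

Section L2.
Variables (R : realType) (n : nat).
Local Notation C := (Cplx R).
Local Notation H := (l2 R n).
Implicit Types (a b : H).

Lemma l2_ext a b : l2f a =1 l2f b -> a = b.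
Proof.
by case: a b => [a ha] [b hb] /= /funext ab; subst b; congr L2; exact: Prop_irrelevance.
Qed.

Lemma sqr_cabs_ge0 (f : multidx n -> C) k : 0 <= cabs (f k) ^+ 2. Proof. exact: sqr_ge0. Qed.

(** The free parameter [s] is what lets the triangle inequality for [nrm] follow: it is
    optimised there. *)
Lemma cabsD_sqr (z w : C) (s : R) : 0 < s ->
  cabs (z + w) ^+ 2 <= (1 + s) * cabs z ^+ 2 + (1 + s^-1) * cabs w ^+ 2.
Proof.
move=> s0; have zw := cabsD z w; have h := cabs_ge0 (z + w).
have h1 := cabs_ge0 z; have h2 := cabs_ge0 w.
apply: (@le_trans _ _ ((cabs z + cabs w) ^+ 2)); first by rewrite lerXn2r// nnegrE addr_ge0.
rewrite -subr_ge0.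
have -> : (1 + s) * cabs z ^+ 2 + (1 + s^-1) * cabs w ^+ 2 - (cabs z + cabs w) ^+ 2 =
    s^-1 * (s * cabs z - cabs w) ^+ 2 by field; rewrite gt_eqF.
by rewrite mulr_ge0 ?sqr_ge0// invr_ge0 ltW.
Qed.

Lemma l2_addP (f g : multidx n -> C) (s : R) : 0 < s -> tsummable (fun k => cabs (f k) ^+ 2) ->
  tsummable (fun k => cabs (g k) ^+ 2) -> tsummable (fun k => cabs (f k + g k) ^+ 2) /\
  tsum (fun k => cabs (f k + g k) ^+ 2) <=
    (1 + s) * tsum (fun k => cabs (f k) ^+ 2) + (1 + s^-1) * tsum (fun k => cabs (g k) ^+ 2).
Proof.
move=> s0 fs gs.
have p1 : 0 <= 1 + s by lra.
have p2 : 0 <= 1 + s^-1 by rewrite addr_ge0// invr_ge0 ltW.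
have S1 := tsummableZ p1 (sqr_cabs_ge0 f) fs; have S2 := tsummableZ p2 (sqr_cabs_ge0 g) gs.
have t1 k : 0 <= (1 + s) * cabs (f k) ^+ 2 by rewrite mulr_ge0 ?sqr_ge0.
have t2 k : 0 <= (1 + s^-1) * cabs (g k) ^+ 2 by rewrite mulr_ge0 ?sqr_ge0.
have h k : 0 <= cabs (f k + g k) ^+ 2 <= (1 + s) * cabs (f k) ^+ 2 + (1 + s^-1) * cabs (g k) ^+ 2.
  by rewrite sqr_ge0 cabsD_sqr.
have S := tsummableD t1 t2 S1 S2.
split; first exact: tsummable_le h S.
apply: le_trans (le_tsum h S) _; apply: le_trans (tsumD_le t1 t2 S1 S2) _.
by rewrite lerD// tsumZ_le//; exact: sqr_cabs_ge0.
Qed.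

Lemma l2_0P : tsummable (fun k : multidx n => cabs (0 : C) ^+ 2).
Proof.
by apply: (@tsummable_finsupp _ _ _ [::]) => // k; rewrite ?sqr_ge0// cabs0 expr0n.
Qed.
Lemma l2_ZP (c : C) (f : multidx n -> C) : tsummable (fun k => cabs (f k) ^+ 2) ->
  tsummable (fun k => cabs (c * f k) ^+ 2).
Proof.
move=> fs; have := tsummableZ (sqr_ge0 (cabs c)) (sqr_cabs_ge0 f) fs; congr tsummable.
by apply/funext => k; rewrite cabsM exprMn.
Qed.

HB.instance Definition _ := gen_eqMixin H.
HB.instance Definition _ := gen_choiceMixin H.

Definition l2_zero : H := L2 l2_0P.
Definition l2_add a b : H := L2 (l2_addP ltr01 (l2P a) (l2P b)).1.
Definition l2_scale (c : C) a : H := L2 (l2_ZP c (l2P a)).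
Definition l2_opp a : H := l2_scale (-1) a.

Fact l2_addA : associative l2_add.
Proof. by move=> a b c; apply: l2_ext => k /=; rewrite addrA. Qed.
Fact l2_addC : commutative l2_add.
Proof. by move=> a b; apply: l2_ext => k /=; rewrite addrC. Qed.
Fact l2_add0 : left_id l2_zero l2_add.
Proof. by move=> a; apply: l2_ext => k /=; rewrite add0r. Qed.
Fact l2_addN : left_inverse l2_zero l2_opp l2_add.
Proof. by move=> a; apply: l2_ext => k /=; rewrite mulN1r addNr. Qed.
HB.instance Definition _ := GRing.isZmodule.Build H l2_addA l2_addC l2_add0 l2_addN.

Fact l2_scaleA (x y : C) a : l2_scale x (l2_scale y a) = l2_scale (x * y) a.
Proof. by apply: l2_ext => k /=; rewrite mulrA. Qed.
Fact l2_scale1 : left_id 1 l2_scale.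
Proof. by move=> a; apply: l2_ext => k /=; rewrite mul1r. Qed.
Fact l2_scaleDr : right_distributive l2_scale +%R.
Proof. by move=> x a b; apply: l2_ext => k /=; rewrite mulrDr. Qed.
Fact l2_scaleDl a : {morph l2_scale^~ a : x y / x + y}.
Proof. by move=> x y; apply: l2_ext => k /=; rewrite mulrDl. Qed.
HB.instance Definition _ := GRing.Zmodule_isLmodule.Build C H
  l2_scaleA l2_scale1 l2_scaleDr l2_scaleDl.

Definition nsq a : R := tsum (fun k => cabs (a k) ^+ 2).
Definition nrm a : R := Num.sqrt (nsq a).

Lemma nsq_ge0 a : 0 <= nsq a. Proof. by apply: tsum_ge0 => k; exact: sqr_ge0. Qed.
Lemma nrm_ge0 a : 0 <= nrm a. Proof. exact: sqrtr_ge0. Qed.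
Lemma sqr_nrm a : nrm a ^+ 2 = nsq a. Proof. by rewrite sqr_sqrtr// nsq_ge0. Qed.

Lemma cabs_le_nrm a k : cabs (a k) <= nrm a.
Proof.
rewrite -(@ler_sqr R) ?nnegrE ?cabs_ge0 ?nrm_ge0// sqr_nrm.
exact: (tsum_ge1 k (sqr_cabs_ge0 a) (l2P a)).
Qed.

Lemma nrm_eq0 a : nrm a = 0 -> a = 0.
Proof.
move=> a0; apply: l2_ext => k; apply/eqP; rewrite -cabs_eq0 eq_le -{1}a0 cabs_le_nrm.
exact: cabs_ge0.
Qed.

Lemma nrmZ (c : C) a : nrm (c *: a) = cabs c * nrm a.
Proof.
have E (d : C) (b : H) : nsq (d *: b) <= cabs d ^+ 2 * nsq b.
  rewrite /nsq (_ : (fun k => _) = (fun k => cabs d ^+ 2 * cabs (b k) ^+ 2)).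
    by apply: tsumZ_le; [exact: sqr_ge0|exact: sqr_cabs_ge0|exact: l2P].
  by apply/funext => k; rewrite /= cabsM exprMn.
have E' (d : C) (b : H) : nrm (d *: b) <= cabs d * nrm b.
  rewrite -(@ler_sqr R) ?nnegrE ?mulr_ge0 ?cabs_ge0 ?nrm_ge0// exprMn !sqr_nrm.
  exact: E.
apply/eqP; rewrite eq_le E' /=.
have [->|c0] := eqVneq c 0; first by rewrite cabs0 mul0r nrm_ge0.
have := E' c^-1 (c *: a); rewrite scalerA mulVf// scale1r cabsV.
by rewrite ler_pdivlMl ?cabs_gt0.
Qed.

Lemma nrmD a b : nrm (a + b) <= nrm a + nrm b.
Proof.
have [/eqP a0|a0] := eqVneq (nrm a) 0.
  by rewrite (nrm_eq0 (eqP a0)) add0r lerDr nrm_ge0.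
have [/eqP b0|b0] := eqVneq (nrm b) 0.
  by rewrite (nrm_eq0 (eqP b0)) addr0 lerDl nrm_ge0.
have A0 : 0 < nrm a by rewrite lt_neqAle eq_sym a0 nrm_ge0.
have B0 : 0 < nrm b by rewrite lt_neqAle eq_sym b0 nrm_ge0.
rewrite -(@ler_sqr R) ?nnegrE ?addr_ge0 ?nrm_ge0// sqr_nrm.
apply: le_trans (l2_addP (divr_gt0 B0 A0) (l2P a) (l2P b)).2 _.
rewrite -/(nsq a) -/(nsq b) -!sqr_nrm le_eqVlt; apply/orP; left; apply/eqP.
by field; rewrite a0 b0.
Qed.

Definition l2_norm a : C := realC (nrm a).
Fact l2_normD a b : l2_norm (a + b) <= l2_norm a + l2_norm b.
Proof. by rewrite /l2_norm -realCD realC_le nrmD. Qed.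
Fact l2_normZ (c : C) a : l2_norm (c *: a) = `|c| * l2_norm a.
Proof. by rewrite /l2_norm nrmZ realCM. Qed.
Fact l2_norm_eq0 a : l2_norm a = 0 -> a = 0.
Proof. by move=> /realC_inj; exact: nrm_eq0. Qed.

HB.instance Definition _ := Lmodule_isNormed.Build C H l2_normD l2_normZ l2_norm_eq0.

Lemma l2_normE a : `|a| = realC (nrm a). Proof. by []. Qed.

Fact l2_complete (F : set_system H) : ProperFilter F -> cauchy F -> cvg F.
Proof.
move=> FF /cauchy_ballP hF.
have hF' (e : R) : 0 < e -> exists2 S, F S & forall a b, S a -> S b -> nrm (a - b) < e.
  move=> e0; have [|[A B] /= [FA FB] AB] := hF (realC e).
    by rewrite -realC0 realC_lt.
  exists (A `&` B); first exact: filterI.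
  move=> a b [Aa _] [_ Bb]; have := AB (a, b) (conj Aa Bb).
  by rewrite -ball_normE /= l2_normE realC_lt.
have /choice[l hl] (k : multidx n) : exists l : C, forall d : R, 0 < d -> F [set b : H | cabs (b k - l) < d].
  have := @cauchy_cabs_cvg R ((fun b : H => b k) @ F) _.
  case=> [d d0|l hl]; last by exists l.
  have [S FS hS] := hF' d d0.
  have FS' : F ((fun b : H => b k) @^-1` ((fun b : H => b k) @` S)).
    by apply: filterS FS => b Sb; exists b.
  exists ((fun b : H => b k) @` S) => //.
  move=> _ _ [a Sa <-] [b Sb <-]; apply: le_lt_trans (hS a b Sa Sb).
  by have := cabs_le_nrm (a - b) k; rewrite /= mulN1r.
(* As for the weighted spaces, finite partial sums pass to the coordinatewise limit. *)
have key (e : R) : 0 < e -> exists2 S, F S & forall a, S a ->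
    forall s, uniq s -> \sum_(k <- s) cabs (a k - l k) ^+ 2 <= e ^+ 2.
  move=> e0; have [S FS hS] := hF' _ e0; exists S => // a Sa s us.
  have lcont : (fun b : H => \sum_(k <- s) cabs (a k - b k) ^+ 2) @ F --> \sum_(k <- s) cabs (a k - l k) ^+ 2.
    apply: (@cvg_nsum R R^o _ _ _ _ _ xpredT (fun k (b : H) => cabs (a k - b k) ^+ 2)) => k.
    apply: (@cvg_comp _ _ _ (fun b : H => a k - b k) (fun z : C => cabs z ^+ 2) F (nbhs (a k - l k))).
      move=> W /nbhs_cabsP[d d0 dW].
      suff h : F [set b : H | W (a k - b k)] by exact: h.
      apply: (filterS _ (hl k d d0)) => b /= bl; apply: dW.
      by rewrite (_ : a k - b k - _ = - (b k - l k)) ?cabsN //; ring.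
    apply: (@continuous_comp C R R (@cabs R) (fun t => t ^+ 2)); first exact: cabs_continuous.
    exact: exp_continuous.
  rewrite leNgt; apply/negP => h.
  have Fh : F [set b : H | e ^+ 2 < \sum_(k <- s) cabs (a k - b k) ^+ 2].
    exact: (cvgr_gt _ lcont).
  have FI : F (S `&` [set b : H | e ^+ 2 < \sum_(k <- s) cabs (a k - b k) ^+ 2]).
    exact: filterI.
  have [b [Sb]] := filter_ex FI; rewrite /=.
  apply/negP; rewrite -leNgt.
  have -> : \sum_(k <- s) cabs (a k - b k) ^+ 2 = \sum_(k <- s) cabs ((a - b : H) k) ^+ 2.
    by apply: eq_bigr => k _ /=; rewrite mulN1r.
  apply: le_trans (sum_le_tsum (sqr_cabs_ge0 (a - b : H)) (l2P (a - b)) us) _.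
  rewrite -/(nsq (a - b)) -sqr_nrm lerXn2r ?nnegrE ?nrm_ge0 ?(ltW e0)// ltW//.
  exact: hS.
have lP : tsummable (fun k => cabs (l k) ^+ 2).
  have [S FS hS] := key 1 ltr01; have [a Sa] := filter_ex FS.
  have h1 := tsummableW (hS a Sa).
  have h2 : tsummable (fun k => cabs (l k - a k) ^+ 2).
    by move: h1; congr tsummable; apply/funext => k; rewrite cabsB.
  have := (l2_addP ltr01 h2 (l2P a)).1; congr tsummable.
  by apply/funext => k; rewrite subrK.
apply/cvg_ex; exists (L2 lP) => W /nbhs_ballP[e e0 eW].
have eR : e = realC (complex.Re e).
  by move: e0; case: (e) => x y /=; rewrite lt_def/= => /andP[_ /andP[/eqP -> _]].
have r0 : 0 < complex.Re e by rewrite -realC_lt -eR.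
have r2 : 0 < complex.Re e / 2 by lra.
have [S FS hS] := key _ r2; apply: filterS FS => a Sa; apply: eW.
rewrite -ball_normE /= distrC l2_normE eR realC_lt; apply: (@le_lt_trans _ _ (complex.Re e / 2)); last lra.
rewrite -(@ler_sqr R) ?nnegrE ?nrm_ge0 ?(ltW r2)// sqr_nrm; apply: tsum_le => [k|s us].
  exact: sqr_ge0.
apply: le_trans (hS a Sa s us); rewrite le_eqVlt; apply/orP; left; apply/eqP.
by apply: eq_bigr => k _ /=; rewrite mulN1r.
Qed.

HB.instance Definition _ := Uniform_isComplete.Build H l2_complete.

(** * Inner product *)

Lemma l2_mul_summable a b : tsummable (fun k => cabs (a k * (b k)^*)).
Proof.
apply: (tsummable_le (t' := fun k => cabs (a k) ^+ 2 + cabs (b k) ^+ 2)); last first.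
  by apply: tsummableD; [exact: sqr_cabs_ge0|exact: sqr_cabs_ge0|exact: l2P|exact: l2P].
move=> k; rewrite cabs_ge0 /= cabsM cabs_conj.
have := sqr_ge0 (cabs (a k) - cabs (b k)); have := cabs_ge0 (a k); have := cabs_ge0 (b k).
nra.
Qed.

Definition l2_ip a b : C := csum (fun k => a k * (b k)^*).

Fact l2_ip_linear (c : C) a b d : l2_ip (c *: a + b) d = c * l2_ip a d + l2_ip b d.
Proof.
rewrite /l2_ip -csumZ; last exact: l2_mul_summable.
rewrite -csumD; last exact: l2_mul_summable.
  by congr csum; apply/funext => k /=; ring.
exact: (l2_mul_summable (c *: a) d) || (have := l2_mul_summable (c *: a) d; congr tsummable;
  by apply/funext => k /=; rewrite mulrA).
Qed.
Fact l2_ip_conj a b : l2_ip b a = (l2_ip a b)^*.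
Proof.
rewrite /l2_ip -csum_conj; last exact: l2_mul_summable.
by congr csum; apply/funext => k; rewrite rmorphM /= conjCK mulrC.
Qed.
Fact l2_ip_norm a : l2_ip a a = `|a| ^+ 2.
Proof.
rewrite l2_normE -realCX sqr_nrm /nsq -csum_realC; [|exact: sqr_cabs_ge0|exact: l2P].
by congr csum; apply/funext => k; rewrite mul_conj_cabs.
Qed.

Definition l2_hilbert : hilbertSpace R :=
  @HilbertSpace R H l2_ip l2_ip_linear l2_ip_conj l2_ip_norm.

Lemma l2_basis_subproof (m : multidx n) :
  tsummable (fun k => cabs ((k == m)%:R : C) ^+ 2).
Proof.
apply: (@tsummable_finsupp _ _ _ [:: m]) => // k; first exact: sqr_ge0.
by rewrite inE => /negbTE ->; rewrite cabs0 expr0n.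
Qed.
Definition l2_basis m : H := L2 (l2_basis_subproof m).

Lemma l2_fsum (I : Type) (s : seq I) (P : pred I) (f : I -> H) k :
  (\sum_(i <- s | P i) f i : H) k = \sum_(i <- s | P i) f i k.
Proof. by elim/big_rec2: _ => // i y1 y2 _ <-. Qed.

Lemma ip_basis a m : l2_ip a (l2_basis m) = a m.
Proof.
rewrite /l2_ip (@csum_finsupp _ _ _ [:: m]) ?big_seq1 /=; rewrite ?eqxx ?conjC1 ?mulr1//.
by move=> k; rewrite inE /= => /negbTE ->; rewrite conjC0 mulr0.
Qed.

Lemma l2_basisP : orthonormal_basis (l2_basis : _ -> l2_hilbert).
Proof.
split=> [i j|].
  by rewrite [LHS]ip_basis /= eq_sym.
move=> U [a Ua] oU; have /nbhs_ballP[e e0 eU] : nbhs a U by apply: open_nbhs_nbhs.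
have eR : e = realC (complex.Re e).
  by move: e0; case: (e) => x y /=; rewrite lt_def/= => /andP[_ /andP[/eqP -> _]].
have r0 : 0 < complex.Re e by rewrite -realC_lt -eR.
have r2 : 0 < (complex.Re e) ^+ 2 by rewrite exprn_gt0.
have r4 : 0 < (complex.Re e) ^+ 2 / 2 by lra.
have [N hN] := box_tail (sqr_cabs_ge0 a) (l2P a) r4.
exists (\sum_(m <- box n N) a m *: l2_basis m : H); split; last by exists (box n N), a.
apply: eU; rewrite -ball_normE /= l2_normE eR realC_lt -(@ltr_sqr R) ?nnegrE ?nrm_ge0 ?(ltW r0)// sqr_nrm.
apply: (@le_lt_trans _ _ ((complex.Re e) ^+ 2 / 2)); last lra.
apply: tsum_le => [k|s us]; first exact: sqr_ge0.
apply/ltW; apply: le_lt_trans (hN N s (leqnn _) us).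
rewrite [leRHS]big_mkcond; apply: ler_sum => k _ /=; rewrite mulN1r l2_fsum.
case: ifPn => kN.
  by rewrite big1_seq ?subr0// => m /= mN; case: eqP kN mN => [->|_ _ _]; [move/negP|rewrite mulr0].
rewrite (bigD1_seq k) ?box_uniq ?(negbNE kN)//= eqxx mulr1 big1 ?addr0 ?subrr ?cabs0 ?expr0n//.
by move=> m /negbTE; rewrite eq_sym => ->; rewrite mulr0.
Qed.

End L2.

(** * The algebra of adjointable operators *)

Section AdjointableOperators.
Variables (R : realType) (n : nat).
Local Notation C := (Cplx R).
Local Notation H := (l2 R n).

Definition l2_linear (T : H -> H) := forall (c : C) u v, T (c *: u + v) = c *: T u + T v.
Definition l2_bounded (T : H -> H) := exists2 M : R, 0 <= M & forall v, nrm (T v) <= M * nrm v.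
Definition adjoint_pair (T S : H -> H) :=
  [/\ l2_linear T, l2_linear S, l2_bounded T, l2_bounded S &
      forall u v, l2_ip (S u) v = l2_ip u (T v)].

(** An operator together with its adjoint: the star is the exchange of the two components. *)
Record adjop := AdjOp { aop : H -> H; aadj : H -> H; adjP : adjoint_pair aop aadj }.
Implicit Types (T S : adjop).

Lemma ip_linear_r (c : C) (u v w : H) : l2_ip u (c *: v + w) = c^* * l2_ip u v + l2_ip u w.
Proof. by rewrite -[LHS]conjCK -l2_ip_conj l2_ip_linear rmorphD rmorphM /= -!l2_ip_conj. Qed.

Lemma adjop_ext T S : aop T =1 aop S -> T = S.
Proof.
move=> TS; have TS' : aadj T =1 aadj S.
  move=> u; apply: l2_ext => k; rewrite -(ip_basis (aadj T u)) -(ip_basis (aadj S u)).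
  by have [_ _ _ _ ->] := adjP T; have [_ _ _ _ ->] := adjP S; rewrite TS.
case: T S TS TS' => [t t' ht] [s s' hs] /= /funext ts /funext ts'; subst s s'.
by congr AdjOp; exact: Prop_irrelevance.
Qed.

Lemma l2_linear0 (T : H -> H) : l2_linear T -> T 0 = 0.
Proof.
move=> hT; have := hT 1 0 0; rewrite !scale1r addr0 => h.
by apply: (@addrI _ (T 0)); rewrite addr0 -h.
Qed.
Lemma l2_linearD (T : H -> H) u v : l2_linear T -> T (u + v) = T u + T v.
Proof. by move=> hT; have := hT 1 u v; rewrite !scale1r. Qed.
Lemma l2_linearZ (T : H -> H) (c : C) u : l2_linear T -> T (c *: u) = c *: T u.
Proof. by move=> hT; have := hT c u 0; rewrite (l2_linear0 hT) !addr0. Qed.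

Lemma l2_linearB (T : H -> H) u v : l2_linear T -> T (u - v) = T u - T v.
Proof.
by move=> hT; rewrite -[- v]scaleN1r (l2_linearD _ _ hT) (l2_linearZ _ _ hT) scaleN1r.
Qed.

Lemma nrm0 : nrm (0 : H) = 0.
Proof. by rewrite -(scale0r (0 : H)) nrmZ cabs0 mul0r. Qed.

Lemma ip0l (v : H) : l2_ip 0 v = 0.
Proof. by have := l2_ip_linear (-1) 0 0 v; rewrite scaler0 addr0 mulN1r addNr. Qed.
Lemma ip0r (v : H) : l2_ip v 0 = 0.
Proof. by rewrite l2_ip_conj ip0l conjC0. Qed.

Fact adj_zero : adjoint_pair (fun=> 0) (fun=> 0).
Proof.
split=> [c u v|c u v|||u v]; rewrite ?scaler0 ?addr0//.
- by exists 0 => // v; rewrite nrm0 mul0r.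
- by exists 0 => // v; rewrite nrm0 mul0r.
- by rewrite ip0l ip0r.
Qed.
Fact adj_one : adjoint_pair idfun idfun.
Proof. by split=> //; exists 1 => // v; rewrite mul1r. Qed.
Fact adj_add T S : adjoint_pair (fun v => aop T v + aop S v) (fun v => aadj T v + aadj S v).
Proof.
have [t1 t2 [M M0 t3] [M' M0' t4] t5] := adjP T.
have [s1 s2 [N N0 s3] [N' N0' s4] s5] := adjP S.
split=> [c u v|c u v|||u v].
- by rewrite t1 s1 scalerDr addrACA.
- by rewrite t2 s2 scalerDr addrACA.
- exists (M + N) => [|v]; first exact: addr_ge0.
  by apply: le_trans (nrmD _ _) _; rewrite mulrDl lerD.
- exists (M' + N') => [|v]; first exact: addr_ge0.
  by apply: le_trans (nrmD _ _) _; rewrite mulrDl lerD.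
- have := l2_ip_linear 1 (aadj T u) (aadj S u) v; rewrite scale1r mul1r => ->.
  by have := ip_linear_r 1 u (aop T v) (aop S v); rewrite scale1r conjC1 mul1r => ->; rewrite t5 s5.
Qed.
Fact adj_scale (c : C) T : adjoint_pair (fun v => c *: aop T v) (fun v => c^* *: aadj T v).
Proof.
have [t1 t2 [M M0 t3] [M' M0' t4] t5] := adjP T.
split=> [d u v|d u v|||u v].
- by rewrite t1 scalerDr !scalerA mulrC.
- by rewrite t2 scalerDr !scalerA mulrC.
- exists (cabs c * M) => [|v]; first by rewrite mulr_ge0 ?cabs_ge0.
  by rewrite nrmZ -mulrA ler_wpM2l ?cabs_ge0.
- exists (cabs c * M') => [|v]; first by rewrite mulr_ge0 ?cabs_ge0.
  by rewrite nrmZ cabs_conj -mulrA ler_wpM2l ?cabs_ge0.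
- have := l2_ip_linear c^* (aadj T u) 0 v; rewrite addr0 ip0l addr0 => ->.
  by have := ip_linear_r c u (aop T v) 0; rewrite addr0 ip0r addr0 => ->; rewrite t5.
Qed.
Fact adj_mul T S : adjoint_pair (fun v => aop T (aop S v)) (fun v => aadj S (aadj T v)).
Proof.
have [t1 t2 [M M0 t3] [M' M0' t4] t5] := adjP T.
have [s1 s2 [N N0 s3] [N' N0' s4] s5] := adjP S.
split=> [c u v|c u v|||u v].
- by rewrite s1 t1.
- by rewrite t2 s2.
- exists (M * N) => [|v]; first exact: mulr_ge0.
  by apply: le_trans (t3 _) _; rewrite -mulrA ler_wpM2l.
- exists (N' * M') => [|v]; first exact: mulr_ge0.
  by apply: le_trans (s4 _) _; rewrite -mulrA ler_wpM2l.
- by rewrite s5 t5.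
Qed.
Fact adj_star T : adjoint_pair (aadj T) (aop T).
Proof.
have [t1 t2 t3 t4 t5] := adjP T; split=> // u v.
by rewrite l2_ip_conj -t5 -l2_ip_conj.
Qed.

HB.instance Definition _ := gen_eqMixin adjop.
HB.instance Definition _ := gen_choiceMixin adjop.

Definition adjop_zero := AdjOp adj_zero.
Definition adjop_one := AdjOp adj_one.
Definition adjop_add T S := AdjOp (adj_add T S).
Definition adjop_scale c T := AdjOp (adj_scale c T).
Definition adjop_mul T S := AdjOp (adj_mul T S).
Definition adjop_star T := AdjOp (adj_star T).
Definition adjop_opp T := adjop_scale (-1) T.

Fact adjop_addA : associative adjop_add.
Proof. by move=> a b c; apply: adjop_ext => v /=; rewrite addrA. Qed.
Fact adjop_addC : commutative adjop_add.
Proof. by move=> a b; apply: adjop_ext => v /=; rewrite addrC. Qed.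
Fact adjop_add0 : left_id adjop_zero adjop_add.
Proof. by move=> a; apply: adjop_ext => v /=; rewrite add0r. Qed.
Fact adjop_addN : left_inverse adjop_zero adjop_opp adjop_add.
Proof. by move=> a; apply: adjop_ext => v /=; rewrite scaleN1r addNr. Qed.
HB.instance Definition _ := GRing.isZmodule.Build adjop
  adjop_addA adjop_addC adjop_add0 adjop_addN.

Fact adjop_mulA : associative adjop_mul.
Proof. by move=> a b c; apply: adjop_ext. Qed.
Fact adjop_mul1 : left_id adjop_one adjop_mul.
Proof. by move=> a; apply: adjop_ext. Qed.
Fact adjop_mulr1 : right_id adjop_one adjop_mul.
Proof. by move=> a; apply: adjop_ext. Qed.
Fact adjop_mulDl : left_distributive adjop_mul +%R.
Proof. by move=> a b c; apply: adjop_ext. Qed.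
Fact adjop_mulDr : right_distributive adjop_mul +%R.
Proof.
move=> a b c; apply: adjop_ext => v /=; have [h _ _ _ _] := adjP a.
exact: l2_linearD.
Qed.
Fact adjop_1neq0 : adjop_one != 0.
Proof.
apply/eqP => /(congr1 (fun T => aop T (l2_basis R 0) 0)) /=.
by rewrite eqxx => /eqP; rewrite oner_eq0.
Qed.
HB.instance Definition _ := GRing.Zmodule_isNzRing.Build adjop
  adjop_mulA adjop_mul1 adjop_mulr1 adjop_mulDl adjop_mulDr adjop_1neq0.

Fact adjop_scaleA (x y : C) a : adjop_scale x (adjop_scale y a) = adjop_scale (x * y) a.
Proof. by apply: adjop_ext => v /=; rewrite scalerA. Qed.
Fact adjop_scale1 : left_id 1 adjop_scale.
Proof. by move=> a; apply: adjop_ext => v /=; rewrite scale1r. Qed.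
Fact adjop_scaleDr : right_distributive adjop_scale +%R.
Proof. by move=> x a b; apply: adjop_ext => v /=; rewrite scalerDr. Qed.
Fact adjop_scaleDl a : {morph adjop_scale^~ a : x y / x + y}.
Proof. by move=> x y; apply: adjop_ext => v /=; rewrite scalerDl. Qed.
HB.instance Definition _ := GRing.Zmodule_isLmodule.Build C adjop
  adjop_scaleA adjop_scale1 adjop_scaleDr adjop_scaleDl.
Fact adjop_scaleAl (x : C) (a b : adjop) : x *: (a * b) = (x *: a) * b.
Proof. exact: adjop_ext. Qed.
Fact adjop_scaleAr (x : C) (a b : adjop) : x *: (a * b) = a * (x *: b).
Proof.
apply: adjop_ext => v /=; have [h _ _ _ _] := adjP a.
by rewrite (l2_linearZ _ _ h).
Qed.
HB.instance Definition _ := GRing.Lmodule_isLalgebra.Build C adjop adjop_scaleAl.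
HB.instance Definition _ := GRing.Lalgebra_isAlgebra.Build C adjop adjop_scaleAr.

Fact adjop_star_linear (c : C) (a b : adjop) :
  adjop_star (c *: a + b) = c^* *: adjop_star a + adjop_star b.
Proof. exact: adjop_ext. Qed.
Fact adjop_starM (a b : adjop) : adjop_star (a * b) = adjop_star b * adjop_star a.
Proof. exact: adjop_ext. Qed.
Fact adjop_starK : involutive adjop_star.
Proof. by move=> a; apply: adjop_ext. Qed.

Definition adjop_alg : starAlgebra R :=
  @StarAlgebra R adjop adjop_star adjop_star_linear adjop_starM adjop_starK.

Lemma aop_continuous T : continuous (aop T : l2_hilbert R n -> l2_hilbert R n).
Proof.
have [t1 _ [M M0 t3] _ _] := adjP T.
move=> v W /nbhs_ballP[e e0 eW].
have eR : e = realC (complex.Re e).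
  by move: e0; case: (e) => x y /=; rewrite lt_def/= => /andP[_ /andP[/eqP -> _]].
have r0 : 0 < complex.Re e by rewrite -realC_lt -eR.
have M1 : 0 < M + 1 by lra.
apply/nbhs_ballP; exists (realC (complex.Re e / (M + 1))).
  by rewrite /= -realC0 realC_lt divr_gt0.
move=> w; rewrite -ball_normE /= l2_normE realC_lt ltr_pdivlMr// => vw; apply: eW.
rewrite -ball_normE /= l2_normE eR realC_lt.
have -> : aop T v - aop T w = aop T (v - w).
  by rewrite (l2_linearB _ _ t1).
apply: le_lt_trans (t3 _) _; apply: le_lt_trans vw.
by rewrite mulrC ler_wpM2l ?nrm_ge0//; lra.
Qed.

End AdjointableOperators.

(** * The Fock representation *)

Section Fock.
Variables (R : realType) (n : nat) (q : R).
Hypothesis q01 : 0 < q < 1.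
Local Notation C := (Cplx R).
Local Notation H := (l2 R n).
Implicit Types (k m : multidx n) (i j : 'I_n).

Definition above k j : nat := (\sum_(i < n | (j < i)%N) k i)%N.
Definition shift_coef j k : R := Num.sqrt (1 - q ^+ 2) * Num.sqrt (qint q (k j).+1) * q ^+ above k j.

Let q0 : 0 < q. Proof. by case/andP: q01. Qed.
Let q1 : q < 1. Proof. by case/andP: q01. Qed.

Lemma qint_qnum (m : nat) : qint q m = qnum (q ^+ 2) m.
Proof. by rewrite /qint /qnum; apply: eq_bigr => i _; rewrite exprM. Qed.

Lemma qint_geom (m : nat) : (1 - q ^+ 2) * qint q m = 1 - (q ^+ 2) ^+ m.
Proof. by rewrite qint_qnum -opprB mulNr -subrX1 opprB. Qed.

Lemma sqr_lt1 : q ^+ 2 < 1. Proof. by rewrite expr_lt1// ltW. Qed.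

Lemma qint_ge0 (m : nat) : 0 <= qint q m.
Proof. by rewrite sumr_ge0// => i _; rewrite exprn_ge0// ltW. Qed.

Lemma shift_coef_ge0 j k : 0 <= shift_coef j k.
Proof. by rewrite !mulr_ge0 ?sqrtr_ge0// exprn_ge0// ltW. Qed.

Lemma shift_coef_sqr j k :
  shift_coef j k ^+ 2 = (1 - (q ^+ 2) ^+ (k j).+1) * (q ^+ 2) ^+ above k j.
Proof.
have p1 := sqr_lt1.
rewrite /shift_coef exprMn [X in X * _ = _]exprMn !sqr_sqrtr ?qint_ge0//; last by lra.
by rewrite qint_geom -[(q ^+ above k j) ^+ 2]exprM mulnC exprM.
Qed.

Lemma shift_coef_le j k : shift_coef j k <= q ^+ above k j.
Proof.
rewrite -(@ler_sqr R) ?nnegrE ?shift_coef_ge0 ?exprn_ge0 ?(ltW q0)//.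
rewrite shift_coef_sqr -!exprM [(above k j * 2)%N]mulnC ler_piMl//.
  by rewrite exprn_ge0// ltW.
by rewrite gerBl exprn_ge0// ltW.
Qed.

Lemma shift_coef_le1 j k : shift_coef j k <= 1.
Proof. by apply: le_trans (shift_coef_le j k) _; rewrite exprn_ile1// ltW. Qed.

Lemma above_mdelta k i j : above (k + mdelta i) j = (above k j + (j < i)%N)%N.
Proof.
rewrite /above (eq_bigr (fun l : 'I_n => k l + (mdelta i : multidx n) l)%N); last first.
  by move=> l _; rewrite ffunE.
rewrite big_split /=; congr (_ + _)%N.
case: ltnP => ji.
  rewrite (bigD1 i)//= big1 ?addn0; first by rewrite ffunE eqxx.
  by move=> l /andP[_ /negbTE li]; rewrite ffunE eq_sym li.
by rewrite big1// => l jl; rewrite ffunE; case: eqP => // il; rewrite il leqNgt jl in ji.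
Qed.

Lemma shift_coef_mdelta i j k : i != j ->
  shift_coef j (k + mdelta i) = shift_coef j k * q ^+ (j < i)%N.
Proof.
move=> ij; rewrite /shift_coef above_mdelta exprD mulrA; congr (_ * _ * _ * _).
congr (Num.sqrt (qint q _.+1)); rewrite !ffunE (negbTE ij); exact: addn0.
Qed.

(** Weighted shifts are bounded by their weights, because they move the coordinates
    injectively. *)
Lemma shift_bound (f g : multidx n -> C) (h : multidx n -> multidx n) (P : pred (multidx n)) (c : R) :
  0 <= c -> tsummable (fun k => cabs (g k) ^+ 2) -> {in P &, injective h} ->
  (forall m, P m -> cabs (f m) <= c * cabs (g (h m))) -> (forall m, ~~ P m -> f m = 0) ->
  tsummable (fun k => cabs (f k) ^+ 2) /\ tsum (fun k => cabs (f k) ^+ 2) <= c ^+ 2 * tsum (fun k => cabs (g k) ^+ 2).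
Proof.
move=> c0 gs hP hf f0.
have key s : uniq s ->
    \sum_(k <- s) cabs (f k) ^+ 2 <= c ^+ 2 * tsum (fun k => cabs (g k) ^+ 2).
  move=> us; rewrite (bigID P)/= [X in _ + X]big1 ?addr0; last first.
    by move=> m /f0 ->; rewrite cabs0 expr0n.
  apply: (@le_trans _ _ (c ^+ 2 * \sum_(k <- [seq h m | m <- s & P m]) cabs (g k) ^+ 2)).
    rewrite big_map big_filter mulr_sumr; apply: ler_sum => m Pm.
    by rewrite -exprMn lerXn2r ?nnegrE ?mulr_ge0 ?cabs_ge0 ?hf.
  rewrite ler_wpM2l ?sqr_ge0// sum_le_tsum//; first exact: sqr_cabs_ge0.
  rewrite map_inj_in_uniq ?filter_uniq// => x y; rewrite !mem_filter => /andP[Px _] /andP[Py _].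
  exact: hP.
split; first exact: tsummableW key.
by apply: tsum_le => // k; exact: sqr_ge0.
Qed.

Definition raise_fun j (a : multidx n -> C) m : C :=
  if (0 < m j)%N then realC (shift_coef j (mpred m j)) * a (mpred m j) else 0.
Definition lower_fun j (a : multidx n -> C) m : C :=
  realC (shift_coef j m) * a (m + mdelta j).

Lemma mpred_inj j : {in [pred m : multidx n | (0 < m j)%N] &, injective (fun m => mpred m j)}.
Proof. by move=> x y /= hx hy e; rewrite -(mpredK hx) e mpredK. Qed.

Lemma mpred_mdelta k j : mpred (k + mdelta j) j = k.
Proof. by apply/ffunP => i; rewrite !ffunE [i == j]eq_sym; exact: addnK. Qed.

Lemma add_mdelta_inj j : injective (fun k : multidx n => k + mdelta j).
Proof. by move=> x y /= e; rewrite -(mpred_mdelta x j) e mpred_mdelta. Qed.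

Lemma raise_bound j (a : multidx n -> C) (c : R) : 0 <= c ->
  tsummable (fun k => cabs (a k) ^+ 2) ->
  (forall k, a k != 0 -> shift_coef j k <= c) ->
  tsummable (fun k => cabs (raise_fun j a k) ^+ 2) /\ tsum (fun k => cabs (raise_fun j a k) ^+ 2) <= c ^+ 2 * tsum (fun k => cabs (a k) ^+ 2).
Proof.
move=> c0 as_ hc; apply: (shift_bound c0 as_ (@mpred_inj j)) => m /=.
  rewrite /raise_fun => -> ; rewrite cabsM cabs_realC ger0_norm ?shift_coef_ge0//.
  have [->|a0] := eqVneq (a (mpred m j)) 0; first by rewrite cabs0 !mulr0.
  by rewrite ler_wpM2r ?cabs_ge0// hc.
by rewrite /raise_fun => /negbTE ->.
Qed.

Lemma lower_bound j (a : multidx n -> C) : tsummable (fun k => cabs (a k) ^+ 2) ->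
  tsummable (fun k => cabs (lower_fun j a k) ^+ 2) /\ tsum (fun k => cabs (lower_fun j a k) ^+ 2) <= 1 ^+ 2 * tsum (fun k => cabs (a k) ^+ 2).
Proof.
move=> as_; apply: (@shift_bound _ _ (fun m => m + mdelta j) predT) => // [x y _ _|m _].
  exact: add_mdelta_inj.
by rewrite cabsM cabs_realC ger0_norm ?shift_coef_ge0// ler_wpM2r ?cabs_ge0// shift_coef_le1.
Qed.

Definition raise j (a : H) : H :=
  L2 (raise_bound ler01 (l2P a) (fun k _ => shift_coef_le1 j k)).1.
Definition lower j (a : H) : H := L2 (lower_bound j (l2P a)).1.

Lemma nrm_raise j (a : H) (c : R) : 0 <= c -> (forall k, a k != 0 -> shift_coef j k <= c) ->
  nrm (raise j a) <= c * nrm a.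
Proof.
move=> c0 hc; rewrite -(@ler_sqr R) ?nnegrE ?mulr_ge0 ?nrm_ge0// exprMn !sqr_nrm.
exact: (raise_bound c0 (l2P a) hc).2.
Qed.

Lemma raise_mdelta j (a : multidx n -> C) k :
  raise_fun j a (k + mdelta j) = realC (shift_coef j k) * a k.
Proof.
by rewrite /raise_fun mpred_mdelta !ffunE eqxx -[(_ + _)%R]/(k j + 1)%N addn1.
Qed.

Lemma raise_out j (a : multidx n -> C) m : (forall k, m <> k + mdelta j) -> raise_fun j a m = 0.
Proof.
move=> hm; rewrite /raise_fun; case: ltnP => // mj.
by case: (hm (mpred m j)); rewrite mpredK.
Qed.

Lemma raise_adjoint j : adjoint_pair (raise j) (lower j).
Proof.
split.
- move=> c u v; apply: l2_ext => m; rewrite /= /raise_fun; case: ifP => _ /=.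
    by rewrite mulrDr mulrCA.
  by rewrite mulr0 addr0.
- by move=> c u v; apply: l2_ext => m; rewrite /= /lower_fun /= mulrDr mulrCA.
- exists 1 => // v; apply: nrm_raise => // k _; exact: shift_coef_le1.
- exists 1 => // v; rewrite -(@ler_sqr R) ?nnegrE ?mulr_ge0 ?nrm_ge0// exprMn !sqr_nrm.
  exact: (lower_bound j (l2P v)).2.
- move=> u v; rewrite /l2_ip [RHS](@csum_reindex _ _ _ (fun k => k + mdelta j)).
  + congr csum; apply/funext => k /=; rewrite raise_mdelta rmorphM /= realC_conj /lower_fun.
    by ring.
  + exact: add_mdelta_inj.
  + exact: l2_mul_summable.
  + by move=> m hm /=; rewrite raise_out// conjC0 mulr0.
Qed.

Definition fock_gen j : adjop_alg R n := AdjOp (raise_adjoint j).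

Lemma raise_raise i j (a : multidx n -> C) k :
  raise_fun i (raise_fun j a) (k + mdelta j + mdelta i) =
  realC (shift_coef i (k + mdelta j)) * (realC (shift_coef j k) * a k).
Proof. by rewrite !raise_mdelta. Qed.

Lemma mdelta_split m i j : i != j -> (0 < m i)%N -> (0 < m j)%N ->
  exists k, m = k + mdelta j + mdelta i.
Proof.
move=> ij mi mj; exists (mpred (mpred m i) j); rewrite mpredK ?mpredK//.
by rewrite ffunE [j == i]eq_sym (negbTE ij) subn0.
Qed.

Lemma number_op j (a : multidx n -> C) m : raise_fun j (lower_fun j a) m =
  realC ((1 - (q ^+ 2) ^+ m j) * (q ^+ 2) ^+ above m j) * a m.
Proof.
have [mj|mj] := posnP (m j); first by rewrite /raise_fun mj expr0 subrr mul0r mul0r.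
rewrite -(mpredK mj) raise_mdelta /lower_fun mulrA -realCM -expr2 shift_coef_sqr.
rewrite above_mdelta ltnn addn0; congr (realC ((1 - _ ^+ _) * _) * _).
by rewrite [RHS]ffunE [X in _ = _ + X]ffunE eqxx; exact: esym (addn1 _).
Qed.

(** In the relation for [star z_i * z_i], the sum over [k > i] of the diagonal operators
    [z_k * star z_k]. *)
Lemma above_telescope (p : R) m i :
  \sum_(l < n | (i < l)%N) (1 - p ^+ m l) * p ^+ above m l = 1 - p ^+ above m i.
Proof.
pose K l := oapp m 0%N (insub l : option 'I_n).
have KE (l : 'I_n) : K l = m l by rewrite /K valK.
have aboveE (j : 'I_n) : above m j = (\sum_(j.+1 <= l < n) K l)%N.
  by rewrite big_geq_mkord /above; apply: eq_big => // l _; rewrite KE.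
have key N : (i < N)%N -> \sum_(i.+1 <= l < N) (1 - p ^+ K l) * p ^+ (\sum_(l.+1 <= h < N) K h)%N =
    1 - p ^+ (\sum_(i.+1 <= h < N) K h)%N.
  elim: N => // N IH; rewrite ltnS leq_eqVlt => /orP[/eqP <-|iN].
    by rewrite !big_geq// expr0 subrr.
  rewrite big_nat_recr//= [X in _ * p ^+ X]big_geq// expr0 mulr1.
  rewrite big_nat_recr//= exprD.
  under eq_big_nat => l /andP[_ lN] do rewrite big_nat_recr//= exprD mulrA.
  by rewrite -mulr_suml IH//; ring.
rewrite aboveE -key ?ltn_ord// big_geq_mkord; apply: eq_big => // l _.
by rewrite KE aboveE.
Qed.

Lemma aop_sum (I : Type) (s : seq I) (P : pred I) (T : I -> adjop R n) (v : H) :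
  aop (\sum_(i <- s | P i) T i) v = \sum_(i <- s | P i) aop (T i) v.
Proof. by elim/big_rec2: _ => // i y1 y2 _ <-. Qed.

(** All sides are weighted shifts, so the relations are compared coefficient by coefficient. *)
Lemma fock_relations : pol_relations q fock_gen.
Proof.
split.
- move=> i j ij; apply: adjop_ext => v; apply: l2_ext => m /=.
  have ij' : i != j by rewrite neq_ltn ij.
  have [mi|mi] := posnP (m i).
    rewrite [LHS]/raise_fun mi /= /raise_fun; case: ifP => _; rewrite ?mulr0//.
    by rewrite ffunE (negbTE ij') mi sub0n !mulr0.
  have [mj|mj] := posnP (m j).
    rewrite [X in _ * X]/raise_fun mj mulr0 /= /raise_fun mi ffunE [j == i]eq_sym (negbTE ij').
    by rewrite mj sub0n mulr0.
  have [k ->] := mdelta_split ij' mi mj.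
  rewrite raise_raise addrAC raise_raise shift_coef_mdelta 1?eq_sym//.
  rewrite (shift_coef_mdelta _ ij') ij ltnNge (ltnW ij) /= expr1 expr0 mulr1 realCM; ring.
- move=> i j ij; apply: adjop_ext => v; apply: l2_ext => m /=; rewrite /lower_fun.
  have [mj|mj] := posnP (m j).
    rewrite /raise_fun !ffunE mj (negbTE ij) /= !mulr0//.
  rewrite -(mpredK mj); set k := mpred m j.
  rewrite addrAC !raise_mdelta !shift_coef_mdelta// 1?eq_sym//.
  have [lij|lji|/val_inj e] := ltngtP i j; last by rewrite e eqxx in ij.
    by rewrite /= expr1 expr0 mulr1 !realCM; ring.
  by rewrite /= expr1 expr0 mulr1 !realCM; ring.
- move=> i; apply: adjop_ext => v; apply: l2_ext => m.
  rewrite /= aop_sum /= l2_fsum mulN1r /=.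
  rewrite (eq_bigr _ (fun l _ => number_op l v m)) number_op.
  rewrite -mulr_suml -realC_sum above_telescope /lower_fun raise_mdelta mulrA -realCM -expr2.
  by rewrite shift_coef_sqr exprS !(realCB, realCM, realC1); ring.
Qed.

(** The Fock representation is also what shows that the presented *-algebra is not zero. *)
Definition fock_model : pol_model n q :=
  existT _ (adjop_alg R n) (exist _ fock_gen fock_relations).

Definition fock_pol : starAlgebra R := pol_alg fock_model.
Definition fock_pol_gen : 'I_n -> fock_pol := @pol_alg_gen R n q fock_model.

Lemma fock_rep_exists : exists f : {lrmorphism fock_pol -> adjop_alg R n},
  (forall u, f (star u) = star (f u)) /\ forall i, f (fock_pol_gen i) = fock_gen i.
Proof.
have [_ /(_ _ _ fock_relations)[f [fs fg _]]] := pol_alg_presents fock_model.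
by exists f.
Qed.

Definition fock_mor := sval (cid fock_rep_exists).
Definition fock_rep (a : fock_pol) : l2_hilbert R n -> l2_hilbert R n := aop (fock_mor a).

Lemma fock_mor_star u : fock_mor (star u) = star (fock_mor u).
Proof. by rewrite /fock_mor; case: cid => f [fs fg]. Qed.
Lemma fock_mor_gen i : fock_mor (fock_pol_gen i) = fock_gen i.
Proof. by rewrite /fock_mor; case: cid => f [fs fg]. Qed.

Lemma fock_repP : star_representation fock_rep.
Proof.
rewrite /fock_rep; split.
- move=> a; split; last exact: aop_continuous.
  by have [h _ _ _ _] := adjP (fock_mor a).
- by move=> c a b v; rewrite linearP.
- by move=> v; rewrite rmorph1.
- by move=> a b v; rewrite rmorphM.
- move=> a u v; rewrite fock_mor_star.
  by have [_ _ _ _ h] := adjP (fock_mor a); exact: h.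
Qed.

Lemma raise_basis j k : raise j (l2_basis R k) = realC (shift_coef j k) *: l2_basis R (k + mdelta j).
Proof.
apply: l2_ext => m /=; rewrite /raise_fun.
have [mj|mj] := posnP (m j).
  case: eqP => [e|_]; last by rewrite mulr0.
  move: mj; rewrite e !ffunE eqxx => /eqP; rewrite -[(_ + _)%R]/(k j + 1)%N addn1//.
rewrite -{3}(mpredK mj).
have [->|mk] := eqVneq (mpred m j) k; first by rewrite eqxx.
rewrite mulr0; case: eqP => [/add_mdelta_inj e|_]; last by rewrite mulr0.
by rewrite e eqxx in mk.
Qed.

Lemma fock_rep_gen j k : fock_rep (fock_pol_gen j) (l2_basis R k) =
  realC (shift_coef j k) *: l2_basis R (k + mdelta j).
Proof. by rewrite /fock_rep fock_mor_gen; exact: raise_basis. Qed.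

(** * The model of the quantum ball *)

Definition fock_reg : algType C := reg_alg n (realC q).
Definition fock_reg_gen : 'I_n -> fock_reg := @pgen _ _ (reg_presentation n (realC q)).

Lemma fock_reg_pol_exists : exists f : {lrmorphism fock_reg -> fock_pol},
  forall i, f (fock_reg_gen i) = fock_pol_gen i.
Proof.
have [[h _ _] _] := pol_alg_presents fock_model.
have [_ /(_ _ _ h)[f [fg _]]] := reg_alg_presents n (realC q).
by exists f.
Qed.
Definition fock_reg_pol := sval (cid fock_reg_pol_exists).

Lemma fock_dilation_exists (s : R) : exists f : {lrmorphism fock_reg -> fock_reg},
  forall i, f (fock_reg_gen i) = realC s *: fock_reg_gen i.
Proof.
have [h u] := reg_alg_presents n (realC q).
by have [f [fg _]] := u fock_reg _ (reg_relationsZ (realC s) h); exists f.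
Qed.
Definition fock_dilation s := sval (cid (fock_dilation_exists s)).

Lemma fock_reg_pol_gen i : fock_reg_pol (fock_reg_gen i) = fock_pol_gen i.
Proof. by rewrite /fock_reg_pol; case: cid. Qed.
Lemma fock_dilation_gen s i : fock_dilation s (fock_reg_gen i) = realC s *: fock_reg_gen i.
Proof. by rewrite /fock_dilation; case: cid. Qed.

Definition fock_qball : qballModel n q.
Proof.
refine (@QballModel R n q fock_reg fock_reg_gen (reg_alg_presents n (realC q))
  fock_pol fock_pol_gen (pol_alg_presents fock_model) fock_reg_pol fock_reg_pol_gen
  (l2_hilbert R n) (@l2_basis R n) (@l2_basisP R n) fock_rep fock_repP fock_rep_gen
  fock_dilation _).
by move=> s _ i; exact: fock_dilation_gen.
Defined.

End Fock.

(** * Ordered monomials *)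

Section OrderedMonomials.
Variables (R : realType) (n : nat) (q : Cplx R) (B : algType (Cplx R)) (x : 'I_n -> B).
Hypothesis q0 : q != 0.
Hypothesis hx : reg_relations q x.

Definition xmon (k : multidx n) : B := \prod_(i < n) x i ^+ k i.

Lemma xmon0 : xmon 0 = 1.
Proof. by rewrite /xmon big1// => i _; rewrite ffunE expr0. Qed.

Let X (i : nat) : B := oapp x 1 (insub i).
Let XE (i : 'I_n) : X i = x i. Proof. by rewrite /X valK. Qed.

Let comm_exp (i j : nat) e : (i < j < n)%N -> X j * X i ^+ e = q ^- e *: (X i ^+ e * X j).
Proof.
move=> /andP[ij jn]; elim: e => [|e IH]; first by rewrite !expr0 invr1 scale1r mulr1 mul1r.
have h : X j * X i = q^-1 *: (X i * X j).
  have := hx (ij : (Ordinal (ltn_trans ij jn) < Ordinal jn)%N).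
  by rewrite -!XE /= => ->; rewrite scalerA mulVf// scale1r.
rewrite exprSr mulrA IH -scalerAl -[X i ^+ e * X j * X i]mulrA h -scalerAr mulrA scalerA.
by rewrite exprSr invfM mulrC.
Qed.

Let comm_prod (K : nat -> nat) (m j : nat) : (m <= j < n)%N ->
  X j * \prod_(0 <= i < m) X i ^+ K i =
  q ^- (\sum_(0 <= i < m) K i) *: (\prod_(0 <= i < m) X i ^+ K i * X j).
Proof.
elim: m => [|m IH] /andP[mj jn]; first by rewrite !big_geq// expr0 invr1 scale1r mulr1 mul1r.
rewrite !big_nat_recr//= mulrA IH; last by rewrite (ltnW mj).
rewrite -scalerAl -[_ * X j * X m ^+ K m]mulrA comm_exp ?mj// -scalerAr mulrA scalerA.
by rewrite exprD invfM.
Qed.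

(** A generator is moved past the smaller ones. *)
Lemma xmonM (j : 'I_n) (k : multidx n) : x j * xmon k = q ^- below k j *: xmon (k + mdelta j).
Proof.
pose K (k : multidx n) i := oapp k 0%N (insub i : option 'I_n).
have KE k' (i : 'I_n) : K k' i = k' i by rewrite /K valK.
have xE k' : xmon k' = \prod_(0 <= i < n) X i ^+ K k' i.
  by rewrite big_mkord; apply: eq_bigr => i _; rewrite XE KE.
have Kj : K (k + mdelta j) j = (K k j).+1.
  by rewrite !KE !ffunE eqxx; exact: addn1.
have Ki (i : nat) : i != j :> nat -> K (k + mdelta j) i = K k i.
  rewrite /K; case: insubP => //= i' _ <- ij; rewrite !ffunE.
  by rewrite [j == i']eq_sym -val_eqE (negbTE ij); exact: addn0.
rewrite !xE (big_cat_nat (n := j))//=; last exact: ltnW.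
rewrite [in RHS](big_cat_nat (n := j))//=; last exact: ltnW.
rewrite [in LHS](big_ltn (ltn_ord j)) [in RHS](big_ltn (ltn_ord j)).
rewrite -XE mulrA comm_prod ?leqnn//= -scalerAl.
have -> : (\sum_(0 <= i < j) K k i)%N = below k j.
  rewrite big_mkord /below [LHS](big_ord_widen _ _ (ltnW (ltn_ord j))).
  by apply: eq_bigr => i _; rewrite KE.
congr (_ *: _); rewrite Kj exprS -!mulrA; congr (_ * (_ * (_ * _))).
  by apply: eq_big_nat => i /andP[_ ij]; rewrite Ki// ltn_eqF.
by apply: eq_big_nat => i /andP[ji _]; rewrite Ki// gtn_eqF.
Qed.

Lemma xmonS (j : 'I_n) (k : multidx n) : below k j = 0%N -> xmon (k + mdelta j) = x j * xmon k.
Proof. by move=> b0; rewrite xmonM b0 expr0 invr1 scale1r. Qed.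

End OrderedMonomials.

(** Every multi-index arises by raising entries from the last one to the first, in the order
    in which [xmonS] builds ordered monomials from the right. *)
Lemma multidx_ind (n : nat) (P : multidx n -> Prop) : P 0 ->
  (forall k j, below k j = 0%N -> P k -> P (k + mdelta j)) -> forall k, P k.
Proof.
move=> P0 PS k; have [m] := ubnP (mdeg k); elim: m k => // m IH k km.
have [/forallP k0|/forallPn[j0 kj0]] := boolP [forall i, k i == 0%N].
  by have -> : k = 0 by apply/ffunP => i; rewrite ffunE; exact/eqP.
rewrite -lt0n in kj0.
case: (@arg_minnP _ j0 (fun i => 0 < k i)%N (fun i => i : nat) kj0) => j kj jmin.
rewrite -(mpredK kj); apply: PS; last first.
  by apply: IH; rewrite -ltnS; apply: leq_trans km; rewrite ltnS -{2}(mpredK kj) mdegD mdeg_mdelta addn1.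
rewrite /below big1// => i ij; rewrite ffunE.
have -> : k i = 0%N by apply/eqP; rewrite -leqn0 leqNgt; apply/negP => /jmin; rewrite leqNgt ij.
by rewrite sub0n.
Qed.

(** * Growth estimates *)

Section Growth.
Variables (R : realType).
Implicit Types (p t eta : R).

Definition poch p m : R := \prod_(i < m) (1 - p ^+ i.+1).

Lemma pochS p m : poch p m.+1 = poch p m * (1 - p ^+ m.+1).
Proof. by rewrite /poch big_ord_recr. Qed.

Lemma poch_qfact p m : poch p m = (1 - p) ^+ m * qfact p m.
Proof.
elim: m => [|m IH]; first by rewrite /poch big_ord0 qfact0 expr0 mulr1.
have E : (1 - p) * qnum p m.+1 = 1 - p ^+ m.+1 by rewrite /qnum -opprB mulNr -subrX1 opprB.
by rewrite pochS qfactS IH [(1 - p) ^+ m.+1]exprS -E; ring.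
Qed.

Lemma poch_gt0 p m : 0 < p < 1 -> 0 < poch p m.
Proof.
by move=> /andP[p0 p1]; apply: prodr_gt0 => i _; rewrite subr_gt0 exprn_ilt1// ltW.
Qed.

Lemma poch_le1 p m : 0 < p < 1 -> poch p m <= 1.
Proof.
move=> /andP[p0 p1]; apply: prodr_ile1 => i _.
rewrite subr_ge0 exprn_ile1 ?(ltW p0) ?(ltW p1)//=.
by rewrite gerBl exprn_ge0// ltW.
Qed.

(** The factors tend to [1], so all but finitely many exceed [eta]. *)
Lemma poch_lower p eta : 0 < p < 1 -> 0 < eta < 1 ->
  exists2 c, 0 < c & forall m, c * eta ^+ m <= poch p m.
Proof.
move=> /[dup] p01 /andP[p0 p1] /andP[e0 e1].
have [N hN] : exists N, forall m, (N <= m)%N -> p ^+ m < 1 - eta.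
  have /cvgrPdist_lt : (fun m => p ^+ m) @ \oo --> (0 : R).
    by apply: cvg_expr; rewrite gtr0_norm.
  have e' : 0 < 1 - eta by lra.
  move=> /(_ _ e')[N _ hN]; exists N => m Nm.
  by have := hN m Nm; rewrite sub0r normrN gtr0_norm ?exprn_gt0.
exists (poch p N) => [|m]; first exact: poch_gt0.
have dec a b : (a <= b)%N -> poch p b <= poch p a.
  move=> /subnK <-; elim: (b - a)%N => // d IH; rewrite addSn pochS.
  apply: le_trans IH; rewrite ler_piMr ?(ltW (poch_gt0 _ p01))//.
  by rewrite gerBl exprn_ge0// ltW.
have [mN|Nm] := leqP m N.
  apply: le_trans (dec _ _ mN); rewrite ler_piMr ?(ltW (poch_gt0 _ p01))//.
  by rewrite exprn_ile1// ltW.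
move/ltnW/subnK: Nm => <-; elim: (m - N)%N => [|d IH].
  by rewrite add0n ler_piMr ?(ltW (poch_gt0 _ p01))// exprn_ile1// ltW.
rewrite addSn pochS exprSr mulrA ler_pM ?mulr_ge0 ?exprn_ge0 ?(ltW e0) ?(ltW (poch_gt0 _ p01))//.
by have := hN (d + N).+1 (leqW (leq_addl _ _)); lra.
Qed.

(** A product of geometric series. *)
Lemma geom_box (n : nat) t (s : seq (multidx n)) : 0 <= t < 1 -> uniq s ->
  \sum_(k <- s) t ^+ mdeg k <= ((1 - t)^-1) ^+ n.
Proof.
move=> /andP[t0 t1] us; have [N /(_ N (leqnn _)) hN] := box_exhaust s.
apply: (@le_trans _ _ (\sum_(k <- box n N) t ^+ mdeg k)).
  rewrite -(subseq_sum (fun k => exprn_ge0 (mdeg k) t0) us (box_uniq _ N) hN) lerDl.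
  by apply: sumr_ge0 => k _; exact: exprn_ge0.
have -> : \sum_(k <- box n N) t ^+ mdeg k = \sum_(k <- box n N) \prod_i t ^+ k i.
  by apply: eq_bigr => k _; rewrite /mdeg expr_sum.
rewrite (sum_box_prod N (fun _ m => t ^+ m)) prodr_const card_ord lerXn2r ?nnegrE//.
- by rewrite sumr_ge0// => i _; exact: exprn_ge0.
- by rewrite invr_ge0; lra.
have t1' : 0 < 1 - t by lra.
rewrite -[leRHS]mul1r ler_pdivlMr// mulrC.
have -> : (1 - t) * \sum_(i < N.+1) t ^+ i = 1 - t ^+ N.+1.
  by rewrite -opprB mulNr -subrX1 opprB.
by rewrite gerBl exprn_ge0.
Qed.

End Growth.

(** * The quantum ball as a fibre *)

Section QuantumBallFiber.
Variables (R : realType) (n : nat) (t : R) (Q : Cstar R).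
Hypothesis t01 : 0 < t < 1.
Hypothesis Qt : cstar_val Q = realC t.
Local Notation C := (Cplx R).
Local Notation U := (ball_weight R n).

Definition unit_radius : pradius R := @PRadius R 1%:E (@lte01 R).
Local Notation F := (wfiber U unit_radius Q).
Local Notation E := (fiber (wbundle U unit_radius) Q).
Local Notation reg := (fock_reg n t).
Local Notation norm rho a := (wnorm U Q rho (fcoef a)).

Let t0 : 0 < t. Proof. by case/andP: t01. Qed.
Let tn0 : realC t != 0. Proof. by rewrite realC_eq0 gt_eqF. Qed.

Lemma unit_radii rho : polydisk_radii unit_radius rho <-> 0 < rho < 1.
Proof. by rewrite /polydisk_radii /= lte_fin; split=> [[-> ->]|/andP[]]. Qed.

Lemma fib_relations (u : weight R n) (r : pradius R) (x : Cstar R) :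
  reg_relations (cstar_val x) (fun i : 'I_n => fib_monomial u r x (mdelta i)).
Proof.
move=> i j ij; rewrite !fib_monomialM /twist !cross_mdelta ij ltnNge (ltnW ij) /=.
by rewrite expr0 invr1 expr1 scale1r scalerA mulfV ?cstar_neq0// scale1r addrC.
Qed.

Lemma fib_xmon (u : weight R n) (r : pradius R) (x : Cstar R) (k : multidx n) :
  xmon (fun i : 'I_n => fib_monomial u r x (mdelta i)) k = fib_monomial u r x k.
Proof.
elim/multidx_ind: k => [|k j kj IH]; first by rewrite xmon0.
rewrite (xmonS (cstar_neq0 x) (@fib_relations u r x) kj) IH fib_monomialM /twist.
by rewrite cross_mdelta_r kj expr0 invr1 scale1r addrC.
Qed.

Lemma emb_exists : exists f : {lrmorphism reg -> E},
  forall i, f (@fock_reg_gen R n t i) = fib_monomial U unit_radius Q (mdelta i).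
Proof.
have [_ h] := reg_alg_presents n (realC t).
have [|f [fg _]] := h F (fun i => fib_monomial U unit_radius Q (mdelta i)).
  by rewrite -Qt; exact: fib_relations.
by exists f.
Qed.
Definition emb : {lrmorphism reg -> E} := sval (cid emb_exists).
Lemma emb_gen i : emb (@fock_reg_gen R n t i) = fib_monomial U unit_radius Q (mdelta i).
Proof. by rewrite /emb; case: cid. Qed.

Local Notation X := (xmon (@fock_reg_gen R n t)).
Let hX : reg_relations (realC t) (@fock_reg_gen R n t).
Proof. by have [] := reg_alg_presents n (realC t). Qed.

Lemma emb_xmon k : emb (X k) = fib_monomial U unit_radius Q k.
Proof.
rewrite -fib_xmon /xmon rmorph_prod; apply: eq_bigr => i _.
by rewrite rmorphXn /= emb_gen.
Qed.

Definition coefs (a : reg) : multidx n -> C := fcoef (emb a : F).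

Lemma emb_fcoefD (a b : reg) k : coefs (a + b) k = coefs a k + coefs b k.
Proof. by rewrite /coefs rmorphD. Qed.
Lemma emb_fcoefZ (c : C) (a : reg) k : coefs (c *: a) k = c * coefs a k.
Proof. by rewrite /coefs linearZ. Qed.
Lemma coefs_xmon k l : coefs (X k) l = (l == k)%:R.
Proof. by rewrite /coefs emb_xmon. Qed.

Definition spanned (a : reg) := exists l : seq (multidx n * C), a = \sum_(p <- l) p.2 *: X p.1.

Lemma spannedD a b : spanned a -> spanned b -> spanned (a + b).
Proof. by move=> [l ->] [m ->]; exists (l ++ m); rewrite big_cat. Qed.
Lemma spannedZ (c : C) a : spanned a -> spanned (c *: a).
Proof.
move=> [l ->]; exists [seq (p.1, c * p.2) | p <- l].
by rewrite big_map scaler_sumr; apply: eq_bigr => p _; rewrite scalerA.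
Qed.

Lemma spanned_gen j b : spanned b -> spanned (@fock_reg_gen R n t j * b).
Proof.
move=> [l ->]; exists [seq (p.1 + mdelta j, p.2 * realC t ^- below p.1 j) | p <- l].
rewrite big_map mulr_sumr; apply: eq_bigr => p _.
by rewrite -scalerAr (xmonM tn0 hX) scalerA.
Qed.

(** By induction on terms, a generator being moved to its place with [xmonM]. *)
Lemma spanned_all (a : reg) : spanned a.
Proof.
suff h : forall a b : reg, spanned b -> spanned (a * b).
  rewrite -[a]mulr1; apply: h; exists [:: (0, 1)].
  by rewrite big_seq1 /= scale1r xmon0.
elim/projW=> s; elim: s => [j|c|s IHs v IHv|s IHs v IHv] b hb.
- exact: spanned_gen.
- by rewrite projC mulr_algl; exact: spannedZ.
- by rewrite projD mulrDl; apply: spannedD; [exact: IHs|exact: IHv].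
- by rewrite projM -mulrA; apply: IHs; exact: IHv.
Qed.

Lemma reg_expand (a : reg) : exists N, a = \sum_(k <- box n N) coefs a k *: X k /\
  forall k, k \notin box n N -> coefs a k = 0.
Proof.
have [l la] := spanned_all a.
have [N /(_ N (leqnn _)) hN] := box_exhaust [seq p.1 | p <- l].
have ca k : coefs a k = \sum_(p <- l) p.2 * (k == p.1)%:R.
  rewrite la; elim: (l) => [|p m IH]; first by rewrite !big_nil /coefs rmorph0.
  by rewrite !big_cons emb_fcoefD IH emb_fcoefZ coefs_xmon.
exists N; split=> [|k kN]; last first.
  rewrite ca big1_seq// => p /= pl; case: eqP => [e|_]; last by rewrite mulr0.
  by case/negP: kN; rewrite e; apply: hN; apply: map_f.
under eq_bigr do rewrite ca scaler_suml.
rewrite exchange_big {1}la big_seq [RHS]big_seq; apply: eq_bigr => p pl.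
rewrite (bigD1_seq p.1) ?box_uniq//=; last by apply: hN; apply: map_f.
rewrite eqxx mulr1 big1 ?addr0// => k /negbTE ->.
by rewrite mulr0 scale0r.
Qed.

(** * Norms of the ordered monomials in the Fock representation *)

Local Notation H := (l2 R n).
Local Notation M := (fock_qball n t01).

Definition act (a : reg) : H -> H := fock_rep (fock_reg_pol n t01 a).
Definition opmor (a : reg) : adjop R n := fock_mor n t01 (fock_reg_pol n t01 a).

Lemma actE a : act a = aop (opmor a). Proof. by []. Qed.

Lemma opmor_gen j : opmor (@fock_reg_gen R n t j) = fock_gen t01 j.
Proof. by rewrite /opmor fock_reg_pol_gen fock_mor_gen. Qed.
Lemma opmorM a b : opmor (a * b) = opmor a * opmor b.
Proof. by rewrite /opmor !rmorphM. Qed.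

Lemma act_gen j b v : act (@fock_reg_gen R n t j * b) v = raise t01 j (act b v).
Proof. by rewrite !actE opmorM opmor_gen. Qed.
Lemma act1 v : act 1 v = v.
Proof. by rewrite /act /fock_rep !rmorph1. Qed.
Lemma actZ (c : C) a v : act (c *: a) v = c *: act a v.
Proof. by rewrite /act /fock_rep !linearZ. Qed.
Lemma act_sum (I : Type) (s : seq I) (f : I -> reg) v :
  act (\sum_(i <- s) f i) v = \sum_(i <- s) act (f i) v.
Proof. by rewrite /act /fock_rep !rmorph_sum aop_sum. Qed.

(** After the action of an ordered monomial all occupation numbers are at least its
    exponents; therefore the next generator acts with norm at most the power of [t] that
    [cross] counts. *)
Lemma act_xmon_bound k (v : H) :
  nrm (act (X k) v) <= t ^+ cross k k * nrm v /\
  forall m, act (X k) v m != 0 -> forall i, (k i <= m i)%N.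
Proof.
elim/multidx_ind: k => [|k j kj [IH1 IH2]].
  rewrite xmon0 act1 cross0l expr0 mul1r; split => // m _ i.
  by rewrite ffunE.
rewrite (xmonS tn0 hX kj) act_gen; split.
  have c0 : 0 <= t ^+ above k j by rewrite exprn_ge0// ltW.
  apply: le_trans (nrm_raise t01 c0 _) _.
    move=> m hm; apply: le_trans (shift_coef_le t01 j m) _.
    rewrite ler_wiXn2l ?(ltW t0) //; first by have /andP[_ /ltW] := t01.
    by apply: leq_sum => i _; exact: IH2.
  have -> : cross (k + mdelta j) (k + mdelta j) = (above k j + cross k k)%N.
    rewrite crossDl !crossDr cross_mdelta_r kj cross_mdelta_l cross_mdelta ltnn.
    by rewrite /above /= !addn0 addnC.
  by rewrite exprD -mulrA ler_wpM2l.
move=> m; have [[m' ->]|hm] := pselect (exists m', m = m' + mdelta j); last first.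
  rewrite /= raise_out ?eqxx// => m' e; apply: hm; by exists m'.
rewrite /= raise_mdelta mulf_eq0 negb_or => /andP[_ hm'] i.
by rewrite !ffunE; apply: leq_add => //; exact: IH2.
Qed.

(** Distinct monomials send the vacuum to orthogonal vectors, so that the vacuum detects the
    coefficients of an element. *)
Lemma act_xmon_vacuum k : act (X k) (l2_basis R 0) =
  realC (t ^+ cross k k * Num.sqrt (\prod_i poch (t ^+ 2) (k i))) *: l2_basis R k.
Proof.
have p01 : 0 < t ^+ 2 < 1.
  by have /andP[a b] := t01; rewrite exprn_gt0//= expr_lt1// ltW.
elim/multidx_ind: k => [|k j kj IH].
  rewrite xmon0 act1 cross0l expr0 mul1r big1 ?sqrtr1 ?scale1r//.
  by move=> i _; rewrite ffunE /poch big_ord0.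
rewrite (xmonS tn0 hX kj) act_gen IH.
have [h _ _ _ _] := raise_adjoint t01 j.
rewrite (l2_linearZ _ _ h) raise_basis scalerA -realCM; congr (realC _ *: _).
have -> : cross (k + mdelta j) (k + mdelta j) = (cross k k + above k j)%N.
  rewrite crossDl !crossDr cross_mdelta_r kj cross_mdelta_l cross_mdelta ltnn.
  by rewrite /above /= !addn0.
have -> : \prod_i poch (t ^+ 2) ((k + mdelta j)%R i) =
    (\prod_i poch (t ^+ 2) (k i)) * (1 - (t ^+ 2) ^+ (k j).+1).
  rewrite (bigD1 j)//= [in RHS](bigD1 j)//= !ffunE eqxx -[(_ + _)%R]/(k j + 1)%N addn1 pochS.
  rewrite [in RHS]mulrAC; congr (_ * _); apply: eq_bigr => i /negbTE ij.
  by rewrite !ffunE eq_sym ij; congr poch; exact: addn0.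
have P0 : 0 <= \prod_i poch (t ^+ 2) (k i).
  by apply: prodr_ge0 => i _; exact/ltW/poch_gt0.
rewrite sqrtrM// exprD /shift_coef -qint_geom sqrtrM; last by have /andP[_ /ltW] := p01; lra.
by ring.
Qed.

End QuantumBallFiber.

Section OpNorm.
Variables (R : realType) (n : nat).
Local Notation H := (l2_hilbert R n).

Lemma op_norm_le (T : H -> H) (S : R) :
  (forall v, nrm v <= 1 -> nrm (T v) <= S) -> op_norm T <= S.
Proof.
move=> h; apply: ge_sup.
  exists (complex.Re `|T 0|), 0 => //=.
  by rewrite l2_normE nrm0 realC0 ler01.
move=> _ [v hv <-]; rewrite l2_normE; apply: h.
by rewrite -realC_le -l2_normE.
Qed.

Lemma le_op_norm (T : H -> H) (B : R) (v : H) :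
  (forall v, nrm v <= 1 -> nrm (T v) <= B) -> nrm v <= 1 -> nrm (T v) <= op_norm T.
Proof.
move=> hB hv; apply: ub_le_sup.
  exists B => _ [w hw <-]; rewrite l2_normE; apply: hB.
  by rewrite -realC_le -l2_normE.
exists v => //=.
by rewrite l2_normE -realC1 realC_le.
Qed.

Lemma nrm_basis k : nrm (l2_basis R k : l2 R n) = 1.
Proof.
rewrite /nrm /nsq (@tsum_finsupp _ _ _ [:: k]) ?big_seq1//=.
- by rewrite eqxx cabs1 expr1n sqrtr1.
- by move=> m; exact: sqr_ge0.
- by move=> m; rewrite inE => /negbTE ->; rewrite cabs0 expr0n.
Qed.

Lemma nrm_sum (I : Type) (s : seq I) (f : I -> l2 R n) :
  nrm (\sum_(i <- s) f i) <= \sum_(i <- s) nrm (f i).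
Proof.
elim: s => [|i s IH]; first by rewrite !big_nil nrm0.
by rewrite !big_cons; apply: le_trans (nrmD _ _) _; rewrite lerD2l.
Qed.

End OpNorm.

Section QuantumBallNorms.
Variables (R : realType) (n : nat) (t : R) (Q : Cstar R).
Hypothesis t01 : 0 < t < 1.
Hypothesis Qt : cstar_val Q = realC t.
Local Notation C := (Cplx R).
Local Notation U := (ball_weight R n).
Local Notation E := (fiber (wbundle U (unit_radius R)) Q).
Local Notation reg := (fock_reg n t).
Local Notation X := (xmon (@fock_reg_gen R n t)).
Local Notation emb := (emb n Qt).
Local Notation coefs := (coefs Qt).
Local Notation act := (act t01).
Local Notation norm rho a := (wnorm U Q rho (coefs a)).
Local Notation M := (fock_qball n t01).
Local Notation p := (t ^+ 2).

Let t0 : 0 < t. Proof. by case/andP: t01. Qed.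
Let tn0 : realC t != 0. Proof. by rewrite realC_eq0 gt_eqF. Qed.
Let p01 : 0 < p < 1.
Proof. by have /andP[a b] := t01; rewrite exprn_gt0//= expr_lt1// ltW. Qed.
Let hX : reg_relations (realC t) (@fock_reg_gen R n t).
Proof. by have [] := reg_alg_presents n (realC t). Qed.

Lemma dilation_xmon s k : fock_dilation n t s (X k) = realC (s ^+ mdeg k) *: X k.
Proof.
elim/multidx_ind: k => [|k j kj IH]; first by rewrite xmon0 rmorph1 mdeg0 expr0 scale1r.
rewrite (xmonS tn0 hX kj) rmorphM /= IH fock_dilation_gen mdegD mdeg_mdelta addn1 exprS realCM.
by rewrite -scalerAl -scalerAr scalerA.
Qed.

Lemma act_dilation N s (a : reg) v : a = \sum_(k <- box n N) coefs a k *: X k ->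
  act (fock_dilation n t s a) v =
  \sum_(k <- box n N) (coefs a k * realC (s ^+ mdeg k)) *: act (X k) v.
Proof.
move=> {1}->; rewrite rmorph_sum act_sum; apply: eq_bigr => k _.
by rewrite /= linearZ /= dilation_xmon scalerA actZ.
Qed.

Lemma qball_normE s (a : reg) : @qball_norm R n t M s a = @op_norm R (l2_hilbert R n) (act (fock_dilation n t s a)).
Proof. by []. Qed.

Lemma ball_wtE k : U Q k = t ^+ cross k k * Num.sqrt (qmulti p k)^-1.
Proof. by rewrite /= /ball_wt Qt cabs_realC gtr0_norm. Qed.

Lemma qmulti_poch (k : multidx n) : qmulti p k = poch p (mdeg k) / \prod_i poch p (k i).
Proof.
rewrite /qmulti poch_qfact; under [in RHS]eq_bigr do rewrite poch_qfact.
rewrite big_split /= -expr_sum -/(mdeg k).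
have h1 : (1 - p) ^+ mdeg k != 0.
  by rewrite expf_neq0// gt_eqF// subr_gt0; case/andP: p01.
have h2 : \prod_i qfact p (k i) != 0.
  by apply/prodf_neq0 => i _; rewrite gt_eqF// qfact_gt0//; case/andP: p01.
by field; rewrite h1 h2.
Qed.

Let P0 (k : multidx n) : 0 < \prod_i poch p (k i).
Proof. by apply: prodr_gt0 => i _; exact: poch_gt0. Qed.

(** In terms of [poch] the powers of [1 - p] cancel, and [poch_lower] bounds the
    denominator. *)
Lemma qmulti_upper eta : 0 < eta < 1 -> exists2 D : R, 0 < D & forall k : multidx n,
  qmulti p k <= D * (eta^-1) ^+ mdeg k.
Proof.
move=> eta01; have [c c0 hc] := poch_lower p01 eta01; have /andP[e0 _] := eta01.
exists (c^-1 ^+ n) => [|k]; first by rewrite exprn_gt0// invr_gt0.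
rewrite qmulti_poch; apply: (@le_trans _ _ (\prod_i poch p (k i))^-1).
  by rewrite ler_piMl ?invr_ge0 ?(ltW (P0 k))// poch_le1.
have -> : c^-1 ^+ n * eta^-1 ^+ mdeg k = (\prod_(i < n) (c * eta ^+ k i))^-1.
  by rewrite big_split /= prodr_const card_ord -expr_sum -/(mdeg k) invfM !exprVn.
rewrite lef_pV2 ?posrE//; last by apply: prodr_gt0 => i _; rewrite mulr_gt0// exprn_gt0.
by apply: ler_prod => i _; rewrite hc mulr_ge0 ?(ltW c0)// exprn_ge0// ltW.
Qed.

Lemma act_bound N s (a : reg) v : 0 <= s -> a = \sum_(k <- box n N) coefs a k *: X k ->
  nrm (act (fock_dilation n t s a) v) <=
  (\sum_(k <- box n N) cabs (coefs a k) * (t ^+ cross k k * s ^+ mdeg k)) * nrm v.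
Proof.
move=> s0 aE; rewrite (act_dilation _ _ aE); apply: le_trans (nrm_sum _ _) _.
rewrite mulr_suml; apply: ler_sum => k _; rewrite nrmZ cabsM cabs_realC ger0_norm ?exprn_ge0//.
rewrite -!mulrA ler_wpM2l ?cabs_ge0// [leRHS]mulrCA ler_wpM2l ?exprn_ge0//.
by have [] := act_xmon_bound t01 k v.
Qed.

(** The triangle inequality; a slightly larger radius absorbs the factor of [qmulti_upper]. *)
Lemma qball_norm_le_weighted s : 0 < s < 1 -> exists rho K : R, [/\ 0 < rho < 1, 0 < K &
  forall a : reg, @qball_norm R n t M s a <= K * norm rho a].
Proof.
move=> /andP[s0 s1]; pose rho := (1 + s) / 2.
have r01 : 0 < rho < 1 by rewrite /rho; apply/andP; split; lra.
have sr : s < rho by rewrite /rho; lra.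
have /andP[r0 r1] := r01.
have eta01 : 0 < (s / rho) ^+ 2 < 1.
  apply/andP; split; first by apply: exprn_gt0; exact: divr_gt0.
  rewrite expr_lt1//; last by apply: divr_ge0; exact: ltW.
  by rewrite ltr_pdivrMr// mul1r.
have [D D0 hD] := qmulti_upper eta01.
exists rho, (Num.sqrt D); split; rewrite ?sqrtr_gt0// => a.
have [N [aE aN]] := reg_expand t01 Qt a.
rewrite qball_normE; apply: op_norm_le => v hv.
apply: le_trans (act_bound _ (ltW s0) aE) _.
have K0 : 0 <= Num.sqrt D by exact: sqrtr_ge0.
apply: le_trans (ler_wpM2l _ hv) _.
  by rewrite sumr_ge0// => k _; rewrite !mulr_ge0 ?cabs_ge0 ?exprn_ge0 ?(ltW t0) ?(ltW s0).
rewrite mulr1 (wnorm_finsupp U Q (ltW r0) (box_uniq n N) aN) mulr_sumr.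
apply: ler_sum => k _; rewrite /wterm ball_wtE -!mulrA [leRHS]mulrCA ler_wpM2l ?cabs_ge0//.
set G := qmulti p k.
have G0 : 0 < G by apply: qmulti_gt0; case/andP: p01.
rewrite [leRHS]mulrCA ler_wpM2l ?exprn_ge0 ?(ltW t0)// [leRHS]mulrCA.
rewrite sqrtrV ?(ltW G0)// ler_pdivlMl ?sqrtr_gt0//.
rewrite -ler_pdivlMr ?exprn_gt0// -mulrA -expr_div_n.
rewrite -[leRHS]ger0_norm; last first.
  by apply: mulr_ge0 => //; apply: exprn_ge0; apply: divr_ge0; exact: ltW.
rewrite -sqrtr_sqr ler_wsqrtr// exprMn sqr_sqrtr ?(ltW D0)//.
by apply: le_trans (hD k) _; rewrite -exprVn invf_div -exprM mulnC exprM.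
Qed.

(** Apply the operator to the vacuum. *)
Lemma coef_le_qball_norm s (a : reg) k : 0 < s ->
  cabs (coefs a k) * s ^+ mdeg k * (t ^+ cross k k * Num.sqrt (\prod_i poch p (k i))) <=
  @qball_norm R n t M s a.
Proof.
move=> s0; have [N [aE aN]] := reg_expand t01 Qt a.
have h := le_op_norm (T := act (fock_dilation n t s a)) (v := l2_basis R 0)
  (B := \sum_(k <- box n N) cabs (coefs a k) * (t ^+ cross k k * s ^+ mdeg k)) _ _.
rewrite qball_normE; apply: le_trans (h _ _); last 2 first.
- move=> v hv; apply: le_trans (act_bound _ (ltW s0) aE) _.
  rewrite -[leRHS]mulr1 ler_wpM2l//.
  by rewrite sumr_ge0// => l _; rewrite !mulr_ge0 ?cabs_ge0 ?exprn_ge0 ?(ltW t0) ?(ltW s0).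
- by rewrite nrm_basis.
have [kN|/aN ->] := boolP (k \in box n N); last by rewrite cabs0 !mul0r nrm_ge0.
apply: le_trans (cabs_le_nrm _ k).
rewrite (act_dilation _ _ aE) l2_fsum (bigD1_seq k kN (box_uniq n N)) /= [X in _ <= cabs (_ + X)]big1 ?addr0; last first.
  move=> l /negbTE lk; rewrite (act_xmon_vacuum t01) /= eq_sym lk.
  by rewrite !mulr0.
rewrite (act_xmon_vacuum t01) /= eqxx mulr1 !cabsM !cabs_realC !ger0_norm ?exprn_ge0 ?(ltW s0)//.
by rewrite mulr_ge0 ?exprn_ge0 ?sqrtr_ge0 ?(ltW t0).
Qed.

(** Coefficient estimates at radius [s] add up at any smaller radius. *)
Lemma weighted_le_qball_norm rho : 0 < rho < 1 -> exists s K : R, [/\ 0 < s < 1, 0 < K &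
  forall a : reg, norm rho a <= K * @qball_norm R n t M s a].
Proof.
move=> /andP[r0 r1]; pose s := (1 + rho) / 2.
have s01 : 0 < s < 1 by rewrite /s; apply/andP; split; lra.
have rs : rho < s by rewrite /s; lra.
have /andP[s0 s1] := s01.
have e0 : 0 < rho / s by rewrite divr_gt0.
have e1 : rho / s < 1 by rewrite ltr_pdivrMr// mul1r.
have [c c0 hc] := poch_lower p01 (introT andP (conj e0 e1)).
set eta := rho / s in e0 e1 hc; pose th := Num.sqrt eta.
have th0 : 0 < th by rewrite sqrtr_gt0.
have th1 : th < 1 by rewrite -sqrtr1 ltr_sqrt.
have th01 : 0 <= th < 1 by rewrite (ltW th0).
exists s, ((Num.sqrt c)^-1 * (1 - th)^-1 ^+ n); split=> // [|a].
  by rewrite mulr_gt0 ?exprn_gt0 ?invr_gt0 ?sqrtr_gt0// subr_gt0.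
apply: tsum_le => [k|l ul]; first by apply: wterm_ge0; exact: ltW.
set q := qball_norm _ _.
have q0 : 0 <= q.
  apply: le_trans (coef_le_qball_norm a 0 s0).
  by rewrite !mulr_ge0 ?cabs_ge0 ?exprn_ge0 ?sqrtr_ge0 ?(ltW s0) ?(ltW t0).
apply: (@le_trans _ _ (\sum_(k <- l) (Num.sqrt c)^-1 * q * th ^+ mdeg k)); last first.
  rewrite -mulr_sumr mulrAC ler_wpM2r// ?ler_wpM2l ?geom_box ?invr_ge0 ?sqrtr_ge0//.
apply: ler_sum => k _; have := coef_le_qball_norm a k s0; rewrite -/q.
set A := cabs _; set d := mdeg k => hk.
have A0 : 0 <= A by exact: cabs_ge0.
rewrite /wterm -/A -/d ball_wtE.
have hE : Num.sqrt (\prod_i poch p (k i)) = Num.sqrt (qmulti p k)^-1 * Num.sqrt (poch p d).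
  rewrite -sqrtrM ?invr_ge0 ?(ltW (qmulti_gt0 _ _))//; last by case/andP: p01.
  congr Num.sqrt; rewrite qmulti_poch invf_div -mulrA mulVf ?mulr1//.
  by rewrite gt_eqF// poch_gt0.
rewrite hE in hk; set W := Num.sqrt (qmulti p k)^-1 in hk *; set c2 := t ^+ cross k k in hk *.
have W0 : 0 <= W by exact: sqrtr_ge0.
have c20 : 0 <= c2 by rewrite exprn_ge0// ltW.
have hp : Num.sqrt c * th ^+ d <= Num.sqrt (poch p d).
  rewrite -[_ * _]ger0_norm; last by rewrite mulr_ge0 ?sqrtr_ge0 ?exprn_ge0 ?(ltW th0).
  rewrite -sqrtr_sqr ler_wsqrtr// exprMn sqr_sqrtr ?(ltW c0)// -exprM mulnC exprM.
  by rewrite sqr_sqrtr ?(ltW e0)// hc.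
have rE : rho ^+ d = s ^+ d * th ^+ d * th ^+ d.
  rewrite -mulrA -exprMn -exprMn -expr2 sqr_sqrtr ?(ltW e0)// /eta mulrC mulfVK//.
  by rewrite gt_eqF.
have sc0 : 0 < Num.sqrt c by rewrite sqrtr_gt0.
rewrite rE [leRHS](_ : _ = (Num.sqrt c)^-1 * (q * th ^+ d)); last by ring.
rewrite ler_pdivlMl//; apply: le_trans (ler_wpM2r (exprn_ge0 d (ltW th0)) hk).
rewrite [leLHS](_ : _ = A * c2 * W * s ^+ d * th ^+ d * (Num.sqrt c * th ^+ d)); last by ring.
rewrite [leRHS](_ : _ = A * c2 * W * s ^+ d * th ^+ d * Num.sqrt (poch p d)); last by ring.
have sd0 : 0 <= s ^+ d by rewrite exprn_ge0// ltW.
have td0 : 0 <= th ^+ d by rewrite exprn_ge0// ltW.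
by apply: ler_wpM2l hp; do !apply: mulr_ge0.
Qed.

Lemma emb_dense : dense (range emb).
Proof.
move=> O [a Oa] oO; have aO : nbhs a O by apply: open_nbhs_nbhs.
have /nbhs_fiberP[rho [e [hrho e0 hO]]] := aO.
have [b [N bN] ab] := fsupp_dense (radii_ge0 hrho) (fcoefP a hrho) e0.
pose c := \sum_(k <- undup N) b k *: X k.
have cE k : fibcoef (emb c) k = b k.
  rewrite -[LHS]/(coefs c k).
  have -> : coefs c k = \sum_(l <- undup N) b l * (k == l)%:R.
    rewrite /c; elim: (undup N) => [|l s IH]; first by rewrite !big_nil /coefs rmorph0.
    by rewrite !big_cons emb_fcoefD IH emb_fcoefZ coefs_xmon.
  have [kN|kN] := boolP (k \in undup N).
    rewrite (bigD1_seq k) ?undup_uniq//= eqxx mulr1 big1 ?addr0// => l.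
    by rewrite eq_sym => /negbTE ->; rewrite mulr0.
  rewrite bN; last by rewrite -mem_undup.
  rewrite big1_seq// => l /= lN; case: eqP => [e1|_]; last by rewrite mulr0.
  by rewrite e1 lN in kN.
exists (emb c); split; last by exists c.
apply: hO => /=; rewrite wnormB.
by under eq_fun do rewrite cE.
Qed.

Lemma emb_norm rho (a b : reg) : wnorm U Q rho (fun k => fibcoef (emb a) k - fibcoef (emb b) k) =
  norm rho (a - b).
Proof.
congr wnorm; apply/funext => k.
by rewrite emb_fcoefD -[- b]scaleN1r emb_fcoefZ mulN1r.
Qed.

(** The operator norms and the weighted norms define the same topology on polynomials, which
    are dense in the complete fibre. *)
Lemma fiber_is_qball : is_qball n t E.
Proof.
exists M, emb; split.
- exact: fiber_topological_algebra.
- exact: wfiber_hausdorff.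
- exact: wfiber_complete.
- exact: emb_dense.
- move=> a W; split.
  + move=> [s [e [sD e0 hW]]].
    suff [V aV hV] : exists2 V : set E, nbhs (emb a) V & forall b, V (emb b) -> forall i, i \in s ->
        @qball_norm R n t M i (b - a) < e.
      by exists V => // b Vb; apply: hW; exact: hV.
    elim: s sD {hW} => [_|i s IH sD]; first by exists setT => //; exact: filterT.
    have [|V aV hV] := IH; first by move=> j js; apply: sD; rewrite inE js orbT.
    have [rho [K [r01 K0 hK]]] := qball_norm_le_weighted (sD i (mem_head _ _)).
    exists (V `&` [set y | wnorm U Q rho (fun k => fibcoef y k - fibcoef (emb a) k) < e / K]).
      apply: filterI => //; apply/nbhs_fiberP; exists rho, (e / K); split => //.
        exact/unit_radii.
      exact: divr_gt0.
    move=> b [Vb /=]; rewrite emb_norm => hb j; rewrite inE => /orP[/eqP ->|]; last exact: hV.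
    by apply: le_lt_trans (hK _) _; rewrite mulrC -ltr_pdivlMr.
  + move=> [V /nbhs_fiberP[rho [e [/unit_radii r01 e0 hV]]] VW].
    have [s [K [s01 K0 hK]]] := weighted_le_qball_norm r01.
    exists [:: s], (e / K); split; [by move=> i; rewrite inE => /eqP ->|exact: divr_gt0|].
    move=> b hb; apply: VW; apply: hV; rewrite /= emb_norm.
    apply: le_lt_trans (hK _) _; rewrite mulrC -ltr_pdivlMr//.
    by apply: hb; rewrite mem_head.
Qed.

End QuantumBallNorms.

(** * Goursat's lemma for the midpoint rule *)

Section Goursat.
Variable R : realType.
Local Notation C := (Cplx R).
Local Notation ic := ('i%C : C).
Implicit Types (g : R -> C) (F : R -> R -> C) (a b x y h : R) (M : R).

(** The midpoint rule with [2 ^ n] nodes on the interval from [a] to [a + h]. It halves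
    exactly like the rectangles in Goursat's argument, which therefore applies to it without
    passing to the integral. *)
Fixpoint midsum (n : nat) (a h : R) (g : R -> C) : C :=
  if n is n'.+1 then midsum n' a (h / 2) g + midsum n' (a + h / 2) (h / 2) g
  else realC h * g (a + h / 2).

Arguments midsum : simpl never.

Lemma midsumS n a h g :
  midsum n.+1 a h g = midsum n a (h / 2) g + midsum n (a + h / 2) (h / 2) g.
Proof. by []. Qed.

Lemma midsum0 a h g : midsum 0 a h g = realC h * g (a + h / 2).
Proof. by []. Qed.

Lemma midsumD n a h g1 g2 :
  midsum n a h (fun t => g1 t + g2 t) = midsum n a h g1 + midsum n a h g2.
Proof.
elim: n a h => [|n IH] a h; first by rewrite !midsum0 mulrDr.
by rewrite !midsumS !IH addrACA.
Qed.

Lemma midsumZ n a h (c : C) g : midsum n a h (fun t => c * g t) = c * midsum n a h g.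
Proof.
elim: n a h => [|n IH] a h; first by rewrite !midsum0 mulrCA.
by rewrite !midsumS !IH mulrDr.
Qed.

Lemma midsum_le n a h g M : 0 <= h -> (forall t, a <= t <= a + h -> cabs (g t) <= M) ->
  cabs (midsum n a h g) <= h * M.
Proof.
elim: n a h => [|n IH] a h h0 gM; rewrite ?midsumS ?midsum0.
  rewrite cabsM cabs_realC ger0_norm// ler_wpM2l//; apply: gM.
  by apply/andP; split; lra.
apply: le_trans (cabsD _ _) _; have -> : h * M = h / 2 * M + h / 2 * M by field.
by apply: lerD; apply: IH => [|t /andP[? ?]]; rewrite ?divr_ge0//; apply: gM; apply/andP; split; lra.
Qed.

(** Exactness on affine functions is the reason for taking midpoints: it gives
    [bdsum_affine]. *)
Lemma midsum_affine n a h (c d : C) :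
  midsum n a h (fun t => c + d * realC t) = realC h * (c + d * realC (a + h / 2)).
Proof.
elim: n a h => [//|n IH] a h; rewrite midsumS !IH -mulrDr.
have -> : realC h = realC (h / 2) * 2.
  by rewrite -(realC_nat R 2) -realCM; congr realC; field.
rewrite -[RHS]mulrA; congr (_ * _).
have -> : a + h / 2 + h / 2 / 2 = 2 * (a + h / 2) - (a + h / 2 / 2) by field.
rewrite realCB realCM realC_nat; ring.
Qed.

(** For a character the two halves are proportional; they cancel if [v = -1]. *)
Lemma midsum_character n a h (u : R -> C) (v : C) : (forall t, u (t + h / 2) = u t * v) ->
  midsum n.+1 a h u = (1 + v) * midsum n a (h / 2) u.
Proof.
move=> uv; rewrite midsumS mulrDl mul1r; congr (_ + _).
have sh m b k : midsum m (b + h / 2) k u = v * midsum m b k u.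
  elim: m b k => [|m IH] b k; first by rewrite !midsum0 addrAC uv; ring.
  by rewrite !midsumS mulrDr -!IH addrAC.
exact: sh.
Qed.

(** The midpoint rule for the counterclockwise boundary of the rectangle with lower left
    corner [x + iy] and sides [a], [b]. *)
Definition bdsum n F x a y b : C :=
  ic * (midsum n y b (F (x + a)) - midsum n y b (F x)) +
  (midsum n x a (F^~ y) - midsum n x a (F^~ (y + b))).

(** The four inner sides cancel in pairs. *)
Lemma bdsum_split n F x a y b : bdsum n.+1 F x a y b =
  bdsum n F x (a / 2) y (b / 2) + bdsum n F (x + a / 2) (a / 2) y (b / 2) +
  bdsum n F x (a / 2) (y + b / 2) (b / 2) +
  bdsum n F (x + a / 2) (a / 2) (y + b / 2) (b / 2).
Proof.
have Ea : x + a / 2 + a / 2 = x + a by rewrite -addrA -splitr.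
have Eb : y + b / 2 + b / 2 = y + b by rewrite -addrA -splitr.
by rewrite /bdsum !midsumS !Ea !Eb; ring.
Qed.

Lemma bdsumD n F G x a y b :
  bdsum n (fun s t => F s t + G s t) x a y b = bdsum n F x a y b + bdsum n G x a y b.
Proof. by rewrite /bdsum !midsumD; ring. Qed.

Lemma bdsum_le n F x a y b M : 0 <= a -> 0 <= b ->
  (forall s t, x <= s <= x + a -> y <= t <= y + b -> cabs (F s t) <= M) ->
  cabs (bdsum n F x a y b) <= 2 * (a + b) * M.
Proof.
move=> a0 b0 FM.
have c1 : cabs ic = 1 by rewrite /cabs /= expr0n add0r expr1n sqrtr1.
have h s : x <= s <= x + a -> cabs (midsum n y b (F s)) <= b * M.
  by move=> hs; apply: midsum_le => // t ht; exact: FM.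
have v t : y <= t <= y + b -> cabs (midsum n x a (F^~ t)) <= a * M.
  by move=> ht; apply: midsum_le => // s hs; exact: FM.
have h1 := h x ltac:(by apply/andP; split; lra).
have h2 := h (x + a) ltac:(by apply/andP; split; lra).
have v1 := v y ltac:(by apply/andP; split; lra).
have v2 := v (y + b) ltac:(by apply/andP; split; lra).
apply: le_trans (cabsD _ _) _; rewrite cabsM c1 mul1r.
apply: le_trans (lerD (cabsD _ _) (cabsD _ _)) _; rewrite !cabsN.
rewrite (_ : 2 * (a + b) * M = b * M + b * M + (a * M + a * M)); last by ring.
by rewrite !lerD.
Qed.

Lemma bdsum_affine n x a y b (c d : C) :
  bdsum n (fun s t => c + d * (realC s + ic * realC t)) x a y b = 0.
Proof.
have hv s : midsum n y b (fun t => c + d * (realC s + ic * realC t)) =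
    realC b * ((c + d * realC s) + d * ic * realC (y + b / 2)).
  by rewrite -(midsum_affine n); congr midsum; apply/funext => t; ring.
have hh t : midsum n x a (fun s => c + d * (realC s + ic * realC t)) =
    realC a * ((c + d * ic * realC t) + d * realC (x + a / 2)).
  by rewrite -(midsum_affine n); congr midsum; apply/funext => s; ring.
by rewrite /bdsum !hv !hh !realCD; ring.
Qed.

(** Complex differentiability of [F] as a function of [x + iy]. *)
Definition rdiff F x y := exists D : C, forall e : R, 0 < e -> exists2 d : R, 0 < d &
  forall s t, `|s - x| < d -> `|t - y| < d ->
    cabs (F s t - F x y - D * (realC (s - x) + ic * realC (t - y))) <=
      e * (`|s - x| + `|t - y|).

Lemma nested_point (u : nat -> R) (a : R) : 0 <= a ->
  (forall k, u k <= u k.+1 /\ u k.+1 + a / 2 ^+ k.+1 <= u k + a / 2 ^+ k) ->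
  exists p, forall k, u k <= p <= u k + a / 2 ^+ k.
Proof.
move=> a0 hu.
have ak k : 0 <= a / 2 ^+ k by rewrite divr_ge0// exprn_ge0.
have um k l : u k <= u (k + l)%N.
  elim: l => [|l IH]; first by rewrite addn0.
  by rewrite addnS; apply: le_trans IH _; have [] := hu (k + l)%N.
have uM k l : u (k + l)%N + a / 2 ^+ (k + l) <= u k + a / 2 ^+ k.
  elim: l => [|l IH]; first by rewrite addn0.
  by rewrite addnS; apply: le_trans IH; have [] := hu (k + l)%N.
have ub k l : u l <= u k + a / 2 ^+ k.
  apply: le_trans (le_trans (um l k) _) (uM k l); rewrite addnC lerDl; exact: ak.
have hs : has_sup (range u).
  by split; [exists (u 0%N), 0%N|exists (u 0%N + a / 2 ^+ 0) => _ [l _ <-]].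
exists (sup (range u)) => k; apply/andP; split.
  by apply: sup_upper_bound => //; exists k.
by apply: ge_sup; [exists (u 0%N), 0%N|move=> _ [l _ <-]].
Qed.

(** Goursat's bisection argument. The boundary sum of a rectangle is the sum of those of its
    four quarters, so if it fails to become small compared with the area, then so does that
    of a quarter; the quarters shrink to a point, near which the function is affine up to an
    error that is small compared with the side. *)
Lemma goursat F x a y b : 0 < a -> 0 < b ->
  (forall s t, x <= s <= x + a -> y <= t <= y + b -> rdiff F s t) ->
  forall e, 0 < e -> exists N, forall n, (N <= n)%N -> cabs (bdsum n F x a y b) <= e.
Proof.
move=> a0 b0 dF e e0; pose c := e / (a * b); have c0 : 0 < c by rewrite divr_gt0// mulr_gt0.
pose good k (p : R * R) := exists N, forall n, (N <= n)%N ->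
  cabs (bdsum n F p.1 (a / 2 ^+ k) p.2 (b / 2 ^+ k)) <= c * (a / 2 ^+ k * (b / 2 ^+ k)).
have half (z : R) k : z / 2 ^+ k / 2 = z / 2 ^+ k.+1.
  by rewrite exprS invfM mulrA mulrAC.
have dbl (z : R) k : z / 2 ^+ k = 2 * (z / 2 ^+ k.+1).
  by rewrite -half mulrCA mulfV ?mulr1// pnatr_eq0.
have step k p : exists p', ~ good k p -> [/\ ~ good k.+1 p',
    p.1 <= p'.1 /\ p'.1 + a / 2 ^+ k.+1 <= p.1 + a / 2 ^+ k &
    p.2 <= p'.2 /\ p'.2 + b / 2 ^+ k.+1 <= p.2 + b / 2 ^+ k].
  have [gp|bp] := pselect (good k p); first by exists p.
  have A0 : 0 <= a / 2 ^+ k.+1 by rewrite divr_ge0 ?exprn_ge0// ltW.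
  have B0 : 0 <= b / 2 ^+ k.+1 by rewrite divr_ge0 ?exprn_ge0// ltW.
  apply: contrapT => /forallNP h.
  have {}h p' : p.1 <= p'.1 -> p'.1 + a / 2 ^+ k.+1 <= p.1 + a / 2 ^+ k ->
      p.2 <= p'.2 -> p'.2 + b / 2 ^+ k.+1 <= p.2 + b / 2 ^+ k -> good k.+1 p'.
    by move=> h1 h2 h3 h4; apply: contrapT => g'; apply: (h p').
  apply: bp.
  have := h p; rewrite !(dbl _ k) => /(_ ltac:(lra) ltac:(lra) ltac:(lra) ltac:(lra))[N1 h1].
  have := h (p.1 + a / 2 ^+ k.+1, p.2); rewrite /= !(dbl _ k).
  move=> /(_ ltac:(lra) ltac:(lra) ltac:(lra) ltac:(lra))[N2 h2].
  have := h (p.1, p.2 + b / 2 ^+ k.+1); rewrite /= !(dbl _ k).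
  move=> /(_ ltac:(lra) ltac:(lra) ltac:(lra) ltac:(lra))[N3 h3].
  have := h (p.1 + a / 2 ^+ k.+1, p.2 + b / 2 ^+ k.+1); rewrite /= !(dbl _ k).
  move=> /(_ ltac:(lra) ltac:(lra) ltac:(lra) ltac:(lra))[N4 h4].
  exists (maxn (maxn N1 N2) (maxn N3 N4)).+1 => -[//|n].
  rewrite ltnS !geq_max => /andP[/andP[n1 n2] /andP[n3 n4]].
  rewrite bdsum_split !half; have := h1 _ n1; have := h2 _ n2; have := h3 _ n3; have := h4 _ n4.
  rewrite /= => g4 g3 g2 g1.
  apply: le_trans (cabsD _ _) _; apply: le_trans (lerD (cabsD _ _) (lexx _)) _.
  apply: le_trans (lerD (lerD (cabsD _ _) (lexx _)) (lexx _)) _.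
  rewrite [in leRHS](dbl a) [in leRHS](dbl b); lra.
have {step} [nxt hnxt] := choice (fun kp : nat * (R * R) => step kp.1 kp.2).
pose P := fix P k := if k is k'.+1 then nxt (k', P k') else (x, y).
have [[N hN]|bad0] := pselect (good 0%N (x, y)).
  exists N => n Nn; have := hN n Nn; rewrite expr0 !divr1 /c /= divfK//.
  by rewrite mulf_neq0 ?gt_eqF.
have bad k : ~ good k (P k).
  by elim: k => [//|k IH]; have [] := hnxt (k, P k) IH.
have [s hs] : exists s, forall k, (P k).1 <= s <= (P k).1 + a / 2 ^+ k.
  by apply: nested_point => [|k]; [exact: ltW|have [] := hnxt (k, P k) (bad k)].
have [t ht] : exists t, forall k, (P k).2 <= t <= (P k).2 + b / 2 ^+ k.
  by apply: nested_point => [|k]; [exact: ltW|have [] := hnxt (k, P k) (bad k)].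
have [D hD] : rdiff F s t.
  by apply: dF; [have := hs 0%N|have := ht 0%N]; rewrite expr0 !divr1.
pose L := a + b; have L0 : 0 < L by exact: addr_gt0.
(* On a rectangle of half perimeter [L / 2^k] the remainder is at most [e' L / 2^k], and so the
   boundary sum at most [2 e' (L / 2^k)^2], which this choice makes [c] times the area. *)
pose e' := c * (a * b) / (2 * L ^+ 2); have e'0 : 0 < e'.
  by apply: divr_gt0; apply: mulr_gt0 => //; [exact: mulr_gt0|exact: exprn_gt0].
have [d d0 hd] := hD e' e'0.
have [k hk] : exists k, L / 2 ^+ k < d.
  have [k hk] : exists k, L / d < 2 ^+ k :> R.
    exists (Num.truncn (L / d)).+1; apply: lt_trans (truncnS_gt (L / d)) _.
    by rewrite -natrX ltr_nat ltn_expl.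
  by exists k; rewrite ltr_pdivrMr ?exprn_gt0// mulrC -ltr_pdivrMr.
exfalso; apply: (bad k); exists 0%N => n _.
move: (hs k) (ht k); set p := P k; set A := a / 2 ^+ k; set B := b / 2 ^+ k.
move=> /andP[s1 s2] /andP[t1 t2].
have A0 : 0 < A by rewrite divr_gt0 ?exprn_gt0.
have B0 : 0 < B by rewrite divr_gt0 ?exprn_gt0.
have AB : A + B = L / 2 ^+ k by rewrite -mulrDl.
pose G s' t' := F s' t' - (F s t - D * (realC s + ic * realC t) +
  D * (realC s' + ic * realC t')).
have -> : bdsum n F p.1 A p.2 B = bdsum n G p.1 A p.2 B.
  rewrite -[LHS]subr0 -[X in _ - X](bdsum_affine n p.1 A p.2 B
    (F s t - D * (realC s + ic * realC t)) D).
  rewrite -[RHS](addrK (bdsum n (fun s' t' => F s t - D * (realC s + ic * realC t) +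
    D * (realC s' + ic * realC t')) p.1 A p.2 B)); congr (_ - _).
  rewrite -bdsumD; congr bdsum; apply/funext => s'; apply/funext => t'.
  by rewrite /G subrK.
apply: le_trans (bdsum_le (M := e' * (A + B)) _ _ _ _) _.
- exact: ltW.
- exact: ltW.
- move=> s' t' /andP[s1' s2'] /andP[t1' t2'].
  have hs' : `|s' - s| <= A by rewrite ler_norml; apply/andP; split; lra.
  have ht' : `|t' - t| <= B by rewrite ler_norml; apply/andP; split; lra.
  have -> : G s' t' = F s' t' - F s t - D * (realC (s' - s) + ic * realC (t' - t)).
    by rewrite /G !realCB; ring.
  apply: le_trans (hd s' t' _ _) _; [lra|lra|].
  by rewrite ler_wpM2l ?lerD// ltW.
rewrite AB /A /B /e' le_eqVlt; apply/orP; left; apply/eqP.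
by field; rewrite ?gt_eqF// ?expf_neq0.
Qed.

End Goursat.

(** * Logarithmic coordinates *)

Section Polar.
Variable R : realType.
Local Notation C := (Cplx R).
Local Notation ic := ('i%C : C).
Implicit Types (x y : R) (z w : C) (f : C -> C).

Definition cis y : C := realC (cos y) + ic * realC (sin y).

Lemma ic_sqr : ic * ic = -1. Proof. by rewrite -expr2 sqr_i. Qed.

Lemma cisD x y : cis (x + y) = cis x * cis y.
Proof.
rewrite /cis cosD sinD realCB realCD !realCM.
by rewrite mulrDl !mulrDr mulrACA ic_sqr; ring.
Qed.

Lemma cabs_cis y : cabs (cis y) = 1.
Proof.
have h := cos2Dsin2 y; rewrite /cabs.
have -> : cis y = (cos y +i* sin y)%C by rewrite /cis /realC; simpc.
by rewrite /= h sqrtr1.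
Qed.

Lemma cis_neq0 y : cis y != 0.
Proof. by rewrite -cabs_eq0 cabs_cis oner_eq0. Qed.

Lemma cis0 : cis 0 = 1.
Proof. by rewrite /cis cos0 sin0 realC0 mulr0 addr0. Qed.

Lemma cispi : cis pi = -1.
Proof. by rewrite /cis cospi sinpi realC0 mulr0 addr0 realCN. Qed.

Lemma cisN y : cis (- y) = (cis y)^-1.
Proof. by apply: (mulfI (cis_neq0 y)); rewrite -cisD subrr cis0 mulfV// cis_neq0. Qed.

Lemma cisM y k : cis (y * k%:R) = cis y ^+ k.
Proof.
elim: k => [|k IH]; first by rewrite mulr0 cis0 expr0.
by rewrite -natr1 mulrDr mulr1 cisD IH exprSr.
Qed.

Lemma cis2pi : cis (2 * pi) = 1.
Proof. by rewrite mulrC cisM cispi sqrrN expr1n. Qed.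

Definition polar x y : C := realC (expR x) * cis y.

Lemma polarD x x' y y' : polar (x + x') (y + y') = polar x y * polar x' y'.
Proof. by rewrite /polar expRD cisD realCM mulrACA. Qed.

Lemma cabs_polar x y : cabs (polar x y) = expR x.
Proof. by rewrite /polar cabsM cabs_realC cabs_cis mulr1 ger0_norm// expR_ge0. Qed.

Lemma is_derive_near (f : R -> R) (d : R) : is_derive (0 : R) 1 f d ->
  forall e, 0 < e -> exists2 r, 0 < r & forall h, `|h| < r -> `|f h - f 0 - d * h| <= e * `|h|.
Proof.
move=> fd e e0; have := @ex_derive _ _ _ _ _ _ _ fd; rewrite /derivable => hc.
have hl : (h^-1 *: (f (h *: 1 + 0) - f 0)) @[h --> 0^'] --> d.
  by have := hc; rewrite -[d](@derive_val _ _ _ _ _ _ _ fd).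
have /cvgrPdist_le/(_ e e0) := hl => /nbhs_ballP[r r0 hr].
exists r => // h hh; have [->|h0] := eqVneq h 0.
  by rewrite mulr0 subrr subr0 normr0 mulr0.
have := hr h; rewrite /ball/= sub0r normrN => /(_ hh h0).
rewrite addr0 -[h *: 1]/(h * 1) mulr1 => {}hr.
have -> : f h - f 0 - d * h = - ((d - h^-1 * (f h - f 0)) * h).
  by field.
by rewrite normrN normrM ler_wpM2r.
Qed.

Lemma polar_near0 e : 0 < e -> exists2 d : R, 0 < d & forall x y, `|x| < d -> `|y| < d ->
  cabs (polar x y - 1 - (realC x + ic * realC y)) <= e * (`|x| + `|y|).
Proof.
move=> e0; have [e1 [e10 e11 e18]] : exists e1, [/\ 0 < e1, e1 <= 1 & e1 <= e / 8].
  by exists (Num.min 1 (e / 8)); rewrite lt_min ltr01 divr_gt0// !ge_min !lexx orbT.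
have [d1 d10 h1] := is_derive_near (is_derive_expR (0 : R)) e10.
have [d2 d20 h2] := is_derive_near (is_derive_cos (0 : R)) e10.
have [d3 d30 h3] := is_derive_near (is_derive_sin (0 : R)) e10.
exists (Num.min (Num.min d1 e1) (Num.min d2 d3)).
  by rewrite !lt_min d10 e10 d20 d30.
move=> x y; rewrite !lt_min => /andP[/andP[x1 xe] _] /andP[_ /andP[y2 y3]].
have := h1 x x1; have := h2 y y2; have := h3 y y3.
rewrite expR0 cos0 sin0 ?oppr0 ?mul0r ?subr0 !mul1r addr0 => g3 g2 g1.
have nx := normr_ge0 x; have ny := normr_ge0 y.
have -> : polar x y - 1 - (realC x + ic * realC y) =
    realC (expR x - 1 - x) * cis y + (1 + realC x) * (realC (cos y - 1) + ic * realC (sin y - y)) +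
    realC x * ic * realC y.
  by rewrite /polar /cis !realCB realC1; ring.
have ci : cabs ic = 1 by rewrite /cabs/= expr0n add0r expr1n sqrtr1.
apply: le_trans (cabsD _ _) _; apply: le_trans (lerD (cabsD _ _) (lexx _)) _.
rewrite !cabsM cabs_cis mulr1 ci mulr1 !cabs_realC.
have m1 : cabs (1 + realC x) <= 2.
  by apply: le_trans (cabsD _ _) _; rewrite cabs1 cabs_realC; lra.
have m2 : cabs (realC (cos y - 1) + ic * realC (sin y - y)) <= 2 * (e1 * `|y|).
  by apply: le_trans (cabsD _ _) _; rewrite cabsM ci mul1r !cabs_realC; lra.
have m3 : cabs (1 + realC x) * cabs (realC (cos y - 1) + ic * realC (sin y - y)) <=
    2 * (2 * (e1 * `|y|)) by apply: ler_pM => //; exact: cabs_ge0.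
have m4 : `|x| * `|y| <= e1 * `|y| by rewrite ler_wpM2r// ltW.
have m5 : e1 * `|x| <= e / 8 * `|x| by rewrite ler_wpM2r.
have m6 : e1 * `|y| <= e / 8 * `|y| by rewrite ler_wpM2r.
have m7 : 0 <= e * `|x| by rewrite mulr_ge0// ltW.
have m8 : 0 <= e * `|y| by rewrite mulr_ge0// ltW.
lra.
Qed.

(** The scalars being complex, derivability in the direction [1] is complex
    differentiability. *)
Definition cdiff f z := derivable f z 1.

Lemma cdiff_near f z : cdiff f z -> exists D : C, forall e : R, 0 < e ->
  exists2 d : R, 0 < d & forall w, cabs (w - z) < d ->
    cabs (f w - f z - D * (w - z)) <= e * cabs (w - z).
Proof.
move=> fz; exists ('D_1 f z) => e e0.
have : (h^-1 *: (f (h *: 1 + z) - f z)) @[h --> 0^'] --> 'D_1 f z by exact: fz.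
move=> /(_ _ (nbhs_cabs_ball ('D_1 f z) e0)) /nbhs_cabsP[d d0 hd]; exists d => // w wz.
have [->|wz0] := eqVneq w z; first by rewrite !subrr mulr0 subr0 cabs0 mulr0.
have h0 : w - z != 0 by rewrite subr_eq0.
have /= := hd (w - z); rewrite subr0 => /(_ wz h0); rewrite -[(w - z) *: 1]/((w - z) * 1) mulr1 subrK => hw.
have -> : f w - f z - 'D_1 f z * (w - z) = ((w - z)^-1 *: (f w - f z) - 'D_1 f z) * (w - z).
  by rewrite mulrBl -[_ *: _]/(_ * _) mulrAC mulVf// mul1r.
by rewrite cabsM ler_wpM2r ?cabs_ge0// ltW.
Qed.

Lemma cdiff_continuous f z : cdiff f z -> {for z, continuous f}.
Proof. by move=> /derivable1_diffP/differentiable_continuous. Qed.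

(** The chain rule for [f] in logarithmic coordinates. *)
Lemma rdiff_polar f x y : cdiff f (polar x y) -> rdiff (fun s t => f (polar s t)) x y.
Proof.
move=> /cdiff_near[D hD]; set P := polar x y in hD *; exists (D * P) => e e0.
have P0 : 0 < cabs P by rewrite cabs_polar expR_gt0.
have D0 := cabs_ge0 D.
pose e1 := e / (4 * cabs P); have e10 : 0 < e1 by rewrite divr_gt0// mulr_gt0.
pose e2 := Num.min 1 (e / (2 * (cabs D + 1) * cabs P)).
have e20 : 0 < e2.
  by rewrite lt_min ltr01 divr_gt0// mulr_gt0// mulr_gt0// ltr_wpDl.
have [d1 d10 h1] := hD e1 e10; have [d2 d20 h2] := polar_near0 e20.
pose d := Num.min d2 (d1 / (4 * cabs P)).
exists d; first by rewrite lt_min d20 divr_gt0// mulr_gt0.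
move=> s t; rewrite !lt_min => /andP[s2 s1] /andP[t2 t1].
have ns := normr_ge0 (s - x); have nt := normr_ge0 (t - y).
have := h2 _ _ s2 t2; set W := _ - 1 - _; set L := _ + ic * _ => hW.
have E : polar s t - P = P * (L + W).
  have -> : polar s t = P * polar (s - x) (t - y).
    by rewrite /P -polarD; congr polar; ring.
  by rewrite /W /L; ring.
have ci : cabs ic = 1 by rewrite /cabs/= expr0n add0r expr1n sqrtr1.
have hL : cabs L <= `|s - x| + `|t - y|.
  by apply: le_trans (cabsD _ _) _; rewrite cabsM ci mul1r !cabs_realC.
have hW1 : cabs W <= `|s - x| + `|t - y|.
  apply: le_trans hW _; rewrite -[leRHS]mul1r ler_wpM2r ?addr_ge0//.
  by rewrite /e2 ge_min lexx.
have hE : cabs (polar s t - P) <= 2 * cabs P * (`|s - x| + `|t - y|).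
  rewrite E cabsM [2 * _]mulrC -mulrA; apply: ler_wpM2l; first exact: ltW.
  by apply: le_trans (cabsD _ _) _; lra.
have hd : cabs (polar s t - P) < d1.
  apply: le_lt_trans hE _; move: s1 t1; rewrite !ltr_pdivlMr ?mulr_gt0//; lra.
have -> : f (polar s t) - f P - D * P * L = (f (polar s t) - f P - D * (polar s t - P)) + D * P * W.
  by rewrite E; ring.
apply: le_trans (cabsD _ _) _; rewrite [cabs (_ * W)]cabsM [cabs (_ * P)]cabsM.
have k1 := le_trans (h1 _ hd) (ler_wpM2l (ltW e10) hE).
have k2 : cabs D * cabs P * cabs W <= cabs D * cabs P * (e2 * (`|s - x| + `|t - y|)).
  by apply: ler_wpM2l => //; rewrite mulr_ge0// ltW.
have k3 : cabs D * cabs P * e2 <= e / 2.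
  apply: le_trans (_ : (cabs D + 1) * cabs P * (e / (2 * (cabs D + 1) * cabs P)) <= _).
    apply: ler_pM; [by rewrite mulr_ge0// ltW|exact: ltW| |by rewrite ge_min lexx orbT].
    by rewrite ler_wpM2r ?lerDl// ltW.
  by rewrite le_eqVlt; apply/orP; left; apply/eqP; field; rewrite !gt_eqF// ltr_wpDl.
have k4 := ler_wpM2r (addr_ge0 ns nt) k3.
have k5 : e1 * (2 * cabs P * (`|s - x| + `|t - y|)) = e / 2 * (`|s - x| + `|t - y|).
  by rewrite /e1; field; rewrite gt_eqF.
rewrite k5 in k1; rewrite mulrA in k2; lra.
Qed.

End Polar.

(** * Averages over circles *)

Section CircleMeans.
Variable R : realType.
Local Notation C := (Cplx R).
Local Notation ic := ('i%C : C).
Implicit Types (x y rho : R) (z w : C) (f g : C -> C) (n m j : nat).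

Definition circ rho y : C := realC rho * cis y.

Lemma cabs_circ rho y : 0 <= rho -> cabs (circ rho y) = rho.
Proof. by move=> r0; rewrite /circ cabsM cabs_realC cabs_cis mulr1 ger0_norm. Qed.

Lemma circX rho y m : circ rho y ^+ m = realC (rho ^+ m) * cis (m%:R * y).
Proof. by rewrite /circ exprMn -realCX -cisM [y * _]mulrC. Qed.

Definition mean n f rho : C :=
  realC (2 * pi)^-1 * midsum n 0 (2 * pi) (fun y => f (circ rho y)).

Let pi20 : 0 < 2 * pi :> R. Proof. by rewrite mulr_gt0// pi_gt0. Qed.

Let pii0 : 0 <= (2 * pi)^-1 :> R. Proof. by rewrite invr_ge0 ltW. Qed.

Lemma eq_mean n f g rho : 0 <= rho -> (forall z, cabs z = rho -> f z = g z) ->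
  mean n f rho = mean n g rho.
Proof.
move=> r0 fg; congr (_ * midsum _ _ _ _); apply/funext => y.
by apply: fg; exact: cabs_circ.
Qed.

Lemma meanD n f g rho : mean n (fun z => f z + g z) rho = mean n f rho + mean n g rho.
Proof. by rewrite /mean midsumD mulrDr. Qed.

Lemma meanZ n (c : C) f rho : mean n (fun z => c * f z) rho = c * mean n f rho.
Proof. by rewrite /mean midsumZ mulrCA. Qed.

Lemma meanB n f g rho : mean n (fun z => f z - g z) rho = mean n f rho - mean n g rho.
Proof.
rewrite -[in RHS]mulN1r -meanZ -meanD; congr (_ * midsum _ _ _ _).
by apply/funext => y; rewrite mulN1r.
Qed.

Lemma mean_cst n (c : C) rho : mean n (fun=> c) rho = c.
Proof.
have := midsum_affine n 0 (2 * pi) c 0; rewrite mul0r addr0 => E.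
rewrite /mean (_ : (fun y => c) = fun t => c + 0 * realC t).
  by rewrite E mulrA -realCM mulVf ?mul1r// gt_eqF.
by apply/funext => t; rewrite mul0r addr0.
Qed.

Lemma mean_sum n (I : Type) (s : seq I) (F : I -> C -> C) rho :
  mean n (fun z => \sum_(i <- s) F i z) rho = \sum_(i <- s) mean n (F i) rho.
Proof.
elim: s => [|i s IH].
  rewrite big_nil -[RHS](mean_cst n 0 rho); congr mean.
  by apply/funext => z; rewrite big_nil.
rewrite big_cons -IH -meanD; congr mean.
by apply/funext => z; rewrite big_cons.
Qed.

Lemma mean_le n f rho M : 0 <= rho -> (forall z, cabs z = rho -> cabs (f z) <= M) ->
  cabs (mean n f rho) <= M.
Proof.
move=> r0 fM; rewrite /mean cabsM cabs_realC (ger0_norm pii0).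
rewrite ler_pdivrMl//; apply: midsum_le; first exact: ltW.
by move=> t _; apply: fM; exact: cabs_circ.
Qed.

Lemma mean0 n f : mean n f 0 = f 0.
Proof.
rewrite -[RHS](mean_cst n _ 0); apply: eq_mean => // z /eqP.
by rewrite cabs_eq0 => /eqP ->.
Qed.

Lemma midsum_cis0 n a h (c : R) i : (i < n)%N -> cis (c * h / 2 ^+ i.+1) = -1 :> C ->
  midsum n a h (fun t => cis (c * t)) = 0.
Proof.
elim: n a h i => [//|n IH] a h i iN hi.
rewrite (@midsum_character _ n a h _ (cis (c * (h / 2)))); last first.
  by move=> t; rewrite mulrDr cisD.
case: i iN hi => [|i]; first by rewrite expr1 mulrA => _ ->; rewrite subrr mul0r.
rewrite ltnS => iN hi; rewrite (IH a (h / 2) i iN) ?mulr0//.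
by rewrite -hi; congr cis; rewrite [in RHS]exprS invfM !mulrA.
Qed.

(** The [2^n] nodes form a coset of the roots of unity, on which the character with exponent
    [m - j] averages to [0] unless it is constant. *)
Lemma mean_monomial n m j rho : 0 < rho -> ~~ (m == j %[mod 2 ^ n])%N ->
  mean n (fun z => z ^+ m / z ^+ j) rho = 0.
Proof.
move=> r0 mj; pose c : R := m%:R - j%:R.
have E y : circ rho y ^+ m / circ rho y ^+ j = realC (rho ^+ m / rho ^+ j) * cis (c * y).
  rewrite !circX /c mulrBl cisD cisN realCM realCV invfM.
  by rewrite mulrACA.
rewrite /mean (_ : (fun y => _) = fun y => realC (rho ^+ m / rho ^+ j) * cis (c * y));
  last by apply/funext => y; exact: E.
suff [i iN hi] : exists2 i, (i < n)%N & cis (c * (2 * pi) / 2 ^+ i.+1) = -1 :> C.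
  by rewrite midsumZ (midsum_cis0 _ iN hi) !mulr0.
have key d : (0 < d)%N -> ~~ (2 ^ n %| d)%N ->
    exists2 i, (i < n)%N & cis (d%:R * (2 * pi) / 2 ^+ i.+1) = -1 :> C.
  move=> d0 dn; have [u] := pfactor_coprime (isT : prime 2) d0.
  rewrite coprime2n => ou dE; exists (logn 2 d).
    by rewrite ltnNge; apply: contra dn => h; rewrite dE dvdn_mull// dvdn_exp2l.
  set i := logn 2 d in dE *.
  have -> : d%:R * (2 * pi) / 2 ^+ i.+1 = pi * u%:R :> R.
    rewrite dE natrM natrX exprS; field.
    by rewrite expf_neq0.
  by rewrite cisM cispi -signr_odd ou.
have [jm|mj'] := leqP j m.
  rewrite /c -natrB//; apply: key.
    by rewrite subn_gt0 ltn_neqAle jm andbT; apply: contra mj => /eqP ->.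
  by rewrite -eqn_mod_dvd.
have [||i iN hi] := key (j - m)%N.
- by rewrite subn_gt0.
- by rewrite -eqn_mod_dvd 1?ltnW// eq_sym.
exists i => //; rewrite -[RHS]invrK invrN invr1 -[in RHS]hi -cisN; congr cis.
rewrite /c natrB; last exact: ltnW.
by field; rewrite expf_neq0.
Qed.

Lemma mean_monomial1 n m rho : 0 < rho -> mean n (fun z => z ^+ m / z ^+ m) rho = 1.
Proof.
move=> r0; rewrite -[RHS](mean_cst n 1 rho); apply: eq_mean; first exact: ltW.
move=> z zr; rewrite mulfV// expf_neq0// -cabs_eq0 zr gt_eqF//.
Qed.

Lemma cvg0_cabsP (u : nat -> C) : u @ \oo --> (0 : C) <->
  forall e, 0 < e -> exists N, forall n, (N <= n)%N -> cabs (u n) <= e.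
Proof.
split => [/cvg_cabsP h e e0|h]; [have [N hN] := h e e0|apply/cvg_cabsP => e e0].
  by exists N => n Nn; have := hN n Nn; rewrite subr0 => /ltW.
have [N hN] := h (e / 2) ltac:(by rewrite divr_gt0); exists N => n Nn.
by rewrite subr0; have := hN n Nn; lra.
Qed.

(** By Goursat's argument on a rectangle in the coordinate [log z]; the horizontal sides
    cancel by periodicity. *)
Lemma mean_annulus f r1 r2 : 0 < r1 -> r1 < r2 ->
  (forall z, r1 <= cabs z <= r2 -> cdiff f z) ->
  forall e, 0 < e -> exists N, forall n, (N <= n)%N ->
    cabs (mean n f r2 - mean n f r1) <= e.
Proof.
move=> r10 r12 df e e0; have r20 := lt_trans r10 r12.
pose F x y := f (polar x y); pose a := ln r2 - ln r1.
have a0 : 0 < a by rewrite subr_gt0 ltr_ln ?posrE.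
have dF s t : ln r1 <= s <= ln r1 + a -> 0 <= t <= 0 + 2 * pi -> rdiff F s t.
  move=> /andP[s1 s2] _; apply: rdiff_polar; apply: df; rewrite cabs_polar.
  rewrite -[r1](lnK (r10 : r1 \is Num.pos)) -[r2](lnK (r20 : r2 \is Num.pos)) !ler_expR.
  by rewrite s1 /=; move: s2; rewrite /a addrC subrK.
have [N hN] := goursat a0 pi20 dF (mulr_gt0 pi20 e0).
exists N => n Nn; have := hN n Nn; rewrite /bdsum.
have -> : F^~ (0 + 2 * pi) = F^~ 0.
  by apply/funext => x; rewrite /F /polar cisD cis2pi mulr1.
rewrite subrr addr0 (_ : ln r1 + a = ln r2); last by rewrite /a addrC subrK.
have FE r : 0 < r -> F (ln r) = fun y => f (circ r y).
  by move=> r0; apply/funext => y; rewrite /F /polar lnK.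
rewrite !FE// cabsM (_ : cabs ic = 1) ?mul1r; last first.
  by rewrite /cabs/= expr0n add0r expr1n sqrtr1.
move=> h; rewrite /mean -mulrBr cabsM cabs_realC (ger0_norm pii0).
by rewrite ler_pdivrMl//.
Qed.

(** Uniform continuity on the circle, by compactness. The bound does not depend on the
    number of nodes, so the average may be carried across a circle on which [f] is only
    continuous. *)
Lemma mean_radius f s : 0 <= s -> (forall z, cabs z = s -> {for z, continuous f}) ->
  forall e, 0 < e -> exists2 d : R, 0 < d & forall n r, 0 <= r -> `|r - s| < d ->
    cabs (mean n f r - mean n f s) <= e.
Proof.
move=> s0 cf e e0.
have cK : compact [set z : C | cabs z = s].
  apply: (subclosed_compact _ (@compact_cdisc R 0 s)).
    exact: (closed_comp (fun z _ => @cabs_continuous R z) (@closed_eq R s)).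
  by move=> z zs; change (cabs (z - 0) <= s); rewrite subr0 (zs : cabs z = s).
move: cK => /compact_near_coveringP cK.
pose P (d : R) z := forall w, cabs (w - z) < d -> cabs (f w - f z) <= e.
have : \forall d \near nbhs (0 : R), [set z : C | cabs z = s] `<=` P d.
  apply: cK => z zs; have e20 : 0 < e / 2 by rewrite divr_gt0.
  have /nbhs_cabsP[d d0 hd] := cf z zs _ (nbhs_cabs_ball (f z) e20).
  have d20 : 0 < d / 2 by rewrite divr_gt0.
  exists ([set w | cabs (w - z) < d / 2], [set t : R | `|t| < d / 2]) => /=.
    split; first exact: nbhs_cabs_ball.
    by apply/nbhs_ballP; exists (d / 2) => // t; rewrite /ball/= sub0r normrN.
  move=> [z' t] /= [zz' td] w wz'.
  have h1 : cabs (f z' - f z) < e / 2 by apply: hd; lra.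
  have h2 : cabs (f w - f z) < e / 2.
    apply: hd; apply: le_lt_trans (_ : cabs (w - z') + cabs (z' - z) < d).
      by apply: le_trans (cabsD _ _); rewrite addrA subrK.
    have := ler_norm t; lra.
  apply: ltW; apply: le_lt_trans (_ : cabs (f w - f z) + cabs (f z - f z') < e).
    by apply: le_trans (cabsD _ _); rewrite addrA subrK.
  rewrite [cabs (f z - _)]cabsB; lra.
move=> /nbhs_ballP[d d0 hd]; exists (d / 2); first by rewrite divr_gt0.
move=> n r r0 rs; rewrite /mean -mulrBr cabsM cabs_realC (ger0_norm pii0).
rewrite ler_pdivrMl//.
rewrite -[X in _ - X]mul1r -mulNr -midsumZ -midsumD; apply: midsum_le; first exact: ltW.
move=> t _; rewrite mulN1r.
have hb : ball (0 : R) d (d / 2).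
  have {}d0 : 0 < d := d0; rewrite /ball/= sub0r normrN gtr0_norm; last exact: divr_gt0.
  lra.
apply: (hd _ hb (circ s t)); first exact: cabs_circ.
by rewrite /circ -mulrBl -realCB cabsM cabs_cis mulr1 cabs_realC.
Qed.

(** The mean value property. The exceptional circle is there for difference quotients, which
    are not known to be differentiable at the point where the denominator vanishes. *)
Lemma mean_center f s rho : 0 < s -> s < rho ->
  (forall z, cabs z <= rho -> {for z, continuous f}) ->
  (forall z, cabs z <= rho -> z != 0 -> cabs z != s -> cdiff f z) ->
  forall e, 0 < e -> exists N, forall n, (N <= n)%N -> cabs (mean n f rho - f 0) <= e.
Proof.
move=> s0 srho cf df e e0; have e5 : 0 < e / 5 by rewrite divr_gt0.
have [|d d0 hd] := @mean_radius f s (ltW s0) _ _ e5.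
  by move=> z zs; apply: cf; rewrite zs ltW.
have [|c c0 hc] := @mean_radius f 0 (lexx _) _ _ e5.
  by move=> z z0; apply: cf; rewrite z0 ltW// (lt_trans s0).
have [t [t0 td ts trho]] : exists t, [/\ 0 < t, t < d, s < rho - t & 2 * t < s].
  exists (Num.min (d / 2) (Num.min ((rho - s) / 2) (s / 4))).
  have h1 : 0 < rho - s by lra.
  have h : Num.min (d / 2) (Num.min ((rho - s) / 2) (s / 4)) <= d / 2 by rewrite ge_min lexx.
  have h' : Num.min (d / 2) (Num.min ((rho - s) / 2) (s / 4)) <= (rho - s) / 2.
    by rewrite !ge_min lexx orbT.
  have h'' : Num.min (d / 2) (Num.min ((rho - s) / 2) (s / 4)) <= s / 4.
    by rewrite !ge_min lexx !orbT.
  by split; [rewrite !lt_min !divr_gt0//|lra..].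
have [b [b0 bc bt]] : exists b, [/\ 0 < b, b < c & b < s - t].
  exists (Num.min (c / 2) (s / 4)).
  have h : Num.min (c / 2) (s / 4) <= c / 2 by rewrite ge_min lexx.
  have h' : Num.min (c / 2) (s / 4) <= s / 4 by rewrite ge_min lexx orbT.
  by split; [rewrite !lt_min !divr_gt0//|lra..].
have [||z /andP[z1 z2]|N1 h1] := @mean_annulus f (s + t) rho _ _ _ _ e5; [lra|lra| |].
  apply: df => //; last by rewrite gt_eqF//; lra.
  by rewrite -cabs_eq0 gt_eqF//; lra.
have [||z /andP[z1 z2]|N2 h2] := @mean_annulus f b (s - t) _ _ _ _ e5; [lra|lra| |].
  apply: df; first by lra.
    by rewrite -cabs_eq0 gt_eqF//; lra.
  by rewrite lt_eqF//; lra.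
(* From [rho] to [s + t], across the circle to [s - t], on to [b], and from there to the centre. *)
exists (maxn N1 N2) => n; rewrite geq_max => /andP[n1 n2].
have g1 := h1 n n1; have g2 := h2 n n2.
have g3 := hd n (s + t) ltac:(lra) ltac:(by rewrite addrC addKr gtr0_norm).
have g4 := hd n (s - t) ltac:(lra) ltac:(by rewrite addrC addKr normrN gtr0_norm).
have g5 := hc n b (ltW b0) ltac:(by rewrite subr0 gtr0_norm).
rewrite mean0 in g5; rewrite cabsB in g4.
have -> : mean n f rho - f 0 = (mean n f rho - mean n f (s + t)) +
    (mean n f (s + t) - mean n f s) + (mean n f s - mean n f (s - t)) +
    (mean n f (s - t) - mean n f b) + (mean n f b - f 0) by ring.
apply: le_trans (cabsD _ _) _; apply: le_trans (lerD (cabsD _ _) (lexx _)) _.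
apply: le_trans (lerD (lerD (cabsD _ _) (lexx _)) (lexx _)) _.
apply: le_trans (lerD (lerD (lerD (cabsD _ _) (lexx _)) (lexx _)) (lexx _)) _.
lra.
Qed.

End CircleMeans.

(** * Discrete Taylor polynomials and Cauchy's formula *)

Section TaylorPolynomials.
Variable R : realType.
Local Notation C := (Cplx R).
Implicit Types (r rho : R) (z w : C) (f g : C -> C) (n m j : nat).

Lemma compact_cabs_bounded (T : topologicalType) (K : set T) (f : T -> C) : compact K ->
  (forall x, K x -> {for x, continuous f}) -> exists M, forall x, K x -> cabs (f x) <= M.
Proof.
move=> /compact_near_coveringP cK cf.
have [M [_ hM]] : \forall M \near +oo, K `<=` [set z | cabs (f z) <= M].
  apply: cK => z Kz; have h1 := cf z Kz _ (nbhs_cabs_ball (f z) (@ltr01 R)).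
  exists ([set w | cabs (f w - f z) < 1], [set M : R | cabs (f z) + 1 < M]) => /=.
    by split; [exact: h1|exists (cabs (f z) + 1); split => //; exact: num_real].
  move=> [w M] /= [h h'].
  have : cabs (f w) <= cabs (f w - f z) + cabs (f z).
    by apply: le_trans (cabsD (f w - f z) (f z)); rewrite subrK.
  move: h h'; set a := cabs (f w); set b := cabs (f w - f z); lra.
by exists (M + 1) => z Kz; apply: (hM (M + 1)) => //; rewrite ltrDl.
Qed.

(** The Taylor polynomial of degree less than [2 ^ n], its coefficients computed by averages
    over [2 ^ n] points of a circle. *)
Definition tayl n f rho z : C := \sum_(m < 2 ^ n) z ^+ m * mean n (fun w => f w / w ^+ m) rho.

Lemma taylE n f rho z :
  tayl n f rho z = mean n (fun w => f w * \sum_(m < 2 ^ n) (z / w) ^+ m) rho.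
Proof.
rewrite (_ : (fun w => _) = fun w => \sum_(m < 2 ^ n) z ^+ m * (f w / w ^+ m)).
  by rewrite mean_sum; apply: eq_bigr => m _; rewrite meanZ.
apply/funext => w; rewrite mulr_sumr; apply: eq_bigr => m _.
by rewrite exprMn exprVn mulrCA.
Qed.

Lemma cvg_expr2n (t : R) : 0 <= t < 1 -> t ^+ (2 ^ n) @[n --> \oo] --> (0 : R).
Proof.
move=> /andP[t0 t1]; have ht : t ^+ n @[n --> \oo] --> (0 : R).
  by apply: cvg_expr; rewrite ger0_norm.
apply: (squeeze_cvgr _ (cvg_cst (0 : R)) ht).
apply: nearW => n; rewrite exprn_ge0//=; apply: ler_wiXn2l => //; first exact: ltW.
by apply: ltnW; exact: ltn_expl.
Qed.

Lemma cdiff_quotient f z0 z : z != z0 -> cdiff f z ->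
  cdiff (fun w => w * (f w - f z0) / (w - z0)) z.
Proof.
move=> zz0 fz.
have h0 : derivable (cst (f z0) : C -> C) z 1 by exact: derivable_cst.
have h0' : derivable (cst z0 : C -> C) z 1 by exact: derivable_cst.
have hid : derivable (id : C -> C) z 1 by exact: derivable_id.
have hB := derivableB fz h0; have hV := derivableB hid h0'.
have hM := derivableM hid hB.
have hI := @derivableV C C (id - cst z0) z 1 _ hV.
have {}hI := hI ltac:(by rewrite -[(id - cst z0) z]/(z - z0) subr_eq0).
exact: (derivableM hM hI).
Qed.

(** Cauchy's formula. The function [w (f w - f z0) / (w - z0)] vanishes at [0], so its
    average over the circle tends to [0]. *)
Lemma tayl_cvg f rho z0 : (forall z, cabs z <= rho -> cdiff f z) -> cabs z0 < rho ->
  tayl n f rho z0 @[n --> \oo] --> f z0.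
Proof.
move=> df z0rho; have rho0 : 0 < rho by apply: le_lt_trans z0rho; exact: cabs_ge0.
have [D hD] := cdiff_near (df z0 (ltW z0rho)).
pose k z := if z == z0 then z0 * D else z * (f z - f z0) / (z - z0).
have kd z : z != z0 -> cabs z <= rho -> cdiff k z.
  move=> zz0 zr; apply: (@near_eq_derivable _ _ _ (fun w => w * (f w - f z0) / (w - z0))).
  - have d0 : 0 < cabs (z - z0) by rewrite cabs_gt0// subr_eq0.
    apply: filterS (nbhs_cabs_ball z d0) => w /= hw; rewrite /k.
    case: eqVneq hw => [->|//]; by rewrite cabsB ltxx.
  - exact: cdiff_quotient (df z zr).
(* At [z0] itself, [k] is only known to be continuous. *)
have kc z : cabs z <= rho -> {for z, continuous k}.
  move=> zr; have [->|zz0] := eqVneq z z0; last exact/cdiff_continuous/kd.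
  move=> W /nbhs_cabsP[e e0 eW].
  have Z0 := cabs_ge0 z0; have D0 := cabs_ge0 D.
  have [d d0 hd] := hD (e / (2 * (cabs z0 + 1))) ltac:(by apply: divr_gt0 => //; lra).
  apply/nbhs_cabsP; exists (Num.min (Num.min d 1) (e / (2 * (cabs D + 1)))).
    by rewrite !lt_min d0 ltr01 divr_gt0//; lra.
  move=> w; rewrite !lt_min => /andP[/andP[wd w1] wD]; apply: eW; rewrite /k eqxx.
  case: eqVneq => [_|wz0]; first by rewrite subrr cabs0.
  have wz0' : w - z0 != 0 by rewrite subr_eq0.
  have -> : w * (f w - f z0) / (w - z0) - z0 * D =
      (w * ((f w - f z0 - D * (w - z0)) / (w - z0))) + (w - z0) * D by field.
  apply: le_lt_trans (cabsD _ _) _; rewrite !cabsM cabsV.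
  have P0 : 0 < cabs (w - z0) by exact: cabs_gt0.
  have q1 : cabs (f w - f z0 - D * (w - z0)) / cabs (w - z0) <= e / (2 * (cabs z0 + 1)).
    by rewrite ler_pdivrMr//; exact: hd.
  have q2 : cabs w <= cabs z0 + 1.
    apply: le_trans (_ : cabs (w - z0) + cabs z0 <= _); last by lra.
    by apply: le_trans (cabsD _ _); rewrite subrK.
  have q3 : cabs w * (cabs (f w - f z0 - D * (w - z0)) / cabs (w - z0)) <=
      (cabs z0 + 1) * (e / (2 * (cabs z0 + 1))).
    by apply: ler_pM => //; rewrite ?cabs_ge0// divr_ge0 ?cabs_ge0.
  have q4 : (cabs z0 + 1) * (e / (2 * (cabs z0 + 1))) = e / 2 by field; rewrite gt_eqF//; lra.
  have q5 : cabs (w - z0) * cabs D < e / 2.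
    move: wD; rewrite ltr_pdivlMr; last by lra.
    by have := mulr_ge0 (ltW P0) D0; lra.
  lra.
have k0 : k 0 = 0 by rewrite /k; case: eqVneq => [<-|_]; rewrite !mul0r.
have [s [s0 srho sz]] : exists s, [/\ 0 < s, s < rho & forall z, z != 0 -> cabs z != s -> z != z0].
  have [->|z00] := eqVneq z0 0; first by exists (rho / 2); split => //; lra.
  exists (cabs z0); split; [exact: cabs_gt0|exact: z0rho|].
  by move=> z _; apply: contra => /eqP ->.
have hk : mean n k rho @[n --> \oo] --> (0 : C).
  apply/cvg0_cabsP => e e0.
  have [z zr zn zs|N hN] := mean_center s0 srho kc _ e0; first by apply: kd => //; exact: sz zs.
  by exists N => n Nn; have := hN n Nn; rewrite k0 subr0.
have [M hM] : exists M, forall z, cabs z <= rho -> cabs (k z) <= M.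
  have [|M hM] := @compact_cabs_bounded _ _ k (@compact_cdisc R 0 rho).
    by move=> z zr; apply: kc; rewrite -[z]subr0.
  by exists M => z zr; apply: hM; change (cabs (z - 0) <= rho); rewrite subr0.
have M0 : 0 <= M by apply: le_trans (hM 0 _); rewrite ?cabs_ge0// cabs0 ltW.
pose t := cabs z0 / rho.
have t01 : 0 <= t < 1 by rewrite divr_ge0 ?cabs_ge0 ?ltW//= ltr_pdivrMr// mul1r.
have htail : mean n (fun w => k w * (z0 / w) ^+ (2 ^ n)) rho @[n --> \oo] --> (0 : C).
  apply/cvg0_cabsP => e e0.
  have /cvgrPdist_le/(_ (e / (M + 1))) := cvg_expr2n t01.
  rewrite divr_gt0 ?ltr_wpDl// => /(_ isT)[N _ hN]; exists N => n Nn.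
  have := hN n Nn; rewrite /= sub0r normrN ger0_norm ?exprn_ge0//; last by case/andP: t01.
  rewrite ler_pdivlMr ?ltr_wpDl// => ht.
  apply: (@mean_le _ _ _ _ _ (ltW rho0)) => z zr; rewrite cabsM cabsX cabsM cabsV zr -/t.
  have := hM z; rewrite zr le_refl => /(_ isT) h.
  apply: le_trans ht; rewrite mulrC ler_wpM2l ?exprn_ge0//; first by case/andP: t01.
  by apply: le_trans h _; rewrite lerDl.
have E n : tayl n f rho z0 =
    mean n k rho - mean n (fun w => k w * (z0 / w) ^+ (2 ^ n)) rho + f z0.
  rewrite taylE -meanB -[X in _ + X](mulr1 (f z0)).
  have -> : 1 = mean n (fun w => \sum_(m < 2 ^ n) (z0 / w) ^+ m) rho.
    rewrite (_ : (fun w => _) = fun w => \sum_(m < 2 ^ n) z0 ^+ m * (w ^+ 0 / w ^+ m)).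
      rewrite mean_sum -(prednK (expn_gt0 2 n : 0 < 2 ^ n)%N) big_ord_recl.
      rewrite meanZ mean_monomial1// mulr1 expr0 big1 ?addr0// => m _.
      rewrite meanZ mean_monomial ?mulr0// mod0n modn_small//= .
      by have := ltn_ord m; rewrite -ltnS prednK// expn_gt0.
    apply/funext => w; apply: eq_bigr => m _.
    by rewrite exprMn exprVn expr0 mul1r.
  rewrite -meanZ -meanD; apply: eq_mean; first exact: ltW.
  move=> w wr; have w0 : w != 0 by rewrite -cabs_eq0 wr gt_eqF.
  have wz0 : w - z0 != 0.
    by rewrite subr_eq0; apply: contraTneq z0rho => <-; rewrite wr ltxx.
  have G : (w - z0) * \sum_(m < 2 ^ n) (z0 / w) ^+ m = w * (1 - (z0 / w) ^+ (2 ^ n)).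
    rewrite -[1](expr1n _ (2 ^ n)) subrXX; under [in RHS]eq_bigr do rewrite expr1n mul1r.
    by rewrite mulrA mulrBr mulr1 mulrCA mulfV ?mulr1.
  have wz : w != z0 by rewrite -subr_eq0.
  have -> : k w = w * (f w - f z0) / (w - z0) by rewrite /k (negbTE wz).
  apply: (mulfI wz0); move: G; set S := \sum_(m < _) _; set U := (z0 / w) ^+ _ => G.
  have h c : (w - z0) * (c * S) = c * (w * (1 - U)) by rewrite mulrCA G.
  rewrite h [RHS]mulrDr h.
  by field.
rewrite (_ : (fun n => tayl n f rho z0) = fun n =>
    mean n k rho - mean n (fun w => k w * (z0 / w) ^+ (2 ^ n)) rho + f z0); last exact/funext.
rewrite -[X in _ --> X]add0r -[X in _ --> X + _](subr0 0).
by apply: cvgD; [apply: cvgB|exact: cvg_cst].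
Qed.

End TaylorPolynomials.

Section TaylorError.
Variable R : realType.
Local Notation C := (Cplx R).
Implicit Types (r rho : R) (z w : C) (f g : C -> C) (n m j : nat).

Lemma midsum_cvg n (a h : R) (g : nat -> R -> C) (l : R -> C) :
  (forall t, g M t @[M --> \oo] --> l t) ->
  midsum n a h (g M) @[M --> \oo] --> midsum n a h l.
Proof.
move=> gl; elim: n a h => [|n IH] a h.
  rewrite midsum0 (_ : (fun M => _) = fun M => realC h * g M (a + h / 2)) //.
  by apply: (@cvgM C); [exact: cvg_cst|exact: gl].
rewrite midsumS (_ : (fun M => _) = fun M => midsum n a (h / 2) (g M) +
  midsum n (a + h / 2) (h / 2) (g M)) //.
by apply: (@cvgD C C); exact: IH.
Qed.

Lemma mean_cvg n r (g : nat -> C -> C) (l : C -> C) : 0 <= r ->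
  (forall z, cabs z = r -> g M z @[M --> \oo] --> l z) ->
  mean n (g M) r @[M --> \oo] --> mean n l r.
Proof.
move=> r0 gl; apply: (@cvgM C); first exact: cvg_cst.
by apply: (@midsum_cvg _ _ _ (fun M y => g M (circ r y)) (fun y => l (circ r y))) => y; apply: gl; exact: cabs_circ.
Qed.

Lemma tayl_cvg_fun n r z (g : nat -> C -> C) (l : C -> C) : 0 <= r ->
  (forall z, cabs z = r -> g M z @[M --> \oo] --> l z) ->
  tayl n (g M) r z @[M --> \oo] --> tayl n l r z.
Proof.
move=> r0 gl; apply: (@cvg_nsum C C _ _ _ _ _ _
  (fun (m : 'I_(2 ^ n)) M => z ^+ m * mean n (fun w => g M w / w ^+ m) r)
  (fun (m : 'I_(2 ^ n)) => z ^+ m * mean n (fun w => l w / w ^+ m) r)) => m.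
apply: (@cvgM C); first exact: cvg_cst.
have h w (wr : cabs w = r) : g M w / w ^+ m @[M --> \oo] --> l w / w ^+ m.
  exact: (@cvgM C _ _ _ (fun M => g M w) (fun=> (w ^+ m)^-1) _ _ (gl w wr) (cvg_cst _)).
exact: (@mean_cvg n r (fun M w => g M w / w ^+ m) (fun w => l w / w ^+ m) r0 h).
Qed.

Lemma tayl_sum n r z K (c : nat -> C) (F : nat -> C -> C) :
  tayl n (fun w => \sum_(m < K) c m * F m w) r z = \sum_(m < K) c m * tayl n (F m) r z.
Proof.
rewrite /tayl; under [RHS]eq_bigr do rewrite mulr_sumr.
rewrite exchange_big/=; apply: eq_bigr => j _.
rewrite (_ : (fun w => _) = fun w => \sum_(m < K) c m * (F m w / w ^+ j)).
  rewrite mean_sum mulr_sumr; apply: eq_bigr => m _.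
  by rewrite meanZ mulrCA.
by apply/funext => w; rewrite mulr_suml; apply: eq_bigr => m _; rewrite mulrA.
Qed.

(** Aliasing: the nodes do not tell apart exponents that agree modulo [2 ^ n]. *)
Lemma tayl_monomial_mod n m r z : 0 < r ->
  tayl n (fun w => w ^+ m) r z =
  z ^+ (m %% 2 ^ n) * mean n (fun w => w ^+ m / w ^+ (m %% 2 ^ n)) r.
Proof.
move=> r0; have mN : (m %% 2 ^ n < 2 ^ n)%N by rewrite ltn_mod expn_gt0.
rewrite /tayl (bigD1 (Ordinal mN))//= big1 ?addr0// => j jm.
rewrite mean_monomial ?mulr0// [(j %% _)%N]modn_small//.
by apply: contra jm => /eqP jm; apply/eqP; apply: val_inj; rewrite /= jm.
Qed.

Lemma tayl_monomial n m r z : 0 < r -> (m < 2 ^ n)%N -> tayl n (fun w => w ^+ m) r z = z ^+ m.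
Proof. by move=> r0 mn; rewrite tayl_monomial_mod// modn_small// mean_monomial1// mulr1. Qed.

Lemma tayl_monomial_le n m r z : 0 < r -> cabs z <= r ->
  cabs (tayl n (fun w => w ^+ m) r z) <= r ^+ m.
Proof.
move=> r0 zr; rewrite tayl_monomial_mod// cabsM cabsX.
have mm : (m %% 2 ^ n <= m)%N by exact: leq_mod.
have -> : r ^+ m = r ^+ (m %% 2 ^ n) * (r ^+ m / r ^+ (m %% 2 ^ n)).
  by rewrite mulrCA mulfV ?mulr1// expf_neq0// gt_eqF.
apply: ler_pM; [by rewrite exprn_ge0// cabs_ge0|exact: cabs_ge0| |].
  by apply: lerXn2r; rewrite ?nnegrE ?cabs_ge0// ltW.
apply: mean_le; first exact: ltW.
by move=> w wr; rewrite cabsM cabsV !cabsX wr.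
Qed.

Lemma geometric_tail (t : R) (N K : nat) : 0 <= t < 1 ->
  \sum_(m < K | (N <= m)%N) t ^+ m <= t ^+ N / (1 - t).
Proof.
move=> /andP[t0 t1]; rewrite ler_pdivlMr ?subr_gt0//.
suff : (\sum_(m < K | (N <= m)%N) t ^+ m) * (1 - t) + t ^+ maxn N K = t ^+ N.
  by have := exprn_ge0 (maxn N K) t0; lra.
elim: K => [|K IH]; first by rewrite big_ord0 mul0r add0r maxn0.
rewrite (big_mkcond (fun m : 'I_K.+1 => (N <= m)%N)) big_ord_recr -big_mkcond/=.
have [NK|KN] := leqP N K.
  rewrite -IH (maxn_idPr NK) (maxn_idPr (leqW NK)) exprS; ring.
by rewrite addr0 (maxn_idPl KN); move: IH; rewrite (maxn_idPl (ltnW KN)).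
Qed.

(** On [|z| <= r], the discrete Taylor polynomial of a power series whose coefficients obey
    Cauchy's estimates of radius [rho] differs from the series only in degree at least [2 ^
    n]. *)
Lemma tayl_error f (S r rho : R) n z : 0 < r -> r < rho ->
  (forall w, cabs w <= rho -> cdiff f w) -> (forall w, cabs w = rho -> cabs (f w) <= S) ->
  cabs z <= r ->
  cabs (tayl n f r z - f z) <= 2 * S * ((r / rho) ^+ (2 ^ n) / (1 - r / rho)).
Proof.
move=> r0 rrho df fS zr; have rho0 := lt_trans r0 rrho.
have S0 : 0 <= S by apply: le_trans (fS (realC rho) _); rewrite ?cabs_ge0// cabs_realC gtr0_norm.
pose P M w := tayl M f rho w.
have Pf w : cabs w <= r -> P M w @[M --> \oo] --> f w.
  by move=> wr; apply: tayl_cvg => //; exact: le_lt_trans rrho.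
have tPf := @tayl_cvg_fun n r z P f (ltW r0) (fun w wr => Pf w (eq_ind_r (fun t => t <= r) (lexx r) wr)).
have t01 : 0 <= r / rho < 1.
  by rewrite divr_ge0 ?ltW//= ltr_pdivrMr// mul1r.
have key M : cabs (tayl n (P M) r z - P M z) <= 2 * S * ((r / rho) ^+ (2 ^ n) / (1 - r / rho)).
  pose c m := mean M (fun w => f w / w ^+ m) rho.
  have cS m : cabs (c m) <= S / rho ^+ m.
    apply: mean_le; first exact: ltW.
    move=> w wr; rewrite cabsM cabsV cabsX wr ler_wpM2r ?fS//.
    by rewrite invr_ge0 exprn_ge0 ?ltW.
  have PE w : P M w = \sum_(m < 2 ^ M) c m * w ^+ m.
    by apply: eq_bigr => m _; rewrite mulrC.
  rewrite (_ : P M = fun w => \sum_(m < 2 ^ M) c m * w ^+ m); last exact/funext.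
  rewrite (tayl_sum n r z (2 ^ M) c (fun m w => w ^+ m)) -sumrB.
  apply: le_trans (cabs_sum _ _ _) _.
  apply: le_trans (_ : \sum_(m < 2 ^ M | (2 ^ n <= m)%N) 2 * S * (r / rho) ^+ m <= _).
    rewrite [leRHS]big_mkcond; apply: ler_sum => m _.
    have [nm|mn] := leqP (2 ^ n) m; last by rewrite tayl_monomial// subrr cabs0.
    rewrite -mulrBr cabsM.
    have h : cabs (tayl n (fun w => w ^+ m) r z - z ^+ m) <= 2 * r ^+ m.
      rewrite [2 * _]mulr_natl mulr2n; apply: le_trans (cabsD _ _) _.
      rewrite cabsN cabsX; apply: lerD; first exact: tayl_monomial_le.
      by apply: lerXn2r; rewrite ?nnegrE ?cabs_ge0// ltW.
    apply: le_trans (ler_pM (cabs_ge0 _) (cabs_ge0 _) (cS m) h) _.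
    rewrite expr_div_n le_eqVlt; apply/orP; left; apply/eqP.
    by field; rewrite expf_neq0// gt_eqF.
  rewrite -mulr_sumr ler_wpM2l ?mulr_ge0//.
  exact: geometric_tail.
apply/ler_addgt0Pr => e e0; have e20 : 0 < e / 2 by rewrite divr_gt0.
have /cvg_cabsP/(_ _ e20)[N1 h1] := tPf.
have /cvg_cabsP/(_ _ e20)[N2 h2] := Pf z zr.
pose M := maxn N1 N2; have g1 := h1 M (leq_maxl _ _); have g2 := h2 M (leq_maxr _ _).
have -> : tayl n f r z - f z = (tayl n f r z - tayl n (P M) r z) +
  (tayl n (P M) r z - P M z) + (P M z - f z) by ring.
apply: le_trans (cabsD _ _) _; apply: le_trans (lerD (cabsD _ _) (lexx _)) _.
rewrite cabsB in g1; have := key M; lra.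
Qed.

End TaylorError.

(** * Polynomials on polydiscs *)

Section Kronecker.

Lemma base_expansion_inj n (B : nat) (k l : 'I_n -> nat) :
  (forall i, k i < B)%N -> (forall i, l i < B)%N ->
  (\sum_i k i * B ^ i = \sum_i l i * B ^ i)%N -> k =1 l.
Proof.
elim: n k l => [|n IH] k l kB lB E i; first by case: i.
have S f : (\sum_(i < n.+1) f i * B ^ i =
    (\sum_(i < n) f (lift ord0 i) * B ^ i) * B + f ord0)%N.
  rewrite big_ord_recl expn0 muln1 addnC big_distrl/=; congr (_ + _)%N.
  by apply: eq_bigr => j _; rewrite /bump/= add1n expnSr mulnA.
have B0 : (0 < B)%N by apply: leq_ltn_trans (kB ord0).
move: E; rewrite !S => E.
have E0 : k ord0 = l ord0.
  by have := congr1 (modn^~ B) E; rewrite !modnMDl !modn_small.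
have [j ->|->] := unliftP ord0 i; last by [].
apply: (IH (fun j => k (lift ord0 j)) (fun j => l (lift ord0 j))) => //.
by move: E; rewrite E0 => /addIn/eqP; rewrite eqn_pmul2r// => /eqP.
Qed.

End Kronecker.

Section PolynomialFunctions.
Variables (R : realType) (n : nat).
Local Notation C := (Cplx R).
Local Notation V := 'rV[C]_n.
Implicit Types (z : V) (k : multidx n) (s : seq (C * multidx n)) (r : 'I_n -> R).

Definition zpow z k : C := \prod_i z 0 i ^+ k i.

(** A polynomial is a list of terms in which exponents may be repeated, so that sums are
    concatenations. *)
Definition polyfun s z : C := \sum_(t <- s) t.1 * zpow z t.2.

Definition pcoef s k : C := \sum_(t <- s | t.2 == k) t.1.

Definition rpow r k : R := \prod_i r i ^+ k i.

Definition pdisc r (z : V) := forall i, cabs (z 0 i) <= r i.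

Lemma rpow_ge0 r k : (forall i, 0 <= r i) -> 0 <= rpow r k.
Proof. by move=> r0; apply: prodr_ge0 => i _; rewrite exprn_ge0. Qed.

Lemma rpow_gt0 r k : (forall i, 0 < r i) -> 0 < rpow r k.
Proof. by move=> r0; apply: prodr_gt0 => i _; rewrite exprn_gt0. Qed.

Lemma zpowD z k l : zpow z (k + l) = zpow z k * zpow z l.
Proof. by rewrite -big_split; apply: eq_bigr => i _; rewrite ffunE exprD. Qed.

Lemma zpow0 z : zpow z 0 = 1.
Proof. by rewrite /zpow big1// => i _; rewrite ffunE expr0. Qed.

Lemma zpow_mdelta z i m : zpow z (mdelta i *+ m) = z 0 i ^+ m.
Proof.
elim: m => [|m IH]; first by rewrite mulr0n zpow0 expr0.
rewrite mulrSr zpowD IH exprSr; congr (_ * _).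
rewrite /zpow (bigD1 i)//= big1 ?mulr1; first by rewrite ffunE eqxx expr1.
by move=> j ji; rewrite ffunE eq_sym (negbTE ji) expr0.
Qed.

Lemma cabs_zpow z k : cabs (zpow z k) = \prod_i cabs (z 0 i) ^+ k i.
Proof. by rewrite /zpow cabs_prod; apply: eq_bigr => i _; rewrite cabsX. Qed.

Lemma cabs_zpow_le r z k : pdisc r z -> cabs (zpow z k) <= rpow r k.
Proof.
move=> zr; rewrite cabs_zpow; apply: ler_prod => i _; rewrite exprn_ge0 ?cabs_ge0//=.
by apply: lerXn2r; rewrite ?nnegrE ?cabs_ge0//; apply: le_trans (zr i); exact: cabs_ge0.
Qed.

Lemma polyfun_cat s1 s2 z : polyfun (s1 ++ s2) z = polyfun s1 z + polyfun s2 z.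
Proof. exact: big_cat. Qed.

Lemma pcoef_cat s1 s2 k : pcoef (s1 ++ s2) k = pcoef s1 k + pcoef s2 k.
Proof. exact: big_cat. Qed.

Definition polyopp s := [seq (- t.1, t.2) | t <- s].

Lemma polyfun_opp s z : polyfun (polyopp s) z = - polyfun s z.
Proof. by rewrite /polyfun big_map -sumrN; apply: eq_bigr => t _; rewrite mulNr. Qed.

Lemma pcoef_opp s k : pcoef (polyopp s) k = - pcoef s k.
Proof. by rewrite /pcoef big_map -sumrN. Qed.

Lemma polyfun_pcoef s z N : (forall t, t \in s -> t.2 \in box n N) ->
  polyfun s z = \sum_(k <- box n N) pcoef s k * zpow z k.
Proof.
elim: s => [|t s IH] sN.
  by rewrite /polyfun big_nil big1// => k _; rewrite /pcoef big_nil mul0r.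
rewrite /polyfun big_cons -/(polyfun s z) IH; last first.
  by move=> u us; apply: sN; rewrite inE us orbT.
have -> : t.1 * zpow z t.2 = \sum_(k <- box n N) (if t.2 == k then t.1 else 0) * zpow z k.
  rewrite (bigD1_seq t.2) ?box_uniq ?sN ?mem_head//= eqxx big1 ?addr0// => k kt.
  by rewrite eq_sym (negbTE kt) mul0r.
rewrite -big_split; apply: eq_bigr => k _; rewrite /pcoef big_cons.
rewrite -[LHS]/(_ * zpow z k + _ * zpow z k) -mulrDl; congr (_ * _).
by case: eqP => _ //; rewrite add0r.
Qed.

(** Cauchy's estimate. Along the curve [z_i = r_i w^(B^i)], with [B] larger than all
    exponents, distinct monomials become distinct powers of [w]. *)
Lemma cauchy_estimate s r k (M : R) : (forall i, 0 <= r i) ->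
  (forall z, (forall i, cabs (z 0 i) = r i) -> cabs (polyfun s z) <= M) ->
  cabs (pcoef s k) * rpow r k <= M.
Proof.
move=> r0 sM; have [B hB] : exists B : nat, forall i t, t \in k :: [seq t.2 | t <- s] -> (t i < B)%N.
  exists (\max_(t <- k :: [seq t.2 | t <- s]) mdeg t).+1 => i t ts; rewrite ltnS.
  apply: leq_trans (mdeg_ge t i) _.
  exact: (leq_bigmax_seq (F := fun t : multidx n => mdeg t)).
pose kap (t : multidx n) := (\sum_i t i * B ^ i)%N.
(* Enough nodes to separate all the exponents of [w]. *)
pose m := (\max_(t <- k :: [seq t.2 | t <- s]) kap t).+1.
have km t : t \in k :: [seq t.2 | t <- s] -> (kap t < 2 ^ m)%N.
  move=> ts; apply: leq_ltn_trans (_ : (m.-1 < _)%N); last first.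
    by apply: leq_trans (ltn_expl m (isT : 1 < 2)%N); rewrite ltnW.
  exact: (leq_bigmax_seq (F := fun t : multidx n => kap t)).
pose z (w : C) : V := \row_i (realC (r i) * w ^+ (B ^ i)).
have zE w t : zpow (z w) t = realC (rpow r t) * w ^+ kap t.
  rewrite /rpow /kap (big_morph _ (@realCM R) (realC1 R)) expr_sum -big_split.
  by apply: eq_bigr => i _; rewrite mxE exprMn -realCX -exprM mulnC.
have E : mean m (fun w => polyfun s (z w) / w ^+ kap k) 1 = pcoef s k * realC (rpow r k).
  rewrite (_ : (fun w => _) =
      fun w => \sum_(t <- s) t.1 * realC (rpow r t.2) * (w ^+ kap t.2 / w ^+ kap k)); last first.
    apply/funext => w; rewrite mulr_suml; apply: eq_bigr => t _.
    by rewrite zE !mulrA.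
  rewrite mean_sum /pcoef mulr_suml big_seq [RHS]big_mkcond [RHS]big_seq.
  apply: eq_bigr => t ts; rewrite meanZ.
  have t2 : t.2 \in k :: [seq t.2 | t <- s] by rewrite inE map_f ?orbT.
  case: eqP => [->|tk]; first by rewrite mean_monomial1// mulr1.
  rewrite mean_monomial ?mulr0// !modn_small ?km ?mem_head//.
  apply/eqP => h; apply: tk; apply/ffunP.
  by apply: (base_expansion_inj _ _ h) => i; apply: hB => //; rewrite mem_head.
have <- : cabs (pcoef s k * realC (rpow r k)) = cabs (pcoef s k) * rpow r k.
  by rewrite cabsM cabs_realC ger0_norm// rpow_ge0.
rewrite -E; apply: mean_le => // w w1; rewrite cabsM cabsV cabsX w1 expr1n invr1 mulr1.
by apply: sM => i; rewrite mxE cabsM cabsX w1 expr1n mulr1 cabs_realC ger0_norm.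
Qed.

End PolynomialFunctions.

(** * Holomorphic functions on polydiscs *)

Section SeveralVariables.
Variables (R : realType) (n : nat).
Local Notation C := (Cplx R).
Local Notation V := 'rV[C]_n.
Implicit Types (z : V) (i j : 'I_n) (rho r : 'I_n -> R) (g : V -> C).

Lemma nbhs_rVP z (W : set V) :
  nbhs z W <-> exists2 e : R, 0 < e & forall w : V, (forall i, cabs (w 0 i - z 0 i) < e) -> W w.
Proof.
split.
  move=> /nbhs_ballP[e e0 eW].
  have eR : e = realC (complex.Re e).
    by move: e0; case: e {eW} => a b /=; rewrite lt_def/= => /andP[_ /andP[/eqP -> _]].
  exists (complex.Re e); first by rewrite -realC_lt -eR.
  move=> w zw; apply: eW; split; first by [].
  move=> i j; rewrite (ord1 i) /ball/= distrC norm_cabs eR realC_lt; exact: zw.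
move=> [e e0 eW]; apply/nbhs_ballP; exists (realC e); first by rewrite /= -realC0 realC_lt.
move=> w zw; apply: eW => i; have [_ zw'] := zw; have := zw' 0 i.
by rewrite /ball/= distrC norm_cabs realC_lt.
Qed.

Lemma compact_pdisc rho : compact (pdisc rho : set V).
Proof.
rewrite (_ : (pdisc rho : set V) =
    [set z : V | forall i, [set w : C | cabs (w - 0) <= rho i] (z ord0 i)]).
  exact: (@rV_compact C n (fun i => [set w : C | cabs (w - 0) <= rho i])
    (fun i => @compact_cdisc R 0 (rho i))).
by apply/seteqP; split => z zr i; have := zr i; rewrite /= subr0.
Qed.

Definition upd z i (w : C) : V := \row_j (if j == i then w else z 0 j).

Lemma upd_id z i : upd z i (z 0 i) = z.
Proof. by apply/rowP => j; rewrite mxE; case: eqP => [->|]. Qed.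

Lemma upd_upd z i w w' : upd (upd z i w) i w' = upd z i w'.
Proof. by apply/rowP => j; rewrite !mxE; case: eqP. Qed.

Lemma updC z i j w w' : i != j -> upd (upd z i w) j w' = upd (upd z j w') i w.
Proof.
move=> ij; apply/rowP => k; rewrite !mxE; case: eqP => [->|//].
by rewrite eq_sym (negbTE ij).
Qed.

Lemma pdisc_upd rho z i w : pdisc rho z -> cabs w <= rho i -> pdisc rho (upd z i w).
Proof. by move=> zr wr j; rewrite mxE; case: eqP => [->|_]. Qed.

Definition sephol rho g := forall z, pdisc rho z ->
  {for z, continuous g} /\ forall i, cdiff (fun w => g (upd z i w)) (z 0 i).

Lemma sepholD rho f g : sephol rho f -> sephol rho g -> sephol rho (fun z => f z + g z).
Proof.
move=> hf hg z zr; have [fc fd] := hf z zr; have [gc gd] := hg z zr.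
split; first exact: (@cvgD C C V (nbhs z) _ f g _ _ fc gc).
by move=> i; exact: (derivableD (fd i) (gd i)).
Qed.

Lemma sepholZ rho (c : C) g : sephol rho g -> sephol rho (fun z => c * g z).
Proof.
move=> hg z zr; have [gc gd] := hg z zr; split.
  exact: (@cvgM C V (nbhs z) _ (fun=> c) g c (g z) (cvg_cst _) gc).
by move=> i; exact: (@derivableM C C (cst c) _ _ _ (derivable_cst _ _ _) (gd i)).
Qed.

Lemma sephol_midsum rho m (a h : R) (G : R -> V -> C) :
  (forall y, sephol rho (G y)) -> sephol rho (fun z => midsum m a h (fun y => G y z)).
Proof.
move=> hG; elim: m a h => [|m IH] a h; first by apply: sepholZ; exact: hG.
by apply: (@sepholD rho (fun z => midsum m a (h / 2) (fun y => G y z))); exact: IH.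
Qed.

Lemma sephol_upd rho i (w : C) g : cabs w <= rho i -> sephol rho g ->
  sephol rho (fun z => g (upd z i w)).
Proof.
move=> wr hg z zr; have [gc gd] := hg _ (pdisc_upd zr wr); split.
  move=> W /gc /nbhs_rVP[e e0 eW]; apply/nbhs_rVP; exists e => // z' zz'.
  apply: eW => j; rewrite !mxE; case: eqP => // _.
  by rewrite subrr cabs0.
move=> j; have [->|ji] := eqVneq j i.
  rewrite (_ : (fun _ => _) = cst (g (upd z i w))); first exact: derivable_cst.
  by apply/funext => w'; rewrite upd_upd.
have := gd j; rewrite mxE (negbTE ji).
rewrite (_ : (fun w' => g (upd (upd z j w') i w)) = fun w' => g (upd (upd z i w) j w')) //.
by apply/funext => w'; rewrite updC.
Qed.

Definition indep i g := forall z w, g (upd z i w) = g z.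

Lemma indep_cst g : (forall i, indep i g) -> forall z, g z = g 0.
Proof.
move=> hg z; have h (s : seq 'I_n) : g (\row_j if j \in s then 0 else z 0 j) = g z.
  elim: s => [|i s IH]; first by congr g; apply/rowP => j; rewrite mxE.
  rewrite -[RHS]IH -[RHS](hg i _ 0); congr g; apply/rowP => j; rewrite !mxE in_cons.
  by case: eqP.
rewrite -(h (enum 'I_n)); congr g; apply/rowP => j; rewrite !mxE.
by rewrite mem_enum.
Qed.

Definition mulX i m (s : seq (C * multidx n)) := [seq (t.1, mdelta i *+ m + t.2) | t <- s].

Lemma polyfun_mulX i m s z : polyfun (mulX i m s) z = z 0 i ^+ m * polyfun s z.
Proof.
rewrite /polyfun big_map mulr_sumr; apply: eq_bigr => t _.
by rewrite zpowD zpow_mdelta mulrCA.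
Qed.

Lemma polyfun_sum i (t : nat -> seq (C * multidx n)) K :
  exists s, forall z, polyfun s z = \sum_(m < K) z 0 i ^+ m * polyfun (t m) z.
Proof.
elim: K => [|K [s hs]]; first by exists [::] => z; rewrite big_ord0 /polyfun big_nil.
exists (s ++ mulX i K (t K)) => z.
by rewrite polyfun_cat hs polyfun_mulX big_ord_recr.
Qed.

(** Polynomials are uniformly dense on a smaller polydisc: expand in one variable after the
    other; the coefficients of the discrete Taylor polynomial in one variable are finite
    linear combinations of restrictions of [g], hence holomorphic in the others. *)
Lemma polyfun_dense rho r g : (forall i, 0 < r i < rho i) -> sephol rho g ->
  forall e, 0 < e -> exists s, forall z, pdisc r z -> cabs (polyfun s z - g z) <= e.
Proof.
move=> rr; have r0 i : 0 < r i by have /andP[] := rr i.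
have rrho i : r i < rho i by have /andP[] := rr i.
have rrz z : pdisc r z -> pdisc rho z by move=> zr i; apply: le_trans (zr i) _; exact: ltW.
suff H (l : seq 'I_n) : forall g, sephol rho g -> (forall i, i \notin l -> indep i g) ->
    forall e, 0 < e -> exists s, forall z, pdisc r z -> cabs (polyfun s z - g z) <= e.
  by move=> hg; apply: (H (enum 'I_n)) => // i; rewrite mem_enum.
elim: l => [|i l IH] {}g hg gl e e0.
  exists [:: (g 0, 0)] => z _; rewrite /polyfun big_seq1 zpow0 mulr1.
  by rewrite (indep_cst (fun i => gl i isT) z) subrr cabs0 ltW.
have [S hS] := compact_cabs_bounded (compact_pdisc (rho := rho)) (fun z zr => (hg z zr).1).
have t01 : 0 <= r i / rho i < 1.
  have rho0 : 0 < rho i := lt_trans (r0 i) (rrho i).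
  by rewrite divr_ge0 ?ltW//= ltr_pdivrMr// mul1r.
have [N hN] : exists N, 2 * S * ((r i / rho i) ^+ (2 ^ N) / (1 - r i / rho i)) <= e / 2.
  have h : 2 * S * (((r i / rho i) ^+ (2 ^ N)) / (1 - r i / rho i)) @[N --> \oo] --> (0 : R).
    rewrite -[X in _ --> X](mulr0 (2 * S)); apply: cvgM; first exact: cvg_cst.
    rewrite -[X in _ --> X](mul0r (1 - r i / rho i)^-1).
    by apply: cvgM; [exact: cvg_expr2n|exact: cvg_cst].
  have e20 : 0 < e / 2 by rewrite divr_gt0.
  have /cvgrPdist_le/(_ _ e20)[N _ hN] := h; exists N; have := hN N (leqnn N).
  by rewrite /= sub0r normrN => h'; apply: le_trans (ler_norm _) h'.
pose G m z := mean N (fun w => g (upd z i w) / w ^+ m) (r i).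
have hG m : sephol rho (G m).
  apply: sepholZ.
  apply: (@sephol_midsum rho N 0 (2 * pi) (fun y z => g (upd z i (circ (r i) y)) / circ (r i) y ^+ m)) => y.
  rewrite (_ : (fun _ => _) = fun z => (circ (r i) y ^+ m)^-1 * g (upd z i (circ (r i) y))).
    by apply: sepholZ; apply: sephol_upd => //; rewrite cabs_circ ltW.
  by apply/funext => z; rewrite mulrC.
have Gl m j : j \notin l -> indep j (G m).
  move=> jl z w; rewrite /G; congr mean; apply/funext => w'.
  have [->|ji] := eqVneq j i; first by rewrite upd_upd.
  by rewrite updC// gl// inE negb_or ji.
(* The [m]-th coefficient function enters the sum with the factor [z_i^m], at most [r_i^m]. *)
pose K := \sum_(m < 2 ^ N) r i ^+ m.
have K0 : 0 <= K by apply: sumr_ge0 => m _; rewrite exprn_ge0 ?ltW.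
have K10 : 0 < 2 * (K + 1) by lra.
have [t ht] := choice (fun m => IH (G m) (hG m) (Gl m) (e / (2 * (K + 1))) (divr_gt0 e0 K10)).
have [s hs] := polyfun_sum i t (2 ^ N); exists s => z zr; rewrite hs.
have zrho := rrz z zr.
pose f w := g (upd z i w).
have h1 : cabs (tayl N f (r i) (z 0 i) - f (z 0 i)) <= e / 2.
  apply: le_trans hN; apply: tayl_error => // [w wr|w wr].
    have := (hg _ (pdisc_upd zrho wr)).2 i; rewrite mxE eqxx.
    rewrite (_ : (fun w' => g (upd (upd z i w) i w')) = f)//.
    by apply/funext => w'; rewrite upd_upd.
  by apply: hS; apply: pdisc_upd => //; rewrite wr.
rewrite /f upd_id in h1.
rewrite -(subrKA (tayl N f (r i) (z 0 i))); apply: le_trans (cabsD _ _) _.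
rewrite (splitr e); apply: lerD => //.
rewrite /tayl -sumrB; apply: le_trans (cabs_sum _ _ _) _.
apply: le_trans (_ : \sum_(m < 2 ^ N) r i ^+ m * (e / (2 * (K + 1))) <= _).
  apply: ler_sum => m _; rewrite -mulrBr cabsM cabsX.
  apply: ler_pM; [by rewrite exprn_ge0 ?cabs_ge0|exact: cabs_ge0| |exact: ht].
  by apply: lerXn2r; rewrite ?nnegrE ?cabs_ge0// ltW.
rewrite -mulr_suml -/K mulrA ler_pdivrMr//.
have := mulr_ge0 K0 (ltW e0); lra.
Qed.

End SeveralVariables.

Section Expansion.
Variables (R : realType) (n : nat).
Local Notation C := (Cplx R).
Local Notation V := 'rV[C]_n.
Implicit Types (z : V) (k : multidx n) (rho r : 'I_n -> R) (g : V -> C) (a c : multidx n -> C).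

(** Weierstrass' test, for box sums. *)
Lemma csum_uniform (t : multidx n -> R) (e : R) : (forall k, 0 <= t k) -> tsummable t -> 0 < e ->
  exists N, forall M (f : multidx n -> C), (N <= M)%N -> (forall k, cabs (f k) <= t k) ->
    cabs (csum f - bsum f M) <= e.
Proof.
move=> t0 ts e0; have e20 : 0 < e / 2 by rewrite divr_gt0.
have [N hN] := box_tail t0 ts e20; exists N => N' f NN' ft.
have fs : tsummable (fun k => cabs (f k)).
  by apply: tsummable_le ts => k; rewrite cabs_ge0 ft.
have [M hM] := csum_near fs e20.
have g1 := hM (maxn N' M) (leq_maxr _ _).
have g2 : cabs (bsum f (maxn N' M) - bsum f N') < e / 2.
  apply: le_lt_trans (bsum_dist _ (leq_maxl _ _)) _.
  apply: le_lt_trans (hN N' (box n (maxn N' M)) NN' (box_uniq _ _)).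
  by apply: ler_sum => k _.
rewrite -(subrKA (bsum f (maxn N' M))); apply: le_trans (cabsD _ _) _.
rewrite cabsB in g1; lra.
Qed.

(** Cauchy's estimate for polynomials, applied to box sums. *)
Lemma coef_le_csum a r k (M : R) : (forall i, 0 <= r i) ->
  tsummable (fun k => cabs (a k) * rpow r k) ->
  (forall z, pdisc r z -> cabs (csum (fun k => a k * zpow z k)) <= M) ->
  cabs (a k) * rpow r k <= M.
Proof.
move=> r0 asum aM; apply/ler_addgt0Pr => e e0.
have t0 l : 0 <= cabs (a l) * rpow r l by rewrite mulr_ge0 ?cabs_ge0 ?rpow_ge0.
have [N hN] := csum_uniform t0 asum e0.
pose M' := maxn N (mdeg k); pose s := [seq (a l, l) | l <- box n M'].
have sE z : polyfun s z = bsum (fun l => a l * zpow z l) M' by rewrite /polyfun big_map.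
have -> : a k = pcoef s k.
  rewrite /pcoef big_map (big_rem k)/=; last by apply: mem_box; exact: leq_maxr.
  rewrite eqxx big_seq_cond big1 ?addr0// => l /andP[].
  by rewrite mem_rem_uniq ?box_uniq// inE => /andP[/negbTE ->].
apply: cauchy_estimate => // z zr; have zr' : pdisc r z by move=> i; rewrite zr.
rewrite sE -(subrKC (csum (fun l => a l * zpow z l)) (bsum _ _)).
apply: le_trans (cabsD _ _) _; apply: lerD; first exact: aM.
rewrite cabsB; apply: hN; first exact: leq_maxl.
by move=> l; rewrite cabsM ler_wpM2l ?cabs_ge0// cabs_zpow_le.
Qed.

Lemma rpowZ (T : R) r k : rpow (fun i => T * r i) k = T ^+ mdeg k * rpow r k.
Proof.
rewrite /rpow /mdeg expr_sum -big_split; apply: eq_bigr => i _.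
by rewrite exprMn.
Qed.

Lemma tsummable_coef c r z (M T : R) : 0 <= T < 1 -> (forall i, 0 <= r i) ->
  (forall k, cabs (c k) * rpow r k <= M) -> (forall i, cabs (z 0 i) <= T * r i) ->
  tsummable (fun k => cabs (c k * zpow z k)) /\
  forall s, uniq s -> \sum_(k <- s) cabs (c k * zpow z k) <= M * ((1 - T)^-1) ^+ n.
Proof.
move=> T01 r0 cM zT.
have M0 : 0 <= M by apply: le_trans (cM 0); rewrite mulr_ge0 ?cabs_ge0 ?rpow_ge0.
suff h s : uniq s -> \sum_(k <- s) cabs (c k * zpow z k) <= M * ((1 - T)^-1) ^+ n.
  by split => //; exact: (tsummableW h).
move=> us; apply: le_trans (ler_wpM2l M0 (geom_box T01 us)).
rewrite mulr_sumr; apply: ler_sum => k _; rewrite cabsM.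
apply: le_trans (ler_wpM2l (cabs_ge0 _) (cabs_zpow_le k zT)) _.
have T0 : 0 <= T by case/andP: T01.
by rewrite rpowZ mulrCA mulrC ler_wpM2r ?exprn_ge0.
Qed.

(** A holomorphic function on a polydisc is the sum of its Taylor series: the coefficients
    of polynomials that converge uniformly to it converge, by Cauchy's estimate for
    polynomials. *)
Lemma hol_expansion rho r g : (forall i, 0 < r i < rho i) -> sephol rho g ->
  exists c : multidx n -> C,
    (forall M, (forall z, pdisc r z -> cabs (g z) <= M) -> forall k, cabs (c k) * rpow r k <= M) /\
    (forall z (T : R), 0 <= T < 1 -> (forall i, cabs (z 0 i) <= T * r i) ->
      tsummable (fun k => cabs (c k * zpow z k)) /\ csum (fun k => c k * zpow z k) = g z).
Proof.
move=> rr hg; have r0 i : 0 < r i by have /andP[] := rr i.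
have rle i : 0 <= r i by exact: ltW.
pose e (j : nat) : R := j.+1%:R^-1.
have e0 j : 0 < e j by rewrite invr_gt0 ltr0n.
have ee j l : (j <= l)%N -> e l <= e j by move=> jl; rewrite lef_pV2 ?posrE ?ltr0n// ler_nat.
have esmall d : 0 < d -> exists j, e j < d.
  move=> d0; exists (Num.truncn d^-1); rewrite invf_plt ?posrE ?ltr0n//.
  exact: truncnS_gt.
have [s hs] := choice (fun j => polyfun_dense rr hg (e0 j)).
have cc j l k : cabs (pcoef (s j) k - pcoef (s l) k) * rpow r k <= e j + e l.
  rewrite -pcoef_opp -pcoef_cat; apply: cauchy_estimate => // z zr.
  have zr' : pdisc r z by move=> i; rewrite zr.
  rewrite polyfun_cat polyfun_opp -(subrKA (g z)); apply: le_trans (cabsD _ _) _.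
  by apply: lerD; [exact: hs|rewrite cabsB; exact: hs].
have [c hc] : exists c : multidx n -> C,
    forall k j, cabs (pcoef (s j) k - c k) * rpow r k <= e j.
  suff /choice[c hc] : forall k, exists x, forall j, cabs (pcoef (s j) k - x) * rpow r k <= e j.
    by exists c.
  move=> k.
  have rk := rpow_gt0 k r0.
  have [|x hx] := @cauchy_cabs_cvg R ((fun j => pcoef (s j) k) @ \oo) _.
    move=> d d0; have [j hj] := esmall (d * rpow r k / 2) ltac:(by rewrite divr_gt0// mulr_gt0).
    exists [set pcoef (s l) k | l in [set l | (j <= l)%N]].
      by exists j => // l jl; exists l.
    move=> _ _ [l1 /= jl1 <-] [l2 /= jl2 <-]; rewrite -(ltr_pM2r rk).
    apply: le_lt_trans (cc l1 l2 k) _; have := ee _ _ jl1; have := ee _ _ jl2; lra.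
  exists x => j; apply/ler_addgt0Pr => d d0.
  have d' : 0 < d / 2 / rpow r k by rewrite !divr_gt0.
  have [N _ hN] := hx _ d'; have [l0 hl0] := esmall (d / 2) ltac:(by rewrite divr_gt0).
  pose l := maxn N l0; have := hN l (leq_maxl _ _); rewrite /= ltr_pdivlMr// => h1.
  have h2 := cc j l k; have h3 := ee _ _ (leq_maxr N l0 : (l0 <= l)%N).
  rewrite -(subrKA (pcoef (s l) k)).
  apply: le_trans (ler_wpM2r (ltW rk) (cabsD _ _)) _; rewrite mulrDl; lra.
have cM M : (forall z, pdisc r z -> cabs (g z) <= M) -> forall k, cabs (c k) * rpow r k <= M.
  move=> gM k; apply/ler_addgt0Pr => d d0; have [j hj] := esmall (d / 2) ltac:(by rewrite divr_gt0).
  have h1 : cabs (pcoef (s j) k) * rpow r k <= M + e j.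
    apply: cauchy_estimate => // z zr; have zr' : pdisc r z by move=> i; rewrite zr.
    rewrite -(subrKC (g z) (polyfun _ _)); apply: le_trans (cabsD _ _) _.
    by apply: lerD; [exact: gM|exact: hs].
  have h2 := hc k j; rewrite cabsB in h2.
  have h3 : cabs (c k) * rpow r k <= cabs (c k - pcoef (s j) k) * rpow r k +
      cabs (pcoef (s j) k) * rpow r k.
    rewrite -mulrDl ler_wpM2r ?rpow_ge0//.
    by apply: le_trans (cabsD _ _); rewrite subrK.
  lra.
exists c; split => // z T T01 zT.
have [M hM] : exists M, forall z, pdisc r z -> cabs (g z) <= M.
  have [M hM] := compact_cabs_bounded (compact_pdisc (rho := rho)) (fun z zr => (hg z zr).1).
  exists M => w wr; apply: hM => i; apply: le_trans (wr i) _; apply: ltW.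
  by have /andP[] := rr i.
have [sc _] := tsummable_coef T01 rle (cM M hM) zT; split => //.
have /andP[T0 T1] := T01.
have zr : pdisc r z.
  by move=> i; apply: le_trans (zT i) _; rewrite ler_piMl// ltW.
apply: csum_eq => //; apply/cvg_cabsP => d d0.
pose K := ((1 - T)^-1) ^+ n; have K0 : 0 <= K by rewrite exprn_ge0// invr_ge0 subr_ge0 ltW.
have [j hj] := esmall (d / (K + 1)) ltac:(by rewrite divr_gt0// ltr_wpDl).
have [N hN] := box_exhaust [seq t.2 | t <- s j]; exists N => N' NN'.
have -> : bsum (fun k => c k * zpow z k) N' - g z =
    bsum (fun k => (c k - pcoef (s j) k) * zpow z k) N' + (polyfun (s j) z - g z).
  rewrite (@polyfun_pcoef _ _ _ _ N'); last by move=> t ts; apply: (hN _ NN'); exact: map_f.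
  rewrite addrA; congr (_ - _); rewrite -big_split; apply: eq_bigr => k _.
  by rewrite mulrBl -[RHS]/(_ + _) subrK.
apply: le_lt_trans (cabsD _ _) _.
have h1 : cabs (bsum (fun k => (c k - pcoef (s j) k) * zpow z k) N') <= e j * K.
  have hc' k : cabs (c k - pcoef (s j) k) * rpow r k <= e j by rewrite cabsB.
  apply: le_trans (cabs_sum _ _ _) _.
  exact: (tsummable_coef T01 rle hc' zT).2 (box_uniq n N').
have h2 := hs j z zr.
apply: le_lt_trans (lerD h1 h2) _.
by rewrite -[X in _ + X]mulr1 -mulrDr -ltr_pdivlMr// ltr_wpDl.
Qed.

(** Cauchy's estimate for the difference, with bound [0]. *)
Lemma csum_inj c c' r : (forall i, 0 < r i) ->
  tsummable (fun k => cabs (c k) * rpow r k) -> tsummable (fun k => cabs (c' k) * rpow r k) ->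
  (forall z, pdisc r z -> csum (fun k => c k * zpow z k) = csum (fun k => c' k * zpow z k)) ->
  c = c'.
Proof.
move=> r0 cs cs' cc'; apply/funext => k; have rk := rpow_gt0 k r0.
have rle i : 0 <= r i by exact: ltW.
have t0 (a : multidx n -> C) l : 0 <= cabs (a l) * rpow r l.
  by rewrite mulr_ge0 ?cabs_ge0 ?rpow_ge0.
have zs (a : multidx n -> C) z : pdisc r z -> tsummable (fun k => cabs (a k) * rpow r k) ->
    tsummable (fun k => cabs (a k * zpow z k)).
  move=> zr; apply: tsummable_le => l; rewrite cabs_ge0 cabsM ler_wpM2l ?cabs_ge0//.
  exact: cabs_zpow_le.
have sN : tsummable (fun k => cabs (-1 * c' k) * rpow r k).
  apply: tsummable_le cs' => l; rewrite (t0 (fun l => -1 * c' l))/=.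
  by rewrite cabsM cabsN cabs1 mul1r.
have sB : tsummable (fun k => cabs (c k + -1 * c' k) * rpow r k).
  apply: tsummable_le (tsummableD (t0 c) (t0 (fun l => -1 * c' l)) cs sN) => l.
  rewrite (t0 (fun l => c l + -1 * c' l))/=.
  by rewrite -mulrDl ler_wpM2r ?rpow_ge0// cabsD.
have := @coef_le_csum (fun k => c k + -1 * c' k) r k 0 rle sB.
have H z : pdisc r z -> cabs (csum (fun l => (c l + -1 * c' l) * zpow z l)) <= 0.
  move=> zr; rewrite (_ : (fun l => _) = fun l => c l * zpow z l + -1 * (c' l * zpow z l)).
    have h := zs c' z zr cs'.
    rewrite csumD; [|exact: zs|].
      by rewrite csumZ// cc'// mulN1r subrr cabs0.
    have E l : cabs (-1 * (c' l * zpow z l)) = cabs (c' l * zpow z l).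
      by rewrite mulN1r cabsN.
    by apply: tsummable_le h => l; rewrite E cabs_ge0 lexx.
  by apply/funext => l; rewrite mulrDl mulrA.
move=> /(_ H) h; apply/eqP; rewrite -subr_eq0 -cabs_eq0 eq_le cabs_ge0 andbT.
by rewrite -(ler_pM2r rk) mul0r -mulN1r.
Qed.

End Expansion.

(** * Weighted norms from Cauchy's estimates *)

Section OptimalRadii.
Variables (R : realType) (n : nat).
Hypothesis n0 : (0 < n)%N.
Local Notation C := (Cplx R).
Implicit Types (k : multidx n) (r : 'I_n -> R) (c : multidx n -> C).
Local Notation e := (expR 1 : R).

Lemma qfact1 m : qfact (1 : R) m = m`!%:R.
Proof.
elim: m => [|m IH]; first by rewrite qfact0 fact0.
rewrite qfactS IH factS natrM mulrC; congr (_ * _).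
rewrite /qnum; under eq_bigr do rewrite expr1n.
by rewrite sumr_const card_ord.
Qed.

(** Half of Stirling's formula, by induction from [e <= (1 + 1 / (m + 1)) ^ (m + 2)]. *)
Lemma fact_le_exp m : m`!%:R * e ^+ m <= m.+1%:R ^+ m.+1 :> R.
Proof.
elim: m => [|m IH]; first by rewrite fact0 expr0 mulr1 expr1.
have m2 : 0 < m.+2%:R :> R by rewrite ltr0n.
have m1 : 0 < m.+1%:R :> R by rewrite ltr0n.
have h : e * m.+1%:R ^+ m.+2 <= m.+2%:R ^+ m.+2.
  have -> : e = expR (m.+2%:R^-1) ^+ m.+2.
    by rewrite -expRM_natl mulfV// gt_eqF.
  rewrite -exprMn; apply: lerXn2r; rewrite ?nnegrE ?mulr_ge0 ?expR_ge0 ?ler0n//.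
  have h : 1 - m.+2%:R^-1 <= expR (- m.+2%:R^-1) :> R by exact: expR_ge1Dx.
  have h1 := ler_wpM2l (expR_ge0 (m.+2%:R^-1 : R)) h.
  rewrite expRxMexpNx_1 in h1.
  have := ler_wpM2r (ltW m2) h1; rewrite mul1r => h2; apply: le_trans h2.
  rewrite le_eqVlt; apply/orP; left; apply/eqP; rewrite -mulrA; congr (_ * _).
  by rewrite mulrBl mul1r mulVf ?gt_eqF// -[m.+2%:R]natr1 addrK.
apply: le_trans h; rewrite factS natrM exprS [_ ^+ m.+2]exprS.
rewrite (_ : m.+1%:R * m`!%:R * (e * e ^+ m) = e * m.+1%:R * (m`!%:R * e ^+ m)); last by ring.
by rewrite [leRHS]mulrA ler_wpM2l// mulr_ge0 ?expR_ge0.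
Qed.

Lemma exp_le_fact (x : R) m : 0 <= x -> x ^+ m <= m`!%:R * expR x.
Proof.
move=> x0; have f0 : 0 < m`!%:R :> R by rewrite ltr0n fact_gt0.
rewrite mulrC -ler_pdivrMr//; case: m f0 => [|m] f0.
  by rewrite expr0 fact0 divr1 -[1](expR0 R) ler_expR.
by apply: le_trans (expR_ge1Dxn m x0); rewrite lerDr.
Qed.

(** On the ball of radius [rho] the monomial [z^k] is largest for [|z_i|^2] proportional to
    [k_i]; taking [k_i + 1] instead keeps all radii positive. By Stirling's estimates the
    value there is [(k! / |k|!)^(1/2) rho^|k|] up to a polynomial factor. *)
Lemma optimal_radii (rho : R) k : 0 < rho -> exists r, [/\ forall i, 0 < r i,
  \sum_i r i ^+ 2 <= rho ^+ 2 &
  rho ^+ mdeg k * Num.sqrt (qmulti 1 k)^-1 <= e ^+ n * (\prod_i (k i).+1%:R) * rpow r k].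
Proof.
move=> rho0; pose m := mdeg k; pose w : R := (m + n)%:R.
have w0 : 0 < w by rewrite ltr0n addn_gt0 n0 orbT.
pose v i : R := (k i).+1%:R / w; have v0 i : 0 < v i by rewrite divr_gt0// ltr0n.
exists (fun i => rho * Num.sqrt (v i)); split.
- by move=> i; rewrite mulr_gt0// sqrtr_gt0.
- under eq_bigr => i _ do rewrite exprMn sqr_sqrtr ?ltW//.
  rewrite -mulr_sumr -mulr_suml -natr_sum (_ : (\sum_i (k i).+1)%N = (m + n)%N).
    by rewrite mulfV ?mulr1// gt_eqF.
  under eq_bigr do rewrite -addn1.
  by rewrite big_split/= sum_nat_const card_ord muln1.
rewrite rpowZ [leRHS]mulrCA ler_wpM2l ?exprn_ge0 ?(ltW rho0)//.
set P := \prod_i _; set r := fun i => Num.sqrt (v i).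
have P1 : 1 <= P.
  by apply: (big_ind (fun x => 1 <= x)) => // [x y x1 y1|i _];
    [exact: mulr_ege1|rewrite ler1n].
have E1 : 1 <= e ^+ n by rewrite exprn_ege1// -[1](expR0 R) ler_expR.
have K1 : 1 <= e ^+ n * P by exact: mulr_ege1.
have K0 : 0 <= e ^+ n * P by apply: le_trans K1.
have rk0 : 0 <= rpow r k by apply: rpow_ge0 => i; exact: sqrtr_ge0.
have G0 : 0 < qmulti 1 k :> R by exact: qmulti_gt0.
have f0 j : 0 < j`!%:R :> R by rewrite ltr0n fact_gt0.
pose F : R := \prod_i (k i)`!%:R; have F0 : 0 < F by apply: prodr_gt0.
have GE : qmulti 1 k = m`!%:R / F :> R.
  by rewrite /qmulti qfact1; congr (_ / _); apply: eq_bigr => i _; rewrite qfact1.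
have rE : rpow r k ^+ 2 = (\prod_i (k i).+1%:R ^+ k i) / w ^+ m.
  rewrite /rpow -prodrXl; under eq_bigr => i _ do
    rewrite -exprM mulnC exprM sqr_sqrtr ?(ltW (v0 i))// expr_div_n.
  rewrite prodf_div; congr (_ / _).
  by rewrite -expr_sum.
have h1 : F * e ^+ m <= P * \prod_i (k i).+1%:R ^+ k i.
  rewrite /m /mdeg expr_sum -!big_split; apply: ler_prod => i _.
  by rewrite mulr_ge0 ?exprn_ge0 ?expR_ge0 ?(ltW (f0 _))//= -exprS fact_le_exp.
have h2 : w ^+ m <= m`!%:R * (e ^+ m * e ^+ n).
  by rewrite -exprD -expRM_natl mulr1; exact: exp_le_fact (ltW w0).
have wm : 0 < w ^+ m by rewrite exprn_gt0.
have key : (qmulti 1 k)^-1 <= e ^+ n * P * rpow r k ^+ 2.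
  rewrite rE mulrA ler_pdivlMr// GE invf_div mulrAC ler_pdivrMr//.
  apply: le_trans (ler_wpM2l (ltW F0) h2) _.
  rewrite (_ : F * (m`!%:R * (e ^+ m * e ^+ n)) = e ^+ n * (F * e ^+ m) * m`!%:R); last by ring.
  by rewrite ler_wpM2r ?(ltW (f0 _))// -mulrA ler_wpM2l ?exprn_ge0 ?expR_ge0.
rewrite -(ler_pXn2r (n := 2))//; last 2 first.
- by rewrite nnegrE sqrtr_ge0.
- by rewrite nnegrE mulr_ge0.
rewrite sqr_sqrtr ?invr_ge0 ?(ltW G0)// exprMn; apply: le_trans key _.
by rewrite ler_wpM2r ?exprn_ge0// expr2 ler_peMl.
Qed.

(** Bernoulli's inequality in each factor: the polynomial factor is dominated by any
    exponential. *)
Lemma prod_succ_le (d : R) k : 0 < d <= 1 -> \prod_i (k i).+1%:R <= (d^-1) ^+ n * (1 + d) ^+ mdeg k.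
Proof.
move=> /andP[d0 d1]; rewrite /mdeg expr_sum -[X in _ ^+ X]card_ord -prodr_const -big_split.
apply: ler_prod => i _; rewrite ler0n/= ler_pdivlMl//.
elim: (k i) => [|m IH]; first by rewrite mulr1 expr0.
rewrite exprS -natr1 mulrDr mulr1.
have : 0 <= d * (1 + d) ^+ m - d.
  by rewrite subr_ge0 ler_peMr ?(ltW d0)// exprn_ege1// lerDl ltW.
lra.
Qed.

Variable Q : Cstar R.
Hypothesis Q1 : cstar_val Q = 1.
Local Notation U := (ball_weight R n).

Lemma ball_wt1 k : U Q k = Num.sqrt (qmulti 1 k)^-1.
Proof. by rewrite /= /ball_wt Q1 cabs1 !expr1n mul1r. Qed.

(** Cauchy's estimates on all polydiscs inside the ball of radius [rho] control the weighted
    norms of smaller radius. *)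
Lemma wnorm_of_estimates (rho' rho : R) : 0 < rho' < rho -> exists2 K : R, 0 < K &
  forall c (M : R), (forall r k, (forall i, 0 < r i) -> \sum_i r i ^+ 2 <= rho ^+ 2 ->
    cabs (c k) * rpow r k <= M) ->
  wsummable U Q rho' c /\ wnorm U Q rho' c <= K * M.
Proof.
move=> /andP[r'0 r'r]; have rho0 := lt_trans r'0 r'r.
pose th := rho' / rho; have th0 : 0 < th by exact: divr_gt0.
have th1 : th < 1 by rewrite ltr_pdivrMr// mul1r.
pose d := (1 - th) / 2; have d01 : 0 < d <= 1 by rewrite /d; apply/andP; split; lra.
have /andP[d0 d1] := d01.
pose T := th * (1 + d).
have T01 : 0 <= T < 1.
  rewrite mulr_ge0 ?(ltW th0)//=; last by lra.
  have : 0 < (1 - th) * (2 - th) by apply: mulr_gt0; lra.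
  by rewrite /T /d; lra.
have /andP[T0 T1] := T01.
exists (e ^+ n * (d^-1) ^+ n * ((1 - T)^-1) ^+ n).
  by rewrite !mulr_gt0// exprn_gt0// ?expR_gt0// invr_gt0// subr_gt0.
move=> c M cM; have M0 : 0 <= M.
  have [r [rp rs _]] := optimal_radii 0 rho0; apply: le_trans (cM r 0 rp rs).
  by rewrite mulr_ge0 ?cabs_ge0 ?rpow_ge0// => i; exact: ltW.
have D0 : 0 <= e ^+ n * (d^-1) ^+ n by rewrite mulr_ge0// exprn_ge0 ?expR_ge0 ?invr_ge0 ?(ltW d0).
have tb k : wterm U Q rho' c k <= e ^+ n * (d^-1) ^+ n * M * T ^+ mdeg k.
  have [r [rp rs hr]] := optimal_radii k rho0; rewrite /wterm ball_wt1.
  have -> : rho' ^+ mdeg k = th ^+ mdeg k * rho ^+ mdeg k.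
    by rewrite -exprMn /th divfK// gt_eqF.
  rewrite [leLHS](_ : _ = th ^+ mdeg k *
    (cabs (c k) * (rho ^+ mdeg k * Num.sqrt (qmulti 1 k)^-1))); last by ring.
  apply: le_trans (ler_wpM2l (exprn_ge0 _ (ltW th0)) (ler_wpM2l (cabs_ge0 _) hr)) _.
  rewrite [leLHS](_ : _ = th ^+ mdeg k * (e ^+ n * (cabs (c k) * rpow r k) *
    \prod_i (k i).+1%:R)); last by ring.
  have -> : T ^+ mdeg k = th ^+ mdeg k * (1 + d) ^+ mdeg k by exact: exprMn.
  rewrite [leRHS](_ : _ = th ^+ mdeg k * (e ^+ n * M *
    ((d^-1) ^+ n * (1 + d) ^+ mdeg k))); last by ring.
  rewrite ler_wpM2l ?exprn_ge0 ?(ltW th0)//; apply: ler_pM.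
  - by rewrite !mulr_ge0 ?exprn_ge0 ?expR_ge0 ?cabs_ge0 ?rpow_ge0// => i; exact: ltW.
  - by apply: prodr_ge0 => i _; rewrite ler0n.
  - by rewrite ler_wpM2l ?exprn_ge0 ?expR_ge0//; exact: cM.
  - exact: prod_succ_le.
have sb (s : seq (multidx n)) : uniq s ->
    \sum_(k <- s) wterm U Q rho' c k <= e ^+ n * (d^-1) ^+ n * ((1 - T)^-1) ^+ n * M.
  move=> us; apply: le_trans (_ : \sum_(k <- s) e ^+ n * (d^-1) ^+ n * M * T ^+ mdeg k <= _).
    by apply: ler_sum => k _; exact: tb.
  rewrite -mulr_sumr [leRHS]mulrAC.
  by apply: ler_wpM2l; [exact: mulr_ge0|exact: geom_box].
split; first exact: (tsummableW sb).
by apply: tsum_le => // k; apply: wterm_ge0; exact: ltW.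
Qed.

End OptimalRadii.

(** * Evaluation of power series on the ball *)

Section Evaluation.
Variables (R : realType) (n : nat) (Q : Cstar R).
Hypothesis Q1 : cstar_val Q = 1.
Local Notation C := (Cplx R).
Local Notation V := 'rV[C]_n.
Local Notation U := (ball_weight R n).
Implicit Types (k : multidx n) (a b : multidx n -> C) (z : V) (rho : R) (x : 'I_n -> R).

(** The multinomial theorem bounds each of its terms. *)
Lemma qmulti1_le x k : (forall i, 0 <= x i) -> qmulti 1 k * rpow x k <= (\sum_i x i) ^+ mdeg k.
Proof.
move=> x0; have [m] := ubnP (mdeg k); elim: m k => // m IH k km.
have S0 : 0 <= \sum_i x i by apply: sumr_ge0.
have [k0|k0] := posnP (mdeg k).
  have -> : k = 0.
    apply/ffunP => i; rewrite ffunE; apply/eqP.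
    by rewrite -leqn0 -k0; exact: mdeg_ge.
  rewrite qmulti0 mul1r mdeg0 expr0 /rpow big1// => i _; by rewrite ffunE expr0.
rewrite qmulti_rec// mulr_suml -(prednK k0) exprS mulr_suml.
rewrite [leRHS](bigID (fun j => 0 < k j)%N)/=; rewrite -[leLHS]addr0; apply: lerD; last first.
  by apply: sumr_ge0 => j _; rewrite mulr_ge0// exprn_ge0.
apply: ler_sum => j kj; rewrite expr1n mul1r.
have kE := mpredK kj.
have mE : mdeg k = (mdeg (mpred k j)).+1 by rewrite -[in LHS]kE mdegD mdeg_mdelta addn1.
have -> : rpow x k = x j * rpow x (mpred k j).
  have e1 : (mpred k j + mdelta j) j = (mpred k j j).+1.
    by rewrite [LHS]ffunE [mdelta _ _]ffunE eqxx; exact: addn1.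
  have e2 i : i != j -> (mpred k j + mdelta j) i = mpred k j i.
    by move=> ij; rewrite [LHS]ffunE [mdelta _ _]ffunE eq_sym (negbTE ij); exact: addn0.
  rewrite -[in LHS]kE /rpow [LHS](bigD1 j)//= [in RHS](bigD1 j)//= e1 exprS -mulrA.
  by congr (_ * (_ * _)); apply: eq_bigr => i ij; rewrite e2.
rewrite mulrCA mE ler_wpM2l//; apply: IH.
by rewrite -ltnS -mE.
Qed.

(** The multinomial bound, for the squares of the [x_i]. *)
Lemma rpow_le_weight x k rho : 0 <= rho -> (forall i, 0 <= x i) ->
  \sum_i x i ^+ 2 <= rho ^+ 2 -> rpow x k <= U Q k * rho ^+ mdeg k.
Proof.
move=> r0 x0 xr; rewrite ball_wt1//; have G0 : 0 < qmulti 1 k :> R by exact: qmulti_gt0.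
rewrite -(ler_pXn2r (n := 2))//; last 2 first.
- by rewrite nnegrE rpow_ge0.
- by rewrite nnegrE mulr_ge0 ?sqrtr_ge0 ?exprn_ge0.
rewrite exprMn sqr_sqrtr ?invr_ge0 ?(ltW G0)// ler_pdivlMl//.
have h := @qmulti1_le (fun i => x i ^+ 2) k (fun i => sqr_ge0 _).
have -> : rpow x k ^+ 2 = rpow (fun i => x i ^+ 2) k.
  by rewrite /rpow -prodrXl; apply: eq_bigr => i _; rewrite -!exprM mulnC.
apply: le_trans h _; rewrite -exprM mulnC exprM; apply: lerXn2r => //.
  by rewrite nnegrE; apply: sumr_ge0 => i _; exact: sqr_ge0.
by rewrite nnegrE sqr_ge0.
Qed.

Definition inball rho z := \sum_i cabs (z 0 i) ^+ 2 <= rho ^+ 2.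

Definition ev a z : C := csum (fun k => a k * zpow z k).

Lemma ev_term_le a z rho k : 0 <= rho -> inball rho z ->
  cabs (a k * zpow z k) <= wterm U Q rho a k.
Proof.
move=> r0 zr; rewrite cabsM /wterm -mulrA ler_wpM2l ?cabs_ge0// cabs_zpow.
by apply: (@rpow_le_weight (fun i => cabs (z 0 i))) => // i; exact: cabs_ge0.
Qed.

Lemma ev_summable a z rho : 0 <= rho -> inball rho z -> wsummable U Q rho a ->
  tsummable (fun k => cabs (a k * zpow z k)).
Proof.
by move=> r0 zr; apply: tsummable_le => k; rewrite cabs_ge0 ev_term_le.
Qed.

Lemma ev_le a z rho : 0 <= rho -> inball rho z -> wsummable U Q rho a ->
  cabs (ev a z) <= wnorm U Q rho a.
Proof.
move=> r0 zr sa; apply: le_trans (cabs_csum (ev_summable r0 zr sa)) _.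
by apply: le_tsum => // k; rewrite cabs_ge0 ev_term_le.
Qed.

Lemma evD a b z rho : 0 <= rho -> inball rho z -> wsummable U Q rho a -> wsummable U Q rho b ->
  ev (fun k => a k + b k) z = ev a z + ev b z.
Proof.
move=> r0 zr sa sb; rewrite -csumD; [|exact: ev_summable sa|exact: ev_summable sb].
by congr csum; apply/funext => k; rewrite mulrDl.
Qed.

Lemma evZ c a z rho : 0 <= rho -> inball rho z -> wsummable U Q rho a ->
  ev (fun k => c * a k) z = c * ev a z.
Proof.
move=> r0 zr sa; rewrite -csumZ; last exact: ev_summable sa.
by congr csum; apply/funext => k; rewrite mulrA.
Qed.

Lemma evB a b z rho : 0 <= rho -> inball rho z -> wsummable U Q rho a -> wsummable U Q rho b ->
  ev (fun k => a k - b k) z = ev a z - ev b z.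
Proof.
move=> r0 zr sa sb.
have -> : (fun k => a k - b k) = (fun k => a k + -1 * b k) by apply/funext => k; rewrite mulN1r.
by rewrite (evD r0 zr sa (wsummableZ (-1) r0 sb)) (evZ _ r0 zr sb) mulN1r.
Qed.

Lemma ev_monomial k z : ev (monomial R k) z = zpow z k.
Proof.
rewrite /ev (@csum_finsupp _ _ _ [:: k])//.
  by rewrite big_seq1 /monomial eqxx mul1r.
by move=> l; rewrite inE /monomial => /negbTE ->; rewrite mul0r.
Qed.

Lemma twist1 k l : twist Q k l = 1.
Proof. by rewrite /twist Q1 expr1n invr1. Qed.

End Evaluation.

Section EvaluationMul.
Variables (R : realType) (n : nat) (Q : Cstar R).
Hypothesis Q1 : cstar_val Q = 1.
Local Notation C := (Cplx R).
Local Notation V := 'rV[C]_n.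
Local Notation U := (ball_weight R n).
Implicit Types (k : multidx n) (z : V) (rho : R).
Variable r : pradius R.
Local Notation F := (wfiber U r Q).
Implicit Types (a b p : F).

Lemma fsupp_sum a (s : seq (multidx n)) : uniq s -> (forall k, k \notin s -> fcoef a k = 0) ->
  a = \sum_(k <- s) fcoef a k *: fib_monomial U r Q k.
Proof.
move=> us as0; apply: fiber_ext => k; rewrite fcoef_sum.
have E l : fcoef (fcoef a l *: fib_monomial U r Q l) k = fcoef a l * (k == l)%:R by [].
under eq_bigr do rewrite E.
have [ks|ks] := boolP (k \in s).
  rewrite (bigD1_seq k)//= eqxx mulr1 big1 ?addr0// => l lk.
  by rewrite eq_sym (negbTE lk) mulr0.
rewrite as0// big_seq big1// => l ls.
by case: eqP ls ks => [->->//|_ _ _]; rewrite mulr0.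
Qed.

Lemma ev_sum z rho (I : Type) (s : seq I) (f : I -> F) : polydisk_radii r rho -> inball rho z ->
  ev (fcoef (\sum_(i <- s) f i)) z = \sum_(i <- s) ev (fcoef (f i)) z.
Proof.
move=> hr zr; have r0 := radii_ge0 hr.
elim: s => [|i s IH].
  rewrite !big_nil /ev (@csum_finsupp _ _ _ [::])// ?big_nil// => k _.
  exact: mul0r.
rewrite !big_cons -IH -(evD Q1 r0 zr (fcoefP _ hr) (fcoefP _ hr)).
by congr ev.
Qed.

Lemma ev_fsuppM z rho a b : polydisk_radii r rho -> inball rho z ->
  fsupp (fcoef a) -> fsupp (fcoef b) ->
  ev (fcoef (a * b)) z = ev (fcoef a) z * ev (fcoef b) z.
Proof.
move=> hr zr [s hs] [s' hs']; have r0 := radii_ge0 hr.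
have {hs} hs k : k \notin undup s -> fcoef a k = 0 by rewrite mem_undup; exact: hs.
have {hs'} hs' k : k \notin undup s' -> fcoef b k = 0 by rewrite mem_undup; exact: hs'.
have evZ' c (x : F) : ev (fcoef (c *: x)) z = c * ev (fcoef x) z.
  by rewrite -(evZ Q1 c r0 zr (fcoefP x hr)).
have evm k : ev (fcoef (fib_monomial U r Q k)) z = zpow z k by exact: ev_monomial.
rewrite {1}(fsupp_sum (undup_uniq s) hs) {1}(fsupp_sum (undup_uniq s') hs').
rewrite mulr_suml (ev_sum _ _ hr zr).
rewrite {2}(fsupp_sum (undup_uniq s) hs) (ev_sum _ _ hr zr) mulr_suml.
apply: eq_bigr => k _; rewrite mulr_sumr (ev_sum _ _ hr zr).
rewrite {2}(fsupp_sum (undup_uniq s') hs') (ev_sum _ _ hr zr) mulr_sumr.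
apply: eq_bigr => l _; rewrite -scalerAl -scalerAr fib_monomialM twist1// scale1r !evZ'.
by rewrite !evm zpowD; ring.
Qed.

(** Evaluation is multiplicative on polynomials, and both sides are continuous. *)
Lemma evM z rho a b : polydisk_radii r rho -> inball rho z ->
  ev (fcoef (a * b)) z = ev (fcoef a) z * ev (fcoef b) z.
Proof.
move=> hr zr; have r0 := radii_ge0 hr.
pose N (x : F) := wnorm U Q rho (fcoef x : multidx n -> C).
pose D (x y : F) := ev (fcoef (x * y)) z - ev (fcoef x) z * ev (fcoef y) z.
have evD' (x y : F) : ev (fcoef (x + y)) z = ev (fcoef x) z + ev (fcoef y) z.
  by rewrite -(evD Q1 r0 zr (fcoefP x hr) (fcoefP y hr)).
have N0 x : 0 <= N x by exact: wnorm_ge0.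
have Dle x y : cabs (D x y) <= 2 * (N x * N y).
  apply: le_trans (cabsD _ _) _; rewrite cabsN cabsM.
  have h1 := ev_le Q1 r0 zr (fcoefP (x * y) hr).
  have h2 := wnormM r0 (fcoefP x hr) (fcoefP y hr).
  have h3 : cabs (ev (fcoef x) z) * cabs (ev (fcoef y) z) <= N x * N y.
    by apply: ler_pM; rewrite ?cabs_ge0//; exact: (ev_le Q1 r0 zr (fcoefP _ hr)).
  rewrite fcoefM in h1 *; have := le_trans h1 h2; rewrite -/(N x) -/(N y); lra.
have Dl x x' y : D (x + x') y = D x y + D x' y.
  by rewrite /D mulrDl !evD'; ring.
have Dr x y y' : D x (y + y') = D x y + D x y'.
  by rewrite /D mulrDr !evD'; ring.
have app (x : F) e : 0 < e -> exists2 p, fsupp (fcoef p) & N (x - p) < e.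
  move=> e0; have [p fp hp] := fsupp_dense r0 (fcoefP x hr) e0.
  by exists (mkfib (fsupp_in_weighted (r := r) U Q fp)).
suff : D a b = 0 by move/eqP; rewrite subr_eq0 => /eqP.
apply/eqP; rewrite -cabs_eq0 eq_le cabs_ge0 andbT.
apply/ler_addgt0Pr => e e0; rewrite add0r.
have B0 := N0 b.
have [p fp hp] := app a (e / (4 * (N b + 1))) ltac:(by rewrite divr_gt0// mulr_gt0// ltr_wpDl).
have P0 := N0 p.
have [p' fp' hp'] := app b (e / (4 * (N p + 1))) ltac:(by rewrite divr_gt0// mulr_gt0// ltr_wpDl).
have Dpp : D p p' = 0 by rewrite /D (ev_fsuppM hr zr fp fp') subrr.
rewrite -(subrK p a) Dl -{2}(subrK p' b) Dr Dpp addr0.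
apply: le_trans (cabsD _ _) _; apply: le_trans (lerD (Dle _ _) (Dle _ _)) _.
have h1 : N (a - p) * (N b + 1) <= e / 4.
  by rewrite -ler_pdivlMr ?ltr_wpDl// -mulrA -invfM ltW.
have h2 : N (b - p') * (N p + 1) <= e / 4.
  by rewrite -ler_pdivlMr ?ltr_wpDl// -mulrA -invfM ltW.
have := N0 (a - p); have := N0 (b - p'); lra.
Qed.

End EvaluationMul.

(** * Differentiability of power series *)

Section DifferentiableRV.
Variables (R : realType) (n : nat).
Local Notation C := (Cplx R).
Local Notation V := 'rV[C]_n.
Implicit Types (z h : V) (l : 'I_n -> C).

Lemma norm_rV_real h : exists2 t : R, 0 <= t & `|h| = realC t /\ forall i, cabs (h 0 i) <= t.
Proof.
have h0 : 0 <= `|h| by exact: normr_ge0.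
have E : `|h| = realC (complex.Re `|h|).
  by move: h0; case: `|h| => a b /=; rewrite lecE/= => /andP[/eqP -> _].
exists (complex.Re `|h|); first by rewrite -realC_le -E.
split=> // i; apply/ler_addgt0Pr => e e0.
have : ball (0 : V) (`|h| + realC e) h.
  by rewrite mx_norm_ball /ball_/= sub0r normrN ltrDl -realC0 realC_lt.
move=> [_ /(_ 0 i)]; rewrite mxE /ball/= sub0r normrN norm_cabs {1}E -realCD realC_lt.
exact: ltW.
Qed.

Lemma differentiable_rV (g : V -> C) z l (K d : R) : 0 < d ->
  (forall h t, 0 < t <= d -> (forall i, cabs (h 0 i) <= t) ->
    cabs (g (h + z) - g z - \sum_i h 0 i * l i) <= K * t ^+ 2) ->
  differentiable g z.
Proof.
move=> d0 hg; pose f (h : V) : C := \sum_i h 0 i * l i.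
have flin : linear f.
  move=> c h h'; rewrite /f scaler_sumr -big_split; apply: eq_bigr => i _.
  by rewrite !mxE mulrDl -mulrA.
pose df : {linear V -> C} := HB.pack f (GRing.isLinear.Build C V C *:%R f flin).
have cdf : continuous df.
  move=> h; apply: (@cvg_nsum C C V (nbhs h) _ _ _ xpredT
    (fun i (h : V) => h 0 i * l i) (fun i => h 0 i * l i)) => i.
  exact: (@cvgM C V (nbhs h) _ (fun h : V => h 0 i) (fun=> l i) _ _
    (@coord_continuous C 1 n 0 i h) (cvg_cst _)).
have hlo : g \o shift z = cst (g z) + df +o_ (0 : V) id.
  apply/eqaddoP => e e0.
  have [e' e'0 eE] : exists2 e' : R, 0 < e' & e = realC e'.
    exists (complex.Re e); first by move: e0; case: e => a b /=; rewrite ltcE/= => /andP[].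
    by move: e0; case: e => a b /=; rewrite ltcE/= => /andP[/eqP -> _].
  pose t0 := Num.min d (e' / (`|K| + 1)).
  have t00 : 0 < t0 by rewrite lt_min d0 divr_gt0// ltr_wpDl.
  have ht0 : (0 : C) < realC t0 by rewrite -realC0 realC_lt.
  apply: filterS (nbhs0_lt ht0) => h; have [t t1 [tE ht]] := norm_rV_real h.
  rewrite tE realC_lt eE norm_cabs -realCM realC_le => htt.
  have -> : ((g \o shift z) - (cst (g z) + df)) h = g (h + z) - g z - \sum_i h 0 i * l i.
    by rewrite opprD addrA.
  have /andP[td te] : (t <= d) && (t <= e' / (`|K| + 1)) by rewrite -le_min ltW.
  have [tz|tp] := leP t 0.
    have h0 : h = 0.
      apply/rowP => i; rewrite mxE; apply/eqP; rewrite -cabs_eq0 eq_le cabs_ge0 andbT.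
      exact: le_trans (ht i) tz.
    rewrite h0 add0r subrr sub0r big1 ?oppr0 ?cabs0 ?mulr_ge0 ?(ltW e'0)// => i _.
    by rewrite mxE mul0r.
  apply: le_trans (hg h t _ ht) _; first by rewrite tp td.
  rewrite expr2 mulrA ler_wpM2r//.
  move: te; rewrite ler_pdivlMr ?ltr_wpDl// => te.
  have := ler_wpM2r t1 (ler_norm K); lra.
have E := diff_unique cdf hlo.
by apply/diff_locallyP; rewrite E.
Qed.

End DifferentiableRV.

Section Jets.
Variables (R : realType) (n : nat).
Local Notation C := (Cplx R).
Local Notation V := 'rV[C]_n.
Implicit Types (z h : V) (k : multidx n).

(** The first order Taylor expansion of a monomial, with the weights [1, 1/e, 1/e^2] that
    make the bound multiplicative. *)
Lemma monomial_jet z (d : R) k : 0 <= d -> exists l : 'I_n -> C,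
  forall h (e : R), 0 < e <= 1 -> (forall i, cabs (h 0 i) <= e * d) ->
  cabs (zpow z k) + cabs (\sum_i h 0 i * l i) / e +
    cabs (zpow (h + z) k - zpow z k - \sum_i h 0 i * l i) / e ^+ 2 <=
  rpow (fun i => cabs (z 0 i) + d) k.
Proof.
move=> d0; elim/multidx_ind: k => [|k j _ [l hl]].
  exists (fun=> 0) => h e _ _; rewrite !zpow0 big1; last by move=> i _; rewrite mulr0.
  rewrite subrr subr0 cabs0 cabs1 !mul0r !addr0 /rpow big1// => i _.
  by rewrite ffunE expr0.
exists (fun i => z 0 j * l i + (i == j)%:R * zpow z k) => h e e01 he.
have /andP[e0 e1] := e01.
have zj w : zpow w (k + mdelta j) = zpow w k * w 0 j.
  by rewrite zpowD -[mdelta j]mulr1n zpow_mdelta expr1.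
have rj : rpow (fun i => cabs (z 0 i) + d) (k + mdelta j) =
    rpow (fun i => cabs (z 0 i) + d) k * (cabs (z 0 j) + d).
  rewrite /rpow [RHS]mulrC (bigD1 j)//= [in RHS](bigD1 j)//= mulrA; congr (_ * _).
    by rewrite -exprS; congr (_ ^+ _); rewrite [LHS]ffunE [mdelta _ _]ffunE eqxx; exact: addn1.
  apply: eq_bigr => i ij; congr (_ ^+ _).
  by rewrite [LHS]ffunE [mdelta _ _]ffunE eq_sym (negbTE ij); exact: addn0.
set A := zpow z k; set B := \sum_i h 0 i * l i.
have -> : \sum_i h 0 i * (z 0 j * l i + (i == j)%:R * A) = z 0 j * B + h 0 j * A.
  under eq_bigr do rewrite mulrDr; rewrite big_split; congr (_ + _).
    by rewrite mulr_sumr; apply: eq_bigr => i _; rewrite mulrCA.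
  rewrite (bigD1 j)// eqxx mul1r big1; first exact: addr0.
  by move=> i /negbTE ->; rewrite mul0r mulr0.
have := hl h e e01 he; rewrite -/A -/B !zj rj mxE -/A.
set E := zpow (h + z) k - A - B => hS.
have -> : zpow (h + z) k * (h 0 j + z 0 j) - A * z 0 j - (z 0 j * B + h 0 j * A) =
    z 0 j * E + h 0 j * B + h 0 j * E by rewrite /E; ring.
have nA := cabs_ge0 A; have nB := cabs_ge0 B; have nE := cabs_ge0 E; have nz := cabs_ge0 (z 0 j).
have nh := cabs_ge0 (h 0 j); have hj := he j.
set a := cabs A in hS nA *; set b := cabs B in hS nB *; set c := cabs E in hS nE *.
set x := cabs (z 0 j) in nz *; set y := cabs (h 0 j) in nh hj *.
have q1 : cabs (A * z 0 j) = x * a by rewrite cabsM mulrC.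
have q2 : cabs (z 0 j * B + h 0 j * A) <= x * b + y * a.
  by apply: le_trans (cabsD _ _) _; rewrite !cabsM.
have q3 : cabs (z 0 j * E + h 0 j * B + h 0 j * E) <= x * c + y * b + y * c.
  apply: le_trans (cabsD _ _) _; apply: le_trans (lerD (cabsD _ _) (lexx _)) _.
  by rewrite !cabsM.
have ei : 0 < e^-1 by rewrite invr_gt0.
have ei2 : 0 < (e ^+ 2)^-1 by rewrite invr_gt0 exprn_gt0.
rewrite q1; apply: le_trans (lerD (lerD (lexx _) (ler_wpM2r (ltW ei) q2))
  (ler_wpM2r (ltW ei2) q3)) _.
set S := a + b / e + c / e ^+ 2 in hS.
have S0 : 0 <= S by rewrite !addr_ge0// mulr_ge0// ltW.
have ye : y / e <= d by rewrite ler_pdivrMr// mulrC.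
have ce : c / e <= c / e ^+ 2.
  rewrite ler_wpM2l// expr2 invfM ler_peMl ?(ltW ei)//.
  by rewrite -[leLHS]invr1 lef_pV2 ?posrE.
have yS : y / e * (a + b / e + c / e) <= d * S.
  apply: ler_pM => //; first by rewrite mulr_ge0// ltW.
    by rewrite !addr_ge0// mulr_ge0// ltW.
  by rewrite /S lerD.
have -> : x * a + (x * b + y * a) / e + (x * c + y * b + y * c) / e ^+ 2 =
    x * S + y / e * (a + b / e + c / e) by rewrite /S; field; rewrite gt_eqF.
have xS := ler_wpM2l (addr_ge0 nz d0) hS.
rewrite [leRHS]mulrC; apply: le_trans xS; rewrite mulrDl; exact: lerD.
Qed.

End Jets.

Section EvDifferentiable.
Variables (R : realType) (n : nat) (Q : Cstar R).
Hypothesis Q1 : cstar_val Q = 1.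
Local Notation C := (Cplx R).
Local Notation V := 'rV[C]_n.
Local Notation U := (ball_weight R n).

Lemma ball_room (z : V) : \sum_i cabs (z 0 i) ^+ 2 < 1 ->
  exists d rho : R, [/\ 0 < d, 0 < rho < 1 & \sum_i (cabs (z 0 i) + d) ^+ 2 <= rho ^+ 2].
Proof.
move=> z1; set S := \sum_i _ in z1.
have S0 : 0 <= S by apply: sumr_ge0 => i _; exact: sqr_ge0.
pose N : R := n%:R; have N0 : 0 <= N by rewrite ler0n.
pose d := (1 - S) / (6 * (N + 1)).
have d0 : 0 < d by rewrite divr_gt0 ?subr_gt0// mulr_gt0// ltr_wpDl.
have dN : d * (6 * (N + 1)) = 1 - S by rewrite divfK// gt_eqF// mulr_gt0// ltr_wpDl.
have Nd : 0 <= N * d by rewrite mulr_ge0// ltW.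
have d1 : d <= 1 by lra.
exists d, ((3 + S) / 4); split => //; first by apply/andP; split; lra.
have z1' i : cabs (z 0 i) <= 1.
  rewrite -(ler_pXn2r (n := 2))// ?nnegrE ?cabs_ge0// expr1n; apply: le_trans (ltW z1).
  by rewrite /S (bigD1 i)//= lerDl; apply: sumr_ge0 => j _; exact: sqr_ge0.
have h : \sum_i (cabs (z 0 i) + d) ^+ 2 <= S + N * (3 * d).
  have -> : N * (3 * d) = \sum_(i < n) (3 * d) by rewrite sumr_const card_ord /N mulr_natl.
  rewrite /S -big_split; apply: ler_sum => i _.
  have h1 : d * cabs (z 0 i) <= d * 1 by rewrite ler_wpM2l// ltW.
  have h2 : d * d <= d * 1 by rewrite ler_wpM2l// ltW.
  rewrite sqrrD -[leRHS]/(_ + _) [d ^+ 2]expr2 [_ *+ 2]mulr2n; lra.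
apply: le_trans h _; have := sqr_ge0 (1 - S); lra.
Qed.

(** A power series is differentiable term by term: on a slightly larger polydisc the
    remainders of the monomials are dominated by the terms of a convergent series. *)
Lemma ev_differentiable (a : multidx n -> C) (z : V) :
  (forall rho, 0 < rho < 1 -> wsummable U Q rho a) -> oball R n z -> differentiable (ev a) z.
Proof.
move=> sa zB; have [d [rho [d0 r01 hd]]] := ball_room zB.
have r0 : 0 <= rho by case/andP: r01 => /ltW.
have zd0 i : 0 <= cabs (z 0 i) + d by rewrite addr_ge0 ?cabs_ge0// ltW.
pose X k := rpow (fun i => cabs (z 0 i) + d) k.
have XU k : X k <= U Q k * rho ^+ mdeg k by exact: rpow_le_weight.
have X0 k : 0 <= X k by exact: rpow_ge0.
have aX k : cabs (a k) * X k <= wterm U Q rho a k.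
  by rewrite /wterm -mulrA ler_wpM2l ?cabs_ge0.
have [l hl] := choice (fun k => monomial_jet z k (ltW d0)).
have lX k i : cabs (l k i) * d <= X k.
  pose h : V := \row_j (if j == i then realC d else 0).
  have hE : \sum_j h 0 j * l k j = realC d * l k i.
    rewrite (bigD1 i)// mxE eqxx big1; first exact: addr0.
    by move=> j /negbTE ji; rewrite mxE ji mul0r.
  have := hl k h 1; rewrite hE ltr01 lexx => /(_ isT) hj.
  have {hj} := hj ltac:(by move=> j; rewrite mxE mul1r; case: eqP => _;
    rewrite ?cabs0 ?(ltW d0)// cabs_realC gtr0_norm).
  rewrite expr1n !divr1 [cabs (realC d * _)]cabsM cabs_realC gtr0_norm// [d * _]mulrC.
  apply: le_trans; rewrite -addrA addrCA lerDl; apply: addr_ge0; exact: cabs_ge0.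
have sl i : tsummable (fun k => cabs (a k * l k i)).
  have di : 0 <= d^-1 by rewrite invr_ge0 ltW.
  have := tsummableZ di (fun k => wterm_ge0 U Q a k r0) (sa rho r01); apply: tsummable_le => k; rewrite cabs_ge0 cabsM.
  rewrite ler_pdivlMl// mulrCA; apply: le_trans (aX k).
  by rewrite ler_wpM2l ?cabs_ge0// mulrC.
pose L i := csum (fun k => a k * l k i).
have sumL (h : V) (s : seq 'I_n) : tsummable (fun k => cabs (\sum_(i <- s) h 0 i * (a k * l k i))) /\
    csum (fun k => \sum_(i <- s) h 0 i * (a k * l k i)) = \sum_(i <- s) h 0 i * L i.
  elim: s => [|i s [IHs IH]].
    split; first by apply: (@tsummable_finsupp _ _ _ [::]) => // k; rewrite ?big_nil ?cabs0.
    by rewrite big_nil (@csum_finsupp _ _ _ [::])// ?big_nil// => k; rewrite big_nil.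
  have hi : tsummable (fun k => cabs (h 0 i * (a k * l k i))).
    have := tsummableZ (cabs_ge0 (h 0 i)) (fun k => cabs_ge0 (a k * l k i)) (sl i).
    by apply: tsummable_le => k; rewrite cabs_ge0 [cabs (h 0 i * _)]cabsM lexx.
  split.
    apply: tsummable_le (tsummableD (fun k => cabs_ge0 _) (fun k => cabs_ge0 _) hi IHs) => k.
    by rewrite cabs_ge0 big_cons cabsD.
  rewrite big_cons -IH -(csumZ _ (sl i)) -csumD//.
  by congr csum; apply/funext => k; rewrite big_cons.
apply: (@differentiable_rV R n (ev a) z L (wnorm U Q rho a / d ^+ 2) d d0) => h t /andP[t0 td] ht.
pose e := t / d; have e0 : 0 < e by exact: divr_gt0.
have e1 : e <= 1 by rewrite ler_pdivrMr// mul1r.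
have ed : e * d = t by rewrite divfK// gt_eqF.
have inb (w : V) : (forall i, cabs (w 0 i) <= cabs (z 0 i) + d) -> inball rho w.
  move=> hw; apply: le_trans hd; apply: ler_sum => i _.
  by apply: lerXn2r; rewrite ?nnegrE ?cabs_ge0.
have zin : inball rho z by apply: inb => i; rewrite lerDl ltW.
have hzin : inball rho (h + z).
  apply: inb => i; rewrite mxE; apply: le_trans (cabsD _ _) _.
  by rewrite addrC lerD2l; apply: le_trans (ht i) td.
have [sL <-] := sumL h (index_enum 'I_n).
have E k : \sum_i h 0 i * (a k * l k i) = a k * \sum_i h 0 i * l k i.
  by rewrite mulr_sumr; apply: eq_bigr => i _; rewrite mulrCA.
have s1 := ev_summable Q1 r0 hzin (sa rho r01).
have s2 := ev_summable Q1 r0 zin (sa rho r01).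
have sN (f : multidx n -> C) : tsummable (fun k => cabs (f k)) -> tsummable (fun k => cabs (-1 * f k)).
  by apply: tsummable_le => k; rewrite mulN1r cabsN cabs_ge0 lexx.
have -> : ev a (h + z) - ev a z - csum (fun k => \sum_i h 0 i * (a k * l k i)) =
    csum (fun k => a k * zpow (h + z) k + -1 * (a k * zpow z k) +
      -1 * \sum_i h 0 i * (a k * l k i)).
  rewrite csumD; last 2 first.
  - by apply: tsummable_le (tsummableD (fun k => cabs_ge0 _) (fun k => cabs_ge0 _) s1 (sN _ s2)) => k;
      rewrite cabs_ge0 cabsD.
  - exact: sN.
  rewrite csumD//; last exact: sN.
  by rewrite !csumZ// !mulN1r.
have tb k : cabs (a k * zpow (h + z) k + -1 * (a k * zpow z k) +
    -1 * \sum_i h 0 i * (a k * l k i)) <= e ^+ 2 * wterm U Q rho a k.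
  rewrite E (_ : _ + _ + _ = a k * (zpow (h + z) k - zpow z k - \sum_i h 0 i * l k i)); last by ring.
  rewrite cabsM; have := hl k h e; rewrite e0 e1 ed => /(_ isT ht) hj.
  have : cabs (zpow (h + z) k - zpow z k - \sum_i h 0 i * l k i) / e ^+ 2 <= X k.
    apply: le_trans hj; rewrite lerDr addr_ge0 ?cabs_ge0// divr_ge0 ?cabs_ge0// ltW//.
  rewrite ler_pdivrMr ?exprn_gt0// => h2.
  apply: le_trans (ler_wpM2l (cabs_ge0 _) h2) _.
  by rewrite mulrA mulrC ler_wpM2l// exprn_ge0// ltW.
have e20 : 0 <= e ^+ 2 by rewrite exprn_ge0// ltW.
have st := tsummableZ e20 (fun k => wterm_ge0 U Q a k r0) (sa rho r01).
apply: le_trans (cabs_csum _) _.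
  by apply: tsummable_le st => k; rewrite cabs_ge0 tb.
apply: le_trans (le_tsum _ st) _; first by move=> k; rewrite cabs_ge0 tb.
apply: le_trans (tsumZ_le e20 (fun k => wterm_ge0 U Q a k r0) (sa rho r01)) _.
rewrite -/(wnorm U Q rho a) /e expr_div_n le_eqVlt; apply/orP; left; apply/eqP; ring.
Qed.

End EvDifferentiable.

(** * The classical ball as a fibre *)

Section BallExpansion.
Variables (R : realType) (n : nat).
Hypothesis n0 : (0 < n)%N.
Variable Q : Cstar R.
Hypothesis Q1 : cstar_val Q = 1.
Local Notation C := (Cplx R).
Local Notation V := 'rV[C]_n.
Local Notation U := (ball_weight R n).
Implicit Types (z : V) (a c : multidx n -> C) (r : 'I_n -> R) (rho : R).

Definition rsq z : R := \sum_i cabs (z 0 i) ^+ 2.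

Lemma rsq_continuous : continuous rsq.
Proof.
move=> z; apply: (@cvg_nsum R R^o V (nbhs z) _ _ _ xpredT
  (fun i (z : V) => cabs (z 0 i) ^+ 2) (fun i => cabs (z 0 i) ^+ 2)) => i.
have h : (fun z : V => cabs (z 0 i)) @ z --> cabs (z 0 i).
  apply: (@continuous_comp V C R (fun z : V => z 0 i) (@cabs R)).
    exact: coord_continuous.
  exact: cabs_continuous.
exact: (@cvgM R V (nbhs z) _ _ _ _ _ h h).
Qed.

Lemma compact_inball rho : 0 <= rho -> compact (inball rho : set V).
Proof.
move=> r0; apply: (subclosed_compact _ (@compact_pdisc R n (fun=> rho))).
  exact: (closed_comp (fun z _ => @rsq_continuous z) (@closed_le R (rho ^+ 2))).
move=> z zr i; rewrite -(ler_pXn2r (n := 2))// ?nnegrE ?cabs_ge0//.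
apply: le_trans zr; rewrite (bigD1 i)//= lerDl; apply: sumr_ge0 => j _; exact: sqr_ge0.
Qed.

Lemma pdisc_inball r rho z : \sum_i r i ^+ 2 <= rho ^+ 2 -> pdisc r z -> inball rho z.
Proof.
move=> rr zr; apply: le_trans rr; apply: ler_sum => i _.
apply: lerXn2r; rewrite ?nnegrE ?cabs_ge0//.
by apply: le_trans (zr i); exact: cabs_ge0.
Qed.

Lemma inball_oball rho z : 0 <= rho < 1 -> inball rho z -> oball R n z.
Proof.
move=> /andP[r0 r1] zr; apply: le_lt_trans zr _.
by rewrite expr_lt1.
Qed.

Lemma oball_inball z : oball R n z -> exists2 rho : R, 0 < rho < 1 & inball rho z.
Proof.
move=> /ball_room[d [rho [d0 r01 hd]]]; exists rho => //; apply: le_trans hd.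
apply: ler_sum => i _; apply: lerXn2r; rewrite ?nnegrE ?addr_ge0 ?cabs_ge0 ?(ltW d0)//.
by rewrite lerDl ltW.
Qed.

(** Cauchy's estimates bound the weighted norms of a power series by its supremum on a
    larger ball. *)
Lemma wnorm_le_sup (rho' rho : R) : 0 < rho' < rho -> exists2 K : R, 0 < K &
  forall a (M : R), wsummable U Q rho a -> (forall z, inball rho z -> cabs (ev a z) <= M) ->
  wnorm U Q rho' a <= K * M.
Proof.
move=> rr; have /andP[r'0 r'r] := rr; have rho0 := lt_trans r'0 r'r.
have [K K0 hK] := wnorm_of_estimates n0 Q1 rr; exists K => // a M sa aM.
apply: (hK a M _).2 => r k rp rs; have r0 i : 0 <= r i by exact: ltW.
apply: coef_le_csum => //; last by move=> z zr; apply: aM; exact: pdisc_inball zr.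
apply: tsummable_le sa => l; rewrite mulr_ge0 ?cabs_ge0 ?rpow_ge0//=.
by rewrite /wterm -mulrA ler_wpM2l ?cabs_ge0// rpow_le_weight// ltW.
Qed.

Lemma sephol_ball (g : V -> C) r : (forall z, oball R n z -> differentiable g z) ->
  (forall i, 0 <= r i) -> \sum_i r i ^+ 2 < 1 -> sephol r g.
Proof.
move=> dg r0 r1 z zr; have zB : oball R n z.
  by apply: le_lt_trans r1; apply: ler_sum => i _; apply: lerXn2r; rewrite ?nnegrE ?cabs_ge0.
split; first exact: differentiable_continuous (dg z zB).
move=> i; have := diff_derivable (v := delta_mx 0 i) (dg z zB); rewrite /cdiff /derivable.
have E (h : C) : h *: delta_mx 0 i + z = upd z i (h *: 1 + z 0 i).
  apply/rowP => j; rewrite !mxE eqxx /=; case: eqP => [->|_]; first by [].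
  by rewrite mulr0 add0r.
suff -> : (fun h : C => h^-1 *: ((g \o shift z) (h *: delta_mx 0 i) - g z)) =
  fun h : C => h^-1 *: (((fun w => g (upd z i w)) \o shift (z 0 i)) (h *: (1 : C)) - g (upd z i (z 0 i))) by [].
by apply/funext => h; rewrite upd_id -[(g \o shift z) _]/(g (_ + z)) E.
Qed.

(** The Taylor expansions on all polydiscs inside the ball have the same coefficients, those
    of the expansion on a small one. *)
Lemma ball_expansion (g : V -> C) : (forall z, oball R n z -> differentiable g z) ->
  exists c, forall rho, 0 < rho < 1 ->
    wsummable U Q rho c /\ forall z, inball rho z -> ev c z = g z.
Proof.
move=> dg.
have room r : \sum_i r i ^+ 2 < 1 -> (forall i, 0 < r i) ->
    exists2 s : 'I_n -> R, sephol s g & forall i, 0 < r i < s i.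
  move=> r1 rp; have [|d [rho [d0 r01 hd]]] := @ball_room R n (\row_i realC (r i)).
    by under eq_bigr do rewrite mxE cabs_realC (gtr0_norm (rp _)).
  exists (fun i => r i + d); last by move=> i; rewrite rp ltrDl.
  apply: sephol_ball => // [i|]; first by rewrite addr_ge0// ltW.
  apply: le_lt_trans (_ : rho ^+ 2 < 1); last by have /andP[? ?] := r01; rewrite expr_lt1// ltW.
  by apply: le_trans hd; apply: ler_sum => i _; rewrite mxE cabs_realC (gtr0_norm (rp _)).
pose P r c := (forall M, (forall z, pdisc r z -> cabs (g z) <= M) -> forall k, cabs (c k) * rpow r k <= M) /\
    (forall z (T : R), 0 <= T < 1 -> (forall i, cabs (z 0 i) <= T * r i) ->
      tsummable (fun k => cabs (c k * zpow z k)) /\ csum (fun k => c k * zpow z k) = g z).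
have ex r : \sum_i r i ^+ 2 < 1 -> (forall i, 0 < r i) -> exists c, P r c.
  by move=> r1 rp; have [s hs rs] := room r r1 rp; exact: hol_expansion rs hs.
have half01 : 0 <= (2^-1 : R) < 1 by rewrite invr_ge0 ler0n/= invf_lt1// ltr1n.
(* On half of the intersection of two polydiscs both expansions converge. *)
have uniq_c r r' c c' : (forall i, 0 < r i) -> (forall i, 0 < r' i) -> P r c -> P r' c' -> c = c'.
  move=> rp rp' [_ h] [_ h']; pose s i := Num.min (r i) (r' i) / 2.
  have s0 i : 0 < s i by rewrite divr_gt0// lt_min rp rp'.
  have sr i : s i <= 2^-1 * r i by rewrite /s mulrC ler_wpM2l ?invr_ge0// ge_min lexx.
  have sr' i : s i <= 2^-1 * r' i by rewrite /s mulrC ler_wpM2l ?invr_ge0// ge_min lexx orbT.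
  have zz k : cabs (zpow (\row_i realC (s i)) k) = rpow s k.
    by rewrite cabs_zpow; apply: eq_bigr => i _; rewrite mxE cabs_realC (gtr0_norm (s0 i)).
  have zs i : cabs ((\row_i realC (s i) : V) 0 i) = s i by rewrite mxE cabs_realC gtr0_norm.
  apply: (csum_inj s0).
  - have [|hs _] := h (\row_i realC (s i)) 2^-1 half01; first by move=> i; rewrite zs.
    apply: tsummable_le hs => k.
    by rewrite mulr_ge0 ?cabs_ge0 ?rpow_ge0 /= ?cabsM ?zz// => i; exact: ltW.
  - have [|hs _] := h' (\row_i realC (s i)) 2^-1 half01; first by move=> i; rewrite zs.
    apply: tsummable_le hs => k.
    by rewrite mulr_ge0 ?cabs_ge0 ?rpow_ge0 /= ?cabsM ?zz// => i; exact: ltW.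
  - move=> z zs'; have [|_ ->] := h z 2^-1 half01; first by move=> i; apply: le_trans (zs' i) _.
    by have [|_ ->] := h' z 2^-1 half01; first by move=> i; apply: le_trans (zs' i) _.
(* Some polydisc inside the ball: here the squares of the radii add up to [n / (n + 1)^2]. *)
have [c0 hc0] : exists c, P (fun=> n.+1%:R^-1) c.
  apply: ex => [|i]; last by rewrite invr_gt0 ltr0n.
  have -> : \sum_(i < n) n.+1%:R^-1 ^+ 2 = n%:R / n.+1%:R ^+ 2 :> R.
    by rewrite sumr_const card_ord -[LHS]mulr_natl exprVn.
  rewrite ltr_pdivrMr ?exprn_gt0 ?ltr0n// mul1r -natrX ltr_nat.
  by rewrite -mulnn mulSn ltn_addr.
have all_c r : \sum_i r i ^+ 2 < 1 -> (forall i, 0 < r i) -> P r c0.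
  move=> r1 rp; have [c hc] := ex r r1 rp.
  by rewrite (uniq_c _ _ _ _ _ rp hc0 hc)// => i; rewrite invr_gt0 ltr0n.
have evg z : oball R n z -> ev c0 z = g z.
  move=> zB; have [d [rho [d0 r01 hd]]] := ball_room zB.
  have rp i : 0 < cabs (z 0 i) + d by rewrite ltr_wpDl ?cabs_ge0.
  have r1 : \sum_i (cabs (z 0 i) + d) ^+ 2 < 1.
    by apply: le_lt_trans hd _; have /andP[? ?] := r01; rewrite expr_lt1// ltW.
  have [_ h] := all_c (fun i => cabs (z 0 i) + d) r1 rp.
  have D1 : 0 < 1 + d by rewrite addr_gt0.
  apply: (h z (1 + d)^-1 _ _).2.
    by rewrite invr_ge0 ltW//= invf_lt1// ltrDl.
  move=> i; rewrite mulrC ler_pdivlMr// mulrDr mulr1 lerD2l ler_piMl ?(ltW d0)//.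
  rewrite -(ler_pXn2r (n := 2))// ?nnegrE ?cabs_ge0// expr1n; apply: le_trans (ltW zB).
  by rewrite (bigD1 i)//= lerDl; apply: sumr_ge0 => j _; exact: sqr_ge0.
exists c0 => rho r01; have /andP[rho0 rho1] := r01; split; last first.
  by move=> z zr; apply: evg; apply: inball_oball zr; rewrite ltW.
pose rho1' := (rho + 1) / 2.
have rr1 : 0 < rho < rho1' by rewrite rho0 /rho1'/=; lra.
have r1' : 0 <= rho1' < 1 by rewrite /rho1'; apply/andP; split; lra.
have r1'0 : 0 <= rho1' by case/andP: r1'.
have [M hM] := compact_cabs_bounded (compact_inball r1'0) (fun z zr =>
  differentiable_continuous (dg z (inball_oball r1' zr))).
have [K _ hK] := wnorm_of_estimates n0 Q1 rr1.
apply: (hK c0 M _).1 => r k rp rs.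
have r1 : \sum_i r i ^+ 2 < 1.
  by apply: le_lt_trans rs _; have /andP[? ?] := r1'; rewrite expr_lt1.
apply: (all_c r r1 rp).1 => z zr; apply: hM; exact: pdisc_inball zr.
Qed.

End BallExpansion.

Section ClassicalFiber.
Variables (R : realType) (n : nat).
Hypothesis n0 : (0 < n)%N.
Variable Q : Cstar R.
Hypothesis Q1 : cstar_val Q = 1.
Local Notation C := (Cplx R).
Local Notation U := (ball_weight R n).
Local Notation F := (fiber (wbundle U (unit_radius R)) Q).
Local Notation H := (hol_ball R n).
Implicit Types (a b : F) (f g : H) (rho : R).

Lemma fib_summable a rho : 0 < rho < 1 -> wsummable U Q rho (fibcoef a).
Proof. by move=> /unit_radii; exact: fcoefP. Qed.

Lemma ev_holomorphic a : holomorphic_on_ball (fun z : oball R n => ev (fibcoef a) (\val z)).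
Proof.
exists (ev (fibcoef a)); split => // z zB; apply: (ev_differentiable Q1) => // rho.
exact: fib_summable.
Qed.

Definition ball_fun a : H := HolBall (ev_holomorphic a).

Lemma ball_point (z : oball R n) : exists2 rho, 0 < rho < 1 & inball rho (\val z).
Proof. by apply: oball_inball; exact: set_valP. Qed.

Lemma ball_funB a b : ball_fun (a - b) = ball_fun a - ball_fun b.
Proof.
apply: hol_ext => z; have [rho r01 zr] := ball_point z.
have r0 : 0 <= rho by case/andP: r01 => /ltW.
rewrite -[hol_fun (_ - _) z]/(ev (fibcoef a) (\val z) + (-1) * ev (fibcoef b) (\val z)) mulN1r.
by rewrite -(evB Q1 r0 zr (fib_summable a r01) (fib_summable b r01)).
Qed.

Lemma ball_fun1 : ball_fun 1 = 1.
Proof.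
apply: hol_ext => z; rewrite -[RHS]/(1 : C) -[RHS](zpow0 (\val z)) -ev_monomial.
by [].
Qed.

Lemma ball_funM a b : ball_fun (a * b) = ball_fun a * ball_fun b.
Proof.
apply: hol_ext => z; have [rho /unit_radii r01 zr] := ball_point z.
exact: (@evM R n Q Q1 (unit_radius R) (\val z) rho a b r01 zr).
Qed.

Lemma ball_funZ (c : C) a : ball_fun (c *: a) = c *: ball_fun a.
Proof.
apply: hol_ext => z; have [rho r01 zr] := ball_point z.
have r0 : 0 <= rho by case/andP: r01 => /ltW.
rewrite -[RHS]/(c * ev (fibcoef a) (\val z)).
by rewrite -(evZ Q1 c r0 zr (fib_summable a r01)).
Qed.

(** Holomorphic functions on the ball are power series, by [ball_expansion]. *)
Lemma ball_fun_surj f : exists a, ball_fun a = f.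
Proof.
have [g [dg fg]] := hol_funP f; have [c hc] := ball_expansion n0 Q1 dg.
have hw : in_weighted U (unit_radius R) Q c by move=> rho /unit_radii/hc[].
exists (mkfib hw : F); apply: hol_ext => z; have [rho r01 zr] := ball_point z.
by rewrite fg -((hc rho r01).2 _ zr).
Qed.

Lemma ball_fun_inj a b : ball_fun a = ball_fun b -> a = b.
Proof.
move=> ab; have h01 : 0 < (2^-1 : R) < 1 by rewrite invr_gt0 ltr0n/= invf_lt1// ltr1n.
have h0 : 0 <= (2^-1 : R) by case/andP: h01 => /ltW.
have [r [rp rs _]] := optimal_radii n0 0 (proj1 (andP h01)).
have sm (x : F) : tsummable (fun k => cabs (fibcoef x k) * rpow r k).
  apply: tsummable_le (fib_summable x h01) => k.
  rewrite mulr_ge0 ?cabs_ge0 ?rpow_ge0//=; last by move=> i; exact: ltW.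
  rewrite /wterm -mulrA ler_wpM2l ?cabs_ge0//; apply: (rpow_le_weight Q1) => // i.
  exact: ltW.
suff E : fibcoef a = fibcoef b.
  by apply: (@fiber_ext R n U (unit_radius R) Q) => k; rewrite -/(fibcoef a) E.
apply: (csum_inj rp (sm a) (sm b)) => z /(pdisc_inball rs) zr.
have zB : oball R n z by apply: inball_oball zr; rewrite h0; case/andP: h01.
by have := congr1 (fun f => hol_fun f (SigSub (mem_set zB))) ab.
Qed.

Lemma compact_in_ball (K : set (oball R n)) : compact K ->
  exists2 rho, 0 < rho < 1 & forall z, K z -> inball rho (\val z).
Proof.
move=> /compact_near_coveringP cK.
have : \forall t \near nbhs (0 : R), K `<=` [set z : oball R n | rsq (\val z) < 1 - t].
  apply: cK => z Kz; have zB : rsq (\val z) < 1 by exact: set_valP z.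
  pose e := (1 - rsq (\val z)) / 2; have e0 : 0 < e by rewrite divr_gt0// subr_gt0.
  have hz : nbhs (\val z) [set w : 'rV[C]_n | rsq w < rsq (\val z) + e].
    have := @rsq_continuous R n (\val z) [set t | t < rsq (\val z) + e].
    by apply; apply: lt_nbhsl; rewrite ltrDl.
  exists ([set w : oball R n | rsq (\val w) < rsq (\val z) + e], [set t : R | t < e]).
    split; first by apply/(nbhs_set_typeP z); exists [set w : 'rV[C]_n | rsq w < rsq (\val z) + e].
    exact: lt_nbhsl.
  move=> [w t] /= [hw ht]; apply: lt_trans hw _; rewrite /e in ht *; lra.
move=> /nbhs_ballP[d d0 hd]; have {}d0 : 0 < d := d0.
pose t := Num.min (d / 2) (1 / 2).
have t0 : 0 < t by rewrite lt_min !divr_gt0.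
have t1 : t <= 1 / 2 by rewrite ge_min lexx orbT.
have td : t <= d / 2 by rewrite ge_min lexx.
exists (1 - t / 2); first by apply/andP; split; lra.
move=> z Kz; have h : rsq (\val z) < 1 - t.
  by apply: (hd t) => //; rewrite /ball/= sub0r normrN gtr0_norm//; lra.
apply: ltW; apply: lt_le_trans h _; have := sqr_ge0 t; lra.
Qed.

(** A compact subset of the ball lies in a ball of radius [rho < 1], where evaluation is
    bounded by the norm of radius [rho]. *)
Lemma ball_fun_continuous : continuous ball_fun.
Proof.
move=> a W /nbhs_initialP[V]; rewrite -[hol_compact _]/(hol_fun (ball_fun a)) => fV VW.
suff h : (fun b : F => hol_fun (ball_fun b)) @ a -->
    (hol_fun (ball_fun a) : {family compact, oball R n -> C}).
  have h' : nbhs a [set b : F | V (hol_fun (ball_fun b))] := h V fV.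
  exact: (filterS (fun b => @VW (ball_fun b)) h').
have aF : Filter (nbhs a) by exact: nbhs_filter.
have FF := fmap_filter (fun b : F => hol_fun (ball_fun b)) aF.
apply/(fam_cvgP _ _ FF) => K cK X /uniform_nbhs[E [entE EX]].
have [e /= e0 eE] := entE; have [e' e'0 ee] : exists2 e' : R, 0 < e' & e = realC e'.
  exists (complex.Re e); first by move: e0; case: (e) => x y /=; rewrite ltcE/= => /andP[].
  by move: e0; case: (e) => x y /=; rewrite ltcE/= => /andP[/eqP -> _].
have [rho r01 Kr] := compact_in_ball cK; have r0 : 0 <= rho by case/andP: r01 => /ltW.
have rr : polydisk_radii (unit_radius R) rho by exact/unit_radii.
apply: filterS (nbhs_fiber_ball a rr e'0) => b hb; apply: EX => z Kz; apply: eE.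
rewrite /ball/= ee norm_cabs realC_lt cabsB.
rewrite -(evB Q1 r0 (Kr z Kz) (fib_summable b r01) (fib_summable a r01)).
exact: le_lt_trans (ev_le Q1 r0 (Kr z Kz) (fib_summable (b - a) r01)) hb.
Qed.

(** Cauchy's estimates for the difference of two functions on the ball of an intermediate
    radius. *)
Lemma ball_fun_inv_continuous (inv : H -> F) : cancel inv ball_fun -> continuous inv.
Proof.
move=> invK f W /nbhs_fiber_ballP[rho [e [/unit_radii r01 e0 eW]]].
have /andP[rho0 rho1] := r01; pose rho' := (rho + 1) / 2.
have r'01 : 0 < rho' < 1 by rewrite /rho'; apply/andP; split; lra.
have r'01' : 0 <= rho' < 1 by rewrite /rho'; apply/andP; split; lra.
have rr : 0 < rho < rho' by rewrite rho0 /rho'/=; lra.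
have [K K0 hK] := wnorm_le_sup n0 Q1 rr.
have cB : compact ((fun z : oball R n => \val z) @^-1` inball rho').
  apply: compact_set_type; first by apply: compact_inball; case/andP: r'01'.
  by move=> z; exact: inball_oball.
have e'0 : 0 < e / (2 * K) by rewrite divr_gt0// mulr_gt0.
have ent : entourage [set xy : C * C | cabs (xy.1 - xy.2) < e / (2 * K)].
  have re : (0 : C) < realC (e / (2 * K)) by rewrite -realC0 realC_lt.
  exists (realC (e / (2 * K))); first exact: re.
  move=> -[x y] /=; by rewrite /ball/= norm_cabs realC_lt.
have nb := @fam_nbhs _ _ _ _ _ (hol_compact f) ent cB.
apply/nbhs_initialP; exists [set g : {family compact, oball R n -> C} |
  forall y : oball R n, inball rho' (\val y) -> cabs (hol_fun f y - g y) < e / (2 * K)].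
  exact: nb.
move=> g hg; apply: eW; apply: le_lt_trans (_ : K * (e / (2 * K)) < e); last first.
  rewrite (_ : K * _ = e / 2); first by rewrite ltr_pdivrMr// ltr_pMr// ltr1n.
  by field; rewrite gt_eqF.
apply: (hK _ _ (fib_summable (inv g - inv f) r'01)) => z zr.
have zB : oball R n z by exact: inball_oball zr.
pose z' : oball R n := SigSub (mem_set zB).
have := congr1 (fun h => hol_fun h z') (ball_funB (inv g) (inv f)); rewrite !invK.
rewrite -[hol_fun (ball_fun _) z']/(ev (fibcoef (inv g - inv f)) z) => ->.
rewrite -[hol_fun (_ - _) z']/(hol_fun g z' + (-1) * hol_fun f z') mulN1r cabsB.
by apply: ltW; exact: (hg z').
Qed.

Lemma ball_iso : topalg_iso F H.
Proof.
have [h hE] := lrmorphism_exists ball_funB ball_fun1 ball_funM ball_funZ.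
have [inv invK] := choice ball_fun_surj.
exists h, inv; split.
- by move=> a; rewrite hE; apply: ball_fun_inj; rewrite invK.
- by move=> f; rewrite hE invK.
- by rewrite (funext hE); exact: ball_fun_continuous.
- exact: ball_fun_inv_continuous.
Qed.

End ClassicalFiber.

(** * Deformations of the polydisk and of the ball *)

Theorem theorem6p1 (R : realType) (n : nat) (n_ge1 : (1 <= n)%N) :
  (forall r : \bar R, (0 < r)%E ->
     exists D : frechetAlgebraBundle R (Cstar R),
       forall q : Cstar R, topalg_iso (fiber D q) (polydisk n q r)) /\
  (exists B : frechetAlgebraBundle R (Cstar R),
     (forall q : Cstar R, cstar_val q = 1 -> topalg_iso (fiber B q) (hol_ball R n)) /\
     (forall (t : R) (q : Cstar R), 0 < t < 1 -> cstar_val q = realC t ->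
        exists E : preTopologicalAlgType (Cplx R),
          is_qball n t E /\ topalg_iso (fiber B q) E)).
Proof.
split.
  move=> r r0; exists (weighted_bundle (polydisk_weight R n) (PRadius r0)) => q.
  exact: (polydisk_iso n (PRadius r0) q).
exists (weighted_bundle (ball_weight R n) (unit_radius R)); split => [q q1|t q t01 qt].
  exact: ball_iso.
exists (fiber (wbundle (ball_weight R n) (unit_radius R)) q); split.
  exact: fiber_is_qball.
have [||||h hE] := @lrmorphism_exists _ (fiber (wbundle (ball_weight R n) (unit_radius R)) q)
  (fiber (wbundle (ball_weight R n) (unit_radius R)) q) id => //.
by exists h, id; split => [a|a||]; rewrite ?(funext hE) ?hE//; move=> a; exact: cvg_id.
Qed.
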